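(* Let $\overline{\mathbf B}$ be the quotient of $\mathbf B$ by the equivalence relation of lying in the same $\mathrm S_n$-orbit (diagonal action), and $\overline Q$ the class of $Q=(A_1,\dots,A_p)$. Then $\pi_1(\overline{\mathbf B},\overline Q)\cong\mathrm{CBr}(T,\mathbf r)$, and $\mathrm{CBr}(T,\mathbf r)$ is an extension of $\mathrm{Aut}(T,\mathbf r)$ by $\mathrm{PCBr}(T)$, i.e. there is a short exact sequence $1\to\mathrm{PCBr}(T)\to\mathrm{CBr}(T,\mathbf r)\to\mathrm{Aut}(T,\mathbf r)\to1$.
   Context: Let $n\ge2$, $\mathfrak g=\mathfrak{sl}_n(\mathbb C)$, $\mathfrak t=\{x\in\mathbb C^n:\sum x_a=0\}$, $W_{\mathfrak g}=\mathrm S_n$ permuting coordinates. Fix $p\ge1$, $A_1,\dots,A_p\in\mathfrak t$. For $l\in\{1,\dots,p+1\}$ let $P_l$ be the partition of $\underline n=\{1,\dots,n\}$ with $a,b$ in the same part iff $(A_j)_a=(A_j)_b$ for all $l\le j\le p$ ($P_{p+1}=\{\underline n\}$). Let $\mathbf B_l=\{x\in\mathfrak t: x_a=x_b$ if $a,b$ lie in the same part of $P_l$; $x_a\ne x_b$ if $a,b$ lie in different parts of $P_l$ but the same part of $P_{l+1}\}$ and $\mathbf B=\mathbf B_1\times\dots\times\mathbf B_p\subseteq\mathfrak t^p$. Ranked fission tree $(T,\mathbf r)$: nodes are pairs $(l,L)$, $L$ a part of $P_l$; root $(p+1,\underline n)$; parent of $(l,L)$ is $(l+1,L')$ with $L\subseteq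 L'\in P_{l+1}$; rank $\mathbf r(l,L)=|L|$; leaves are the level-1 nodes. A ranked tree is a rooted tree with positive integer ranks; an isomorphism of ranked trees is a bijection of nodes preserving root, parent map and ranks; $\mathrm{Aut}(T,\mathbf r)$ is the group of self-isomorphisms. For a node $v$ the subtree $T_v$ consists of $v$ and its descendants with restricted ranks. Braids: $\mathrm{Br}_N$ is the braid group on $N$ strands, $\mathrm{PBr}_N$ the pure braid group, and each braid has an underlying permutation in $\mathrm S_N$. Cabling: for $\beta\in\mathrm{Br}_k$ and $\beta_i\in\mathrm{Br}_{m_i}$ ($1\le i\le k$), $\gamma^{\mathcal B}(\beta;\beta_1,\dots,\beta_k)\in\mathrm{Br}_{m_1+\dots+m_k}$ is the braid obtained by first applying the juxtaposition of $\beta_1,\dots,\beta_k$ (with $\beta_i$ acting on the $i$-th consecutive block of $m_i$ strands) and then $\beta$ with its $i$-th strand replaced by a ribbon of $m_i$ parallel strands. Fix an ordering of the children of every node of $T$ such that any two isomorphic subtrees admit an isomorphism preserving these orderings, and order the leaves accordingly (leaves of each subtree forming a consecutive block). For a subtree $t$ with $N_t$ leaves, define recursively $\mathrm{PCBr}(t)\subseteq\mathrm{CBr}(t,\mathbf r|_t)\subseteq\mathrm{Br}_{N_t}$: if $t$ is a single node both are the trivial group $\mathrm{Br}_1$; otherwise, if the root of $t$ has children $c_1<\dots<c_k$ with subtrees $t_i=T_{c_i}$, then $\mathrm{PCBr}(t)=\{\gamma^{\mathcal B}(\beta;\beta_1,\dots,\beta_k):\beta\in\mathrm{PBr}_k,\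 \beta_i\in\mathrm{PCBr}(t_i)\}$ and $\mathrm{CBr}(t,\mathbf r|_t)=\{\gamma^{\mathcal B}(\beta;\beta_1,\dots,\beta_k):\beta\in\mathrm{Br}_k$ with underlying permutation $\pi$ satisfying $t_{\pi(i)}\cong t_i$ for all $i$, $\beta_i\in\mathrm{CBr}(t_i,\mathbf r|_{t_i})\}$ (these are subgroups; isomorphic subtrees have equal groups under the chosen orderings). Equivalently $\mathrm{CBr}(T,\mathbf r)=\mathrm{Br}_\varphi\ltimes\prod_{t\in\widetilde{\mathcal T}}\mathrm{CBr}(t,\mathbf r|_t)^{n(t)}$, where $\mathrm{Br}_\varphi\subseteq\mathrm{Br}_k$ is the group of braids whose permutation preserves isomorphism classes of the maximal proper subtrees, $\widetilde{\mathcal T}$ is a set of representatives of these classes and $n(t)$ the size of the class of $t$. *)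

(* Defs.v *)
From HB Require Import structures.
From mathcomp Require Import all_boot all_order all_algebra all_fingroup.
From mathcomp Require Import complex generic_quotient.
From mathcomp Require Import all_classical all_reals all_analysis.
From Stdlib Require List Permutation.

Set Implicit Arguments.
Unset Strict Implicit.
Unset Printing Implicit Defensive.

Import Order.TTheory GRing.Theory Num.Theory.
Local Open Scope classical_set_scope.
Local Open Scope ring_scope.
Local Open Scope quotient_scope.

(* The complex numbers C = R[i] (R a real closed complete field, e.g. the    *)
(* reals) with the metric topology of the complex modulus.                   *)
HB.instance Definition _ (R : realType) :=
  PseudoPointedMetric.copy R[i] (R[i] : numClosedFieldType)^o.

Section Loops.
Context (R : realType) (X : topologicalType) (x0 : X).

Definition is_loop (f : R -> X) : Prop :=
  {within `[0, 1], continuous f} /\ f 0 = x0 /\ f 1 = x0.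

Definition loop_homotopic (f g : R -> X) : Prop :=
  exists H : R * R -> X,
    {within `[0, 1] `*` `[0, 1], continuous H} /\
    (forall s : R, s \in `[0, 1] -> H (s, 0) = f s /\ H (s, 1) = g s) /\
    (forall t : R, t \in `[0, 1] -> H (0, t) = x0 /\ H (1, t) = x0).

Definition loop_cat (f g : R -> X) : R -> X :=
  fun s => if s <= 2^-1 then f (2 * s) else g (2 * s - 1).

End Loops.

(* Braid groups Br_N: words in the Artin generators sigma_i (0 <= i < N-1)   *)
(* and their inverses, modulo the Artin presentation.  A letter (i, true) is *)
(* sigma_i, (i, false) is sigma_i^-1.  Words are read left to right in time: *)
(* u ++ v means "first u, then v".                                           *)
Definition bword := seq (nat * bool).

Definition wf_word (N : nat) (w : bword) : bool := all (fun x => (x.1.+1 < N)%N) w.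

Inductive breq (N : nat) : bword -> bword -> Prop :=
| breq_refl w : breq N w w
| breq_sym u v : breq N u v -> breq N v u
| breq_trans u v w : breq N u v -> breq N v w -> breq N u w
| breq_cat u1 u2 v1 v2 : breq N u1 u2 -> breq N v1 v2 ->
    breq N (u1 ++ v1) (u2 ++ v2)
| breq_inv i b : (i.+1 < N)%N -> breq N [:: (i, b); (i, ~~ b)] [::]
| breq_far i j : (i.+1 < N)%N -> (j.+1 < N)%N -> (i.+1 < j)%N ->
    breq N [:: (i, true); (j, true)] [:: (j, true); (i, true)]
| breq_braid i : (i.+2 < N)%N ->
    breq N [:: (i, true); (i.+1, true); (i, true)]
           [:: (i.+1, true); (i, true); (i.+1, true)].

(* underlying permutation: the final position of the strand starting at k *)
Definition strand_step (k : nat) (x : nat * bool) : nat :=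
  if k == x.1 then x.1.+1 else if k == x.1.+1 then x.1 else k.
Definition perm_word (w : bword) (k : nat) : nat := foldl strand_step k w.

Definition winv (w : bword) : bword := rev [seq (x.1, ~~ x.2) | x <- w].
Definition wshift (s : nat) (w : bword) : bword := [seq ((x.1 + s)%N, x.2) | x <- w].

(* positive crossing of a ribbon of a strands (at positions s..s+a-1) over  *)
(* the ribbon of the b following strands                                     *)
Definition ribbon (s a b : nat) : bword :=
  flatten [seq [seq ((s + i + j)%N, true) | j <- iota 0 b] | i <- rev (iota 0 a)].

Definition swap_sizes (ms : seq nat) (i : nat) : seq nat :=
  set_nth 0%N (set_nth 0%N ms i (nth 0%N ms i.+1)) i.+1 (nth 0%N ms i).

Definition cable_letter (ms : seq nat) (x : nat * bool) : bword :=
  let s := sumn (take x.1 ms) in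
  let a := nth 0%N ms x.1 in
  let c := nth 0%N ms x.1.+1 in
  if x.2 then ribbon s a c else winv (ribbon s c a).

(* beta with its strands (initially) replaced by ribbons of sizes ms *)
Fixpoint cable_word (ms : seq nat) (w : bword) : bword :=
  match w with
  | [::] => [::]
  | x :: w' => cable_letter ms x ++ cable_word (swap_sizes ms x.1) w'
  end.

Definition juxt (ms : seq nat) (bs : seq bword) : bword :=
  flatten [seq wshift (sumn (take i ms)) (nth [::] bs i) | i <- iota 0 (size ms)].

Definition gammaB (ms : seq nat) (beta : bword) (bs : seq bword) : bword :=
  juxt ms bs ++ cable_word ms beta.

(* Planar (children-ordered) ranked rooted trees.                            *)
Inductive ptree := PNode of nat & seq ptree.

Definition ptree0 := PNode 0 [::].
Definition pchildren (t : ptree) : seq ptree := let: PNode _ ts := t in ts.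

Fixpoint nleaves (t : ptree) : nat :=
  let: PNode _ ts := t in if ts is [::] then 1%N else sumn (map nleaves ts).

Fixpoint subtrees (t : ptree) : seq ptree :=
  let: PNode _ ts := t in t :: flatten (map subtrees ts).

Inductive tiso : ptree -> ptree -> Prop :=
| TIso r ts us vs : List.Forall2 tiso ts vs -> Permutation.Permutation vs us ->
    tiso (PNode r ts) (PNode r us).

Inductive cbr : ptree -> bword -> Prop :=
| cbr_leaf r : cbr (PNode r [::]) [::]
| cbr_node r ts beta bs w :
    ts <> [::] ->
    wf_word (size ts) beta ->
    (forall i, (i < size ts)%N ->
        tiso (nth ptree0 ts (perm_word beta i)) (nth ptree0 ts i)) ->
    size bs = size ts ->
    List.Forall2 cbr ts bs ->
    wf_word (nleaves (PNode r ts)) w ->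
    breq (nleaves (PNode r ts)) w (gammaB (map nleaves ts) beta bs) ->
    cbr (PNode r ts) w.

Inductive pcbr : ptree -> bword -> Prop :=
| pcbr_leaf r : pcbr (PNode r [::]) [::]
| pcbr_node r ts beta bs w :
    ts <> [::] ->
    wf_word (size ts) beta ->
    (forall i, (i < size ts)%N -> perm_word beta i = i) ->
    size bs = size ts ->
    List.Forall2 pcbr ts bs ->
    wf_word (nleaves (PNode r ts)) w ->
    breq (nleaves (PNode r ts)) w (gammaB (map nleaves ts) beta bs) ->
    pcbr (PNode r ts) w.

(* The data attached to A_1, ..., A_p.  A : 'M_(p, n), row j (0-based) is   *)
(* A_{j+1}.                                                                  *)
Section Fission.
Context (R : realType) (n p : nat) (A : 'M[R[i]]_(p, n)).

(* a, b in the same part of P_l  (l in 1..p+1) *)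
Definition sim (l : nat) (a b : 'I_n) : bool :=
  [forall j : 'I_p, (l <= j.+1)%N ==> (A j a == A j b)].

Definition is_part (l : nat) (L : {set 'I_n}) : bool :=
  [exists a, L == [set b | sim l a b]%SET].

(* B = B_1 x ... x B_p inside t^p; a point is x : 'M_(p, n), row j = x_{j+1} *)
Definition Bset : set 'M[R[i]]_(p, n) :=
  [set x | forall j : 'I_p,
     (\sum_(a < n) x j a = 0) /\
     (forall a b : 'I_n, sim j.+1 a b -> x j a = x j b) /\
     (forall a b : 'I_n, ~~ sim j.+1 a b -> sim j.+2 a b -> x j a != x j b)].

Definition sB := set_type Bset.

Definition orbrel (x y : sB) : bool :=
  `[< exists s : 'S_n, set_val y = col_perm s (set_val x) >].

Lemma orbrel_refl : reflexive orbrel.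
Proof. by move=> x; apply/asboolP; exists 1%g; rewrite col_perm1. Qed.

Lemma orbrel_sym : symmetric orbrel.
Proof.
have H : forall x y, orbrel x y -> orbrel y x.
  move=> x y /asboolP [s Hs]; apply/asboolP; exists s^-1%g.
  by rewrite Hs -col_permM mulVg col_perm1.
by move=> x y; apply/idP/idP; apply: H.
Qed.

Lemma orbrel_trans : transitive orbrel.
Proof.
move=> y x z /asboolP [s Hs] /asboolP [t Ht]; apply/asboolP; exists (t * s)%g.
by rewrite Ht Hs col_permM.
Qed.

Definition orbrel_equiv := EquivRel orbrel orbrel_refl orbrel_sym orbrel_trans.

Definition Bbar := {eq_quot orbrel_equiv}.
HB.instance Definition _ := Topological.copy Bbar (quotient_topology Bbar).
HB.instance Definition _ := Quotient.on Bbar.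

(* ranked fission tree (T, r): nodes (l, L), 1 <= l <= p+1, L a part of P_l *)
Definition is_nodeb (v : 'I_p.+2 * {set 'I_n}) : bool :=
  (0 < v.1)%N && is_part v.1 v.2.
Definition fnode := {v : 'I_p.+2 * {set 'I_n} | is_nodeb v}.
Definition flevel (v : fnode) : nat := (val v).1.
Definition fset_of (v : fnode) : {set 'I_n} := (val v).2.
Definition frank (v : fnode) : nat := #|fset_of v|.
Definition fis_root (v : fnode) : bool := flevel v == p.+1.
Definition fparent (u v : fnode) : bool :=
  (flevel v == (flevel u).+1) && (fset_of u \subset fset_of v).

Definition AutT : {set {perm fnode}} :=
  [set s : {perm fnode} |
     [forall v, fis_root (s v) == fis_root v] &&
     [forall u, forall v, fparent (s u) (s v) == fparent u v] &&
     [forall v, frank (s v) == frank v]]%SET.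

Definition valid_ord (ord : nat -> {set 'I_n} -> seq {set 'I_n}) : Prop :=
  forall l L, (2 <= l <= p.+1)%N -> is_part l L ->
    uniq (ord l L) /\
    (forall L', L' \in ord l L = is_part l.-1 L' && (L' \subset L)).

Fixpoint build (ord : nat -> {set 'I_n} -> seq {set 'I_n}) (l : nat)
    (L : {set 'I_n}) : ptree :=
  match l with
  | 0 => PNode #|L| [::]
  | l'.+1 => PNode #|L| (if l' is 0 then [::] else map (build ord l') (ord l L))
  end.

Definition Tplanar ord : ptree := build ord p.+1 [set: 'I_n]%SET.

(* any two isomorphic subtrees admit an isomorphism preserving the orderings *)
Definition compatible_ord ord : Prop :=
  forall t t', List.In t (subtrees (Tplanar ord)) ->
    List.In t' (subtrees (Tplanar ord)) ->
    tiso t t' -> t = t'.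

End Fission.

(* Main.v *)
(* A point of B is a family of configurations of distinct points of the plane, one for every inner
   node of the fission tree, with one point for every child of the node.  Only permutations that
   preserve the tree identify points of B, and a permutation fixing one point of B fixes all of
   them, so B is a covering of its quotient and loops of the quotient lift to paths in B from Q to a
   translate of Q.  Reading off a braid word at every node and cabling these words along the tree
   gives the map to CBr(T, r).

   Both the invariance and the faithfulness of the word of a path of configurations come from the
   convex stars of configurations: a short path stays in one star, where its word is a reduced word
   between two orderings of the points whose signs are dictated by the centre, and such words are
   unique in the braid group (Matsumoto's theorem with signs).  Cabling is injective because
   forgetting strands recovers each constituent braid; hence equal words give homotopies node by
   node, which assemble to a homotopy in B.

   An element of CBr(T, r) permutes the leaves by an automorphism of the tree, and this permutation
   is trivial exactly when all constituent braids are pure. *)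

Require Import Defs.
From HB Require Import structures.
From mathcomp Require Import all_boot all_order all_algebra all_fingroup.
From mathcomp Require Import zify lra.
From mathcomp Require Import complex generic_quotient.
From mathcomp Require Import all_classical all_reals all_analysis.
From Stdlib Require Setoid Morphisms List Permutation.

Set Implicit Arguments.
Unset Strict Implicit.
Unset Printing Implicit Defensive.
Import Order.TTheory GRing.Theory Num.Theory numFieldNormedType.Exports.

(** * Braid words modulo the Artin relations and their action on labelled strands *)

Section BraidWords.
Local Open Scope nat_scope.

(** [Br_N] is known only by its presentation, so it has to be proved that the Artin relations
    account for all homotopies. Points are projected to the real axis, ties being broken by the
    imaginary part; a crossing is positive when the strand coming from the left has the smaller
    imaginary part. Depths of three strands are linearly ordered, which excludes exactly the sign
    patterns for which the three-letter relation fails. Three choices need compensation. The chosen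
    order of the children differs from the order of their positions in [A], so node words are
    conjugated by [cw]. A lift ends at a translate of [A], so the second factor of a product is read
    at the translated node. The sum-zero condition ties the configurations of one level together, so
    row means are subtracted, and words ignore translations. Compatible orderings enter through
    ribbon widths: children permuted by an element of CBr have equal planar trees, so the widths
    after a permutation are those before it. Paths are glued as sums of clamped pieces, which makes
    continuity algebraic. *)

#[global] Instance breq_Equivalence N : RelationClasses.Equivalence (breq N).
Proof. split; [exact: breq_refl|exact: breq_sym|exact: breq_trans]. Qed.

#[global] Instance cat_breq_Proper N :
  Morphisms.Proper (Morphisms.respectful (breq N) (Morphisms.respectful (breq N) (breq N)))
    (@cat (nat * bool)).
Proof. by move=> ? ? ? ? ? ?; apply: breq_cat. Qed.

#[global] Instance cons_breq_Proper N :
  Morphisms.Proper (Morphisms.respectful eq (Morphisms.respectful (breq N) (breq N)))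
    (@cons (nat * bool)).
Proof.
move=> x _ <- u v uv; rewrite -[x :: u]/([:: x] ++ u) -[x :: v]/([:: x] ++ v).
by apply: breq_cat => //; apply: breq_refl.
Qed.

Lemma breq_catl N w u v : breq N u v -> breq N (w ++ u) (w ++ v).
Proof. by move=> uv; apply: breq_cat => //; apply: breq_refl. Qed.

Lemma breq_catr N w u v : breq N u v -> breq N (u ++ w) (v ++ w).
Proof. by move=> uv; apply: breq_cat => //; apply: breq_refl. Qed.

Lemma breq_wf N u v : breq N u v -> wf_word N u = wf_word N v.
Proof.
elim=> {u v} //=.
- by move=> u v w _ -> _ ->.
- by move=> u1 u2 v1 v2 _ + _ +; rewrite /wf_word !all_cat => -> ->.
- by move=> i b ->.
- by move=> i j -> ->.
- by move=> i Hi; rewrite Hi (ltnW Hi).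
Qed.

Lemma breq_widen N M u v : N <= M -> breq N u v -> breq M u v.
Proof.
move=> NM; elim=> {u v}.
- by move=> *; apply: breq_refl.
- by move=> *; apply: breq_sym.
- by move=> u v w _ H1 _ H2; apply: breq_trans H1 H2.
- by move=> *; apply: breq_cat.
- by move=> i b Hi; apply: breq_inv; apply: leq_trans NM.
- by move=> i j Hi Hj ij; apply: breq_far => //; apply: leq_trans NM.
- by move=> i Hi; apply: breq_braid; apply: leq_trans NM.
Qed.

Lemma wshiftD s t w : wshift s (wshift t w) = wshift (t + s) w.
Proof. by rewrite /wshift -map_comp; apply: eq_map => x /=; rewrite addnA. Qed.

Lemma wshift0 w : wshift 0 w = w.
Proof. by rewrite /wshift -[RHS]map_id; apply: eq_map => -[i b] /=; rewrite addn0. Qed.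

Lemma wshift_cat s u v : wshift s (u ++ v) = wshift s u ++ wshift s v.
Proof. exact: map_cat. Qed.

Lemma wf_wshift N s w : wf_word N w -> wf_word (N + s) (wshift s w).
Proof.
by rewrite /wf_word /wshift all_map => /allP H; apply/allP=> x /H /=; rewrite -addSn ltn_add2r.
Qed.

Lemma wf_widen N M w : N <= M -> wf_word N w -> wf_word M w.
Proof. by move=> NM /allP H; apply/allP=> x /H /leq_trans; apply. Qed.

Lemma wf_cat N u v : wf_word N (u ++ v) = wf_word N u && wf_word N v.
Proof. exact: all_cat. Qed.

Lemma breq_shift N s u v : breq N u v -> breq (N + s) (wshift s u) (wshift s v).
Proof.
elim=> {u v}.
- by move=> *; apply: breq_refl.
- by move=> *; apply: breq_sym.
- by move=> u v w _ H1 _ H2; apply: breq_trans H1 H2.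
- by move=> *; rewrite !wshift_cat; apply: breq_cat.
- by move=> i b Hi; apply: breq_inv; rewrite -addSn ltn_add2r.
- by move=> i j Hi Hj ij; apply: breq_far; rewrite -addSn ltn_add2r.
- by move=> i Hi; apply: (@breq_braid _ (i + s)); lia.
Qed.

Definition linv (x : nat * bool) := (x.1, ~~ x.2).

Lemma breq_linv N x : x.1.+1 < N -> breq N [:: x; linv x] [::].
Proof. by case: x => i b; apply: breq_inv. Qed.

Lemma winv_cat u v : winv (u ++ v) = winv v ++ winv u.
Proof. by rewrite /winv map_cat rev_cat. Qed.

Lemma winv_cons x w : winv (x :: w) = winv w ++ [:: linv x].
Proof. by rewrite /winv /= rev_cons cats1. Qed.

Lemma winvK w : winv (winv w) = w.
Proof.
rewrite /winv map_rev revK -map_comp -[RHS]map_id.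
by apply: eq_map => -[i b] /=; rewrite negbK.
Qed.

Lemma wf_winv N w : wf_word N (winv w) = wf_word N w.
Proof. by rewrite /wf_word /winv all_rev all_map. Qed.

Lemma breq_winvr N w : wf_word N w -> breq N (w ++ winv w) [::].
Proof.
elim: w => [|x w IH] /=; first by move=> _; apply: breq_refl.
case/andP=> Hx /IH H; rewrite winv_cons catA.
by rewrite H; apply: breq_linv.
Qed.

Lemma breq_winvl N w : wf_word N w -> breq N (winv w ++ w) [::].
Proof. by move=> H; rewrite -{2}(winvK w); apply: breq_winvr; rewrite wf_winv. Qed.

Lemma breq_winv N u v : wf_word N u -> breq N u v -> breq N (winv u) (winv v).
Proof.
move=> wu uv; have wv : wf_word N v by rewrite -(breq_wf uv).
rewrite -[winv u]cats0 -(breq_winvr wv) catA -{1}uv.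
by rewrite (breq_winvl wu); apply: breq_refl.
Qed.

(* Intertwining relations [x R = R y] pass to inverses on either side. *)
Lemma breq_conj_winv N u v r : wf_word N u -> wf_word N v ->
  breq N (u ++ r) (r ++ v) -> breq N (winv u ++ r) (r ++ winv v).
Proof.
move=> wu wv H; rewrite -[winv u ++ r]cats0 -(breq_winvr wv).
rewrite !catA -(catA _ r) -H !catA (breq_winvl wu); exact: breq_refl.
Qed.

Lemma breq_conj_letter N x y r : x.1.+1 < N -> y.1.+1 < N ->
  breq N (x :: r) (r ++ [:: y]) -> breq N (linv x :: r) (r ++ [:: linv y]).
Proof.
move=> wx wy H; have := @breq_conj_winv N [:: x] [:: y] r.
by rewrite /wf_word /= wx wy; apply.
Qed.

Lemma breq_conj_winvr N u v r : wf_word N r ->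
  breq N (u ++ r) (r ++ v) -> breq N (v ++ winv r) (winv r ++ u).
Proof.
move=> wr H; rewrite -[v ++ _]cat0s -(breq_winvl wr).
rewrite -catA (catA r) -H -!catA (breq_winvr wr) cats0; exact: breq_refl.
Qed.

Lemma breq_comm N i j b c : i.+1 < N -> j.+1 < N ->
  (i.+1 < j) || (j.+1 < i) -> breq N [:: (i, b); (j, c)] [:: (j, c); (i, b)].
Proof.
move=> Hi Hj.
have H : forall i j b c, i.+1 < N -> j.+1 < N -> i.+1 < j ->
    breq N [:: (i, b); (j, c)] [:: (j, c); (i, b)].
  move=> {b c Hi Hj}i {}j b c Hi Hj ij; have H0 := breq_far Hi Hj ij.
  have H1 : breq N [:: (i, b); (j, true)] [:: (j, true); (i, b)].
    by case: b => //; apply: (@breq_conj_letter N (i, true) (i, true) [:: (j, true)]).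
  case: c => //; apply: breq_sym.
  by apply: (@breq_conj_letter N (j, true) (j, true) [:: (i, b)]) => //; apply: breq_sym.
by case/orP=> ij; [|apply: breq_sym]; apply: H.
Qed.

Definition inr lo hi (w : bword) := all (fun x => (lo <= x.1) && (x.1.+1 < hi)) w.

Lemma inr_wf lo hi N w : hi <= N -> inr lo hi w -> wf_word N w.
Proof. by move=> hN /allP H; apply/allP=> x /H /andP[_ /leq_trans]; apply. Qed.

Lemma inr_wshift s a w : wf_word a w -> inr s (s + a) (wshift s w).
Proof.
move=> /allP H; rewrite /inr /wshift all_map; apply/allP=> x /H /=; lia.
Qed.

Lemma breq_comm_inr N lo hi lo' hi' u v : inr lo hi u -> inr lo' hi' v ->
  wf_word N u -> wf_word N v -> hi <= lo' -> breq N (u ++ v) (v ++ u).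
Proof.
move=> + + + + hl; elim: u => [|x u IHu] /=.
  by move=> _ _ _ _; rewrite cats0; apply: breq_refl.
case/andP=> Hx Hu Hv /andP[wx wu] wv; rewrite (IHu Hu Hv wu wv).
rewrite -cat_cons -(cat1s x u) catA; apply: breq_catr.
elim: v Hv wv {IHu} => [|y v IHv] /=; first by move=> _ _; apply: breq_refl.
case/andP=> Hy Hv /andP[wy wv]; rewrite -(IHv Hv wv).
apply: (@breq_catr N v [:: x; y] [:: y; x]); move: Hx Hy wx wy; clear IHv; case: x y => i b [j c] /= Hx Hy wx wy.
apply: breq_comm => //; lia.
Qed.

(** A total adjacent swap: it does nothing past the end of the sequence, which makes [swpK] and
    [act_winv] unconditional. *)
Fixpoint swp (T : Type) (i : nat) (l : seq T) : seq T :=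
  match i, l with
  | 0, x :: y :: r => y :: x :: r
  | i'.+1, x :: r => x :: swp i' r
  | _, _ => l
  end.

(** The sequence lists the strands by current position, whereas [perm_word] follows one strand;
    [nth_act] relates the two views. Signs of letters are ignored. *)
Definition act (T : Type) (w : bword) (l : seq T) : seq T :=
  foldl (fun l x => swp x.1 l) l w.

Lemma swp_cat T (l1 : seq T) x y r i : size l1 = i ->
  swp i (l1 ++ x :: y :: r) = l1 ++ y :: x :: r.
Proof. by elim: l1 i => [|z l1 IH] [|i] //= [/IH->]. Qed.

Lemma size_swp T i (l : seq T) : size (swp i l) = size l.
Proof. by elim: i l => [|i IH] [|x [|y l]] //=; rewrite IH. Qed.

Lemma swpK T i (l : seq T) : swp i (swp i l) = l.
Proof. by elim: i l => [|i IH] [|x [|y l]] //=; rewrite ?IH //; case: i {IH}. Qed.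

Lemma swp_out T i (l : seq T) : size l <= i.+1 -> swp i l = l.
Proof. by elim: i l => [|i IH] [|x [|y l]] //= H; rewrite IH. Qed.

Lemma swp_map T U (f : T -> U) i l : swp i (map f l) = map f (swp i l).
Proof. by elim: i l => [|i IH] [|x [|y l]] //=; rewrite -IH. Qed.

Lemma split_two T i (l : seq T) : i.+1 < size l ->
  exists l1 x y l2, size l1 = i /\ l = l1 ++ x :: y :: l2.
Proof.
elim: i l => [|i IH] [|x l] //=.
  by case: l => [|y l] // _; exists [::], x, y, l.
by rewrite ltnS => /IH[l1 [y [z [l2 [<- ->]]]]]; exists (x :: l1), y, z, l2.
Qed.

Lemma count_swp (T : eqType) (a : pred T) i l : count a (swp i l) = count a l.
Proof.
elim: i l => [|i IH] [|x l] //=; last by rewrite IH.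
by case: l => [|y l] //=; rewrite addnCA.
Qed.

Lemma swp_far T i j (l : seq T) : i.+1 < j -> swp i (swp j l) = swp j (swp i l).
Proof.
elim: i j l => [|i IH] [|j] [|x l] //= H; last by rewrite IH.
by case: j l H => [|j] [|y l].
Qed.

Lemma swp_braid T i (l : seq T) : i.+2 < size l ->
  swp i (swp i.+1 (swp i l)) = swp i.+1 (swp i (swp i.+1 l)).
Proof.
elim: i l => [|i IH] [|x l] //=; last by rewrite ltnS => /IH /= ->.
by case: l => [|y [|z l]].
Qed.

Lemma nth_swp T (x0 : T) i b l k : i.+1 < size l ->
  nth x0 (swp i l) (strand_step k (i, b)) = nth x0 l k.
Proof.
rewrite /strand_step /=; elim: i l k => [|i IH] [|x l] //=.
  by case: l => [|y l] // [|[|k]].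
move=> [|k]; rewrite ltnS => H //=; rewrite !eqSS -(IH l k H); by case: ifP => //; case: ifP.
Qed.

Lemma act_cat T u v (l : seq T) : act (u ++ v) l = act v (act u l).
Proof. exact: foldl_cat. Qed.

Lemma size_act T w (l : seq T) : size (act w l) = size l.
Proof. by elim: w l => //= x w IH l; rewrite /act /= -/(act _ _) IH size_swp. Qed.

Lemma act_map T U (f : T -> U) w l : act w (map f l) = map f (act w l).
Proof. by elim: w l => //= x w IH l; rewrite /act /= -/(act _ _) swp_map IH. Qed.

Lemma count_act (T : eqType) (a : pred T) w l : count a (act w l) = count a l.
Proof. by elim: w l => //= x w IH l; rewrite /act /= -/(act _ _) IH count_swp. Qed.

Lemma act_breq T N u v (l : seq T) : size l = N -> breq N u v -> act u l = act v l.
Proof.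
move=> + H; elim: H l => {u v} //=.
- by move=> u v _ IH l Hl; rewrite IH.
- by move=> u v w _ H1 _ H2 l Hl; rewrite H1 // H2.
- by move=> u1 u2 v1 v2 _ H1 _ H2 l Hl; rewrite !act_cat H1 // H2 // size_act.
- by move=> i b Hi l Hl; rewrite /act /= swpK.
- by move=> i j Hi Hj ij l Hl; rewrite /act /= -swp_far.
- by move=> i Hi l Hl; rewrite /act /=; apply: swp_braid; rewrite Hl.
Qed.

Lemma act_winv T w (l : seq T) : act (winv w) (act w l) = l.
Proof.
elim: w l => //= x w IH l; rewrite winv_cons act_cat.
by rewrite IH /act /= swpK.
Qed.

Lemma act_winvK T w (l : seq T) : act w (act (winv w) l) = l.
Proof. by rewrite -{1}(winvK w) act_winv. Qed.

Lemma act_inj T w : injective (@act T w).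
Proof. by move=> l l' /(congr1 (act (winv w))); rewrite !act_winv. Qed.

Lemma perm_word_cat u v k : perm_word (u ++ v) k = perm_word v (perm_word u k).
Proof. exact: foldl_cat. Qed.

Lemma strand_stepP k i b : (k = i /\ strand_step k (i, b) = i.+1) \/
  (k = i.+1 /\ strand_step k (i, b) = i) \/
  (k <> i /\ k <> i.+1 /\ strand_step k (i, b) = k).
Proof.
rewrite /strand_step /=; have [->|/eqP ki] := eqVneq k i; first by left.
by have [->|/eqP ki'] := eqVneq k i.+1; right; [left|right].
Qed.

Lemma strand_stepK i b c k : strand_step (strand_step k (i, b)) (i, c) = k.
Proof.
by have := strand_stepP k i b; have := strand_stepP (strand_step k (i, b)) i c; lia.
Qed.

Lemma perm_word_winv w k : perm_word (winv w) (perm_word w k) = k.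
Proof.
elim: w k => //= -[i b] w IH k; rewrite winv_cons perm_word_cat IH.
exact: strand_stepK.
Qed.

Lemma perm_word_lt N w k : wf_word N w -> k < N -> perm_word w k < N.
Proof.
elim: w k => //= -[i b] w IH k /= /andP[Hi Hw] Hk; apply: IH => //.
by have := strand_stepP k i b; lia.
Qed.

Lemma perm_word_breq N u v : breq N u v -> perm_word u =1 perm_word v.
Proof.
elim=> {u v} //=.
- by move=> u v _ IH k; rewrite IH.
- by move=> u v w _ H1 _ H2 k; rewrite H1 // H2.
- by move=> u1 u2 v1 v2 _ H1 _ H2 k; rewrite !perm_word_cat H1 // H2.
- by move=> i b Hi k; rewrite /perm_word /= strand_stepK.
- move=> i j Hi Hj ij k; rewrite /perm_word /=.
  have := strand_stepP k i true; have := strand_stepP k j true.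
  have := strand_stepP (strand_step k (i, true)) j true.
  by have := strand_stepP (strand_step k (j, true)) i true; lia.
- move=> i Hi k; rewrite /perm_word /=.
  set a := strand_step k (i, true); set a1 := strand_step a (i.+1, true).
  set b := strand_step k (i.+1, true); set b1 := strand_step b (i, true).
  have := strand_stepP k i true; have := strand_stepP a i.+1 true.
  have := strand_stepP a1 i true; have := strand_stepP k i.+1 true.
  by have := strand_stepP b i true; have := strand_stepP b1 i.+1 true; lia.
Qed.

Lemma nth_act T (x0 : T) w l k : wf_word (size l) w ->
  nth x0 (act w l) (perm_word w k) = nth x0 l k.
Proof.
elim: w l k => //= -[i b] w IH l k /andP[Hi Hw]; rewrite /act /= -/(act _ _).
by rewrite /perm_word /= -/(perm_word _ _) IH ?size_swp // nth_swp.
Qed.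

Lemma act_pure T w (l : seq T) : wf_word (size l) w ->
  (forall k, k < size l -> perm_word w k = k) -> act w l = l.
Proof.
case: l => [|x0 l]; first by elim: w.
move=> wf H; apply: (@eq_from_nth _ x0) => [|k]; rewrite size_act // => Hk.
by rewrite -{1}(H k Hk) nth_act.
Qed.

Lemma perm_act (T : eqType) w (l : seq T) : perm_eq (act w l) l.
Proof. by apply/seq.permP => a; rewrite count_act. Qed.

(** Selection sort: [front] carries the first required element to the head, and the rest is sorted
    by a word shifted by one. All letters are positive, which is harmless since only the permutation
    is prescribed. *)
Lemma act_surj (T : eqType) (l l' : seq T) : perm_eq l l' ->
  exists2 w, wf_word (size l) w & act w l = l'.
Proof.
have shift (w : bword) T' (x : T') m : act (wshift 1 w) (x :: m) = x :: act w m.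
  by elim: w m => //= -[i b] w IH m; rewrite /act /= addn1 /= -/(act _ _) IH.
have front (x : T) l1 l2 : exists2 w, wf_word (size (l1 ++ x :: l2)) w &
    act w (l1 ++ x :: l2) = x :: l1 ++ l2.
  elim: l1 => [|y l1 [w wf Hw]]; first by exists [::].
  exists (wshift 1 w ++ [:: (0, true)]); last by rewrite act_cat shift Hw.
  by rewrite wf_cat /=; have := wf_wshift 1 wf; rewrite addn1 => ->; rewrite size_cat /= addnS.
elim: l' l => [|x l' IH] l.
  by move/perm_size/size0nil->; exists [::].
move=> Hp; have : x \in l by rewrite (perm_mem Hp) mem_head.
move=> xl; case: (splitPr xl) Hp => l1 l2 Hp; have [w1 wf1 H1] := front x l1 l2.
have /IH[w wf2 H2] : perm_eq (l1 ++ l2) l'.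
  by rewrite -(perm_cons x); apply: perm_trans Hp; rewrite perm_sym perm_catC /= perm_cons perm_catC.
exists (w1 ++ wshift 1 w); last by rewrite act_cat H1 shift H2.
rewrite wf_cat wf1; have := wf_wshift 1 wf2; rewrite !size_cat /= addn1 addnS; exact.
Qed.

Lemma swap_sizesE ms i : i.+1 < size ms -> swap_sizes ms i = swp i ms.
Proof.
move=> /split_two[l1 [x [y [l2 [Hs ->]]]]]; rewrite /swap_sizes (swp_cat _ _ _ Hs).
rewrite !nth_cat Hs ltnn subnn ltnNge leqnSn /= subSnn /=.
apply: (@eq_from_nth _ 0) => [|k].
  by rewrite !size_set_nth !size_cat /=; lia.
rewrite !size_set_nth !size_cat /= => Hk; rewrite !nth_set_nth /= !nth_cat /=.
have [->|ki] := eqVneq k i.+1; first by rewrite Hs ltnNge leqnSn subSnn.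
rewrite nth_set_nth /=; have [->|ki'] := eqVneq k i; first by rewrite Hs ltnn subnn.
rewrite nth_cat; case: ltnP => // Hk'; have -> : k - size l1 = (k - size l1).-2.+2 by lia.
by [].
Qed.

End BraidWords.

(** * Ribbon crossings and the erasing of strands *)

Section Cabling.
Local Open Scope nat_scope.

(** One strand passing over the [b] strands to its right. A ribbon crossing is a stack of such rows,
    beginning with the rightmost strand of the ribbon ([ribbonS]). *)
Definition row t b : bword := [seq (t + j, true) | j <- iota 0 b].

Lemma rowS t b : row t b.+1 = (t, true) :: row t.+1 b.
Proof.
rewrite /row /= addn0; congr cons; rewrite -[1]addn0 iotaDl -map_comp.
by apply: eq_map => j /=; rewrite addnA addn1.
Qed.

Lemma rowD t a b : row t (a + b) = row t a ++ row (t + a) b.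
Proof.
rewrite /row iotaD map_cat add0n; congr cat; rewrite -{1}[a]addn0 iotaDl -map_comp.
by apply: eq_map => j /=; rewrite addnA.
Qed.

Lemma rowSr t b : row t b.+1 = row t b ++ [:: (t + b, true)].
Proof. by rewrite -addn1 rowD /row /= addn0. Qed.

Lemma inr_row t b : inr t (t + b).+1 (row t b).
Proof.
rewrite /inr /row all_map; apply/allP => j; rewrite mem_iota /=; lia.
Qed.

Lemma ribbonS s a b : ribbon s a.+1 b = row (s + a) b ++ ribbon s a b.
Proof. by rewrite /ribbon -addn1 iotaD rev_cat. Qed.

Lemma ribbonr0 s a : ribbon s a 0 = [::].
Proof. by elim: a => // a IH; rewrite ribbonS IH. Qed.

Lemma ribbonD s a b c : ribbon s (a + b) c = ribbon (s + a) b c ++ ribbon s a c.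
Proof. by elim: b => [|b IH]; rewrite ?addn0 // addnS !ribbonS IH !catA addnA. Qed.

Lemma inr_widen lo hi lo' hi' w : lo' <= lo -> hi <= hi' -> inr lo hi w -> inr lo' hi' w.
Proof. by move=> H1 H2 /allP H; apply/allP=> x /H; lia. Qed.

Lemma inr_cat lo hi u v : inr lo hi (u ++ v) = inr lo hi u && inr lo hi v.
Proof. exact: all_cat. Qed.

Lemma inr_ribbon s a b : inr s (s + a + b) (ribbon s a b).
Proof.
elim: a => [|a IH] //; rewrite ribbonS inr_cat (inr_widen _ _ IH) //; last by lia.
by rewrite andbT; apply: inr_widen (inr_row _ _); lia.
Qed.

Lemma wf_ribbon N s a b : s + a + b <= N -> wf_word N (ribbon s a b).
Proof. by move=> H; apply: inr_wf (inr_ribbon s a b). Qed.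

Lemma wshift_ribbon t s a b : wshift t (ribbon s a b) = ribbon (s + t) a b.
Proof.
elim: a => [|a IH] //; rewrite !ribbonS wshift_cat IH; congr cat.
by rewrite /wshift /row -map_comp; apply: eq_map => j /=; congr pair; lia.
Qed.

Lemma act_row T t b (l1 : seq T) x B r : size l1 = t -> size B = b ->
  act (row t b) (l1 ++ x :: B ++ r) = l1 ++ B ++ x :: r.
Proof.
elim: B t b l1 => [|y B IH] t b l1 <- <- //; rewrite [size _]/= rowS /act /= -/(act _ _) swp_cat //.
by rewrite -cat_rcons (IH _ _ (rcons l1 y)) // ?size_rcons // cat_rcons.
Qed.

Lemma act_ribbon T s a b (l1 A B r : seq T) : size l1 = s -> size A = a -> size B = b ->
  act (ribbon s a b) (l1 ++ A ++ B ++ r) = l1 ++ B ++ A ++ r.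
Proof.
move=> Hs + Hb; elim/last_ind: A a r => [|A x IH] a r <- //; rewrite size_rcons ribbonS act_cat.
rewrite cat_rcons catA act_row ?size_cat ?Hs // -catA IH //.
by rewrite cat_rcons.
Qed.

Lemma act_catl T w (l r : seq T) : wf_word (size l) w -> act w (l ++ r) = act w l ++ r.
Proof.
elim: w l => //= x w IH l /andP[Hx Hw]; rewrite /act /= -/(act _ _) -/(act _ _).
case: (split_two Hx) => l1 [y [z [l2 [Hs Hl]]]]; rewrite Hl -catA /= !swp_cat //.
rewrite -!cat_cons catA IH // size_cat /=; move: Hw; rewrite Hl size_cat //.
Qed.

Lemma act_wshift T w (l r : seq T) t : size l = t -> act (wshift t w) (l ++ r) = l ++ act w r.
Proof.
move=> <-; elim: w r => //= x w IH r; rewrite /act /= -/(act _ _) -/(act _ _) -IH; congr act.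
by elim: l {IH} => [|y l /= IH]; rewrite ?addn0 // addnS /= IH.
Qed.

(* [fg m w] is the braid word left after erasing the strands that start at the
   positions where the mask [m] is false. *)
Fixpoint fg (m : seq bool) (w : bword) : bword :=
  if w is x :: w' then
    (if nth false m x.1 && nth false m x.1.+1
     then [:: (count id (take x.1 m), x.2)] else [::]) ++ fg (swp x.1 m) w'
  else [::].

Lemma fg_cons m i b w : fg m ((i, b) :: w) =
  (if nth false m i && nth false m i.+1
   then [:: (count id (take i m), b)] else [::]) ++ fg (swp i m) w.
Proof. by []. Qed.

(** Erasing is not a homomorphism: the mask travels with the strands, so the second factor sees
    [act u m]. *)
Lemma fg_cat m u v : fg m (u ++ v) = fg m u ++ fg (act u m) v.
Proof. by elim: u m => //= x u IH m; rewrite IH catA. Qed.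

(** A letter survives only if both of its strands do, so each Artin relation turns into an instance
    of itself on fewer strands or into two equal words. With one of three strands missing, both
    sides of the braid relation leave the same single crossing. *)
Lemma fg_breq N m u v : size m = N -> breq N u v -> breq (count id m) (fg m u) (fg m v).
Proof.
move=> + H; elim: H m => {u v}.
- by move=> *; apply: breq_refl.
- by move=> u v _ IH m /IH H; apply: breq_sym.
- by move=> u v w _ H1 _ H2 m Hm; apply: breq_trans (H1 m Hm) (H2 m Hm).
- move=> u1 u2 v1 v2 H0 H1 _ H2 m Hm; rewrite !fg_cat; apply: breq_cat; first exact: H1.
  by have := H2 (act u2 m); rewrite size_act count_act => /(_ Hm); rewrite (act_breq Hm H0).
- move=> i b Hi m Hm /=; have := Hi; rewrite -Hm => /split_two[l1 [x [y [l2 [Hs ->]]]]].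
  rewrite swp_cat // !take_size_cat // !nth_cat Hs ltnn subnn ltnNge leqnSn /= subSnn /=.
  case: x y => -[] /=; try exact: breq_refl.
  by apply: breq_inv; rewrite count_cat /=; lia.
- move=> i j Hi Hj ij m Hm /=.
  have [l1 [x [y [l2 [Hs Hl]]]]] := @split_two _ i m ltac:(lia).
  have [l3 [z [t [l4 [Hs3 Hl4]]]]] := @split_two _ (j - i.+2) l2 ltac:(move: Hm; rewrite Hl size_cat /=; lia).
  have E (u v : bool) (r : seq bool) : l1 ++ [:: u, v & l3 ++ r] = (l1 ++ [:: u, v & l3]) ++ r by rewrite -catA.
  have S u v : size (l1 ++ [:: u, v & l3]) = j by rewrite size_cat /= Hs Hs3; lia.
  have SW u v a b : swp j (l1 ++ [:: u, v & l3 ++ [:: a, b & l4]]) = l1 ++ [:: u, v & l3 ++ [:: b, a & l4]].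
    by rewrite !E swp_cat.
  have TK u v r : take j (l1 ++ [:: u, v & l3 ++ r]) = l1 ++ [:: u, v & l3].
    by rewrite E take_size_cat.
  rewrite Hl Hl4 SW !swp_cat // !TK !take_size_cat //.
  have N1 u v r : nth false (l1 ++ [:: u, v & r]) i = u by rewrite nth_cat Hs ltnn subnn.
  have N2 u v r : nth false (l1 ++ [:: u, v & r]) i.+1 = v by rewrite nth_cat Hs ltnNge leqnSn /= subSnn.
  have N3 u v a b r : nth false (l1 ++ [:: u, v & l3 ++ [:: a, b & r]]) j = a.
    by rewrite E nth_cat S ltnn subnn.
  have N4 u v a b r : nth false (l1 ++ [:: u, v & l3 ++ [:: a, b & r]]) j.+1 = b.
    by rewrite E nth_cat S ltnNge leqnSn /= subSnn.
  rewrite !N1 !N2 !N3 !N4; rewrite !count_cat /= !count_cat /=.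
  case: x y z t {Hl Hl4} => [] [] [] [] /=; try exact: breq_refl.
  by apply: breq_far; lia.
- move=> i Hi m Hm; have [l1 [x [y [l2 [Hs Hl]]]]] := @split_two _ i m ltac:(lia).
  case: l2 Hl => [|z l2] Hl; first by move: Hi; rewrite -Hm Hl size_cat /=; lia.
  have swp1 u v w : swp i.+1 (l1 ++ [:: u, v, w & l2]) = l1 ++ [:: u, w, v & l2].
    by rewrite -cat_rcons swp_cat ?size_rcons ?Hs // cat_rcons.
  have N1 u v r : nth false (l1 ++ [:: u, v & r]) i = u by rewrite nth_cat Hs ltnn subnn.
  have N2 u v r : nth false (l1 ++ [:: u, v & r]) i.+1 = v by rewrite nth_cat Hs ltnNge leqnSn /= subSnn.
  have N3 u v w : nth false (l1 ++ [:: u, v, w & l2]) i.+2 = w.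
    by rewrite nth_cat Hs; case: ltnP; [lia|move=> _]; have -> : i.+2 - i = 2 by lia.
  have T1 u v w : take i.+1 (l1 ++ [:: u, v, w & l2]) = rcons l1 u.
    by rewrite -cat_rcons take_size_cat // size_rcons Hs.
  rewrite !fg_cons [fg _ [::]]/= Hl !(swp1, swp_cat, N1, N2, N3, T1, take_size_cat) //.
  rewrite -!cats1 !count_cat /=.
  case: x y z {Hl} => [] [] [] /=; rewrite ?addn0 ?addn1; try exact: breq_refl.
  by apply: breq_braid; lia.
Qed.

Lemma fg_row t b l1 x B r : size l1 = t -> size B = b ->
  fg (l1 ++ x :: B ++ r) (row t b) = if x then row (count id l1) (count id B) else [::].
Proof.
elim: B t b l1 => [|y B IH] t b l1 <- <-; first by case: x.
rewrite [size _]/= rowS /= swp_cat // take_size_cat // nth_cat ltnn subnn nth_cat ltnNge leqnSn /= subSnn /=.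
rewrite -cat_rcons (IH _ _ (rcons l1 y)) // ?size_rcons // -cats1 count_cat /= addn0.
by case: (x) y => [] []; rewrite //= ?addn0 ?addn1 ?add1n ?add0n ?rowS.
Qed.

Lemma fg_ribbon s a b l1 A B r : size l1 = s -> size A = a -> size B = b ->
  fg (l1 ++ A ++ B ++ r) (ribbon s a b) = ribbon (count id l1) (count id A) (count id B).
Proof.
move=> Hs + Hb; elim/last_ind: A a r => [|A x IH] a r <- //; rewrite size_rcons ribbonS fg_cat.
rewrite cat_rcons catA fg_row ?act_row ?size_cat ?Hs // -catA IH //.
rewrite -cats1 !count_cat /= addn0; case: x; last by rewrite addn0.
by rewrite addn1 ribbonS.
Qed.

Lemma take_swp T i (l : seq T) : take i (swp i l) = take i l.
Proof. by elim: i l => [|i IH] [|x l] //=; [case: l|rewrite IH]. Qed.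

Lemma fg_winv m w : fg (act w m) (winv w) = winv (fg m w).
Proof.
elim: w m => //= x w IH m; rewrite winv_cons fg_cat winv_cat -IH /=.
congr cat; rewrite act_winv cats0 take_swp.
have [H|H] := leqP (size m) x.1.+1; first by rewrite swp_out // [nth _ _ _.+1]nth_default ?andbF.
have [l1 [y [z [l2 [Hs ->]]]]] := split_two H.
rewrite swp_cat // !nth_cat Hs ltnn subnn ltnNge leqnSn /= subSnn /= [_ && y]andbC.
by case: ifP.
Qed.

Lemma fg_catl m r w : wf_word (size m) w -> fg (m ++ r) w = fg m w.
Proof.
elim: w m => //= x w IH m /andP[Hx Hw].
have [l1 [y [z [l2 [Hs Hl]]]]] := split_two Hx.
have E : swp x.1 (m ++ r) = swp x.1 m ++ r by rewrite Hl -catA /= !swp_cat // -catA.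
rewrite E IH ?size_swp // !nth_cat Hx (ltnW Hx) takel_cat //; exact: ltnW (ltnW Hx).
Qed.

Lemma fg_wshift l m t w : size l = t -> fg (l ++ m) (wshift t w) = wshift (count id l) (fg m w).
Proof.
move=> Hl; elim: w m => //= x w IH m; rewrite wshift_cat.
have := @act_wshift _ [:: x] l m t Hl; rewrite /act /= => ->; rewrite IH; congr cat.
rewrite -addSn !nth_cat -Hl ltnNge leq_addl /= addnK ltnNge leq_addl /= addnK.
case: ifP => //= _; rewrite take_cat ltnNge leq_addl /= addnK count_cat /=.
by rewrite /wshift /= addnC.
Qed.

Lemma fg_small m w : count id m <= 1 -> fg m w = [::].
Proof.
elim: w m => //= x w IH m H; rewrite IH ?count_swp // cats0.
case: ifP => // /andP[H1 H2]; case: (ltnP x.1.+1 (size m)) => Hs; last by rewrite nth_default in H2.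
have [l1 [y [z [l2 [Hl E]]]]] := split_two Hs; move: H H1 H2.
rewrite E !nth_cat Hl ltnn subnn ltnNge leqnSn /= subSnn /= count_cat /= => + Hy Hz; rewrite Hy Hz; lia.
Qed.

Lemma fg_true n w : wf_word n w -> fg (nseq n true) w = w.
Proof.
elim: w => //= -[i b] w IH /andP[/= Hx Hw].
rewrite !nth_nseq Hx (ltnW Hx) /= take_nseq ?count_nseq ?mul1n; last by lia.
congr cons; have -> : swp i (nseq n true) = nseq n true; last exact: IH.
by elim: i n {IH Hx Hw} => [|i IHi] [|n] //=; [case: n|rewrite IHi].
Qed.

End Cabling.

(** * Sliding braids through ribbon crossings; cabling respects the braid relations *)

Section Naturality.
Local Open Scope nat_scope.

(** Only the letters of the row at [j] and [j.+1] interact with the crossing, by one braid relation;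
    the letters before and after them commute with it. Inverse letters follow by conjugation. *)
Lemma breq_nat_row N t b j c : t <= j -> j.+1 < t + b -> t + b < N ->
  breq N ((j.+1, c) :: row t b) (row t b ++ [:: (j, c)]).
Proof.
move=> tj jb bN.
suff H : breq N ((j.+1, true) :: row t b) (row t b ++ [:: (j, true)]).
  case: c => //; apply: (@breq_conj_letter N (j.+1, true) (j, true)) => //=; lia.
have -> : b = (j - t) + (2 + (t + b - j - 2)) by lia.
rewrite !rowD; have -> : t + (j - t) = j by lia.
rewrite -cat1s !catA.
set x := row t (j - t); set y := row (j + 2) _.
have E : row j 2 = [:: (j, true); (j.+1, true)] by rewrite /row /= addn0 addn1.
have Hx : inr t j.+1 x by apply: inr_widen (inr_row _ _); lia.
have Hy : inr (j + 2) (t + b).+1 y by apply: inr_widen (inr_row _ _); lia.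
have wx : wf_word N x by apply: inr_wf Hx; lia.
have wy : wf_word N y by apply: inr_wf Hy; lia.
rewrite -(breq_comm_inr (u := x) (v := [:: (j.+1, true)]) Hx (lo' := j.+1) (hi' := j.+3)) //=;
  [|by rewrite /inr /=; lia|by rewrite /wf_word /=; lia].
rewrite E -!catA; apply: breq_catl.
rewrite -(breq_comm_inr (u := [:: (j, true)]) (v := y) (lo := j) (hi := j + 2) _ Hy) //=;
  [|by rewrite /inr /=; lia|by rewrite /wf_word /=; lia].
apply: (@breq_catr _ y [:: (j.+1, true); (j, true); (j.+1, true)]
          [:: (j, true); (j.+1, true); (j, true)]).
by apply: breq_sym; apply: breq_braid; lia.
Qed.

(** Two adjacent strands pass over the same [b] strands in turn. Induction peels off the last strand
    passed, where one braid relation carries the crossing of the two to the other side. *)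
Lemma breq_two_rows N t b : t + b.+1 < N ->
  breq N ((t, true) :: row t.+1 b ++ row t b) (row t.+1 b ++ row t b ++ [:: (t + b, true)]).
Proof.
elim: b => [|b IH] H; first by rewrite /= addn0; apply: breq_refl.
have E : breq N (row t.+1 b.+1 ++ row t b.+1)
    ((row t.+1 b ++ row t b) ++ [:: (t.+1 + b, true); (t + b, true)]).
  rewrite !rowSr -!catA; apply: breq_catl; rewrite !catA.
  rewrite -[[:: (_, _); (_, _)]]/([:: (t.+1 + b, true)] ++ [:: (t + b, true)]) catA.
  apply: breq_catr; apply: breq_sym.
  apply: (@breq_comm_inr _ t (t + b).+1 (t + b).+1 (t + b).+3); first exact: inr_row.
  - by rewrite /inr /=; lia.
  - by apply: inr_wf (inr_row _ _); lia.
  - by rewrite /wf_word /=; lia.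
  - by [].
rewrite catA E -cat_cons IH; last by lia.
rewrite -!catA; do 2 apply: breq_catl.
rewrite addSn addnS; apply: breq_braid; lia.
Qed.

Lemma breq_nat_ribbonB N s a b j c : j.+1 < b -> s + a + b <= N ->
  breq N ((s + a + j, c) :: ribbon s a b) (ribbon s a b ++ [:: (s + j, c)]).
Proof.
move=> jb; elim: a => [|a IH] H; first by rewrite addn0; apply: breq_refl.
rewrite ribbonS -cat_cons addnS addSn breq_nat_row; try lia.
by rewrite -!catA; apply: breq_catl; apply: IH; lia.
Qed.

(** The rows of the other strands of the ribbon act on positions away from the crossing, before or
    after it; the two rows of the crossing strands themselves are [breq_two_rows]. *)
Lemma breq_nat_ribbonA N s a b i c : i.+1 < a -> s + a + b <= N ->
  breq N ((s + i, c) :: ribbon s a b) (ribbon s a b ++ [:: (s + i + b, c)]).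
Proof.
move=> ia H.
suff H0 : breq N ((s + i, true) :: ribbon s a b) (ribbon s a b ++ [:: (s + i + b, true)]).
  case: c => //; apply: (@breq_conj_letter N (s + i, true) (s + i + b, true)) => //=; lia.
have -> : a = i.+2 + (a - i.+2) by lia.
rewrite ribbonD !ribbonS -cat1s; set x := ribbon (s + i.+2) _ _; set y := ribbon s i b.
have Hx : inr (s + i.+2) N x by apply: inr_widen (inr_ribbon _ _ _); lia.
have Hy : inr s (s + i + b) y by exact: inr_ribbon.
rewrite catA (breq_comm_inr (u := [:: (s + i, true)]) (lo := s + i) (hi := s + i.+2) _ Hx);
  last by []; first last.
- exact: inr_wf Hx.
- by rewrite /wf_word /=; lia.
- by rewrite /inr /=; lia.
rewrite -!catA; apply: breq_catl; rewrite (breq_comm_inr Hy (v := [:: (s + i + b, true)])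
   (lo' := s + i + b) (hi' := s + i + b.+2)); last by []; first last.
- by rewrite /wf_word /=; lia.
- by apply: inr_wf Hy; lia.
- by rewrite /inr /=; lia.
rewrite !catA; apply: breq_catr; rewrite addnS -!catA.
by apply: breq_two_rows; lia.
Qed.

Lemma breq_nat_wordA N s a b u : wf_word a u -> s + a + b <= N ->
  breq N (wshift s u ++ ribbon s a b) (ribbon s a b ++ wshift (s + b) u).
Proof.
move=> + H; elim: u => [|[i c] u IH] /=; first by rewrite cats0; move=> _; apply: breq_refl.
case/andP=> Hi Hu; rewrite (IH Hu) -cat_cons addnC breq_nat_ribbonA //.
by rewrite -catA [_ + (s + b)]addnC [s + b + i]addnAC; apply: breq_refl.
Qed.

Lemma breq_nat_wordB N s a b u : wf_word b u -> s + a + b <= N ->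
  breq N (wshift (s + a) u ++ ribbon s a b) (ribbon s a b ++ wshift s u).
Proof.
move=> + H; elim: u => [|[i c] u IH] /=; first by rewrite cats0; move=> _; apply: breq_refl.
case/andP=> Hi Hu; rewrite (IH Hu) -cat_cons addnC breq_nat_ribbonB //.
by rewrite -catA [_ + s]addnC; apply: breq_refl.
Qed.

Lemma cable_letter_split ms1 a c ms2 i b : size ms1 = i ->
  cable_letter (ms1 ++ a :: c :: ms2) (i, b) =
  if b then ribbon (sumn ms1) a c else winv (ribbon (sumn ms1) c a).
Proof.
move=> <-; rewrite /cable_letter /= take_size_cat // !nth_cat ltnn subnn.
by rewrite ltnNge leqnSn /= subSnn.
Qed.

Lemma cable_cons ms x w : x.1.+1 < size ms ->
  cable_word ms (x :: w) = cable_letter ms x ++ cable_word (swp x.1 ms) w.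
Proof. by move=> H; rewrite /= swap_sizesE. Qed.

Lemma cable_cons' ms i b w : i.+1 < size ms ->
  cable_word ms ((i, b) :: w) = cable_letter ms (i, b) ++ cable_word (swp i ms) w.
Proof. exact: (@cable_cons ms (i, b)). Qed.

Lemma cable_cat ms u v : wf_word (size ms) u ->
  cable_word ms (u ++ v) = cable_word ms u ++ cable_word (act u ms) v.
Proof.
elim: u ms => //= x u IH ms /andP[Hx Hu].
by rewrite swap_sizesE // IH ?size_swp // catA.
Qed.

Lemma sumn_swp i ms : sumn (swp i ms) = sumn ms.
Proof.
elim: i ms => [|i IH] [|x ms] //=; last by rewrite IH.
by case: ms => //= y ms; rewrite addnCA.
Qed.

Lemma sumn_act w ms : sumn (act w ms) = sumn ms.
Proof. by elim: w ms => //= x w IH ms; rewrite /act /= -/(act _ _) IH sumn_swp. Qed.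

Lemma wf_cable_letter ms x : x.1.+1 < size ms -> wf_word (sumn ms) (cable_letter ms x).
Proof.
case: x => i b /= /split_two[ms1 [a [c [ms2 [Hs ->]]]]].
rewrite cable_letter_split //; case: b; rewrite ?wf_winv; apply: wf_ribbon;
  rewrite sumn_cat /=; lia.
Qed.

Lemma wf_cable ms w : wf_word (size ms) w -> wf_word (sumn ms) (cable_word ms w).
Proof.
elim: w ms => //= x w IH ms /andP[Hx Hw]; rewrite wf_cat wf_cable_letter //=.
by rewrite swap_sizesE // -(sumn_swp x.1); apply: IH; rewrite size_swp.
Qed.

(* Naturality of ribbon crossings makes the braid relation survive cabling: both
   sides slide the crossing of the first two ribbons past the third one. *)
Lemma breq_cable k ms u v : breq k u v -> size ms = k -> wf_word k u ->
  breq (sumn ms) (cable_word ms u) (cable_word ms v).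
Proof.
move=> H; elim: H ms => {u v}.
- by move=> *; apply: breq_refl.
- by move=> u v uv IH ms Hs wv; apply: breq_sym; apply: IH => //; rewrite (breq_wf uv).
- by move=> u v w uv H1 _ H2 ms Hs wu; apply: breq_trans (H1 _ Hs wu) (H2 _ Hs _); rewrite -(breq_wf uv).
- move=> u1 u2 v1 v2 H1 IH1 H2 IH2 ms Hs; rewrite wf_cat => /andP[wu wv].
  rewrite !cable_cat ?Hs ?wu -?(breq_wf H1) //; apply: breq_cat; first exact: IH1.
  by rewrite (act_breq Hs H1) -(sumn_act u2 ms); apply: IH2; rewrite ?size_act.
- move=> i b Hi ms Hs _; rewrite !cable_cons ?size_swp ?Hs //=; have := Hi; rewrite -Hs.
  move=> /split_two[ms1 [a [c [ms2 [Hs1 ->]]]]]; rewrite swp_cat // !cable_letter_split //.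
  rewrite cats0 sumn_cat /=.
  by case: b => /=; [apply: breq_winvr|apply: breq_winvl]; apply: wf_ribbon; lia.
- move=> i j Hi Hj ij ms Hs _; rewrite !cable_cons ?size_swp ?Hs //= !cats0.
  have [l1 [x [y [l2 [Hs1 Hl]]]]] := @split_two _ i ms ltac:(lia).
  have [l3 [z [t [l4 [Hs3 Hl4]]]]] := @split_two _ (j - i.+2) l2 ltac:(move: Hs; rewrite Hl size_cat /=; lia).
  have E (u v : nat) (r : seq nat) : l1 ++ [:: u, v & l3 ++ r] = (l1 ++ [:: u, v & l3]) ++ r by rewrite -catA.
  have S u v : size (l1 ++ [:: u, v & l3]) = j by rewrite size_cat /= Hs1 Hs3; lia.
  have SW u v a b : swp j (l1 ++ [:: u, v & l3 ++ [:: a, b & l4]]) = l1 ++ [:: u, v & l3 ++ [:: b, a & l4]].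
    by rewrite !E swp_cat.
  have CL u v a b : cable_letter (l1 ++ [:: u, v & l3 ++ [:: a, b & l4]]) (j, true) =
      ribbon (sumn l1 + (u + v) + sumn l3) a b.
    by rewrite E cable_letter_split // sumn_cat /= !addnA.
  rewrite Hl Hl4 SW swp_cat // !CL !cable_letter_split // [y + x]addnC.
  rewrite !sumn_cat /= sumn_cat /=.
  apply: breq_comm_inr (inr_ribbon _ _ _) (inr_ribbon _ _ _) _ _ _; try lia;
    apply: wf_ribbon; lia.
- move=> i Hi ms Hs _; have [l1 [a [b [l2 [Hs1 Hl]]]]] := @split_two _ i ms ltac:(lia).
  case: l2 Hl => [|c l2] Hl; first by move: Hi; rewrite -Hs Hl size_cat /=; lia.
  have swp1 u v w : swp i.+1 (l1 ++ [:: u, v, w & l2]) = l1 ++ [:: u, w, v & l2].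
    by rewrite -cat_rcons swp_cat ?size_rcons ?Hs1 // cat_rcons.
  have cl u v w : cable_letter (l1 ++ [:: u, v, w & l2]) (i.+1, true) = ribbon (sumn l1 + u) v w.
    by rewrite -cat_rcons cable_letter_split ?size_rcons ?Hs1 // -cats1 sumn_cat /= addn0.
  rewrite !cable_cons' ?size_swp ?Hs //; try exact: ltnW.
  rewrite ![cable_word _ [::]]/= !cats0 Hl !(swp1, swp_cat, cl, cable_letter_split) // -!ribbonD.
  rewrite catA -ribbonD [b + a]addnC.
  (* The crossing of the first two ribbons is a braid [ribbon 0 a b] on the [a + b] strands of their
     union, and it is this union that crosses the third ribbon. *)
  have := @breq_nat_wordA (sumn (l1 ++ [:: a, b, c & l2])) (sumn l1) (a + b) c (ribbon 0 a b).
  rewrite !wshift_ribbon !add0n; apply; first exact: wf_ribbon.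
  rewrite sumn_cat /=; lia.
Qed.

End Naturality.

(** * Operadic composition: product law, action and injectivity *)

Section Gamma.
Local Open Scope nat_scope.

Definition zipw (T U V : Type) (f : T -> U -> V) (s : seq T) (t : seq U) : seq V :=
  [seq f p.1 p.2 | p <- zip s t].

Definition wf_blocks (ms : seq nat) (bs : seq bword) :=
  size bs = size ms /\ (forall i, i < size ms -> wf_word (nth 0 ms i) (nth [::] bs i)).

Lemma wf_blocks_cons m ms b bs :
  wf_blocks (m :: ms) (b :: bs) <-> wf_word m b /\ wf_blocks ms bs.
Proof.
split=> [[[Hs] H]|[H0 [Hs H]]]; first split; [exact: (H 0)|split=> // i Hi; exact: (H i.+1)|].
by split=> [|[|i] Hi] /=; rewrite ?Hs //; apply: H.
Qed.

Lemma wf_blocks_nil bs : wf_blocks [::] bs <-> bs = [::].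
Proof. by split=> [[/size0nil]|->] //; split. Qed.

Lemma juxt_cons m ms b bs : juxt (m :: ms) (b :: bs) = b ++ wshift m (juxt ms bs).
Proof.
rewrite /juxt /= wshift0; congr cat; rewrite -[1]addn0 iotaDl -map_comp.
rewrite /wshift map_flatten -/(wshift _ _) -map_comp; congr flatten; apply: eq_map => i /=.
by rewrite -/(wshift _ _) -/(wshift _ _) wshiftD addnC.
Qed.

Lemma juxt_cat ms1 bs1 ms2 bs2 : size ms1 = size bs1 ->
  juxt (ms1 ++ ms2) (bs1 ++ bs2) = juxt ms1 bs1 ++ wshift (sumn ms1) (juxt ms2 bs2).
Proof.
elim: ms1 bs1 => [|m ms1 IH] [|b bs1] //=; first by rewrite wshift0.
by case=> Hs; rewrite !juxt_cons IH // wshift_cat wshiftD catA addnC.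
Qed.

Lemma wf_juxt ms bs : wf_blocks ms bs -> wf_word (sumn ms) (juxt ms bs).
Proof.
elim: ms bs => [|m ms IH] [|b bs] //; try by case.
move=> /wf_blocks_cons[wb /IH wbs]; rewrite juxt_cons wf_cat /= (wf_widen _ wb) ?leq_addr //=.
by rewrite addnC wf_wshift.
Qed.

Lemma breq_juxt ms bs bs' : size bs = size ms -> size bs' = size ms ->
  (forall i, i < size ms -> breq (nth 0 ms i) (nth [::] bs i) (nth [::] bs' i)) ->
  breq (sumn ms) (juxt ms bs) (juxt ms bs').
Proof.
elim: ms bs bs' => [|m ms IH] [|b bs] [|b' bs'] //=; first by move=> *; apply: breq_refl.
move=> [H1] [H2] H; rewrite !juxt_cons; apply: breq_cat.
  by apply: breq_widen (H 0 _) => //; apply: leq_addr.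
by rewrite addnC; apply: breq_shift; apply: IH => // i Hi; apply: (H i.+1).
Qed.

Lemma wf_blocks_cat ms1 bs1 ms2 bs2 : size ms1 = size bs1 ->
  wf_blocks (ms1 ++ ms2) (bs1 ++ bs2) <-> wf_blocks ms1 bs1 /\ wf_blocks ms2 bs2.
Proof.
elim: ms1 bs1 => [|m ms1 IH] [|b bs1] //=; first by move=> _; split=> [|[]] //; split=> //; split.
case=> /IH E; rewrite !wf_blocks_cons E; tauto.
Qed.

Lemma wf_blocks_act ms bs w : wf_blocks ms bs -> wf_blocks (act w ms) (act w bs).
Proof.
elim: w ms bs => //= x w IH ms bs H; apply: IH; case: (ltnP x.1.+1 (size ms)) => Hx; last first.
  by rewrite !swp_out //; case: H => ->.
have [ms1 [a [c [ms2 [Hs Hl]]]]] := split_two Hx.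
have [bs1 [u [v [bs2 [Hb Hlb]]]]] := @split_two _ x.1 bs ltac:(by case: H => ->).
move: H; rewrite Hl Hlb !swp_cat // !wf_blocks_cat ?Hs ?Hb // !wf_blocks_cons; tauto.
Qed.

Lemma inr_juxt ms bs s : wf_blocks ms bs -> inr s (s + sumn ms) (wshift s (juxt ms bs)).
Proof. by move=> H; apply: inr_wshift; apply: wf_juxt. Qed.

(** The two blocks concerned ride along their own ribbons by naturality; the supports of the other
    blocks are disjoint from the crossing. *)
Lemma breq_juxt_ribbon ms1 bs1 a c u v ms2 bs2 (ms := ms1 ++ a :: c :: ms2) :
  size ms1 = size bs1 -> wf_blocks ms (bs1 ++ u :: v :: bs2) ->
  breq (sumn ms) (juxt ms (bs1 ++ u :: v :: bs2) ++ ribbon (sumn ms1) a c)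
    (ribbon (sumn ms1) a c ++ juxt (ms1 ++ c :: a :: ms2) (bs1 ++ v :: u :: bs2)).
Proof.
move=> Hs; rewrite /ms !juxt_cat // !juxt_cons wf_blocks_cat // !wf_blocks_cons.
move=> [wb1 [wu [wv wb2]]]; rewrite !wshift_cat !wshiftD.
set s := sumn ms1; rewrite [c + s]addnC [a + s]addnC.
have -> : c + (s + a) = a + (s + c) by lia.
set X := juxt ms1 bs1; set Y := wshift (a + (s + c)) (juxt ms2 bs2); set N := sumn _.
have HN : N = s + a + c + sumn ms2 by rewrite /N sumn_cat /= -/s; lia.
have HX : inr 0 s X by rewrite -[X]wshift0; exact: (@inr_juxt _ _ 0 wb1).
have HY : inr (a + (s + c)) N Y by rewrite HN; apply: inr_widen (inr_juxt _ wb2); lia.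
have HR := inr_ribbon s a c.
have w1 : wf_word N X by apply: inr_wf HX; lia.
have w2 : wf_word N Y by apply: inr_wf HY; lia.
have w3 : wf_word N (ribbon s a c) by apply: inr_wf HR; lia.
have w4 : wf_word N (wshift s v) by apply: (@inr_wf s (s + c)); [lia|exact: inr_wshift].
have w5 : wf_word N (wshift (s + c) u) by apply: (@inr_wf (s + c) (s + c + a)); [lia|exact: inr_wshift].
rewrite -!catA -(breq_comm_inr HR HY) //; last by lia.
rewrite (catA (wshift (s + a) v)) (@breq_nat_wordB N) //; last by lia.
rewrite !catA -(catA X) -(catA X) (@breq_nat_wordA N) //; last by lia.
rewrite !catA (breq_comm_inr HX HR) // -!catA; do 2 apply: breq_catl.
rewrite !catA; apply: breq_catr; apply: breq_sym.
by apply: breq_comm_inr (inr_wshift s wv) (inr_wshift (s + c) wu) _ _ _.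
Qed.

(** Letter by letter: two blocks change places with their ribbons, and a negative letter is the
    positive case read backwards ([breq_conj_winvr]). *)
Lemma breq_cable_juxt ms bs w : wf_blocks ms bs -> wf_word (size ms) w ->
  breq (sumn ms) (juxt ms bs ++ cable_word ms w)
    (cable_word ms w ++ juxt (act w ms) (act w bs)).
Proof.
elim: w ms bs => [|x w IH] ms bs Hb /=; first by move=> _; rewrite cats0; apply: breq_refl.
case/andP=> Hx Hw; rewrite swap_sizesE // -catA.
have E : breq (sumn ms) (juxt ms bs ++ cable_letter ms x)
    (cable_letter ms x ++ juxt (swp x.1 ms) (swp x.1 bs)).
  have [ms1 [a [c [ms2 [Hs Hl]]]]] := split_two Hx.
  have [bs1 [u [v [bs2 [Hs2 Hlb]]]]] := @split_two _ x.1 bs ltac:(by case: Hb => ->).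
  have Hss : size ms1 = size bs1 by rewrite Hs.
  case: x Hs Hs2 {Hx Hw IH} => i b /= Hs Hs2; rewrite Hl Hlb !swp_cat // cable_letter_split //.
  have Hb' : wf_blocks (ms1 ++ c :: a :: ms2) (bs1 ++ v :: u :: bs2).
    by have := @wf_blocks_act _ _ [:: (i, true)] Hb; rewrite Hl Hlb /act /= !swp_cat.
  rewrite Hl Hlb in Hb; case: b; first exact: breq_juxt_ribbon.
  have -> : sumn (ms1 ++ [:: a, c & ms2]) = sumn (ms1 ++ [:: c, a & ms2]) by rewrite !sumn_cat /=; lia.
  apply: breq_conj_winvr; last exact: breq_juxt_ribbon.
  by apply: wf_ribbon; rewrite sumn_cat /=; lia.
rewrite catA E -catA; apply: breq_catl.
have := IH (swp x.1 ms) (swp x.1 bs); rewrite sumn_swp size_swp; apply=> //.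
exact: (@wf_blocks_act _ _ [:: x] Hb).
Qed.

Lemma wf_gammaB ms w bs : wf_blocks ms bs -> wf_word (size ms) w ->
  wf_word (sumn ms) (gammaB ms w bs).
Proof. by move=> H1 H2; rewrite /gammaB wf_cat wf_juxt // wf_cable. Qed.

Lemma breq_gammaB ms w w' bs bs' : size bs = size ms -> size bs' = size ms ->
  (forall i, i < size ms -> breq (nth 0 ms i) (nth [::] bs i) (nth [::] bs' i)) ->
  wf_word (size ms) w -> breq (size ms) w w' ->
  breq (sumn ms) (gammaB ms w bs) (gammaB ms w' bs').
Proof.
by move=> H1 H2 H3 H4 H5; apply: breq_cat; [exact: breq_juxt|exact: breq_cable H5 erefl H4].
Qed.

Lemma breq_juxt_zip ms bs bs' : wf_blocks ms bs -> wf_blocks ms bs' ->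
  breq (sumn ms) (juxt ms (zipw cat bs bs')) (juxt ms bs ++ juxt ms bs').
Proof.
elim: ms bs bs' => [|m ms IH] bs bs'.
  by move=> /wf_blocks_nil-> /wf_blocks_nil->; apply: breq_refl.
case: bs => [|b bs]; first by case.
case: bs' => [|b' bs']; first by move=> _ [].
move=> /wf_blocks_cons[wb wbs] /wf_blocks_cons[wb' wbs'].
rewrite /zipw /= -/(zipw cat bs bs') !juxt_cons.
rewrite (_ : wshift m (juxt ms bs) = wshift (0 + m) (juxt ms bs)) //.
have Hm := inr_juxt m wbs; have Hm' := inr_juxt m wbs'.
have H0 : inr 0 m b' by rewrite -[b']wshift0; exact: (@inr_wshift 0).
have Hw : breq (m + sumn ms) (wshift m (juxt ms (zipw cat bs bs')))
   (wshift m (juxt ms bs) ++ wshift m (juxt ms bs')).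
  by rewrite -wshift_cat addnC; apply: breq_shift; apply: IH.
rewrite add0n Hw -!catA; apply: breq_catl; rewrite !catA; apply: breq_catr.
apply: (breq_comm_inr H0 Hm) => //; first by apply: inr_wf H0; apply: leq_addr.
exact: inr_wf Hm.
Qed.

(** The semidirect product law of CBr: the second family of blocks is pulled back through the first
    cabled braid and then meets the first family block by block. *)
Lemma breq_gammaB_cat ms w w' bs bs' : wf_blocks ms bs -> wf_blocks ms bs' ->
  wf_word (size ms) w ->
  breq (sumn ms) (gammaB ms w bs ++ gammaB (act w ms) w' (act w bs'))
    (gammaB ms (w ++ w') (zipw cat bs bs')).
Proof.
move=> Hb Hb' Hw; rewrite /gammaB cable_cat // (breq_juxt_zip Hb Hb') -!catA.
apply: breq_catl; rewrite !catA; apply: breq_catr.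
by apply: breq_sym; apply: breq_cable_juxt.
Qed.

Lemma act_cable T ms w (ll : seq (seq T)) : map size ll = ms -> wf_word (size ms) w ->
  act (cable_word ms w) (flatten ll) = flatten (act w ll).
Proof.
elim: w ms ll => //= x w IH ms ll Hl /andP[Hx Hw]; rewrite swap_sizesE // act_cat.
have [l1 [A [B [l2 [Hs Hll]]]]] := @split_two _ x.1 ll ltac:(by rewrite -(size_map size) Hl).
have Hms : ms = map size l1 ++ size A :: size B :: map size l2 by rewrite -Hl Hll map_cat.
have Hst : sumn (map size l1) = size (flatten l1) by rewrite size_flatten.
have -> : act (cable_letter ms x) (flatten ll) = flatten (swp x.1 ll).
  case: x Hs {Hx Hw IH} => i b /= Hs; rewrite Hms cable_letter_split ?size_map // Hll swp_cat //.
  rewrite !flatten_cat /= Hst; case: b; first exact: act_ribbon.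
  by apply: (@act_inj _ (ribbon (size (flatten l1)) (size B) (size A))); rewrite act_winvK act_ribbon.
by rewrite (IH (swp x.1 ms)) ?size_swp // -Hl swp_map.
Qed.

Lemma act_juxt T ms bs (ll : seq (seq T)) : map size ll = ms -> wf_blocks ms bs ->
  act (juxt ms bs) (flatten ll) = flatten (zipw (@act T) bs ll).
Proof.
elim: ll ms bs => [|l ll IH] ms bs <-; first by move/wf_blocks_nil->.
case: bs => [|b bs]; first by case.
move=> /wf_blocks_cons[wb wbs]; rewrite juxt_cons act_cat /= act_catl //.
by rewrite act_wshift ?size_act // (IH _ _ erefl).
Qed.

Lemma map_size_zipw_act T bs (ll : seq (seq T)) : size bs = size ll ->
  map size (zipw (@act T) bs ll) = map size ll.
Proof. by elim: ll bs => [|l ll IH] [|b bs] //= [/IH]; rewrite /zipw /= size_act => ->. Qed.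

Lemma act_gammaB T ms w bs (ll : seq (seq T)) : map size ll = ms -> wf_blocks ms bs ->
  wf_word (size ms) w ->
  act (gammaB ms w bs) (flatten ll) = flatten (act w (zipw (@act T) bs ll)).
Proof.
move=> Hl Hb Hw; rewrite /gammaB act_cat act_juxt // act_cable //.
by rewrite map_size_zipw_act // (proj1 Hb) -Hl size_map.
Qed.

(** Erasing strands inside ribbons only makes the ribbons thinner. A negative letter is reduced to a
    positive one by writing the mask as the image of another mask under a ribbon crossing. *)
Lemma fg_cable ms w (mu : seq (seq bool)) : map size mu = ms -> wf_word (size ms) w ->
  fg (flatten mu) (cable_word ms w) = cable_word (map (count id) mu) w.
Proof.
elim: w ms mu => //= x w IH ms mu Hl /andP[Hx Hw].
have Hsz : size mu = size ms by rewrite -Hl size_map.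
rewrite !swap_sizesE ?size_map ?Hsz // fg_cat swp_map.
have [l1 [A [B [l2 [Hs Hll]]]]] := @split_two _ x.1 mu ltac:(by rewrite Hsz).
have Hms : ms = map size l1 ++ size A :: size B :: map size l2 by rewrite -Hl Hll map_cat.
have Hst : sumn (map size l1) = size (flatten l1) by rewrite size_flatten.
have Hct : sumn (map (count id) l1) = count id (flatten l1) by rewrite count_flatten.
have [-> ->] : fg (flatten mu) (cable_letter ms x) = cable_letter (map (count id) mu) x /\
    act (cable_letter ms x) (flatten mu) = flatten (swp x.1 mu).
  case: x Hs {Hx Hw IH} => i b /= Hs; rewrite Hms Hll map_cat /= !cable_letter_split ?size_map //.
  rewrite swp_cat // !flatten_cat /= Hst Hct; case: b.
    by rewrite fg_ribbon // act_ribbon.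
  have E : flatten l1 ++ A ++ B ++ flatten l2 =
     act (ribbon (size (flatten l1)) (size B) (size A)) (flatten l1 ++ B ++ A ++ flatten l2).
    by rewrite act_ribbon.
  by rewrite E fg_winv fg_ribbon // act_winv.
by rewrite (IH (swp x.1 ms)) ?size_swp // -Hl swp_map.
Qed.

Lemma fg_juxt ms bs (mu : seq (seq bool)) : map size mu = ms -> wf_blocks ms bs ->
  fg (flatten mu) (juxt ms bs) = juxt (map (count id) mu) (zipw fg mu bs).
Proof.
elim: mu ms bs => [|l mu IH] ms bs <-; first by move/wf_blocks_nil->.
case: bs => [|b bs]; first by case.
move=> /wf_blocks_cons[wb wbs]; rewrite /zipw /= -/(zipw fg mu bs) !juxt_cons fg_cat fg_catl //.
by rewrite act_catl // fg_wshift ?size_act // count_act (IH _ _ erefl).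
Qed.

Lemma cable_ones k w : wf_word k w -> cable_word (nseq k 1) w = w.
Proof.
elim: w => //= -[i b] w IH /andP[/= Hi Hw].
rewrite swap_sizesE ?size_nseq // /cable_letter /= !nth_nseq Hi (ltnW Hi) take_nseq; last by lia.
have -> : swp i (nseq k 1) = nseq k 1.
  by elim: i k {IH Hi Hw} => [|i IHi] [|n] //=; [case: n|rewrite IHi].
by rewrite IH // sumn_nseq mul1n; case: b; rewrite /ribbon /winv /= !addn0.
Qed.

(** When at most one ribbon is nonempty, every crossing has an empty side. *)
Lemma cable_single ms w : wf_word (size ms) w -> count (fun m => m != 0) ms <= 1 ->
  cable_word ms w = [::].
Proof.
elim: w ms => //= x w IH ms /andP[Hx Hw] Hc; rewrite swap_sizesE // IH ?size_swp ?count_swp //.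
have [ms1 [a [c [ms2 [Hs Hl]]]]] := split_two Hx.
case: x Hs {Hx Hw IH} => i b /= Hs; move: Hc; rewrite Hl count_cat /= cable_letter_split //.
by case: a c {Hl} => [|a] [|c] H; [| | |lia]; case: b; rewrite ?ribbonr0.
Qed.

(* Keeping one strand of every ribbon recovers the cabled braid; keeping a single
   ribbon recovers the braid inside it. *)
Lemma gammaB_inj ms w w' bs bs' : all (leq 1) ms ->
  wf_blocks ms bs -> wf_blocks ms bs' -> wf_word (size ms) w -> wf_word (size ms) w' ->
  breq (sumn ms) (gammaB ms w bs) (gammaB ms w' bs') ->
  breq (size ms) w w' /\
  (forall i, i < size ms -> breq (nth 0 ms i) (nth [::] bs i) (nth [::] bs' i)).
Proof.
move=> pos Hb Hb' Hw Hw' H.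
have juxt0 ks cs : size cs = size ks -> (forall i, nth [::] cs i = [::]) -> juxt ks cs = [::].
  elim: ks cs => [|k ks IH] [|c cs] // [Hs] Hc; rewrite juxt_cons [c](Hc 0) IH //.
  by move=> i; apply: (Hc i.+1).
have main (mu : seq (seq bool)) : map size mu = ms ->
    breq (sumn (map (count id) mu))
      (juxt (map (count id) mu) (zipw fg mu bs) ++ cable_word (map (count id) mu) w)
      (juxt (map (count id) mu) (zipw fg mu bs') ++ cable_word (map (count id) mu) w').
  move=> Hmu; have := @fg_breq (sumn ms) (flatten mu) _ _ _ H.
  rewrite size_flatten /shape Hmu => /(_ erefl).
  have aux b u : wf_blocks ms b -> wf_word (size ms) u -> fg (flatten mu) (gammaB ms u b) =
      juxt (map (count id) mu) (zipw fg mu b) ++ cable_word (map (count id) mu) u.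
    move=> wb wu; rewrite /gammaB fg_cat fg_juxt // act_juxt // fg_cable //.
      congr (_ ++ cable_word _ _); elim: (mu) b (ms) Hmu wb {wu} => [|l mu' IH] [|c b] ms' //.
        by move=> <- [].
      by move=> <- /wf_blocks_cons[_ /(IH _ _ erefl)]; rewrite /zipw /= count_act => ->.
    by rewrite map_size_zipw_act // -(size_map size) Hmu; case: wb.
  by rewrite !aux // count_flatten.
split.
(* The first strand of each ribbon is kept; it exists because widths are positive. A block reduced
   to one strand has no crossings. *)
- pose mu := [seq true :: nseq m.-1 false | m <- ms].
  have Hmu : map size mu = ms.
    rewrite -map_comp -[RHS]map_id; apply/eq_in_map => m /(allP pos) /=.
    by rewrite size_nseq; case: m.
  have Hc : map (count id) mu = nseq (size ms) 1.
    rewrite -map_comp; elim: (ms) => //= m ms' ->.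
    by rewrite count_nseq mul0n.
  have z b : wf_blocks ms b -> juxt (nseq (size ms) 1) (zipw fg mu b) = [::].
    case=> Hs _; apply: juxt0; first by rewrite size_map size_zip size_nseq size_map Hs minnn.
    move=> i; have [Hi|Hi] := ltnP i (size ms); last first.
      by rewrite nth_default // size_map size_zip size_map Hs minnn.
    rewrite (nth_map ([::], [::])) ?size_zip ?size_map ?Hs ?minnn // nth_zip ?size_map ?Hs //=.
    by rewrite fg_small // (nth_map 0) //= count_nseq mul0n.
  have := main mu Hmu; rewrite Hc !z // !cable_ones // sumn_nseq mul1n; exact.
- move=> i Hi.
  (* All ribbons but the [i]-th become empty, so the cabled part disappears by [cable_single]. *)
  pose mu := [seq nseq (nth 0 ms j) (j == i) | j <- iota 0 (size ms)].
  have Hmu : map size mu = ms.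
    rewrite -map_comp; apply: (@eq_from_nth _ 0) => [|j]; rewrite size_map size_iota // => Hj.
    by rewrite (nth_map 0) ?size_iota //= size_nseq nth_iota.
  have Hc : map (count id) mu = [seq (j == i) * nth 0 ms j | j <- iota 0 (size ms)].
    by rewrite -map_comp; apply: eq_map => j /=; rewrite count_nseq.
  have Hsum : sumn (map (count id) mu) = nth 0 ms i.
    rewrite Hc sumnE big_map -{1}[size ms]subn0 -/(index_iota 0 (size ms)) big_mkord (bigD1 (Ordinal Hi)) //=.
    rewrite eqxx mul1n big1 ?addn0 // => j; rewrite -val_eqE /= => /negbTE->.
    by rewrite mul0n.
  have Hone : count (fun m => m != 0) (map (count id) mu) <= 1.
    rewrite Hc count_map (_ : 1 = count (pred1 i) (iota 0 (size ms))); last first.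
      by rewrite count_uniq_mem ?iota_uniq // mem_iota /= add0n Hi.
    by apply: sub_count => j /=; case: (j == i).
  have szmu : size mu = size ms by rewrite size_map size_iota.
  have z b : wf_blocks ms b -> juxt (map (count id) mu) (zipw fg mu b) = nth [::] b i.
    move=> wb; rewrite -(cats0 (nth _ _ _)).
    have : forall j, j < size ms -> nth [::] (zipw fg mu b) j = if j == i then nth [::] b i else [::].
      case: wb => Hs wb j Hj; rewrite (nth_map ([::], [::])) ?size_zip ?szmu ?Hs ?minnn //.
      rewrite nth_zip ?szmu ?Hs //= (nth_map 0) ?size_iota // nth_iota // add0n.
      case: eqP => [->|_]; first by rewrite fg_true //; apply: wb.
      by rewrite fg_small // count_nseq mul0n.
    have : size (zipw fg mu b) = size ms by case: wb => Hs _; rewrite size_map size_zip szmu Hs minnn.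
    rewrite Hc; move: (zipw fg mu b) (nth [::] b i) => Z c Zs HZ; rewrite cats0.
    have -> : Z = [seq if j == i then c else [::] | j <- iota 0 (size ms)].
      apply: (@eq_from_nth _ [::]) => [|j]; rewrite ?size_map ?size_iota // Zs => Hj.
      by rewrite HZ // (nth_map 0) ?size_iota // nth_iota.
    have -> : iota 0 (size ms) = iota 0 i ++ i :: iota i.+1 (size ms - i.+1).
      by rewrite -[i :: _]/(iota i (size ms - i.+1).+1) -iotaD; congr iota; lia.
    have E1 lo n f (g : nat -> bword) : (forall j, lo <= j < lo + n -> g j = [::]) ->
        juxt [seq f j | j <- iota lo n] [seq g j | j <- iota lo n] = [::].
      move=> Hg; apply: juxt0; rewrite ?size_map // => j.
      have [Hj|Hj] := ltnP j n; last by rewrite nth_default // size_map size_iota.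
      by rewrite (nth_map 0) ?size_iota // nth_iota // Hg //; lia.
    rewrite !map_cat juxt_cat ?size_map // juxt_cons /= eqxx !E1 /=; last first.
    - by move=> j Hj; case: eqP => //; lia.
    - by move=> j Hj; case: eqP => //; lia.
    rewrite cats0 (_ : sumn _ = 0) ?wshift0 // sumnE big_map big_seq big1 // => j.
    by rewrite mem_iota => Hj; case: eqP => //; lia.
  have := main mu Hmu; rewrite Hsum !z // !cable_single ?cats0 //; by rewrite !size_map size_iota.
Qed.

End Gamma.

(** * Reduced words with prescribed signs and their uniqueness *)

Section SignedMatsumoto.
Local Open Scope nat_scope.

(** The excluded patterns, with equal outer signs and a different middle sign, are false in the
    braid group; for three strands at distinct depths they would mean a cyclic order of depths. Two
    mixed cases come from the positive relation by inserting a cancelling pair, the remaining ones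
    by inversion. *)
Lemma breq_braid_signs N i s1 s2 s3 : i.+2 < N -> ~~ ((s1 == s3) && (s1 != s2)) ->
  breq N [:: (i, s1); (i.+1, s2); (i, s3)] [:: (i.+1, s3); (i, s2); (i.+1, s1)].
Proof.
move=> Hi; have Hi' : i.+1 < N by lia.
have ins u v x : x.1.+1 < N -> breq N (u ++ v) (u ++ [:: x; linv x] ++ v).
  by move=> Hx; rewrite breq_linv //; apply: breq_refl.
have w3 x y z : wf_word N [:: (i, x); (i.+1, y); (i, z)] by rewrite /wf_word /=; lia.
have ttt := breq_braid Hi.
have ttf : breq N [:: (i, true); (i.+1, true); (i, false)] [:: (i.+1, false); (i, true); (i.+1, true)].
  apply: (breq_trans (ins [::] _ (i.+1, false) _)) => //=.
  rewrite (_ : [:: _; _; _; _; _] = [:: (i.+1, false)] ++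
    [:: (i.+1, true); (i, true); (i.+1, true)] ++ [:: (i, false)]) // -ttt.
  exact/breq_sym/(ins [:: (i.+1, false); (i, true); (i.+1, true)] [::] (i, true)).
have ftt : breq N [:: (i, false); (i.+1, true); (i, true)] [:: (i.+1, true); (i, true); (i.+1, false)].
  apply: (breq_trans (ins [:: (i, false); (i.+1, true); (i, true)] [::] (i.+1, true) _)) => //=.
  rewrite (_ : [:: _; _; _; _; _] = [:: (i, false)] ++
    [:: (i.+1, true); (i, true); (i.+1, true)] ++ [:: (i.+1, false)]) // -ttt.
  exact/breq_sym/(ins [::] [:: (i.+1, true); (i, true); (i.+1, false)] (i, false)).
have tff := breq_winv (w3 _ _ _) ttf; have fft := breq_winv (w3 _ _ _) ftt.
have fff := breq_winv (w3 _ _ _) ttt.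
by case: s1 s2 s3 => [] [] [].
Qed.

Variable k : nat.

(* A state sends each of the labels below [k] to its position; it is the identity
   beyond [k] so that states can be compared by extensionality. *)
Definition state (p : nat -> nat) :=
  [/\ forall a, a < k -> p a < k,
      forall a b, a < k -> b < k -> p a = p b -> a = b &
      forall a, k <= a -> p a = a].

Definition sw i (p : nat -> nat) a := strand_step (p a) (i, true).

Lemma state_id : state id. Proof. by []. Qed.

Lemma state_sw i p : i.+1 < k -> state p -> state (sw i p).
Proof.
move=> Hi [H1 H2 H3]; split.
- by move=> a /H1 Ha; rewrite /sw; have := strand_stepP (p a) i true; lia.
- move=> a b Ha Hb /(congr1 (fun x => strand_step x (i, true))).
  by rewrite !strand_stepK; apply: H2.
- by move=> a Ha; rewrite /sw H3 //; have := strand_stepP a i true; lia.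
Qed.

Lemma sw_sw i p : sw i (sw i p) = p.
Proof. by apply/funext => a; rewrite /sw strand_stepK. Qed.

Lemma state_eq p q : state p -> state q -> (forall a, a < k -> p a = q a) -> p = q.
Proof.
move=> [_ _ H1] [_ _ H2] H; apply/funext => a.
by have [/H//|Ha] := ltnP a k; rewrite H1 // H2.
Qed.

Lemma state_surj p j : state p -> j < k -> exists2 a, a < k & p a = j.
Proof.
move=> [H1 H2 _] Hj.
pose f (a : 'I_k) : 'I_k := Ordinal (H1 a (ltn_ord a)).
have fi : injective f by move=> a b [] /H2 E; apply/val_inj/E.
have [g _ gK] := injF_bij fi.
by exists (g (Ordinal Hj)) => //; rewrite -[p _]/(val (f _)) gK.
Qed.

Lemma sw_lt p a b c d : state p -> a < k -> b < k -> c < k -> d < k ->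
  (p a).+1 = p b -> ~~ ((c == a) && (d == b)) -> ~~ ((c == b) && (d == a)) ->
  (sw (p a) p c < sw (p a) p d) = (p c < p d).
Proof.
move=> [_ H2 _] Ha Hb Hc Hd E N1 N2; rewrite /sw.
have I1 := H2 c a Hc Ha; have I2 := H2 c b Hc Hb; have I3 := H2 d a Hd Ha.
have I4 := H2 d b Hd Hb; have I5 := H2 c d Hc Hd.
case: (strand_stepP (p c) (p a) true) => [[e1 ->]|[[e1 ->]|[e1 [e1' ->]]]];
case: (strand_stepP (p d) (p a) true) => [[e2 ->]|[[e2 ->]|[e2 [e2' ->]]]]; move: N1 N2.
- by rewrite e1 e2 !ltnn.
- by rewrite (I1 e1) (I4 ltac:(lia)) !eqxx.
- move=> _ _; lia.
- by rewrite (I2 ltac:(lia)) (I3 e2) !eqxx.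
- by rewrite e1 e2 !ltnn.
- move=> _ _; lia.
- move=> _ _; lia.
- move=> _ _; lia.
- by [].
Qed.

Lemma sw_l p a b : (p a).+1 = p b -> sw (p a) p a = p b.
Proof. by move=> E; rewrite /sw; have := strand_stepP (p a) (p a) true; lia. Qed.

Lemma sw_r p a b : (p a).+1 = p b -> sw (p a) p b = p a.
Proof. by move=> E; rewrite /sw; have := strand_stepP (p b) (p a) true; lia. Qed.

Definition inversions p q : {set 'I_k * 'I_k} :=
  [set u : 'I_k * 'I_k | (p u.1 < p u.2) && (q u.2 < q u.1)]%SET.

Lemma inversions_sw p q a b : state p -> a < k -> b < k -> (p a).+1 = p b -> q b < q a ->
  #|inversions p q| = #|inversions (sw (p a) p) q|.+1.
Proof.
move=> sp Ha Hb E qba; rewrite (cardsD1 (Ordinal Ha, Ordinal Hb)) inE /= -E leqnn qba /= add1n.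
congr _.+1; apply: eq_card => -[c d]; rewrite !inE /= xpair_eqE -!val_eqE /=.
have [/andP[/eqP-> /eqP->]|N1] /= := boolP ((_ == a) && (_ == b)).
  by rewrite (sw_l E) (sw_r E) -E ltnNge leqnSn.
have [/andP[/eqP-> /eqP->]|N2] /= := boolP ((val c == b) && (val d == a)).
  by rewrite [q a < q b]ltnNge (ltnW qba) !andbF.
by rewrite (sw_lt sp Ha Hb _ _ E).
Qed.

(** Otherwise [q] increases along the positions of [p]. Counting up from position 0 gives
    [p a <= q a], counting up to position [k.-1] gives the reverse inequality, and the states
    coincide. *)
Lemma exists_adjacent p q : state p -> state q -> p <> q ->
  exists a b, [/\ a < k, b < k, (p a).+1 = p b & q b < q a].
Proof.
move=> sp sq pq; apply: contrapT => H; apply: pq; apply: state_eq => // a0 Ha0.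
have up a b : a < k -> b < k -> (p a).+1 = p b -> q a < q b.
  move=> Ha Hb E; rewrite ltnNge; apply/negP => ba; apply: H; exists a, b; split => //.
  rewrite ltn_neqAle ba andbT; apply/eqP => e; case: sq => _ I _.
  by have Eab := I _ _ Hb Ha e; move: E; rewrite Eab; lia.
have mono d a b : a < k -> b < k -> p b = p a + d -> q a + d <= q b.
  elim: d b => [|d IH] b Ha Hb E.
    by case: sp => _ I _; rewrite !addn0 in E *; rewrite (I _ _ Hb Ha E).
  have [|c Hc Ec] := @state_surj p (p a + d) sp; first by case: sp => /(_ b Hb); lia.
  by have := IH c Ha Hc Ec; have := up c b Hc Hb ltac:(lia); lia.
have pa : p a0 < k by case: sp => /(_ a0 Ha0).
have [b Hb Eb] := @state_surj p 0 sp ltac:(lia).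
have [c Hc Ec] := @state_surj p k.-1 sp ltac:(lia).
have := mono (p a0) b a0 Hb Ha0 ltac:(lia); have := mono (k.-1 - p a0) a0 c Ha0 Hc ltac:(lia).
by case: sq => /(_ c Hc); lia.
Qed.

Lemma state_order_eq p q : state p -> state q ->
  (forall a b, a < k -> b < k -> p a < p b -> q a < q b) -> p = q.
Proof.
move=> sp sq H; apply: contrapT => pq; have [a [b [Ha Hb E qba]]] := exists_adjacent sp sq pq.
by have := H a b Ha Hb; lia.
Qed.

(* Words for minimal sequences of adjacent transpositions from [p] to [q]; the sign
   of a crossing is dictated by the reference ordering [io] of the two labels. *)
Inductive red (io : nat -> nat) : (nat -> nat) -> (nat -> nat) -> bword -> Prop :=
| red_nil p : red io p p [::]
| red_cons p q a b w : a < k -> b < k -> (p a).+1 = p b -> q b < q a ->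
    red io (sw (p a) p) q w -> red io p q ((p a, io a < io b) :: w).

Lemma red_inv io p q w : red io p q w -> (w = [::] /\ p = q) \/
  exists a b w', [/\ a < k, b < k, (p a).+1 = p b & q b < q a] /\
    red io (sw (p a) p) q w' /\ w = (p a, io a < io b) :: w'.
Proof.
case=> [{}p|{}p {}q a b {}w Ha Hb E qba H]; first by left.
by right; exists a, b, w.
Qed.

Lemma state_sw_adj p a b : state p -> b < k -> (p a).+1 = p b -> state (sw (p a) p).
Proof. by move=> sp Hb E; apply: state_sw => //; rewrite E; case: sp => /(_ b Hb). Qed.

Lemma red_exists io p q : state p -> state q -> exists w, red io p q w.
Proof.
move=> + sq; have [n] := ubnP #|inversions p q|; elim: n p => // n IH p Hn sp.
have [->|pq] := pselect (p = q); first by exists [::]; apply: red_nil.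
have [a [b [Ha Hb E qba]]] := exists_adjacent sp sq pq.
have [|w Hw] := IH (sw (p a) p) _ (state_sw_adj sp Hb E).
  by move: Hn; rewrite (inversions_sw sp Ha Hb E qba) ltnS.
by exists ((p a, io a < io b) :: w); apply: red_cons Hw.
Qed.

Lemma red_wf io p q w : state p -> red io p q w -> wf_word k w.
Proof.
move=> + H; elim: H => //= {}p {}q a b {}w Ha Hb E qba _ IH sp.
by rewrite IH ?andbT ?E; [case: sp => /(_ b Hb)|exact: state_sw_adj sp Hb E].
Qed.

Lemma red_perm io p q w c : red io p q w -> perm_word w (p c) = q c.
Proof. by elim. Qed.

(** A reduced word crosses only pairs that are inverted between its ends, so the reference order
    matters on those pairs alone. *)
Lemma red_sign io io' p q w : state p ->
  (forall c d, c < k -> d < k -> p c < p d -> q d < q c -> (io c < io d) = (io' c < io' d)) ->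
  red io p q w -> red io' p q w.
Proof.
move=> + + H; elim: H => [{}p sp _|{}p {}q a b {}w Ha Hb E qba _ IH sp Hs]; first exact: red_nil.
rewrite Hs //; last by rewrite -E.
apply: red_cons => //; apply: IH => [|c d Hc Hd pcd qdc]; first exact: state_sw_adj sp Hb E.
have [/andP[/eqP cb /eqP da]|N2] := boolP ((c == b) && (d == a)); first by subst; lia.
have [/andP[/eqP ca /eqP db]|N1] := boolP ((c == a) && (d == b)).
  by move: pcd; rewrite ca db (sw_l E) (sw_r E); lia.
by apply: Hs => //; rewrite -(sw_lt sp Ha Hb Hc Hd E).
Qed.

Lemma sw_far p i j : i.+1 < j -> sw i (sw j p) = sw j (sw i p).
Proof.
move=> ij; apply/funext => a.
exact: (@perm_word_breq j.+2 [:: (j, true); (i, true)] [:: (i, true); (j, true)]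
  (@breq_comm j.+2 j i true true ltac:(lia) ltac:(lia) ltac:(lia)) (p a)).
Qed.

Lemma sw_braid p i : sw i (sw i.+1 (sw i p)) = sw i.+1 (sw i (sw i.+1 p)).
Proof.
apply/funext => a; exact: (@perm_word_breq i.+3 _ _ (@breq_braid i.+3 i (leqnn _)) (p a)).
Qed.

Lemma sw_out p i a : p a <> i -> p a <> i.+1 -> sw i p a = p a.
Proof. by move=> H1 H2; rewrite /sw; have := strand_stepP (p a) i true; lia. Qed.

(** Induction on the number of inversions. First crossings on disjoint positions commute, and both
    words are compared with words that perform the two crossings in either order. If the first
    crossings share the middle label [b], all three pairs among [a], [b], [d] are inverted, and both
    words are compared with words through the state in which the three are reversed. *)
Lemma red_unique io p q w1 w2 : (forall a b, a < k -> b < k -> io a = io b -> a = b) ->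
  state p -> state q -> red io p q w1 -> red io p q w2 -> breq k w1 w2.
Proof.
move=> ioI + sq; have [n] := ubnP #|inversions p q|.
elim: n p w1 w2 => // n IH p w1 w2 Hn sp H1 H2.
have nilE w : red io p q w -> p = q -> w = [::].
  by case/red_inv=> [[]|[a [b [w' [[Ha Hb E qba] _]]]]] // e; move: qba; rewrite -e; lia.
have [e|pq] := pselect (p = q); first by rewrite (nilE _ H1 e) (nilE _ H2 e); apply: breq_refl.
have small a b : a < k -> b < k -> (p a).+1 = p b -> q b < q a ->
    #|inversions (sw (p a) p) q| < n.
  by move=> Ha Hb E qba; move: Hn; rewrite (inversions_sw sp Ha Hb E qba) ltnS.
have sgn a b : a < k -> b < k -> a <> b -> (io a < io b) = ~~ (io b < io a).
  by move=> Ha Hb ab; have := ioI a b Ha Hb; lia.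
suff key a b c d u v : [/\ a < k, b < k, c < k & d < k] -> (p a).+1 = p b -> q b < q a ->
    (p c).+1 = p d -> q d < q c -> red io (sw (p a) p) q u -> red io (sw (p c) p) q v ->
    p a <= p c -> breq k ((p a, io a < io b) :: u) ((p c, io c < io d) :: v).
  case: (red_inv H1) => [[_ /pq]|[a [b [u [[Ha Hb Eab qba] [Hu ->]]]]]] //.
  case: (red_inv H2) => [[_ /pq]|[c [d [v [[Hc Hd Ecd qdc] [Hv ->]]]]]] //.
  have [ac|/ltnW ca] := leqP (p a) (p c); first exact: key.
  by apply: breq_sym; apply: key.
case=> Ha Hb Hc Hd Eab qba Ecd qdc Hu Hv; rewrite leq_eqVlt => /orP[/eqP pac|pac].
  have ac : a = c by case: sp => _ I _; apply: I.
  have bd : b = d by case: sp => _ I _; apply: I => //; rewrite -Eab -Ecd pac.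
  subst c d; have := IH _ u v (small a b Ha Hb Eab qba) (state_sw_adj sp Hb Eab) Hu Hv => ->.
  exact: breq_refl.
have s1 := state_sw_adj sp Hb Eab; have s2 := state_sw_adj sp Hd Ecd.
have pbk : p b < k by case: sp => /(_ b Hb).
have pdk : p d < k by case: sp => /(_ d Hd).
have [pbc|pbc] := eqVneq (p b) (p c).
  have bc : b = c by case: sp => _ I _; apply: I.
  subst c; set i := p a in Eab Ecd *; have Eb : p b = i.+1 by [].
  rewrite Eb in Ecd Hv s2 pac *; have Ed : p d = i.+2 by [].
  have ab : a <> b by move=> e; move: Eb; rewrite -e -/i; lia.
  have bd : b <> d by move=> e; move: Ed; rewrite -e Eb; lia.
  have ad : a <> d by move=> e; move: Ed; rewrite -e -/i; lia.
  pose p1 := sw i p; pose p2 := sw i.+1 p.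
  have [A1 B1 D1] : [/\ p1 a = i.+1, p1 b = i & p1 d = i.+2].
    by split; [rewrite /p1 (@sw_l p a b)|rewrite /p1 (@sw_r p a b)|rewrite /p1 sw_out; lia].
  have [A2 B2 D2] : [/\ p2 a = i, p2 b = i.+2 & p2 d = i.+1].
    split; first by rewrite /p2 sw_out -/i; lia.
      by rewrite /p2 -Eb (@sw_l p b d) ?Eb ?Ed.
    by rewrite /p2 -Eb (@sw_r p b d) ?Eb ?Ed.
  pose p3 := sw i.+1 p1; pose p4 := sw i p2.
  have [A3 B3 D3] : [/\ p3 a = i.+2, p3 b = i & p3 d = i.+1].
    split; first by rewrite /p3 -A1 (@sw_l p1 a d) ?A1 ?D1.
      by rewrite /p3 sw_out; lia.
    by rewrite /p3 -A1 (@sw_r p1 a d) ?A1 ?D1.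
  have [A4 B4 D4] : [/\ p4 a = i.+1, p4 b = i.+2 & p4 d = i].
    split; first by rewrite /p4 -A2 (@sw_l p2 a d) ?A2 ?D2.
      by rewrite /p4 sw_out; lia.
    by rewrite /p4 -A2 (@sw_r p2 a d) ?A2 ?D2.
  have s3 : state p3 by rewrite /p3; apply: state_sw => //; lia.
  have s5 : state (sw i p3) by apply: state_sw => //; lia.
  (* In [sw i p3] the labels [a], [b], [d] are reversed; [w] is the common tail of the two
     comparison words. *)
  have [w Hw] := red_exists io s5 sq.
  have R1 : red io p1 q ((i.+1, io a < io d) :: (i, io b < io d) :: w).
    rewrite -A1; apply: (@red_cons io p1 q a d) => //; rewrite ?A1 ?D1 //; first lia.
    rewrite -/p3 -B3; apply: (@red_cons io p3 q b d) => //; rewrite ?B3 ?D3 //; lia.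
  have R2 : red io p2 q ((i, io a < io d) :: (i.+1, io a < io b) :: w).
    rewrite -A2; apply: (@red_cons io p2 q a d) => //; rewrite ?A2 ?D2 //; first lia.
    rewrite -/p4 -A4; apply: (@red_cons io p4 q a b) => //; rewrite ?A4 ?B4 //.
    by move: Hw; rewrite /p3 /p1 /p4 /p2 sw_braid.
  have U := IH _ _ _ (small a b Ha Hb ltac:(by rewrite -/i) qba) s1 Hu R1.
  have sm := small b d Hb Hd ltac:(by rewrite Eb Ed) qdc; rewrite Eb in sm.
  have V := IH _ _ _ sm s2 Hv R2.
  rewrite U V.
  apply: (@breq_catr k w [:: (i, io a < io b); (i.+1, io a < io d); (i, io b < io d)]
     [:: (i.+1, io b < io d); (i, io a < io d); (i.+1, io a < io b)]).
  apply: breq_braid_signs; first lia.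
  (* Since [io] orders the three labels linearly, the sign patterns for which the relation fails do
     not occur. *)
  by have := ioI a b Ha Hb; have := ioI b d Hb Hd; have := ioI a d Ha Hd; lia.
have far : (p a).+1 < p c by lia.
pose p1 := sw (p a) p; pose p2 := sw (p c) p.
have C1 : p1 c = p c by rewrite /p1 sw_out; lia.
have D1 : p1 d = p d by rewrite /p1 sw_out; lia.
have A2 : p2 a = p a by rewrite /p2 sw_out; lia.
have B2 : p2 b = p b by rewrite /p2 sw_out; lia.
have E1 : (p1 c).+1 = p1 d by rewrite C1 D1.
have [w Hw] := red_exists io (state_sw_adj s1 Hd E1) sq.
have R1 : red io p1 q ((p c, io c < io d) :: w).
  by rewrite -C1; apply: (@red_cons io p1 q c d) => //; rewrite C1 D1.
have R2 : red io p2 q ((p a, io a < io b) :: w).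
  rewrite -A2; apply: (@red_cons io p2 q a b) => //; rewrite ?A2 ?B2 //.
  by move: Hw; rewrite -/p1 C1 /p1 /p2 => Hw; rewrite sw_far.
have U := IH _ _ _ (small a b Ha Hb Eab qba) s1 Hu R1.
have V := IH _ _ _ (small c d Hc Hd Ecd qdc) s2 Hv R2.
rewrite U V.
apply: (@breq_catr k w [:: (p a, io a < io b); (p c, io c < io d)]
  [:: (p c, io c < io d); (p a, io a < io b)]).
by apply: breq_comm; lia.
Qed.

(** Any reduced word serves: by [red_unique] the choice does not affect the braid when [io] is
    injective below [k]. *)
Definition hw io p q : bword := xget [::] [set w | red io p q w].

Lemma hwP io p q : state p -> state q -> red io p q (hw io p q).
Proof. by move=> sp sq; have [w Hw] := red_exists io sp sq; apply: (xgetPex [::]); exists w. Qed.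

Lemma hw_wf io p q : state p -> state q -> wf_word k (hw io p q).
Proof. by move=> sp sq; apply: red_wf (hwP io sp sq). Qed.

Lemma hw_perm io p q c : state p -> state q -> perm_word (hw io p q) (p c) = q c.
Proof. by move=> sp sq; apply: red_perm (hwP io sp sq). Qed.

Lemma hw_id io p : state p -> hw io p p = [::].
Proof.
by move=> sp; case: (red_inv (hwP io sp sp)) => [[]|[a [b [w [[Ha Hb E qba] _]]]]] //; lia.
Qed.

Lemma hw_sign io io' p q : (forall a b, a < k -> b < k -> io a = io b -> a = b) ->
  (forall a b, a < k -> b < k -> io' a = io' b -> a = b) -> state p -> state q ->
  (forall c d, c < k -> d < k -> p c < p d -> q d < q c -> (io c < io d) = (io' c < io' d)) ->
  breq k (hw io p q) (hw io' p q).
Proof.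
move=> I1 I2 sp sq H; apply: (red_unique I2 sp sq _ (hwP io' sp sq)).
exact: red_sign sp H (hwP io sp sq).
Qed.

Section Groupoid.
Variable io : nat -> nat.
Hypothesis ioI : forall a b, a < k -> b < k -> io a = io b -> a = b.

(** The crossing need not bring [p] closer to [q]. If the pair is not inverted, the word from the
    swapped state can begin by crossing it back with the opposite sign, and the two letters
    cancel. *)
Lemma hw_step p q a b : state p -> state q -> a < k -> b < k -> (p a).+1 = p b ->
  breq k (hw io p q) ((p a, io a < io b) :: hw io (sw (p a) p) q).
Proof.
move=> sp sq Ha Hb E; have s1 := state_sw_adj sp Hb E.
have inv p' a' b' : state p' -> a' < k -> b' < k -> (p' a').+1 = p' b' -> q b' < q a' ->
    breq k (hw io p' q) ((p' a', io a' < io b') :: hw io (sw (p' a') p') q).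
  move=> sp' Ha' Hb' E' qba; apply: (red_unique ioI sp' sq (hwP io sp' sq)).
  by apply: red_cons => //; apply: hwP => //; apply: state_sw_adj sp' Hb' E'.
have [qba|qab] := ltnP (q b) (q a); first exact: inv.
have ab : a <> b by move=> e; move: E; rewrite e; lia.
have {}qab : q a < q b.
  by rewrite ltn_neqAle qab andbT; apply/eqP; case: sq => _ I _ /(I _ _ Ha Hb).
have := inv (sw (p a) p) b a s1 Hb Ha; rewrite (sw_l E) (sw_r E) E sw_sw => /(_ erefl qab) ->.
have -> : (io b < io a) = ~~ (io a < io b) by have := ioI Ha Hb; lia.
apply: breq_sym.
apply: (@breq_catr k _ [:: (p a, io a < io b); (p a, ~~ (io a < io b))] [::]).
by apply: breq_inv; rewrite E; case: sp => /(_ b Hb).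
Qed.

(** Concatenations are usually not reduced, but [hw_step] absorbs the letters of the first word one
    at a time. With signs fixed by a single [io], the braid depends on the end states only. *)
Lemma hw_trans p q r : state p -> state q -> state r ->
  breq k (hw io p q ++ hw io q r) (hw io p r).
Proof.
move=> sp sq sr; move: (hwP io sp sq); move: (hw io p q) => w0.
elim: w0 p sp => [|x w IH] p sp /red_inv[]; first by case=> _ ->; apply: breq_refl.
- by case=> a [b [w' [_ []]]].
- by case.
case=> a [b [w' [[Ha Hb E qba] [H [-> ew]]]]]; move: H; rewrite -ew => H.
rewrite (hw_step sp sr Ha Hb E) cat_cons (IH _ (state_sw_adj sp Hb E) H).
exact: breq_refl.
Qed.

End Groupoid.

End SignedMatsumoto.

(** * Configurations of points, their stars, and chains of short steps *)

Section Configurations.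
Local Open Scope ring_scope.
Context (R : realType) (k : nat).

(* [x (a, true)] and [x (a, false)] are the real and imaginary parts of the point
   with label [a]; only the labels below [k] matter. *)
Definition cfg := (nat * bool -> R)%type.

Definition lex (x : cfg) a b : bool :=
  (x (a, true) < x (b, true)) ||
  ((x (a, true) == x (b, true)) && (x (a, false) < x (b, false))).

Definition conf (x : cfg) := forall a b, (a < k)%N -> (b < k)%N -> a <> b ->
  ~ (x (a, true) = x (b, true) /\ x (a, false) = x (b, false)).

(** The rank in the order [lex]: vertically aligned points are separated as by a slight tilt of the
    projection. Being the identity beyond [k] is what [state] asks for. *)
Definition pos (x : cfg) a : nat :=
  if (a < k)%N then count (fun b => lex x b a) (iota 0 k) else a.

(* The star of [c]: a convex set of configurations in which strict inequalities
   between real parts, and between imaginary parts at equal real parts, persist. *)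
Definition star (c x : cfg) := forall a b, (a < k)%N -> (b < k)%N ->
  (c (a, true) < c (b, true) -> x (a, true) < x (b, true)) /\
  (c (a, true) = c (b, true) -> c (a, false) < c (b, false) -> x (a, false) < x (b, false)).

Lemma lex_irr x a : lex x a a = false.
Proof. by rewrite /lex !ltxx andbF. Qed.

Lemma lex_trans x a b c : lex x a b -> lex x b c -> lex x a c.
Proof.
rewrite /lex => /orP[H|/andP[/eqP-> H]] /orP[H'|/andP[/eqP E H']].
- by rewrite (lt_trans H H').
- by rewrite -E H.
- by rewrite H'.
- by rewrite E eqxx (lt_trans H H') orbT.
Qed.

Lemma lex_total x a b : conf x -> (a < k)%N -> (b < k)%N -> a <> b -> lex x a b || lex x b a.
Proof.
move=> cx Ha Hb ab; have := cx _ _ Ha Hb ab; rewrite /lex.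
case: (ltgtP (x (a, true)) (x (b, true))) => //= E N.
by case: (ltgtP (x (a, false)) (x (b, false))) => //= E'; case: N.
Qed.

Lemma lex_asym x a b : lex x a b -> lex x b a = false.
Proof. by move=> H; apply/negP => /(lex_trans H); rewrite lex_irr. Qed.

Lemma count_lex x a b : (a < k)%N -> lex x a b ->
  (count (fun c => lex x c a) (iota 0 k) < count (fun c => lex x c b) (iota 0 k))%N.
Proof.
move=> Ha ab; have E : count (pred1 a) (iota 0 k) = 1%N.
  by rewrite count_uniq_mem ?iota_uniq // mem_iota Ha.
rewrite -addn1 -E -count_predUI (_ : count (predI _ _) _ = 0%N); last first.
  by apply/eqP; rewrite -leqn0 leqNgt -has_count; apply/hasPn => c _ /=; apply/negP => /andP[+ /eqP e]; rewrite e lex_irr.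
by rewrite addn0; apply: sub_count => c /= /orP[/lex_trans/(_ ab)|/eqP->].
Qed.

Lemma pos_lt x a b : conf x -> (a < k)%N -> (b < k)%N -> (pos x a < pos x b)%N = lex x a b.
Proof.
move=> cx Ha Hb; rewrite /pos Ha Hb; have [ab|ab] := boolP (lex x a b); first exact: count_lex.
have [->|/eqP nab] := eqVneq a b; first by rewrite ltnn.
have := lex_total cx Ha Hb nab; rewrite (negbTE ab) /= => ba.
by apply/negbTE; rewrite -leqNgt ltnW // count_lex.
Qed.

Lemma state_pos x : conf x -> state k (pos x).
Proof.
move=> cx; split.
- move=> a Ha; rewrite /pos Ha -[X in (_ < X)%N](size_iota 0 k) -(count_predC (fun b => lex x b a)).
  rewrite -[X in (X < _)%N]addn0 ltn_add2l -has_count.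
  by apply/hasP; exists a; rewrite ?mem_iota //= lex_irr.
- move=> a b Ha Hb E; apply: contrapT => ab; case/orP: (lex_total cx Ha Hb ab) => H.
    by have := pos_lt cx Ha Hb; rewrite H E ltnn.
  by have := pos_lt cx Hb Ha; rewrite H E ltnn.
- by move=> a Ha; rewrite /pos ltnNge Ha.
Qed.

Lemma star_conf c x : conf c -> star c x -> conf x.
Proof.
move=> cc V a b Ha Hb ab [E1 E2]; have := lex_total cc Ha Hb ab.
have [V1 V2] := V a b Ha Hb; have [V3 V4] := V b a Hb Ha; rewrite /lex.
case: (ltgtP (c (a, true)) (c (b, true))) => /= [/V1|/V3|E]; rewrite ?E1 ?ltxx //.
by case: (ltgtP (c (a, false)) (c (b, false))) => //= [/(V2 E)|/(V4 (esym E))]; rewrite E2 ltxx.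
Qed.

Lemma star_refl c : star c c. Proof. by move=> a b _ _; split. Qed.

Lemma star_convex c x y t : star c x -> star c y -> 0 <= t <= 1 ->
  star c (fun j => (1 - t) * x j + t * y j).
Proof.
move=> Vx Vy /andP[t0 t1] a b Ha Hb; have [X1 X2] := Vx a b Ha Hb; have [Y1 Y2] := Vy a b Ha Hb.
have conv (u v u' v' : R) : u < u' -> v < v' -> (1 - t) * u + t * v < (1 - t) * u' + t * v'.
  move=> H1 H2; have [->|tn] := eqVneq t 0; first by rewrite subr0 !mul1r !mul0r !addr0.
  apply: ler_ltD; first by apply: ler_wpM2l; [rewrite subr_ge0|exact: ltW].
  by rewrite ltr_pM2l // lt_neqAle eq_sym tn.
by split=> [H|E H]; apply: conv; auto.
Qed.

(** Only differences of coordinates enter a star, so translations of the plane are invisible; later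
    this undoes the subtraction of row means. *)
Lemma star_shift c x y (t : bool -> R) : star c x -> (forall a b, (a < k)%N -> y (a, b) = x (a, b) + t b) ->
  star c y.
Proof.
move=> V E a b Ha Hb; have [V1 V2] := V a b Ha Hb.
by rewrite !E //; split=> [/V1|e /(V2 e)] H; rewrite ltrD2r.
Qed.

Lemma pos_shift x y (t : bool -> R) : (forall a b, (a < k)%N -> y (a, b) = x (a, b) + t b) ->
  pos y = pos x.
Proof.
move=> E; apply/funext => a; rewrite /pos; case: ifP => // Ha.
apply: eq_in_count => b; rewrite mem_iota /= => Hb.
by rewrite /lex !E // !ltrD2r (inj_eq (addIr _)).
Qed.

Lemma star_lex c x a b : conf c -> star c x -> (a < k)%N -> (b < k)%N ->
  c (a, true) < c (b, true) -> lex x a b.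
Proof. by move=> cc V Ha Hb H; rewrite /lex (proj1 (V a b Ha Hb) H). Qed.

(* If a pair changes order inside the star of [c], it is vertically aligned in [c]. *)
Lemma star_inverted c x y a b : conf c -> star c x -> star c y -> (a < k)%N -> (b < k)%N ->
  lex x a b -> lex y b a -> lex c a b = (x (a, false) < x (b, false)).
Proof.
move=> cc Vx Vy Ha Hb ab ba.
have E : c (a, true) = c (b, true).
  case: (ltgtP (c (a, true)) (c (b, true))) => // H.
    by have := star_lex cc Vy Ha Hb H; rewrite (lex_asym ba).
  by have := star_lex cc Vx Hb Ha H; rewrite (lex_asym ab).
rewrite /lex E ltxx eqxx /=.
have [V1 V2] := Vx a b Ha Hb; have [V3 V4] := Vx b a Hb Ha.
have nab : a <> b by move=> e; move: ab; rewrite e lex_irr.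
case: (ltgtP (c (a, false)) (c (b, false))) => [/(V2 E)->|/(V4 (esym E))/ltW|E'] //.
  by rewrite leNgt => /negbTE.
by case: (cc _ _ Ha Hb nab).
Qed.

Lemma pos_inj c a b : conf c -> (a < k)%N -> (b < k)%N -> pos c a = pos c b -> a = b.
Proof. by move=> /state_pos[_ H _]; apply: H. Qed.

Definition linked x y := exists c, [/\ conf c, star c x & star c y].

(** A common centre is chosen, with [x] itself as default when there is none, so that the word is
    well formed for any two configurations ([stepw_wf]). *)
Definition stepw x y : bword :=
  hw k (pos (xget x [set c | [/\ conf c, star c x & star c y]])) (pos x) (pos y).

(** A pair that changes order is vertically aligned in every common centre, and its order in the
    centre is then its vertical order in [x]. Two centres therefore prescribe the same signs on all
    pairs that cross. *)
Lemma stepwE c x y : conf c -> star c x -> star c y ->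
  breq k (stepw x y) (hw k (pos c) (pos x) (pos y)).
Proof.
move=> cc Vx Vy; rewrite /stepw; set c' := xget _ _.
have [cc' Vx' Vy'] : [/\ conf c', star c' x & star c' y].
  by apply: (@xgetPex _ x [set c | [/\ conf c, star c x & star c y]]); exists c.
have cx := star_conf cc Vx; have cy := star_conf cc Vy.
apply: hw_sign; [by move=> a b; exact: pos_inj|by move=> a b; exact: pos_inj|exact: state_pos|exact: state_pos|].
move=> a b Ha Hb; rewrite !pos_lt // => ab ba.
by rewrite (star_inverted cc Vx Vy) // (star_inverted cc' Vx' Vy').
Qed.

Lemma stepw_trans c x y z : conf c -> star c x -> star c y -> star c z ->
  breq k (stepw x y ++ stepw y z) (stepw x z).
Proof.
move=> cc Vx Vy Vz; rewrite (stepwE cc Vx Vy) (stepwE cc Vy Vz) (stepwE cc Vx Vz).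
apply: hw_trans; first by move=> a b; exact: pos_inj.
- exact/state_pos/(star_conf cc Vx).
- exact/state_pos/(star_conf cc Vy).
- exact/state_pos/(star_conf cc Vz).
Qed.

Lemma stepw_id x y : conf x -> pos x = pos y -> stepw x y = [::].
Proof. by move=> cx E; rewrite /stepw -E hw_id //; apply: state_pos. Qed.

Lemma stepw_shift x y x' y' (t t' : bool -> R) : linked x y ->
  (forall a b, (a < k)%N -> x' (a, b) = x (a, b) + t b) ->
  (forall a b, (a < k)%N -> y' (a, b) = y (a, b) + t' b) -> breq k (stepw x y) (stepw x' y').
Proof.
move=> [c [cc Vx Vy]] Ex Ey; rewrite (stepwE cc Vx Vy).
rewrite (stepwE cc (star_shift Vx Ex) (star_shift Vy Ey)).
by rewrite (pos_shift Ex) (pos_shift Ey); apply: breq_refl.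
Qed.

Lemma stepw_wf x y : conf x -> conf y -> wf_word k (stepw x y).
Proof. by move=> cx cy; apply: hw_wf; apply: state_pos. Qed.

Lemma stepw_perm x y a : conf x -> conf y -> perm_word (stepw x y) (pos x a) = pos y a.
Proof. by move=> cx cy; apply: hw_perm; apply: state_pos. Qed.

Fixpoint chain (x : cfg) (l : seq cfg) : Prop :=
  if l is y :: l' then linked x y /\ chain y l' else conf x.

Fixpoint dword (x : cfg) (l : seq cfg) : bword :=
  if l is y :: l' then stepw x y ++ dword y l' else [::].

(** Elementary homotopies of polygonal paths, the start being a separate argument: a vertex is
    skipped inside a star, or a repeated vertex is dropped. The end of the path never changes. *)
Inductive dh : cfg -> seq cfg -> seq cfg -> Prop :=
| dh_rm c x y z l : conf c -> star c x -> star c y -> star c z -> dh x (y :: z :: l) (z :: l)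
| dh_dup x l : dh x (x :: l) l
| dh_cons x y l l' : dh y l l' -> dh x (y :: l) (y :: l')
| dh_refl x l : dh x l l
| dh_sym x l l' : dh x l l' -> dh x l' l
| dh_trans x l1 l2 l3 : dh x l1 l2 -> dh x l2 l3 -> dh x l1 l3.

Lemma linked_conf x y : linked x y -> conf x /\ conf y.
Proof. by case=> c [cc Vx Vy]; split; [apply: star_conf Vx|apply: star_conf Vy]. Qed.

Lemma chain_conf x l : chain x l -> conf x.
Proof. by case: l => [|y l] //= [/linked_conf[]]. Qed.

Lemma dh_chain x l l' : dh x l l' -> chain x l <-> chain x l'.
Proof.
elim=> {x l l'} /=; try tauto.
- move=> c x y z l cc Vx Vy Vz.
  have L u v : star c u -> star c v -> linked u v by exists c.
  by split=> [[_ [_ H]]|[_ H]]; split => //; [exact: L|exact: L|split=> //; exact: L].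
- move=> x l; split=> [[]|H] //; split=> //; have cx := chain_conf H.
  by exists x; split=> //; apply: star_refl.
Qed.

(** Integral configurations with positions [p] and depths [q]. For a state [p], the configuration
    [stdcfg p p] is the normal stop between two letters of a canonical path. *)
Definition stdcfg (p q : nat -> nat) : cfg := fun j => if j.2 then (p j.1)%:R else (q j.1)%:R.

Lemma conf_Pr p q : (forall a b, (a < k)%N -> (b < k)%N -> q a = q b -> a = b) -> conf (stdcfg p q).
Proof.
by move=> I a b Ha Hb ab [_ /eqP]; rewrite /stdcfg /= eqr_nat => /eqP /(I _ _ Ha Hb).
Qed.

Lemma conf_P p q : state k p -> conf (stdcfg p q).
Proof.
by move=> [_ I _] a b Ha Hb ab [/eqP + _]; rewrite /stdcfg /= eqr_nat => /eqP /(I _ _ Ha Hb).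
Qed.

Lemma star_P p q p' q' : (forall a b, (a < k)%N -> (b < k)%N -> (p a < p b)%N -> (p' a < p' b)%N) ->
  (forall a b, (a < k)%N -> (b < k)%N -> p a = p b -> (q a < q b)%N -> (q' a < q' b)%N) ->
  star (stdcfg p q) (stdcfg p' q').
Proof.
move=> H1 H2 a b Ha Hb; rewrite /stdcfg /= !ltr_nat; split=> [|/eqP]; first exact: H1.
by rewrite eqr_nat => /eqP; apply: H2.
Qed.

(** Distinct real parts leave the imaginary parts free, so depths can be rearranged at fixed
    positions without a crossing. *)
Lemma star_P1 p q q' : state k p -> star (stdcfg p q) (stdcfg p q').
Proof. by move=> [_ I _]; apply: star_P => // a b Ha Hb /(I _ _ Ha Hb) ->; rewrite ltnn. Qed.

Lemma pos_P p q : state k p -> pos (stdcfg p q) = p.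
Proof.
move=> sp; have cP := @conf_P p q sp; apply: (@state_order_eq k) => //; first exact: state_pos.
move=> a b Ha Hb; rewrite pos_lt // /lex /stdcfg /= ltr_nat eqr_nat => /orP[]// /andP[/eqP].
by case: sp => _ I _ /(I _ _ Ha Hb) ->; rewrite ltr_nat ltnn.
Qed.

Lemma star_xP x q : conf x -> (forall a b, (a < k)%N -> (b < k)%N ->
  x (a, true) = x (b, true) -> x (a, false) < x (b, false) -> (q a < q b)%N) ->
  star x (stdcfg (pos x) q).
Proof.
move=> cx H a b Ha Hb; rewrite /stdcfg /= !ltr_nat pos_lt //; split; last exact: H.
by rewrite /lex => ->.
Qed.

Lemma star_cP c x : conf c -> star c x -> star c (stdcfg (pos x) (pos c)).
Proof.
move=> cc Vx a b Ha Hb; rewrite /stdcfg /= !ltr_nat !pos_lt //; last exact: star_conf Vx.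
split=> [H|E H]; last by rewrite /lex E eqxx H orbT.
exact: star_lex cc Vx Ha Hb H.
Qed.

(** Each letter is a horizontal exchange together with a change of depths that restores a normal
    stop. The depths change after the exchange for a positive letter and before it for a negative
    one, so the strand moving right passes below, respectively above, the other one in the plane. *)
Fixpoint canon (p : nat -> nat) (w : bword) : seq cfg :=
  if w is (i, b) :: w' then
    (if b then stdcfg (sw i p) p else stdcfg p (sw i p)) :: stdcfg (sw i p) (sw i p) :: canon (sw i p) w'
  else [::].

Definition run (w : bword) (p : nat -> nat) a := perm_word w (p a).

Lemma canon_cat p u v : canon p (u ++ v) = canon p u ++ canon (run u p) v.
Proof. by elim: u p => //= -[i b] u IH p; rewrite IH. Qed.

Lemma state_run w p : wf_word k w -> state k p -> state k (run w p).
Proof.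
elim: w p => //= -[i b] w IH p /andP[/= Hi Hw] sp.
exact: (IH (sw i p) Hw (state_sw Hi sp)).
Qed.

(** Real parts on the wall between two chambers: [a] and [b] are aligned, and the star of such a
    configuration reaches both orders of the pair. *)
Definition merge p a b : nat -> nat := fun d => if d == b then p a else p d.

Section Edge.
Variables (p : nat -> nat) (a b : nat).
Hypotheses (sp : state k p) (Ha : (a < k)%N) (Hb : (b < k)%N).
Hypothesis E : (p a).+1 = p b.
Let s := sw (p a) p.

Lemma merge_lt c d : (c < k)%N -> (d < k)%N -> (merge p a b c < merge p a b d)%N ->
  (p c < p d)%N /\ (s c < s d)%N.
Proof.
case: (sp) => _ I _; rewrite /merge => Hc Hd.
have := I c a Hc Ha; have := I d a Hd Ha; have := I c b Hc Hb; have := I d b Hd Hb.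
case: (strand_stepP (p c) (p a) true) => [[e1 e1']|[[e1 e1']|[e1 [e1'' e1']]]];
case: (strand_stepP (p d) (p a) true) => [[e2 e2']|[[e2 e2']|[e2 [e2'' e2']]]];
rewrite /s /sw e1' e2'; case: eqP => [?|?]; case: eqP => [?|?]; subst; lia.
Qed.

Lemma merge_eq c d : (c < k)%N -> (d < k)%N -> merge p a b c = merge p a b d ->
  c = d \/ (c = a /\ d = b) \/ (c = b /\ d = a).
Proof.
case: (sp) => _ I _; rewrite /merge => Hc Hd.
case: eqP => [->|?]; case: eqP => [->|?]; [by left|move=> e|move=> e|move=> e; left; exact: I].
  by right; right; split=> //; apply/esym/I.
by right; left; split=> //; apply: I.
Qed.

(** Only the pair [a], [b] is aligned in the centre, hence only its depth order is constrained. *)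
Lemma star_merge q q' : (q a < q b)%N = (q' a < q' b)%N -> (q b < q a)%N = (q' b < q' a)%N ->
  star (stdcfg (merge p a b) q) (stdcfg p q') /\ star (stdcfg (merge p a b) q) (stdcfg s q').
Proof.
move=> E1 E2; split; apply: star_P => c d Hc Hd; try by case/(merge_lt Hc Hd).
  by case/(merge_eq Hc Hd)=> [->|[[-> ->]|[-> ->]]]; rewrite ?ltnn ?E1 ?E2.
by case/(merge_eq Hc Hd)=> [->|[[-> ->]|[-> ->]]]; rewrite ?ltnn ?E1 ?E2.
Qed.

Let ss : state k s. Proof. exact: state_sw_adj sp Hb E. Qed.

Lemma io_sw_r : (s b < s a)%N. Proof. by rewrite /s (sw_l E) (sw_r E) -E. Qed.

(** The depths used during an exchange are immaterial as long as the order of [a] and [b] gives the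
    right sign: all stops involved lie in the star of one merged configuration. *)
Lemma dh_edge io l : state k io -> dh (stdcfg p p) (canon p [:: (p a, (io a < io b)%N)] ++ l)
  (stdcfg p io :: stdcfg s io :: stdcfg s s :: l).
Proof.
move=> sio; have Ls q q' l' x : dh (stdcfg s q) (stdcfg s q' :: stdcfg s x :: l') (stdcfg s x :: l').
  by apply: (dh_rm _ (@conf_P s s ss)); apply: star_P1.
have Lp q q' l' x : dh (stdcfg p q) (stdcfg p q' :: stdcfg p x :: l') (stdcfg p x :: l').
  by apply: (dh_rm _ (@conf_P p p sp)); apply: star_P1.
have ltab := io_sw_r; have [_ I _] := sio.
have nab : a <> b by move=> e; move: E; rewrite e; lia.
have Iab := I a b Ha Hb.
have cm : conf (stdcfg (merge p a b) io) by apply: conf_Pr => c d Hc Hd; apply: I.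
have [M1 M2] := @star_merge io io erefl erefl.
rewrite /= -/s; case: ifP => /= ab.
  have [M3 M4] := @star_merge io p ltac:(lia) ltac:(lia).
  apply: dh_sym; apply: dh_trans (dh_rm _ cm M3 M1 M2) _.
  apply: dh_trans (dh_sym (dh_rm _ cm M3 M4 M2)) _.
  exact/dh_cons/Ls.
have [M3 M4] := @star_merge io s ltac:(lia) ltac:(lia).
apply: dh_sym; apply: dh_trans (dh_cons _ (dh_rm _ cm M1 M2 M4)) _.
apply: dh_trans (dh_cons _ (dh_sym (dh_rm _ cm M1 M3 M4))) _.
exact: Lp.
Qed.

Lemma linked_edge : linked (stdcfg p p) (stdcfg s p) /\ linked (stdcfg p s) (stdcfg s s).
Proof.
have L q : state k q -> linked (stdcfg p q) (stdcfg s q).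
  move=> [_ I _]; exists (stdcfg (merge p a b) q); have [] := @star_merge q q erefl erefl.
  by split=> //; apply: conf_Pr => c d Hc Hd; apply: I.
by split; apply: L.
Qed.

Lemma stepw_edge q : state k q -> breq k (stepw (stdcfg p q) (stdcfg s q)) [:: (p a, (q a < q b)%N)].
Proof.
move=> sq; have [M1 M2] := @star_merge q q erefl erefl; set c := stdcfg (merge p a b) q in M1 M2.
have cc : conf c by case: sq => _ I _; apply: conf_Pr => ? ? ? ?; apply: I.
rewrite (stepwE cc M1 M2) (@pos_P p q sp) (@pos_P s q ss).
have I : forall u v, (u < k)%N -> (v < k)%N -> pos c u = pos c v -> u = v by move=> u v; exact: pos_inj.
rewrite (hw_step I sp ss Ha Hb E) -/s hw_id // pos_lt // /lex /c /stdcfg /= /merge eqxx.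
by rewrite (_ : (a == b) = false); [rewrite ltxx eqxx /= ltr_nat; apply: breq_refl|apply/eqP => e; move: E; rewrite e; lia].
Qed.

End Edge.

Lemma adjacent_labels p i : state k p -> (i.+1 < k)%N ->
  exists a b, [/\ (a < k)%N, (b < k)%N, p a = i & p b = i.+1].
Proof.
move=> sp Hi; have [a Ha Ea] := state_surj sp (ltnW Hi); have [b Hb Eb] := state_surj sp Hi.
by exists a, b.
Qed.

(** The canonical path of a reduced word contracts to one straight move at depths [io]. A reduced
    word never disturbs a pair that keeps its order, so every state it meets satisfies the condition
    on [r], and all stops lie in the star of [c]. *)
Lemma dh_red c io p q w l : red k io p q w -> state k p -> state k q -> state k io -> conf c ->
  (forall r, (forall a b, (a < k)%N -> (b < k)%N -> (p a < p b)%N -> (q a < q b)%N -> (r a < r b)%N) ->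
     star c (stdcfg r io)) ->
  dh (stdcfg p p) (canon p w ++ l) (stdcfg p io :: stdcfg q io :: stdcfg q q :: l).
Proof.
move=> + + sq sio cc; elim: w p => [|x w IH] p H sp Hr.
  case/red_inv: H => [[_ pq]|[a [b [w [_ []]]]]] //; rewrite -pq in Hr *.
  have L y z l' x : dh (stdcfg p y) (stdcfg p z :: stdcfg p x :: l') (stdcfg p x :: l').
    by apply: (dh_rm _ (@conf_P p p sp)); apply: star_P1.
  apply: dh_sym; apply: dh_trans (L _ _ _ _) _; apply: dh_trans (L _ _ _ _) _.
  exact: dh_dup.
case/red_inv: H => [[]|[a [b [w' [[Ha Hb E qba] [H [-> ew]]]]]]] //; rewrite -{w'}ew in H *.
set s := sw (p a) p in H.
have ss : state k s by exact: state_sw_adj sp Hb E.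
have Hs r : (forall c d, (c < k)%N -> (d < k)%N -> (s c < s d)%N -> (q c < q d)%N -> (r c < r d)%N) ->
    star c (stdcfg r io).
  move=> Hsr; apply: Hr => u v Hu Hv puv quv; apply: Hsr => //.
  rewrite (sw_lt sp Ha Hb Hu Hv E) //; first by apply/negP => /andP[/eqP e /eqP e']; subst; lia.
  by apply/negP => /andP[/eqP e /eqP e']; subst; lia.
have L y z l' x' : dh (stdcfg s y) (stdcfg s z :: stdcfg s x' :: l') (stdcfg s x' :: l').
  by apply: (dh_rm _ (@conf_P s s ss)); apply: star_P1.
apply: dh_trans (@dh_edge p a b sp Ha Hb E io (canon s w ++ l) sio) _; rewrite -/s.
apply: dh_trans (dh_cons _ (dh_cons _ (dh_cons _ (IH s H ss Hs)))) _.
apply: dh_trans (dh_cons _ (dh_cons _ (L _ _ _ _))) _.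
apply: dh_trans (dh_cons _ (dh_cons _ (dh_dup _ _))) _.
apply: dh_cons; apply: (dh_rm _ cc); apply: Hr => u v Hu Hv //.
move=> puv quv; rewrite /s (sw_lt sp Ha Hb Hu Hv E) //; first by apply/negP => /andP[/eqP e /eqP e']; subst; lia.
by apply/negP => /andP[/eqP e /eqP e']; subst; lia.
Qed.

(** [f] puts labels on common abscissas so that the straight move from [p] to [q] stays in the star
    of the resulting configuration; both reduced words contract to that move. *)
Lemma dh_canon_red io p q w1 w2 (f : nat -> nat) l : red k io p q w1 -> red k io p q w2 ->
  state k p -> state k q -> state k io ->
  (forall a b, (a < k)%N -> (b < k)%N -> (f a < f b)%N -> (p a < p b)%N /\ (q a < q b)%N) ->
  dh (stdcfg p p) (canon p w1 ++ l) (canon p w2 ++ l).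
Proof.
move=> H1 H2 sp sq sio Hf.
have cf : conf (stdcfg f io) by case: sio => _ I _; apply: conf_Pr => ? ? ? ?; apply: I.
have Hr r : (forall a b, (a < k)%N -> (b < k)%N -> (p a < p b)%N -> (q a < q b)%N -> (r a < r b)%N) ->
    star (stdcfg f io) (stdcfg r io).
  by move=> H; apply: star_P => // a b Ha Hb /(Hf _ _ Ha Hb)[]; apply: H.
apply: dh_trans (dh_red _ H1 sp sq sio cf Hr) _.
exact: dh_sym (dh_red _ H2 sp sq sio cf Hr).
Qed.

Lemma red_letter io p q i s a b w : (a < k)%N -> (b < k)%N -> p a = i -> p b = i.+1 ->
  (io a < io b)%N = s -> (q b < q a)%N -> red k io (sw i p) q w -> red k io p q ((i, s) :: w).
Proof. by move=> Ha Hb <- E <- qba H; apply: red_cons. Qed.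

Lemma run_breq u v p : breq k u v -> run u p = run v p.
Proof. by move=> H; apply/funext => a; rewrite /run (perm_word_breq H). Qed.

(** Each Artin relation is a homotopy inside one star. The centre aligns the two strands of a
    cancelling pair, each of the two pairs of a commutation, or the three strands of a braid
    relation. *)
Lemma dh_canon_breq u v p l : breq k u v -> wf_word k u -> state k p ->
  dh (stdcfg p p) (canon p u ++ l) (canon p v ++ l).
Proof.
move=> H; elim: H p l => {u v}.
- by move=> *; apply: dh_refl.
- by move=> u v uv IH p l wv sp; apply/dh_sym/IH => //; rewrite (breq_wf uv).
- by move=> u v w uv H1 _ H2 p l wu sp; apply: dh_trans (H1 _ _ _ _) (H2 _ _ _ _); rewrite // -(breq_wf uv).
- move=> u1 u2 v1 v2 Hu IHu Hv IHv p l; rewrite wf_cat => /andP[wu wv] sp.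
  rewrite !canon_cat -!catA; apply: dh_trans (IHu _ _ wu sp) _.
  rewrite (run_breq _ Hu); have su : state k (run u2 p).
    by apply: state_run; rewrite -?(breq_wf Hu).
  have : dh (stdcfg (run u2 p) (run u2 p)) (canon (run u2 p) v1 ++ l) (canon (run u2 p) v2 ++ l).
    exact: IHv.
  move: (canon _ v1 ++ l) (canon _ v2 ++ l) => l1 l2; rewrite (breq_wf Hu) in wu.
  elim: u2 p wu {IHu Hu sp su} => [|[i b] w IH] p //= /andP[_ Hw] H12.
  by do 2 apply: dh_cons; apply: IH.
- move=> i b Hi p l _ sp; have [a [c [Ha Hc Ea Ec]]] := adjacent_labels sp Hi.
  have E : (p a).+1 = p c by rewrite Ea Ec.
  pose s := sw i p; have ss : state k s by apply: state_sw.
  have Es : (s c).+1 = s a by rewrite /s -Ea (sw_l E) (sw_r E) E.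
  (* Depths for which the first exchange has sign [b] and the exchange back has sign [~~ b]. *)
  pose io := if b then p else s.
  have sio : state k io by rewrite /io; case: (b).
  have [b1 b2] : (io a < io c)%N = b /\ (io c < io a)%N = ~~ b.
    by rewrite /io; case: (b); rewrite -?Es -?E ltnS leqnn; split=> //; lia.
  have := fun l => @dh_edge p a c sp Ha Hc E io l sio; rewrite b1 Ea -/s => D1.
  have := fun l => @dh_edge s c a ss Hc Ha Es io l sio; rewrite b2 (_ : s c = i) ?sw_sw; last by rewrite /s -Ea (sw_r E).
  move=> D2.
  have L t y z l' x : state k t -> dh (stdcfg t y) (stdcfg t z :: stdcfg t x :: l') (stdcfg t x :: l').
    by move=> st; apply: (dh_rm _ (@conf_P t t st)); apply: star_P1.
  rewrite -[canon p _ ++ l]/(canon p [:: (i, b)] ++ (canon s [:: (i, ~~ b)] ++ l)).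
  apply: dh_trans (D1 _) _; apply: dh_trans (dh_cons _ (dh_cons _ (dh_cons _ (D2 l)))) _.
  apply: dh_trans (dh_cons _ (dh_cons _ (L _ _ _ _ _ ss))) _.
  apply: dh_trans (dh_cons _ (dh_cons _ (dh_dup _ _))) _.
  have [M1 M2] := @star_merge p a c sp Ha Hc E io io erefl erefl; rewrite Ea -/s in M2.
  have cm : conf (stdcfg (merge p a c) io) by case: sio => _ I _; apply: conf_Pr => ? ? ? ?; apply: I.
  apply: dh_trans (dh_cons _ (dh_rm _ cm M1 M2 M1)) _.
  apply: dh_trans (dh_cons _ (dh_dup _ _)) _.
  by apply: dh_trans (L _ _ _ _ _ sp) _; apply: dh_dup.
- move=> i j Hi Hj ij p l _ sp.
  have [a [b [Ha Hb Ea Eb]]] := adjacent_labels sp Hi.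
  have [c [d [Hc Hd Ec Ed]]] := adjacent_labels sp Hj.
  pose q := sw j (sw i p).
  have sq : state k q by do 2 apply: state_sw => //.
  have qE u : q u = strand_step (strand_step (p u) (i, true)) (j, true) by [].
  have qv u : (p u = i /\ q u = i.+1) \/ (p u = i.+1 /\ q u = i) \/ (p u = j /\ q u = j.+1) \/
     (p u = j.+1 /\ q u = j) \/ (p u <> i /\ p u <> i.+1 /\ p u <> j /\ p u <> j.+1 /\ q u = p u).
    have := strand_stepP (p u) i true; have := strand_stepP (strand_step (p u) (i, true)) j true.
    rewrite -qE => H1 H2; have [?|?] := eqVneq (p u) i; first lia.
    have [?|?] := eqVneq (p u) i.+1; first lia.
    have [?|?] := eqVneq (p u) j; first lia.
    have [?|?] := eqVneq (p u) j.+1; first lia.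
    by do 4 right; lia.
  have qba : (q b < q a)%N by have := qv a; have := qv b; lia.
  have qdc : (q d < q c)%N by have := qv c; have := qv d; lia.
  have swo t u : t u <> i -> t u <> i.+1 -> sw i t u = t u by apply: sw_out.
  have swo' t u : t u <> j -> t u <> j.+1 -> sw j t u = t u by apply: sw_out.
  (* Positions [i] and [i.+1] are merged, and so are [j] and [j.+1]; taking [p] for the depths makes
     all letters positive. *)
  apply: (@dh_canon_red p p q _ _ (fun a => if p a == i.+1 then i else if p a == j.+1 then j else p a)) => //.
  + apply: (@red_letter _ _ _ _ _ a b) => //; first by lia.
    apply: (@red_letter _ _ _ _ _ c d) => //; try by [rewrite swo; lia|lia].
    exact: red_nil.
  + apply: (@red_letter _ _ _ _ _ c d) => //; first by lia.
    apply: (@red_letter _ _ _ _ _ a b) => //; try by [rewrite swo'; lia|lia].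
    by rewrite sw_far //; apply: red_nil.
  + move=> u v Hu Hv; have := qv u; have := qv v; case: sp => _ I _.
    have := I u v Hu Hv; repeat (case: ifP => ?); lia.
- move=> i Hi p l _ sp.
  have [a [b [Ha Hb Ea Eb]]] := adjacent_labels sp (ltnW Hi).
  have [b' [d [Hb' Hd Eb' Ed]]] := adjacent_labels sp Hi.
  have {Hb'}e : b' = b by case: sp => _ I _; apply: I; rewrite ?Eb'.
  subst b'.
  pose q := sw i (sw i.+1 (sw i p)).
  have sq : state k q by do 3 (apply: state_sw; first by lia).
  have qv u : (p u = i /\ q u = i.+2) \/ (p u = i.+1 /\ q u = i.+1) \/ (p u = i.+2 /\ q u = i) \/
     (p u <> i /\ p u <> i.+1 /\ p u <> i.+2 /\ q u = p u).
    rewrite /q /sw; set x := strand_step (p u) (i, true); set y := strand_step x _.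
    have := strand_stepP (p u) i true; have := strand_stepP x i.+1 true.
    have := strand_stepP y i true; rewrite -/x -/y => H1 H2 H3.
    have [?|?] := eqVneq (p u) i; first lia.
    have [?|?] := eqVneq (p u) i.+1; first lia.
    have [?|?] := eqVneq (p u) i.+2; first lia.
    by do 3 right; lia.
  have qa : q a = i.+2 by have := qv a; lia.
  have qb : q b = i.+1 by have := qv b; lia.
  have qd : q d = i by have := qv d; lia.
  (* All three positions are merged into [i]; the depths [p] again give positive letters only. *)
  apply: (@dh_canon_red p p q _ _ (fun a => if p a == i.+1 then i else if p a == i.+2 then i else p a)) => //.
  + pose p1 := sw i p; pose p2 := sw i.+1 p1.
    have A1 : p1 a = i.+1 by rewrite /p1 -Ea (@sw_l p a b) Ea.
    have B1 : p1 b = i by rewrite /p1 -Ea (@sw_r p a b) Ea.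
    have D1 : p1 d = i.+2 by rewrite /p1 sw_out; lia.
    have B2 : p2 b = i by rewrite /p2 sw_out; lia.
    have D2 : p2 d = i.+1 by rewrite /p2 -A1 (@sw_r p1 a d) A1.
    apply: (@red_letter _ _ _ _ _ a b) => //; try lia.
    apply: (@red_letter _ _ _ _ _ a d) => //; try lia.
    apply: (@red_letter _ _ _ _ _ b d) => //; try lia.
    exact: red_nil.
  + pose p1 := sw i.+1 p; pose p2 := sw i p1.
    have A1 : p1 a = i by rewrite /p1 sw_out; lia.
    have B1 : p1 b = i.+2 by rewrite /p1 -Eb (@sw_l p b d) Eb.
    have D1 : p1 d = i.+1 by rewrite /p1 -Eb (@sw_r p b d) Eb.
    have B2 : p2 b = i.+2 by rewrite /p2 sw_out; lia.
    have A2 : p2 a = i.+1 by rewrite /p2 -A1 (@sw_l p1 a d) A1.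
    apply: (@red_letter _ _ _ _ _ b d) => //; try lia.
    apply: (@red_letter _ _ _ _ _ a d) => //; try lia.
    apply: (@red_letter _ _ _ _ _ a b) => //; try lia.
    rewrite /q sw_braid; exact: red_nil.
  + move=> u v Hu Hv; have := qv u; have := qv v; case: sp => _ I _.
    have := I u v Hu Hv; repeat (case: ifP => ?); lia.
Qed.

(** The normal stop of a configuration lies in its own star, so both ends may detour through their
    stops. Between these stops, at the depths of [c], the move is the contracted form of the
    canonical path of its word. *)
Lemma dh_step x y l : linked x y ->
  dh x (y :: stdcfg (pos y) (pos y) :: l)
    (stdcfg (pos x) (pos x) :: canon (pos x) (stepw x y) ++ l).
Proof.
move=> [c [cc Vx Vy]]; have cx := star_conf cc Vx; have cy := star_conf cc Vy.
set p := pos x; set q := pos y; set io := pos c.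
have sp : state k p by exact: state_pos.
have sq : state k q by exact: state_pos.
have sio : state k io by exact: state_pos.
have Vxx : star x (stdcfg p p).
  by apply: star_xP => // a b Ha Hb e H; rewrite pos_lt // /lex e eqxx H orbT.
have Vyy : star y (stdcfg q q).
  by apply: star_xP => // a b Ha Hb e H; rewrite pos_lt // /lex e eqxx H orbT.
have iox z : star c z -> conf z -> star z (stdcfg (pos z) io).
  move=> Vz cz; apply: star_xP => // a b Ha Hb e H; rewrite /io pos_lt //.
  have nab : a <> b by move=> e'; move: H; rewrite e' ltxx.
  case/orP: (lex_total cc Ha Hb nab) => //.
  case/orP=> [H'|/andP[/eqP e' H']].
    by have := proj1 (Vz b a Hb Ha) H'; rewrite e ltxx.
  by have := proj2 (Vz b a Hb Ha) e' H'; rewrite ltNge (ltW H).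
have Wx := star_cP cc Vx; have Wy := star_cP cc Vy; rewrite -/p -/q -/io in Wx Wy.
have Hr r : (forall a b, (a < k)%N -> (b < k)%N -> (p a < p b)%N -> (q a < q b)%N -> (r a < r b)%N) ->
    star c (stdcfg r io).
  move=> H a b Ha Hb; rewrite /stdcfg /= !ltr_nat; split=> [e|e e'].
    by apply: H => //; rewrite /p /q pos_lt //; apply: star_lex e.
  by rewrite /io pos_lt // /lex e eqxx e' orbT.
have D := dh_red l (hwP io sp sq) sp sq sio cc Hr.
have D' := dh_canon_breq l (stepwE cc Vx Vy) (stepw_wf cx cy) sp.
apply: dh_sym; apply: dh_trans (dh_cons _ (dh_trans D' D)) _.
apply: dh_trans (dh_rm _ cx (@star_refl x) Vxx (iox x Vx cx)) _.
apply: dh_trans (dh_rm _ cc Vx Wx Wy) _.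
apply: dh_trans (dh_sym (dh_rm _ cc Vx Vy Wy)) _.
apply: dh_cons; exact: dh_rm cy (@star_refl y) (iox y Vy cy) Vyy.
Qed.

Lemma dh_canonize x l : chain x l ->
  dh x l (stdcfg (pos x) (pos x) :: canon (pos x) (dword x l) ++ [:: last x l]).
Proof.
have diag y : conf y -> star y (stdcfg (pos y) (pos y)).
  by move=> cy; apply: star_xP => // a b Ha Hb e H; rewrite pos_lt // /lex e eqxx H orbT.
elim: l x => [|y l IH] x /=.
  move=> cx; apply: dh_sym; have V := @star_refl x.
  by apply: dh_trans (dh_rm _ cx V (diag _ cx) V) _; apply: dh_dup.
move=> [xy ch]; have [cx cy] := linked_conf xy; apply: dh_trans (dh_cons _ (IH _ ch)) _.
apply: dh_trans (dh_step _ xy) _; rewrite canon_cat -catA.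
rewrite (_ : run (stepw x y) (pos x) = pos y); first exact: dh_refl.
by apply/funext => a; rewrite /run stepw_perm.
Qed.

Lemma dword_wf x l : chain x l -> wf_word k (dword x l).
Proof.
elim: l x => [|y l IH] x //= [/linked_conf[cx cy] /IH H]; rewrite wf_cat H andbT.
exact: stepw_wf.
Qed.

(** By [dh_canonize] a chain is equivalent to a path built from its start, its word and its last
    vertex alone. *)
Lemma dh_faithful x l l' : chain x l -> chain x l' -> last x l = last x l' ->
  breq k (dword x l) (dword x l') -> dh x l l'.
Proof.
move=> ch ch' e H; apply: dh_trans (dh_canonize ch) _.
apply: dh_trans _ (dh_sym (dh_canonize ch')); rewrite -e; apply: dh_cons.
by apply: dh_canon_breq => //; [apply: dword_wf|apply/state_pos/chain_conf/ch].
Qed.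

(** Of the two moves that make up a letter only the horizontal one crosses strands, and it
    contributes that letter. *)
Lemma chain_canon p w l : state k p -> wf_word k w -> chain (stdcfg (run w p) (run w p)) l ->
  chain (stdcfg p p) (canon p w ++ l) /\
  breq k (dword (stdcfg p p) (canon p w ++ l)) (w ++ dword (stdcfg (run w p) (run w p)) l).
Proof.
elim: w p => [|[i b] w IH] p sp; first by move=> _ H; split=> //; apply: breq_refl.
move=> /= /andP[/= Hi Hw] H; have ss := state_sw Hi sp.
have [ch Hd] := IH (sw i p) ss Hw H.
have [a [c [Ha Hc Ea Ec]]] := adjacent_labels sp Hi; have E : (p a).+1 = p c by rewrite Ea Ec.
have [L1 L2] := linked_edge sp Ha Hc E; rewrite Ea in L1 L2.
have S q := @stepw_edge p a c sp Ha Hc E q; rewrite Ea in S.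
have lt := io_sw_r E; rewrite Ea in lt.
have Ls q q' t : state k t -> linked (stdcfg t q) (stdcfg t q').
  by move=> st; exists (stdcfg t t); split; [exact: conf_P|exact: star_P1|exact: star_P1].
have Sn q q' t : state k t -> stepw (stdcfg t q) (stdcfg t q') = [::].
  by move=> st; apply: stepw_id; rewrite ?pos_P //; apply: conf_P.
case: b {H} => /=; split.
- by split=> //; split=> //; apply: Ls.
- rewrite (S _ sp) Sn //= (_ : (p a < p c)%N = true); last by lia.
  by rewrite Hd; apply: breq_refl.
- by split; [apply: Ls|split].
- rewrite Sn //= (S _ ss) /= (_ : (sw i p a < sw i p c)%N = false); last by lia.
  by rewrite Hd; apply: breq_refl.
Qed.

(** Start and end are joined to their normal stops by steps with empty word; the canonical path of
    [w] connects the two stops because [w] has the prescribed permutation. *)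
Lemma realize x y w : conf x -> conf y -> wf_word k w ->
  (forall a, (a < k)%N -> perm_word w (pos x a) = pos y a) ->
  exists l, [/\ chain x l, last x l = y, l <> [::] & breq k (dword x l) w].
Proof.
move=> cx cy Hw Hp; have sx := state_pos cx; have sy := state_pos cy.
have E : run w (pos x) = pos y by apply: (@state_eq k) => //; apply: state_run.
have diag z : conf z -> star z (stdcfg (pos z) (pos z)).
  by move=> cz; apply: star_xP => // a b Ha Hb e H; rewrite pos_lt // /lex e eqxx H orbT.
have Lx z : conf z -> linked z (stdcfg (pos z) (pos z)) /\ linked (stdcfg (pos z) (pos z)) z.
  by move=> cz; split; exists z; split=> //; try exact: star_refl; apply: diag.
have := @chain_canon (pos x) w [:: y] sx Hw; rewrite E /= => -[|ch Hd].
  by split=> //; case: (Lx y cy).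
exists (stdcfg (pos x) (pos x) :: canon (pos x) w ++ [:: y]); split.
- by split=> //; case: (Lx x cx).
- by rewrite /= last_cat.
- by [].
- rewrite /= (stepw_id cx) ?pos_P // Hd stepw_id ?pos_P //; last exact: conf_P.
  by rewrite !cats0; apply: breq_refl.
Qed.

Definition dw (y : nat -> cfg) m : bword :=
  flatten [seq stepw (y i) (y i.+1) | i <- iota 0 m].

Lemma dwD y a b : dw y (a + b) = dw y a ++ dw (fun i => y (a + i)%N) b.
Proof.
rewrite /dw iotaD map_cat flatten_cat add0n; congr (_ ++ flatten _).
by rewrite -{1}[a]addn0 iotaDl -map_comp; apply: eq_map => i /=; rewrite addnS.
Qed.

Lemma dwS y m : dw y m.+1 = dw y m ++ stepw (y m) (y m.+1).
Proof. by rewrite -addn1 dwD /dw /= cats0 addn0 addn1. Qed.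

Lemma dw_dword y m : dw y m = dword (y 0%N) [seq y i.+1 | i <- iota 0 m].
Proof.
elim: m y => // m IH y; rewrite -[m.+1]add1n dwD [dw y 1]/dw /= cats0; congr cat.
rewrite -[1%N]addn0 iotaDl -map_comp (IH (fun i => y (1 + i)%N)) /=.
by congr dword; apply: eq_map => i.
Qed.

Lemma dw_tele c y m : conf c -> (forall r, (r <= m)%N -> star c (y r)) ->
  breq k (dw y m) (stepw (y 0%N) (y m)).
Proof.
move=> cc; elim: m => [|m IH] H; first by rewrite stepw_id; [apply: breq_refl|exact: star_conf (H _ _)|].
rewrite dwS IH; last by move=> r Hr; apply: H; lia.
by apply: stepw_trans cc _ _ _; apply: H.
Qed.

(** Inside one star a chain of steps telescopes to a single step ([dw_tele]). *)
Lemma dw_refine y M K : (forall i, (i < M)%N -> exists2 c, conf c & forall r, (r <= K)%N -> star c (y (i * K + r)%N)) ->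
  breq k (dw y (M * K)) (dw (fun i => y (i * K)%N) M).
Proof.
elim: M => [|M IH] H; first exact: breq_refl.
rewrite mulSn addnC dwD dwS IH; last by move=> i Hi; apply: H; lia.
apply: breq_catl; have [c cc Hc] := H M (leqnn _).
by rewrite (dw_tele cc) /= ?addn0 ?[(M * K + K)%N]addnC; [exact: breq_refl|move=> r Hr; apply: Hc].
Qed.

(** Each cell lies in one star, so both of its boundary words equal the word of its diagonal; adding
    cells one by one moves the vertical step across the row. *)
Lemma dw_grid x y m : (forall i, (i < m)%N -> exists c,
    [/\ conf c, star c (x i), star c (x i.+1), star c (y i) & star c (y i.+1)]) ->
  conf (x 0%N) ->
  breq k (dw x m ++ stepw (x m) (y m)) (stepw (x 0%N) (y 0%N) ++ dw y m).
Proof.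
elim: m => [|m IH] H cx; first by rewrite cats0; apply: breq_refl.
have [c [cc V1 V2 V3 V4]] := H m (leqnn _).
rewrite !dwS catA -IH //; last by move=> i Hi; apply: H; lia.
rewrite -!catA; apply: breq_catl.
rewrite (stepw_trans cc V1 V2 V4) (stepw_trans cc V1 V3 V4); exact: breq_refl.
Qed.

Lemma dw_shift x y m (t : nat -> bool -> R) : (forall i, (i < m)%N -> linked (x i) (x i.+1)) ->
  (forall i a b, (i <= m)%N -> (a < k)%N -> y i (a, b) = x i (a, b) + t i b) ->
  breq k (dw x m) (dw y m).
Proof.
elim: m => [|m IH] L E; first exact: breq_refl.
rewrite !dwS IH; first last.
- by move=> i a b Hi; apply: E; lia.
- by move=> i Hi; apply: L; lia.
apply: breq_catl; apply: (@stepw_shift _ _ _ _ (t m) (t m.+1)); first exact: L.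
- by move=> a b; apply: E.
- by move=> a b; apply: E.
Qed.

Lemma dw_wf y m : (forall i, (i < m)%N -> linked (y i) (y i.+1)) -> wf_word k (dw y m).
Proof.
elim: m => // m IH H; rewrite dwS wf_cat IH; last by move=> i Hi; apply: H; lia.
by have [] := linked_conf (H m (leqnn _)); apply: stepw_wf.
Qed.

Lemma dw_perm y m a : (forall i, (i < m)%N -> linked (y i) (y i.+1)) ->
  perm_word (dw y m) (pos (y 0%N) a) = pos (y m) a.
Proof.
elim: m => // m IH H; rewrite dwS perm_word_cat IH; last by move=> i Hi; apply: H; lia.
by have [] := linked_conf (H m (leqnn _)); apply: stepw_perm.
Qed.

Lemma dw_chain y m : conf (y 0%N) -> (forall i, (i < m)%N -> linked (y i) (y i.+1)) ->
  chain (y 0%N) [seq y i.+1 | i <- iota 0 m].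
Proof.
elim: m y => // m IH y cy H /=; split; first exact: H.
rewrite -[1%N]addn0 iotaDl -map_comp.
rewrite (_ : [seq _ | i <- iota 0 m] = [seq (fun i => y i.+1) i.+1 | i <- iota 0 m]) //.
apply: (IH (fun i => y i.+1)) => [|i Hi]; last exact: H.
by have [] := linked_conf (H 0%N isT).
Qed.

End Configurations.

(** * Continuity of real-valued expressions *)

Section Continuity.
Local Open Scope ring_scope.
Local Open Scope classical_set_scope.
Context (R : realType) (T : topologicalType).

Lemma contD (f g : T -> R) : continuous f -> continuous g -> continuous (fun x => f x + g x).
Proof. by move=> cf cg x; apply: cvgD; [exact: cf|exact: cg]. Qed.

Lemma contN (f : T -> R) : continuous f -> continuous (fun x => - f x).
Proof. by move=> cf x; apply: cvgN; exact: cf. Qed.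

Lemma contB (f g : T -> R) : continuous f -> continuous g -> continuous (fun x => f x - g x).
Proof. by move=> cf cg; apply: contD => //; apply: contN. Qed.

Lemma contM (f g : T -> R) : continuous f -> continuous g -> continuous (fun x => f x * g x).
Proof. by move=> cf cg x; apply: cvgM; [exact: cf|exact: cg]. Qed.

Lemma contc (a : R) : continuous (fun _ : T => a).
Proof. by move=> x; apply: cvg_cst. Qed.

Lemma contsum (f : nat -> T -> R) m : (forall i, continuous (f i)) ->
  continuous (fun x => \sum_(i < m) f i x).
Proof.
move=> cf; elim: m => [|m IH].
  by rewrite (_ : (fun _ => _) = fun _ => 0); [exact: contc|apply/funext => x; rewrite big_ord0].
rewrite (_ : (fun _ => _) = fun x => \sum_(i < m) f i x + f m x).
  exact: contD.
by apply/funext => x; rewrite big_ord_recr.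
Qed.

Lemma contcomp (U : topologicalType) (f : U -> R) (g : T -> U) : continuous f -> continuous g ->
  continuous (fun x => f (g x)).
Proof. by move=> cf cg x; apply: continuous_comp; [exact: cg|exact: cf]. Qed.

End Continuity.

(** * Clamping to the unit interval and Lebesgue numbers *)

Section Clamp.
Local Open Scope ring_scope.
Local Open Scope classical_set_scope.
Context (R : realType).

(** The retraction of the line onto the unit interval, written with absolute values so that
    continuity needs no case analysis. *)
Definition cl (s : R) : R := (`|s| - `|s - 1| + 1) / 2.

Lemma cl_le0 s : s <= 0 -> cl s = 0.
Proof. by move=> H; rewrite /cl ler0_norm // ler0_norm; [lra|lra]. Qed.

Lemma cl_ge1 s : 1 <= s -> cl s = 1.
Proof. by move=> H; rewrite /cl ger0_norm ?ger0_norm; [lra|lra|lra]. Qed.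

Lemma cl_id s : 0 <= s <= 1 -> cl s = s.
Proof. by move=> /andP[H1 H2]; rewrite /cl ger0_norm // ler0_norm; [lra|lra]. Qed.

Lemma cl_in s : 0 <= cl s <= 1.
Proof.
have [H|H] := leP s 0; first by rewrite cl_le0 // lexx ler01.
have [H'|H'] := leP 1 s; first by rewrite cl_ge1 // lexx ler01.
by rewrite cl_id ?(ltW H) ?(ltW H').
Qed.

Lemma cont_cl : continuous cl.
Proof.
apply: contM; last exact: contc.
apply: contD; last exact: contc.
have cid : continuous (fun s : R => s) by move=> x; exact: cvg_id.
apply: contB; first by move=> x; apply: norm_continuous.
apply: (@contcomp R R R (fun x : R => `|x|)); first exact: norm_continuous.
by apply: contB => //; apply: contc.
Qed.

Lemma cont_id (T : topologicalType) : continuous (fun s : T => s).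
Proof. by move=> x; exact: cvg_id. Qed.

Lemma cont_fst : continuous (fun u : R * R => u.1).
Proof. by move=> x; apply: cvg_fst. Qed.

Lemma cont_snd : continuous (fun u : R * R => u.2).
Proof. by move=> x; apply: cvg_snd. Qed.

Lemma cont_pair (T : topologicalType) (f g : T -> R) : continuous f -> continuous g ->
  continuous (fun x => (f x, g x)).
Proof. by move=> cf cg x; apply: (@cvg_pair _ _ _ _ (nbhs (f x)) (nbhs (g x))); [exact: cf|exact: cg]. Qed.

(** The Lebesgue number lemma for the unit square, from compactness in near-covering form. Half of a
    local radius is spent on moving the point, the other half bounds the mesh. *)
Lemma lebesgue2 (C : Type) (G : C -> R -> R -> Prop) :
  (forall s t : R, 0 <= s <= 1 -> 0 <= t <= 1 -> exists (e : R) c, 0 < e /\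
     forall s' t' : R, 0 <= s' <= 1 -> 0 <= t' <= 1 -> `|s' - s| < e -> `|t' - t| < e -> G c s' t') ->
  exists2 M : nat, (0 < M)%N & forall s t : R, 0 <= s <= 1 -> 0 <= t <= 1 -> exists c,
    forall s' t' : R, 0 <= s' <= 1 -> 0 <= t' <= 1 -> `|s' - s| <= M%:R^-1 -> `|t' - t| <= M%:R^-1 -> G c s' t'.
Proof.
move=> H.
have cpt : compact (`[(0:R), 1] `*` `[(0:R), 1]).
  by apply: compact_setX; apply: segment_compact.
(* The shift to [M.+1] avoids an inverse of zero. *)
pose P (M : nat) (u : R * R) := exists c, forall s' t' : R, 0 <= s' <= 1 -> 0 <= t' <= 1 ->
  `|s' - u.1| <= M.+1%:R^-1 -> `|t' - u.2| <= M.+1%:R^-1 -> G c s' t'.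
have := (@compact_near_coveringP (R * R)%type _).1 cpt nat \oo P _.
have Hloc : forall x : R * R, (`[(0:R), 1] `*` `[(0:R), 1]) x ->
    \forall x' \near x & i \near \oo, P i x'.
  move=> [s t] [/= Hs Ht]; rewrite !in_itv /= in Hs Ht.
  have [e [c [e0 He]]] := H s t Hs Ht; have e2 : 0 < e / 2 by lra.
  near=> x' i; exists c => s' t' Hs' Ht' H1 H2.
  have Hi : i.+1%:R^-1 < e / 2 by near: i; exact: (near_infty_natSinv_lt (PosNum e2)).
  have [B1 B2] : `|x'.1 - s| < e / 2 /\ `|x'.2 - t| < e / 2.
    near: x'; exists ([set u | `|u - s| < e / 2], [set u | `|u - t| < e / 2]).
      by split; apply/nbhs_ballP; exists (e / 2) => //= y; rewrite /ball /= distrC.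
    by move=> [u v] [].
  apply: He => //.
  - rewrite (le_lt_trans (ler_distD x'.1 _ _)) // [e]splitr ltrD //; exact: le_lt_trans H1 Hi.
  - rewrite (le_lt_trans (ler_distD x'.2 _ _)) // [e]splitr ltrD //; exact: le_lt_trans H2 Hi.
move=> /(_ _ Hloc)[] //.
move=> N _ /(_ N (leqnn _)) HN; exists N.+1 => // s t Hs Ht.
by apply: (HN (s, t)); split; rewrite /= in_itv.
Unshelve. all: by end_near.
Qed.

Lemma lebesgue1 (C : Type) (G : C -> R -> Prop) :
  (forall s : R, 0 <= s <= 1 -> exists (e : R) c, 0 < e /\
     forall s' : R, 0 <= s' <= 1 -> `|s' - s| < e -> G c s') ->
  exists2 M : nat, (0 < M)%N & forall s : R, 0 <= s <= 1 -> exists c,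
    forall s' : R, 0 <= s' <= 1 -> `|s' - s| <= M%:R^-1 -> G c s'.
Proof.
move=> H; have [|M M0 HM] := @lebesgue2 C (fun c s _ => G c s).
  by move=> s t Hs _; have [e [c [e0 He]]] := H s Hs; exists e, c; split=> // s' t' *; apply: He.
exists M => // s Hs; have [c Hc] := HM s 0 Hs ltac:(by rewrite lexx ler01).
by exists c => s' Hs' H'; apply: (Hc s' 0) => //; rewrite ?lexx ?ler01 // subrr normr0 invr_ge0.
Qed.

End Clamp.

Ltac clamp := first [by rewrite cl_le0; lra | by rewrite cl_ge1; lra
  | by rewrite cl_id; [lra | apply/andP; split; lra]].

(** * Paths and homotopies in coordinates *)

Section Homotopy.
Local Open Scope ring_scope.
Local Open Scope classical_set_scope.
Context (R : realType) (J : Type) (X : (J -> R) -> Prop).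

Definition cpath (f : R -> J -> R) := forall j, continuous (fun s => f s j).
Definition inX (f : R -> J -> R) := forall s, 0 <= s <= 1 -> X (f s).

(** Homotopy relative to the end points. Continuity is asked coordinatewise on the whole plane,
    which clamped parameters provide, and membership in [X] on the unit square only; no subspace
    topology occurs. *)
Definition ph (f g : R -> J -> R) := exists H : R -> R -> J -> R,
  [/\ forall j, continuous (fun u : R * R => H u.1 u.2 j),
      forall s t, 0 <= s <= 1 -> 0 <= t <= 1 -> X (H s t),
      forall s, 0 <= s <= 1 -> H s 0 = f s /\ H s 1 = g s &
      forall t, 0 <= t <= 1 -> H 0 t = f 0 /\ H 1 t = f 1].

Let i0 : 0 <= (0 : R) <= 1. Proof. by rewrite lexx ler01. Qed.
Let i1 : 0 <= (1 : R) <= 1. Proof. by rewrite lexx ler01. Qed.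

Lemma cont_path1 f (u : R * R -> R) j : cpath f -> continuous u -> continuous (fun v => f (u v) j).
Proof. by move=> cf cu; apply: (@contcomp R _ _ (fun s => f s j)). Qed.

Lemma cont_path2 (H : R -> R -> J -> R) (u v : R * R -> R) j :
  (forall j, continuous (fun u : R * R => H u.1 u.2 j)) -> continuous u -> continuous v ->
  continuous (fun w => H (u w) (v w) j).
Proof.
move=> cH cu cv; apply: (@contcomp R _ _ (fun u : R * R => H u.1 u.2 j) (fun w => (u w, v w))) => //.
exact: cont_pair.
Qed.

Lemma ph_ends f g : ph f g -> f 0 = g 0 /\ f 1 = g 1.
Proof.
case=> H [_ _ Hs Ht]; have [<- <-] := Ht 1 i1.
by have [_ <-] := Hs 0 i0; have [_ <-] := Hs 1 i1.
Qed.

Lemma ph_refl f : cpath f -> inX f -> ph f f.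
Proof.
move=> cf fX; exists (fun s _ => f s); split=> //; last by move=> s t /fX.
by move=> j; apply: cont_path1 => //; apply: cont_fst.
Qed.

Lemma ph_ext f f' g g' : (forall s, 0 <= s <= 1 -> f s = f' s) ->
  (forall s, 0 <= s <= 1 -> g s = g' s) -> ph f g -> ph f' g'.
Proof.
move=> Ef Eg [H [c1 c2 c3 c4]]; exists H; split=> // s Hs; first by rewrite -Ef // -Eg //; apply: c3.
by rewrite -!Ef //; apply: c4.
Qed.

Lemma ph_sym f g : ph f g -> ph g f.
Proof.
move=> fg; have [E0 E1] := ph_ends fg; case: fg => H [c1 c2 c3 c4].
exists (fun s t => H s (1 - t)); split.
- move=> j; apply: cont_path2 => //; first exact: cont_fst.
  by apply: contB; [exact: contc|exact: cont_snd].
- by move=> s t Hs /andP[t0 t1]; apply: c2 => //; apply/andP; split; lra.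
- by move=> s Hs; rewrite subr0 subrr; have [] := c3 s Hs.
- by move=> t /andP[t0 t1]; rewrite -E0 -E1; apply: c4; apply/andP; split; lra.
Qed.

Lemma ph_trans f g h : ph f g -> ph g h -> ph f h.
Proof.
move=> fg; have [E0 E1] := ph_ends fg; case: fg => H [c1 c2 c3 c4] [K [d1 d2 d3 d4]].
(* At every time one of the two summands is frozen at the common value [K s 0], which is subtracted;
   the glued map is continuous as a sum. *)
pose L s t j := H s (cl (2 * t)) j + K s (cl (2 * t - 1)) j - K s 0 j.
have cc : continuous (fun u : R * R => cl (2 * u.2)).
  apply: (@contcomp R _ _ (@cl R)); first exact: cont_cl.
  by apply: contM; [exact: contc|exact: cont_snd].
have cc' : continuous (fun u : R * R => cl (2 * u.2 - 1)).
  apply: (@contcomp R _ _ (@cl R)); first exact: cont_cl.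
  by apply: contB; [apply: contM; [exact: contc|exact: cont_snd]|exact: contc].
have L1 s t : 0 <= s <= 1 -> t <= 1 / 2 -> L s t = H s (cl (2 * t)).
  by move=> Hs Ht; apply/funext => j; rewrite /L [cl (2 * t - 1)]cl_le0 ?addrK //; lra.
have L2 s t : 0 <= s <= 1 -> 1 / 2 <= t -> L s t = K s (cl (2 * t - 1)).
  move=> Hs Ht; apply/funext => j; rewrite /L [cl (2 * t)]cl_ge1; last by lra.
  by have [_ ->] := c3 s Hs; have [-> _] := d3 s Hs; rewrite addrAC addrN add0r.
exists L; split.
- move=> j; apply: contB; last first.
    by apply: cont_path2 => //; [exact: cont_fst|exact: contc].
  by apply: contD; apply: cont_path2 => //; exact: cont_fst.
- move=> s t Hs Ht; have [t2|/ltW t2] := leP t (1 / 2).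
    by rewrite L1 //; apply: c2 => //; apply: cl_in.
  by rewrite L2 //; apply: d2 => //; apply: cl_in.
- move=> s Hs; have -> : L s 0 = H s 0 by rewrite L1 ?cl_le0 //; lra.
  have -> : L s 1 = K s 1 by rewrite L2 ?cl_ge1 //; lra.
  by have [-> _] := c3 s Hs; have [_ ->] := d3 s Hs.
- move=> t Ht; have [t2|/ltW t2] := leP t (1 / 2).
    by rewrite !L1 //; apply: c4; apply: cl_in.
  by rewrite !L2 // E0 E1; apply: d4; apply: cl_in.
Qed.

(** Concatenation as a sum: for paths that fit together, one of the clamped paths always rests at
    the junction, whose value is subtracted. *)
Definition pcat (f g : R -> J -> R) : R -> J -> R :=
  fun s j => f (cl (2 * s)) j + g (cl (2 * s - 1)) j - g 0 j.

Lemma pcat_l f g s : s <= 1 / 2 -> pcat f g s = f (cl (2 * s)).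
Proof. by move=> Hs; apply/funext => j; rewrite /pcat [cl (2 * s - 1)]cl_le0 ?addrK //; lra. Qed.

Lemma pcat_r f g s : f 1 = g 0 -> 1 / 2 <= s -> pcat f g s = g (cl (2 * s - 1)).
Proof.
move=> E Hs; apply/funext => j; rewrite /pcat [cl (2 * s)]cl_ge1; last by lra.
by rewrite E addrAC addrN add0r.
Qed.

Lemma cont_cl2 : continuous (fun s : R => cl (2 * s)).
Proof.
apply: (@contcomp R _ _ (@cl R)); first exact: cont_cl.
by apply: contM; [exact: contc|exact: cont_id].
Qed.

Lemma cont_cl2m : continuous (fun s : R => cl (2 * s - 1)).
Proof.
apply: (@contcomp R _ _ (@cl R)); first exact: cont_cl.
by apply: contB; [apply: contM; [exact: contc|exact: cont_id]|exact: contc].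
Qed.

Lemma cpath_comp f u : cpath f -> continuous u -> cpath (fun s => f (u s)).
Proof. by move=> cf cu j; apply: (@contcomp R _ _ (fun s => f s j)). Qed.

Lemma cpath_cat f g : cpath f -> cpath g -> cpath (pcat f g).
Proof.
move=> cf cg j; apply: contB; last exact: contc.
by apply: contD; [apply: (cpath_comp cf cont_cl2)|apply: (cpath_comp cg cont_cl2m)].
Qed.

Lemma inX_cat f g : f 1 = g 0 -> inX f -> inX g -> inX (pcat f g).
Proof.
move=> E fX gX s Hs; have [s2|/ltW s2] := leP s (1 / 2).
  by rewrite pcat_l //; apply: fX; apply: cl_in.
by rewrite pcat_r //; apply: gX; apply: cl_in.
Qed.

Lemma pcat0 f g : pcat f g 0 = f 0.
Proof. by rewrite pcat_l ?cl_le0 //; lra. Qed.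

Lemma pcat1 f g : f 1 = g 0 -> pcat f g 1 = g 1.
Proof. by move=> E; rewrite pcat_r ?cl_ge1 //; lra. Qed.

Lemma ph_cat f g f' g' : f 1 = g 0 -> ph f f' -> ph g g' -> ph (pcat f g) (pcat f' g').
Proof.
move=> E [H [c1 c2 c3 c4]] [K [d1 d2 d3 d4]].
pose L s t j := H (cl (2 * s)) t j + K (cl (2 * s - 1)) t j - K 0 t j.
have L1 s t : s <= 1 / 2 -> L s t = H (cl (2 * s)) t.
  by move=> Hs; apply/funext => j; rewrite /L [cl (2 * s - 1)]cl_le0 ?addrK //; lra.
have L2 s t : 0 <= t <= 1 -> 1 / 2 <= s -> L s t = K (cl (2 * s - 1)) t.
  move=> Ht Hs; apply/funext => j; rewrite /L [cl (2 * s)]cl_ge1; last by lra.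
  by have [_ ->] := c4 t Ht; have [-> _] := d4 t Ht; rewrite E addrAC addrN add0r.
have cf2 : continuous (fun u : R * R => cl (2 * u.1)).
  exact: (@contcomp R _ _ (fun s : R => cl (2 * s)) (fun u : R * R => u.1) cont_cl2 (@cont_fst R)).
have cg2 : continuous (fun u : R * R => cl (2 * u.1 - 1)).
  exact: (@contcomp R _ _ (fun s : R => cl (2 * s - 1)) (fun u : R * R => u.1) cont_cl2m (@cont_fst R)).
exists L; split.
- move=> j; apply: contB; first by apply: contD; apply: cont_path2 => //; exact: cont_snd.
  by apply: cont_path2 => //; [exact: contc|exact: cont_snd].
- move=> s t Hs Ht; have [s2|/ltW s2] := leP s (1 / 2).
    by rewrite L1 //; apply: c2 => //; apply: cl_in.
  by rewrite L2 //; apply: d2 => //; apply: cl_in.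
- move=> s Hs; rewrite /L /pcat; split; apply/funext => j.
    by rewrite !(proj1 (c3 _ (cl_in _))) !(proj1 (d3 _ (cl_in _))) (proj1 (d3 _ i0)).
  by rewrite !(proj2 (c3 _ (cl_in _))) !(proj2 (d3 _ (cl_in _))) (proj2 (d3 _ i0)).
- move=> t Ht; rewrite pcat0 pcat1 //.
  have -> : L 0 t = H 0 t by rewrite L1 ?cl_le0 //; lra.
  have -> : L 1 t = K 1 t by rewrite L2 ?cl_ge1 //; lra.
  by have [-> _] := c4 t Ht; have [_ ->] := d4 t Ht.
Qed.

(** Interpolating linearly between the two parameters never leaves the curve [F]. This serves
    associativity, constant pieces and subdivisions. *)
Lemma ph_sub (F : R -> J -> R) a b (u v : R -> R) : cpath F ->
  (forall s, a <= s <= b -> X (F s)) -> continuous u -> continuous v ->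
  (forall s, 0 <= s <= 1 -> a <= u s <= b) -> (forall s, 0 <= s <= 1 -> a <= v s <= b) ->
  u 0 = v 0 -> u 1 = v 1 -> ph (fun s => F (u s)) (fun s => F (v s)).
Proof.
move=> cF FX cu cv Hu Hv E0 E1.
exists (fun s t => F ((1 - t) * u s + t * v s)); split.
- have cus : continuous (fun w : R * R => u w.1) by apply: (@contcomp R _ _ u) => //; exact: cont_fst.
  have cvs : continuous (fun w : R * R => v w.1) by apply: (@contcomp R _ _ v) => //; exact: cont_fst.
  move=> j; apply: cont_path1 => //; apply: contD; apply: contM => //.
  + by apply: contB; [exact: contc|exact: cont_snd].
  + exact: cont_snd.
- move=> s t Hs /andP[t0 t1]; apply: FX; have /andP[u1 u2] := Hu s Hs; have /andP[v1 v2] := Hv s Hs.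
  have A x y : x <= y -> (1 - t) * x <= (1 - t) * y by move=> ?; apply: ler_wpM2l => //; lra.
  have B x y : x <= y -> t * x <= t * y by move=> ?; apply: ler_wpM2l.
  have := A _ _ u1; have := A _ _ u2; have := B _ _ v1; have := B _ _ v2.
  by move=> *; apply/andP; split; lra.
- by move=> s Hs; rewrite subr0 mul1r mul0r addr0 subrr mul0r mul1r add0r.
- by move=> t Ht; rewrite -E0 -E1 -!mulrDl subrK !mul1r.
Qed.

Lemma ph_convex f g : cpath f -> cpath g -> f 0 = g 0 -> f 1 = g 1 ->
  (forall s t, 0 <= s <= 1 -> 0 <= t <= 1 -> X (fun j => (1 - t) * f s j + t * g s j)) -> ph f g.
Proof.
move=> cf cg E0 E1 HX; exists (fun s t j => (1 - t) * f s j + t * g s j); split=> //.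
- move=> j; apply: contD; apply: contM.
  + by apply: contB; [exact: contc|exact: cont_snd].
  + by apply: cont_path1 => //; exact: cont_fst.
  + exact: cont_snd.
  + by apply: cont_path1 => //; exact: cont_fst.
- by move=> s Hs; split; apply/funext => j; rewrite ?subr0 ?subrr ?mul1r ?mul0r ?addr0 ?add0r.
- by move=> t Ht; rewrite -E0 -E1; split; apply/funext => j; rewrite -mulrDl subrK mul1r.
Qed.

Lemma ph_assoc f g h : cpath f -> cpath g -> cpath h -> inX f -> inX g -> inX h ->
  f 1 = g 0 -> g 1 = h 0 -> ph (pcat f (pcat g h)) (pcat (pcat f g) h).
Proof.
move=> cf cg ch fX gX hX E1 E2.
(* The three paths laid end to end over the interval from 0 to 3; [u] and [v] run through it at the
   speeds of the two bracketings. *)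
pose F (r : R) j := f (cl r) j + (g (cl (r - 1)) j - g 0 j) + (h (cl (r - 2)) j - h 0 j).
pose u (s : R) := cl (2 * s) + cl (4 * s - 2) + cl (4 * s - 3).
pose v (s : R) := cl (4 * s) + cl (4 * s - 1) + cl (2 * s - 1).
have F1 r : r <= 1 -> F r = f (cl r).
  move=> Hr; apply/funext => j; rewrite /F [cl (r - 1)]cl_le0 ?[cl (r - 2)]cl_le0 ?subrr ?addr0 //; lra.
have F2 r : 1 <= r <= 2 -> F r = g (cl (r - 1)).
  move=> /andP[r1 r2]; apply/funext => j; rewrite /F [cl r]cl_ge1 // [cl (r - 2)]cl_le0; last by lra.
  by rewrite E1 subrr addr0 addrC subrK.
have F3 r : 2 <= r -> F r = h (cl (r - 2)).
  move=> r2; apply/funext => j; rewrite /F [cl r]cl_ge1 ?[cl (r - 1)]cl_ge1; try lra.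
  by rewrite E1 E2 [g 0 j + _]addrC subrK [LHS]addrC subrK.
have claff (a b : R) : continuous (fun s : R => cl (a * s - b)).
  apply: (@contcomp R _ _ (@cl R)); first exact: cont_cl.
  by apply: contB; [apply: contM; [exact: contc|exact: cont_id]|exact: contc].
have claff0 (a : R) : continuous (fun s : R => cl (a * s)).
  apply: (@contcomp R _ _ (@cl R)); first exact: cont_cl.
  by apply: contM; [exact: contc|exact: cont_id].
have clsub (b : R) : continuous (fun s : R => cl (s - b)).
  apply: (@contcomp R _ _ (@cl R)); first exact: cont_cl.
  by apply: contB; [exact: cont_id|exact: contc].
have cF : cpath F.
  move=> j; apply: contD; [apply: contD; first exact: (cpath_comp cf (@cont_cl R))|];
    (apply: contB; last exact: contc).
  + exact: (cpath_comp cg (clsub _)).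
  + exact: (cpath_comp ch (clsub _)).
have FX s : 0 <= s <= 3 -> X (F s).
  move=> /andP[s0 s3]; have [H1|/ltW H1] := leP s 1; first by rewrite F1 //; apply: fX; exact: cl_in.
  have [H2|/ltW H2] := leP s 2; first by rewrite F2 ?H1 //; apply: gX; exact: cl_in.
  by rewrite F3 //; apply: hX; exact: cl_in.
have r3 (x y z : R) : 0 <= cl x + cl y + cl z <= 3.
  have /andP[? ?] := cl_in x; have /andP[? ?] := cl_in y; have /andP[? ?] := cl_in z.
  by apply/andP; split; lra.
have P : ph (fun s => F (u s)) (fun s => F (v s)).
  apply: (@ph_sub F 0 3) => //.
  + by apply: contD; [apply: contD|].
  + by apply: contD; [apply: contD|].
  + by move=> s _; apply: r3.
  + by move=> s _; apply: r3.
  + by rewrite /u /v; do !rewrite cl_le0; lra.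
  + by rewrite /u /v; do !rewrite cl_ge1; lra.
apply: ph_ext P => s /andP[s0 s1].
- have [H1|/ltW H1] := leP s (1 / 2).
    rewrite pcat_l // /u; have -> : cl (4 * s - 2) = 0 by clamp.
    have -> : cl (4 * s - 3) = 0 by clamp.
    have -> : cl (2 * s) = 2 * s by clamp.
    by rewrite F1; [congr f; clamp|lra].
  rewrite pcat_r ?pcat0 // /u; have -> : cl (2 * s) = 1 by clamp.
  have -> : cl (2 * s - 1) = 2 * s - 1 by clamp.
  have [H2|/ltW H2] := leP s (3 / 4).
    have -> : cl (4 * s - 3) = 0 by clamp.
    have -> : cl (4 * s - 2) = 4 * s - 2 by clamp.
    rewrite pcat_l; last by lra.
    by rewrite F2; [congr (g (cl _)); lra|apply/andP; split; lra].
  have -> : cl (4 * s - 2) = 1 by clamp.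
  have -> : cl (4 * s - 3) = 4 * s - 3 by clamp.
  rewrite pcat_r //; last by lra.
  by rewrite F3; [congr (h (cl _)); lra|lra].
- have [H1|/ltW H1] := leP s (1 / 2).
    rewrite [RHS]pcat_l // /v; have -> : cl (2 * s - 1) = 0 by clamp.
    have -> : cl (2 * s) = 2 * s by clamp.
    have [H2|/ltW H2] := leP s (1 / 4).
      have -> : cl (4 * s) = 4 * s by clamp.
      have -> : cl (4 * s - 1) = 0 by clamp.
      rewrite pcat_l; last by lra.
      by rewrite F1; [congr (f (cl _)); lra|lra].
    have -> : cl (4 * s) = 1 by clamp.
    have -> : cl (4 * s - 1) = 4 * s - 1 by clamp.
    rewrite pcat_r //; last by lra.
    by rewrite F2; [congr (g (cl _)); lra|apply/andP; split; lra].
  rewrite [RHS]pcat_r ?pcat1 // /v; have -> : cl (4 * s) = 1 by clamp.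
  have -> : cl (4 * s - 1) = 1 by clamp.
  have -> : cl (2 * s - 1) = 2 * s - 1 by clamp.
  by rewrite F3; [congr h; clamp|lra].
Qed.

End Homotopy.

(** * Polygonal paths, and words of continuous paths of configurations *)

Section ConfPaths.
Local Open Scope ring_scope.
Local Open Scope classical_set_scope.
Context (R : realType) (k : nat).
Local Notation cfg := (cfg R).
Local Notation conf := (@conf R k).
Local Notation star := (@star R k).
Local Notation ph := (ph conf).

Definition seg (x y : cfg) : R -> cfg := fun s j => (1 - s) * x j + s * y j.

Fixpoint poly (x : cfg) (l : seq cfg) : R -> cfg :=
  if l is y :: l' then pcat (seg x y) (poly y l') else fun _ => x.

Lemma cpath_seg x y : cpath (seg x y).
Proof.
move=> j; apply: contD; apply: contM; [|exact: contc|exact: cont_id|exact: contc].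
by apply: contB; [exact: contc|exact: cont_id].
Qed.

Lemma seg0 x y : seg x y 0 = x.
Proof. by apply/funext => j; rewrite /seg subr0 mul1r mul0r addr0. Qed.

Lemma seg1 x y : seg x y 1 = y.
Proof. by apply/funext => j; rewrite /seg subrr mul0r mul1r add0r. Qed.

Lemma segxx x : seg x x = fun _ => x.
Proof. by apply/funext => s; apply/funext => j; rewrite /seg -mulrDl subrK mul1r. Qed.

Lemma inX_seg x y : linked k x y -> inX conf (seg x y).
Proof. by move=> [c [cc Vx Vy]] s Hs; apply: (star_conf cc); apply: star_convex. Qed.

Lemma poly0 x l : poly x l 0 = x.
Proof. by case: l => //= y l; rewrite pcat0 seg0. Qed.

Lemma cpath_poly x l : cpath (poly x l).
Proof.
elim: l x => [|y l IH] x /=; first by move=> j; apply: contc.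
exact: cpath_cat (@cpath_seg x y) (IH y).
Qed.

Lemma inX_poly x l : chain k x l -> inX conf (poly x l).
Proof.
elim: l x => [|y l IH] x /=; first by move=> cx s _.
by move=> [xy ch]; apply: inX_cat; [rewrite seg1 poly0|exact: inX_seg|exact: IH].
Qed.

(** Skipping a vertex: reassociate, then contract the triangle, which lies in a convex star.
    Dropping a repetition: reparametrise a constant segment away. *)
Lemma dh_ph x l l' : dh k x l l' -> chain k x l -> ph (poly x l) (poly x l').
Proof.
elim=> {x l l'}.
- move=> c x y z l cc Vx Vy Vz /= [xy [yz ch]].
  have xz : linked k x z by exists c.
  have E1 : seg x y 1 = seg y z 0 by rewrite seg1 seg0.
  have E2 : seg y z 1 = poly z l 0 by rewrite seg1 poly0.
  apply: ph_trans (ph_assoc _ _ _ _ _ _ E1 E2) _; try exact: cpath_seg; try exact: inX_seg.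
  + exact: cpath_poly.
  + exact: inX_poly.
  apply: ph_cat; first by rewrite (pcat1 E1) seg1 poly0.
    apply: ph_convex; [exact/cpath_cat/cpath_seg/cpath_seg|exact: cpath_seg| | |].
    + by rewrite pcat0 !seg0.
    + by rewrite (pcat1 E1) !seg1.
    move=> s t Hs Ht; apply: (star_conf cc); apply: star_convex => //; last exact: star_convex.
    have [s2|/ltW s2] := leP s (1 / 2); first by rewrite pcat_l //; apply: star_convex (cl_in _).
    by rewrite pcat_r //; apply: star_convex (cl_in _).
  by apply: ph_refl; [exact: cpath_poly|exact: inX_poly].
- move=> x l /= [_ ch]; rewrite segxx; have px := poly0 x l.
  have H : ph (fun s => poly x l (cl (2 * s - 1))) (fun s => poly x l s).
    apply: (@ph_sub _ _ _ _ 0 1 (fun s => cl (2 * s - 1)) (fun s => s)) => //.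
    + exact: cpath_poly.
    + exact: inX_poly.
    + exact: cont_cl2m.
    + exact: cont_id.
    + by move=> s _; apply: cl_in.
    + by rewrite cl_le0 //; lra.
    + by rewrite cl_ge1 //; lra.
  apply: ph_ext H => // s Hs; apply/funext => j; rewrite /pcat px.
  by rewrite addrAC subrr add0r.
- move=> x y l l' D IH /= [xy ch]; apply: ph_cat; first by rewrite seg1 poly0.
    by apply: ph_refl; [exact: cpath_seg|exact: inX_seg].
  exact: IH.
- by move=> x l ch; apply: ph_refl; [exact: cpath_poly|exact: inX_poly].
- by move=> x l l' D IH ch; apply/ph_sym/IH/(dh_chain D).
- move=> x l1 l2 l3 D1 IH1 D2 IH2 ch; apply: ph_trans (IH1 ch) _.
  by apply: IH2; apply/(dh_chain D1).
Qed.

(** Each piece of the path lies in a star together with its chord and is straightened there; pieces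
    are split off one at a time. *)
Lemma ph_poly (t : nat -> R) (F : R -> cfg) m : cpath F -> (forall i, t i <= t i.+1) ->
  conf (F (t 0%N)) ->
  (forall i, (i < m)%N -> exists2 c, conf c & forall s, t i <= s <= t i.+1 -> star c (F s)) ->
  ph (fun s => F ((1 - s) * t 0%N + s * t m)) (poly (F (t 0%N)) [seq F (t i.+1) | i <- iota 0 m]).
Proof.
move=> cF; elim: m t => [|m IH] t tm c0 Hm.
  apply: (@ph_ext _ _ _ (fun _ => F (t 0%N)) _ (fun _ => F (t 0%N))) => //.
    by move=> s _; rewrite -mulrDl subrK mul1r.
  by apply: ph_refl => [j|s _] //; apply: contc.
have mono a b : (a <= b)%N -> t a <= t b.
  by move=> /subnK <-; elim: (b - a)%N => [|d IHd] //; rewrite addSn; apply: le_trans IHd (tm _).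
have inconf s : t 0%N <= s <= t m.+1 -> conf (F s).
  move=> /andP[s0 s1]; suff : exists2 i, (i < m.+1)%N & t i <= s <= t i.+1.
    by case=> i /Hm[c cc Hc] /Hc; apply: star_conf.
  elim: (m) s1 => [|d IHd] s1; first by exists 0%N; rewrite ?s0.
  have [/IHd[i Hi Hs]|H] := leP s (t d.+1); first by exists i => //; apply: ltnW.
  by exists d.+1; rewrite ?(ltW H).
(* The first interval is run through in the first half of the time and all the rest in the second,
   which is the timing of [poly]. *)
pose w (s : R) := t 0%N + (t 1%N - t 0%N) * cl (2 * s) + (t m.+1 - t 1%N) * cl (2 * s - 1).
have t01 := tm 0%N; have t1m : t 1%N <= t m.+1 by apply: mono.
have E0 : (fun s => F ((1 - s) * t 0%N + s * t 1%N)) 1 = (fun s => F ((1 - s) * t 1%N + s * t m.+1)) 0.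
  by rewrite /= subrr subr0 !mul0r !mul1r add0r addr0.
have caff (a b : R) : continuous (fun s : R => (1 - s) * a + s * b).
  apply: contD; apply: contM; [|exact: contc|exact: cont_id|exact: contc].
  by apply: contB; [exact: contc|exact: cont_id].
have H1 : ph (fun s => F ((1 - s) * t 0%N + s * t m.+1)) (fun s => F (w s)).
  apply: (@ph_sub _ _ _ F (t 0%N) (t m.+1) (fun s => (1 - s) * t 0%N + s * t m.+1) w) => //.
  + apply: contD; first (apply: contD; first exact: contc); apply: contM;
      by [exact: contc|exact: cont_cl2|exact: cont_cl2m].
  + move=> s /andP[s0 s1]; have : 0 <= s * (t m.+1 - t 0%N) by apply: mulr_ge0; lra.
    have : 0 <= (1 - s) * (t m.+1 - t 0%N) by apply: mulr_ge0; lra.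
    by move=> *; apply/andP; split; lra.
  + move=> s _; rewrite /w; have /andP[a0 a1] := cl_in (2 * s); have /andP[b0 b1] := cl_in (2 * s - 1).
    have : 0 <= (t 1%N - t 0%N) * cl (2 * s) by apply: mulr_ge0; lra.
    have : 0 <= (t m.+1 - t 1%N) * cl (2 * s - 1) by apply: mulr_ge0; lra.
    have : 0 <= (t 1%N - t 0%N) * (1 - cl (2 * s)) by apply: mulr_ge0; lra.
    have : 0 <= (t m.+1 - t 1%N) * (1 - cl (2 * s - 1)) by apply: mulr_ge0; lra.
    by move=> *; apply/andP; split; lra.
  + by rewrite /w [cl (2 * 0)]cl_le0 ?[cl (2 * 0 - 1)]cl_le0; lra.
  + by rewrite /w [cl (2 * 1)]cl_ge1 ?[cl (2 * 1 - 1)]cl_ge1; lra.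
apply: ph_trans H1 _.
apply: (@ph_ext _ _ _ (pcat (fun s => F ((1 - s) * t 0%N + s * t 1%N)) (fun s => F ((1 - s) * t 1%N + s * t m.+1))) _
   (pcat (seg (F (t 0%N)) (F (t 1%N))) (poly (F (t 1%N)) [seq F (t i.+2) | i <- iota 0 m]))).
- move=> s Hs; have [s2|/ltW s2] := leP s (1 / 2).
    by rewrite pcat_l // /w [cl (2 * s - 1)]cl_le0; [congr F; lra|lra].
  by rewrite pcat_r // /w [cl (2 * s)]cl_ge1; [congr F; lra|lra].
- move=> s Hs /=; congr (pcat _ (poly _ _) _).
  by rewrite -[1%N]addn0 iotaDl -map_comp; apply: eq_map => i.
apply: ph_cat => //.
  have [c cc Hc] := Hm 0%N isT.
  have Hr s : 0 <= s <= 1 -> star c (F ((1 - s) * t 0%N + s * t 1%N)).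
    move=> /andP[s0 s1]; apply: Hc.
    have : 0 <= s * (t 1%N - t 0%N) by apply: mulr_ge0; lra.
    have : 0 <= (1 - s) * (t 1%N - t 0%N) by apply: mulr_ge0; lra.
    by move=> *; apply/andP; split; lra.
  have F0 : star c (F (t 0%N)) by apply: Hc; rewrite lexx.
  have F1 : star c (F (t 1%N)) by apply: Hc; rewrite lexx andbT.
  apply: ph_convex.
  + exact: (cpath_comp cF (caff _ _)).
  + exact: cpath_seg.
  + by rewrite seg0 subr0 mul1r mul0r addr0.
  + by rewrite seg1 subrr mul1r mul0r add0r.
  + by move=> s s' Hs Hs'; apply: (star_conf cc); apply: star_convex => //; [exact: Hr|exact: star_convex].
apply: (IH (fun i => t i.+1)) => // [|i Hi]; last exact: Hm.
by apply: inconf; rewrite t01 t1m.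
Qed.

Definition tm (M i : nat) : R := i%:R / M%:R.

Definition fine M (f : R -> cfg) := forall i, (i < M)%N ->
  exists2 c, conf c & forall s, tm M i <= s <= tm M i.+1 -> star c (f s).

Lemma tm0 M : tm M 0 = 0. Proof. by rewrite /tm mul0r. Qed.
Lemma tmM M : (0 < M)%N -> tm M M = 1.
Proof. by move=> M0; rewrite /tm divff // pnatr_eq0 -lt0n. Qed.

Lemma tm_le M i j : (i <= j)%N -> tm M i <= tm M j.
Proof. by move=> ij; rewrite /tm ler_wpM2r ?invr_ge0 ?ler_nat. Qed.

Lemma tm_mul M K i : (0 < K)%N -> tm (M * K) (i * K) = tm M i.
Proof. by move=> K0; rewrite /tm !natrM -mulf_div divff ?mulr1 // pnatr_eq0 -lt0n. Qed.

Lemma fine_linked M f i : fine M f -> (i < M)%N -> linked k (f (tm M i)) (f (tm M i.+1)).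
Proof.
move=> Hf Hi; have [c cc Hc] := Hf i Hi; exists c; split=> //; apply: Hc; rewrite ?lexx ?andbT //; exact: tm_le.
Qed.

Lemma ph_dw M f : (0 < M)%N -> cpath f -> fine M f ->
  ph f (poly (f 0) [seq f (tm M i.+1) | i <- iota 0 M]).
Proof.
move=> M0 cf Hf; have := @ph_poly (tm M) f M cf _ _ Hf; rewrite tm0 tmM // => H.
apply: (@ph_ext _ _ _ (fun s => f ((1 - s) * 0 + s * 1)) _ (poly (f 0) [seq f (tm M i.+1) | i <- iota 0 M])) => //.
  by move=> s _; rewrite mulr0 add0r mulr1.
apply: H => [i|]; first exact: tm_le.
by have [c cc Hc] := Hf 0%N M0; apply: (star_conf cc); apply: Hc; rewrite tm0 lexx; have := @tm_le M 0 1 isT; rewrite tm0.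
Qed.

(** Both paths are straightened to polygons along their subdivisions, and equal braids make these
    polygons discretely homotopic. *)
Lemma ph_faithful M M' f g : (0 < M)%N -> (0 < M')%N -> cpath f -> cpath g ->
  fine M f -> fine M' g -> f 0 = g 0 -> f 1 = g 1 ->
  breq k (dw k (fun i => f (tm M i)) M) (dw k (fun i => g (tm M' i)) M') -> ph f g.
Proof.
move=> M0 M0' cf cg ff fg E0 E1; rewrite !dw_dword !tm0 => H.
have cnf (m : nat) (F : R -> cfg) : (0 < m)%N -> fine m F -> conf (F (tm m 0)).
  move=> m0 fF; have [c cc Hc] := fF 0%N m0; apply: (star_conf cc); apply: Hc.
  by rewrite lexx tm_le.
have lastE (m : nat) (F : R -> cfg) : (0 < m)%N -> last (F 0) [seq F (tm m i.+1) | i <- iota 0 m] = F 1.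
  case: m => // m _; have -> : iota 0 m.+1 = rcons (iota 0 m) m by rewrite -addn1 iotaD cats1.
  by rewrite map_rcons last_rcons tmM.
have chf := dw_chain (cnf _ _ M0 ff) (fun i => fine_linked ff (i := i)).
have chg := dw_chain (cnf _ _ M0' fg) (fun i => fine_linked fg (i := i)).
rewrite /= !tm0 in chf chg.
apply: ph_trans (ph_dw M0 cf ff) _; apply: ph_trans _ (ph_sym (ph_dw M0' cg fg)).
rewrite -E0 in H chg *; apply: dh_ph => //; apply: dh_faithful => //.
by rewrite lastE // E1 -(lastE M' g M0') E0.
Qed.

(** Whereas [poly] halves the remaining time at every vertex, this polygon reaches its vertices at
    equidistant times, so the subdivision [tm] reads off its word. *)
Definition upoly (x : cfg) (l : seq cfg) (s : R) : cfg := fun j =>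
  x j + \sum_(i < size l) cl ((size l)%:R * s - i%:R) * (nth x l i j - nth x (x :: l) i j).

Lemma cpath_upoly x l : cpath (upoly x l).
Proof.
move=> j; apply: contD; first exact: contc.
apply: (@contsum R R (fun (i : nat) (s : R) => cl ((size l)%:R * s - i%:R) * (nth x l i j - nth x (x :: l) i j)) (size l)) => i.
apply: contM; last exact: contc.
apply: (@contcomp R _ _ (@cl R)); first exact: cont_cl.
by apply: contB; [apply: contM; [exact: contc|exact: cont_id]|exact: contc].
Qed.

Lemma upoly_seg x l i s : (i < size l)%N -> tm (size l) i <= s <= tm (size l) i.+1 ->
  upoly x l s = seg (nth x (x :: l) i) (nth x l i) ((size l)%:R * s - i%:R).
Proof.
move=> Hi; set M := size l; have M0 : 0 < M%:R :> R by rewrite ltr0n; lia.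
rewrite /tm ler_pdivrMr // ler_pdivlMr // => /andP[s0 s1].
have s0' : 0 <= M%:R * s - i%:R by lra.
have s1' : M%:R * s - i%:R <= 1 by move: s1; rewrite -natr1; lra.
apply/funext => j; rewrite /upoly -/M.
(* Edges already finished have clamp 1 and telescope to the current vertex; those still to come,
   treated in [post], have clamp 0. *)
have pre m : (m <= i)%N -> x j + \sum_(i < m) cl (M%:R * s - i%:R) * (nth x l i j - nth x (x :: l) i j)
    = nth x (x :: l) m j.
  elim: m => [|m IH] Hm; first by rewrite big_ord0 addr0.
  rewrite big_ord_recr /= addrA IH; last by lia.
  rewrite cl_ge1; first by rewrite mul1r addrC subrK.
  by have H : (m.+1%:R : R) <= i%:R by [rewrite ler_nat]; move: H; rewrite -natr1; lra.
have post m : (i < m)%N -> x j + \sum_(i < m) cl (M%:R * s - i%:R) * (nth x l i j - nth x (x :: l) i j)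
    = seg (nth x (x :: l) i) (nth x l i) (M%:R * s - i%:R) j.
  elim: m => // m IH; rewrite ltnS leq_eqVlt => /orP[/eqP <-|im].
    rewrite big_ord_recr /= addrA pre // cl_id ?s0' // /seg; lra.
  rewrite big_ord_recr /= addrA IH // cl_le0 ?mul0r ?addr0 //.
  by have H : (i.+1%:R : R) <= m%:R by [rewrite ler_nat]; move: H; rewrite -natr1; lra.
exact: post.
Qed.

Lemma upoly_tm x l i : (i <= size l)%N -> upoly x l (tm (size l) i) = nth x (x :: l) i.
Proof.
case: l => [|y l].
  by rewrite leqn0 => /eqP->; apply/funext => j; rewrite /upoly big_ord0 addr0.
set l' := y :: l; have M0 : (size l')%:R != 0 :> R by rewrite pnatr_eq0.
rewrite leq_eqVlt => /orP[/eqP ->|Hi].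
  rewrite (@upoly_seg x l' (size l)) ?lexx ?andbT ?tm_le //.
  by rewrite /tm mulrA [_ * (size l').-1.+1%:R]mulrC mulfK //= -natr1 addrC addKr seg1.
rewrite (@upoly_seg x l' i) ?lexx ?tm_le // /tm mulrA [(size l')%:R * _]mulrC mulfK //.
by rewrite subrr seg0.
Qed.

Lemma chain_linked (x : cfg) l i : chain k x l -> (i < size l)%N -> linked k (nth x (x :: l) i) (nth x l i).
Proof.
elim: l x i => [|y l IH] x [|i] //= [xy ch] Hi //.
have := IH y i ch Hi; rewrite (@set_nth_default _ (y :: l) x y i) ?(@set_nth_default _ l x y i) //=.
exact: ltnW.
Qed.

Lemma fine_upoly x l : chain k x l -> fine (size l) (upoly x l).
Proof.
move=> ch i Hi; have [c [cc V1 V2]] := chain_linked ch Hi; exists c => // s Hs.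
rewrite (upoly_seg x Hi Hs); apply: star_convex => //; move: Hs.
have M0 : 0 < (size l)%:R :> R by rewrite ltr0n; lia.
rewrite /tm ler_pdivrMr // ler_pdivlMr // -natr1 => /andP[s0 s1].
by apply/andP; split; lra.
Qed.

Lemma dw_upoly x l : dw k (fun i => upoly x l (tm (size l) i)) (size l) = dword k x l.
Proof.
rewrite dw_dword upoly_tm //; congr dword; apply: (@eq_from_nth _ x).
  by rewrite size_map size_iota.
by move=> i; rewrite size_map size_iota => Hi; rewrite (nth_map 0%N) ?size_iota // nth_iota // upoly_tm.
Qed.

Lemma hol_refine M K f : (0 < K)%N -> fine M f ->
  breq k (dw k (fun i => f (tm (M * K) i)) (M * K)) (dw k (fun i => f (tm M i)) M).
Proof.
move=> K0 Hf; rewrite dw_refine.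
  by rewrite (_ : (fun i => _) = (fun i => f (tm M i))); [exact: breq_refl|apply/funext => i; rewrite tm_mul].
move=> i Hi; have [c cc Hc] := Hf i Hi; exists c => // r Hr; apply: Hc.
rewrite -!(@tm_mul M K) // !tm_le ?leq_addr //=.
by rewrite mulSn addnC leq_add2r.
Qed.

(** Both words agree with the word of the common refinement into [M * M'] pieces. *)
Lemma hol_unique M M' f : (0 < M)%N -> (0 < M')%N -> fine M f -> fine M' f ->
  breq k (dw k (fun i => f (tm M i)) M) (dw k (fun i => f (tm M' i)) M').
Proof.
move=> M0 M0' H H'; rewrite -(hol_refine M0' H) -(hol_refine M0 H') mulnC.
exact: breq_refl.
Qed.

End ConfPaths.

(** * Auxiliary facts on sequences *)

Section SeqExtra.
Local Open Scope nat_scope.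

Lemma perm_Permutation (T : eqType) (U : Type) (f : T -> U) s t : perm_eq s t ->
  Permutation.Permutation (map f s) (map f t).
Proof.
elim: s t => [|x s IH] t H.
  by move: H; rewrite perm_sym => /perm_size/size0nil->; apply: Permutation.perm_nil.
have xt : x \in t by rewrite -(perm_mem H) mem_head.
case: (splitPr xt) H => t1 t2 H.
have /IH : perm_eq s (t1 ++ t2).
  by rewrite -(perm_cons x); apply: perm_trans H _; rewrite perm_catC /= perm_cons perm_catC.
rewrite !map_cat /= => H'; apply: Permutation.Permutation_cons_app; exact: H'.
Qed.

Lemma Forall2_nth (T U : Type) (P : T -> U -> Prop) (x0 : T) (y0 : U) s t :
  List.Forall2 P s t <-> size s = size t /\ (forall i, i < size s -> P (nth x0 s i) (nth y0 t i)).
Proof.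
split=> [|[]].
  elim=> [|x y {}s {}t Pxy _ [Hs H]]; first by [].
  by split=> [|[|i] Hi] /=; rewrite ?Hs //; apply: H.
elim: s t => [|x s IH] [|y t] //= [Hs] H.
by apply: List.Forall2_cons; [exact: (H 0)|apply: IH => // i Hi; exact: (H i.+1)].
Qed.

Lemma find_nth (T : Type) (x0 : T) (P : pred T) s i : i < size s -> P (nth x0 s i) ->
  (forall j, j < i -> ~~ P (nth x0 s j)) -> find P s = i.
Proof.
elim: s i => //= x s IH [|i] Hi Hp Hj; first by rewrite Hp.
by rewrite (negbTE (Hj 0 isT)) (IH i) // => j ji; apply: (Hj j.+1).
Qed.

End SeqExtra.

(** * The planar fission tree and cabled families of node words *)

Section Tree.
Local Open Scope nat_scope.
Context (R : realType) (n p : nat) (A : 'M[R[i]]_(p, n)).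
Variable ord : nat -> {set 'I_n} -> seq {set 'I_n}.
Hypothesis n0 : 0 < n.
Hypothesis Hv : valid_ord A ord.
Hypothesis Hc : compatible_ord p ord.

Local Notation sim := (sim A).
Local Notation part := (is_part A).
Local Notation lev l := (1 <= l <= p.+1).
Local Notation fset0 := (@finset.set0 'I_n).

Lemma sim_refl l a : sim l a a.
Proof. by apply/forallP => j; rewrite eqxx implybT. Qed.

Lemma sim_sym l a b : sim l a b = sim l b a.
Proof. by apply: eq_forallb => j; rewrite eq_sym. Qed.

Lemma sim_trans l a b c : sim l a b -> sim l b c -> sim l a c.
Proof.
move=> /forallP H1 /forallP H2; apply/forallP => j; apply/implyP => lj.
by rewrite (eqP (implyP (H1 j) lj)) (eqP (implyP (H2 j) lj)).
Qed.

Lemma sim_mono l l' a b : l <= l' -> sim l a b -> sim l' a b.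
Proof.
by move=> ll' /forallP H; apply/forallP => j; apply/implyP => lj; apply: (implyP (H j)); apply: leq_trans lj.
Qed.

Lemma sim_top a b : sim p.+1 a b.
Proof. by apply/forallP => j; apply/implyP; rewrite ltnS leqNgt ltn_ord. Qed.

Definition cls l a : {set 'I_n} := [set b | sim l a b]%SET.

Lemma cls_id l a : a \in cls l a. Proof. by rewrite inE sim_refl. Qed.

Lemma cls_eq l a b : sim l a b -> cls l a = cls l b.
Proof.
move=> ab; apply/setP => c; rewrite !inE; apply/idP/idP; last exact: sim_trans.
by apply: sim_trans; rewrite sim_sym.
Qed.

Lemma part_cls l a : part l (cls l a). Proof. by apply/existsP; exists a. Qed.

Lemma partE l L a : part l L -> a \in L -> L = cls l a.
Proof. by case/existsP => b /eqP-> ; rewrite inE => /cls_eq. Qed.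

Lemma part_ex l L : part l L -> exists2 a, a \in L & L = cls l a.
Proof. by case/existsP => a /eqP E; exists a; rewrite E ?cls_id. Qed.

Lemma part_eq l L L' a : part l L -> part l L' -> a \in L -> a \in L' -> L = L'.
Proof. by move=> pL pL' aL aL'; rewrite (partE pL aL) -(partE pL' aL'). Qed.

Lemma cls_sub l l' a b : l <= l' -> sim l' a b -> (cls l b \subset cls l' a)%SET.
Proof.
move=> ll' ab; apply/fintype.subsetP => c; rewrite !inE => /(sim_mono ll'); exact: sim_trans.
Qed.

Lemma part_top : part p.+1 [set: 'I_n]%SET.
Proof.
apply/existsP; exists (Ordinal n0); apply/eqP/setP => b; rewrite !inE; apply/esym; exact: sim_top.
Qed.

Lemma ord_uniq l L : 1 < l <= p.+1 -> part l L -> uniq (ord l L).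
Proof. by move=> Hl pL; case: (Hv Hl pL). Qed.

Lemma ord_mem l L C : 1 < l <= p.+1 -> part l L ->
  (C \in ord l L) = part l.-1 C && (C \subset L)%SET.
Proof. by move=> Hl pL; case: (Hv Hl pL). Qed.

Lemma cls_ord l L a : 1 < l <= p.+1 -> part l L -> a \in L -> cls l.-1 a \in ord l L.
Proof.
move=> Hl pL aL; rewrite ord_mem // part_cls (partE pL aL) cls_sub ?sim_refl //; lia.
Qed.

Lemma ord_part l L C : 1 < l <= p.+1 -> part l L -> C \in ord l L -> part l.-1 C.
Proof. by move=> Hl pL; rewrite ord_mem // => /andP[]. Qed.

Lemma ord_sub l L C : 1 < l <= p.+1 -> part l L -> C \in ord l L -> (C \subset L)%SET.
Proof. by move=> Hl pL; rewrite ord_mem // => /andP[]. Qed.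

Lemma ord_pos l L : 1 < l <= p.+1 -> part l L -> 0 < size (ord l L).
Proof.
move=> Hl pL; have [a aL _] := part_ex pL; have := cls_ord Hl pL aL.
by case: (ord l L).
Qed.

Lemma ord_disj l L i j : 1 < l <= p.+1 -> part l L -> i < size (ord l L) -> j < size (ord l L) ->
  forall a, a \in nth fset0 (ord l L) i -> a \in nth fset0 (ord l L) j -> i = j.
Proof.
move=> Hl pL Hi Hj a ai aj; apply/eqP; rewrite -(nth_uniq fset0 Hi Hj (ord_uniq Hl pL)); apply/eqP.
by apply: part_eq ai aj; apply: ord_part (mem_nth _ _).
Qed.

Lemma buildE l L : 1 < l -> build ord l L = PNode #|L| (map (build ord l.-1) (ord l L)).
Proof. by case: l => [|[|l]]. Qed.

Lemma build1 L : build ord 1 L = PNode #|L| [::]. Proof. by []. Qed.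

Fixpoint leaves l (L : {set 'I_n}) : seq {set 'I_n} :=
  match l with
  | 0 => [:: L]
  | l'.+1 => if l' is 0 then [:: L] else flatten (map (leaves l') (ord l L))
  end.

Lemma leavesE l L : 1 < l -> leaves l L = flatten (map (leaves l.-1) (ord l L)).
Proof. by case: l => [|[|l]]. Qed.

(** The element of CBr with one prescribed word at every inner node; [be] is never read at leaves.
    By [cbr_fam] all elements arise in this way, which allows arguments node by node. *)
Fixpoint asm (be : nat -> {set 'I_n} -> bword) l (L : {set 'I_n}) : bword :=
  match l with
  | 0 => [::]
  | l'.+1 => if l' is 0 then [::] else
      gammaB (map (fun C => nleaves (build ord l' C)) (ord l L)) (be l L)
             (map (asm be l') (ord l L))
  end.

Lemma asmE be l L : 1 < l -> asm be l L =
  gammaB (map (fun C => nleaves (build ord l.-1 C)) (ord l L)) (be l L)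
    (map (asm be l.-1) (ord l L)).
Proof. by case: l => [|[|l]]. Qed.

Lemma lev_ind (P : nat -> {set 'I_n} -> Prop) :
  (forall L, part 1 L -> P 1 L) ->
  (forall l L, 1 < l <= p.+1 -> part l L -> (forall C, C \in ord l L -> P l.-1 C) -> P l L) ->
  forall l L, lev l -> part l L -> P l L.
Proof.
move=> H1 H2; elim=> // -[|l] IH L Hl pL; first exact: H1.
by apply: H2 => // C CL; apply: IH => //; [lia|apply: ord_part CL].
Qed.

Lemma nleavesE l L : 1 < l <= p.+1 -> part l L ->
  nleaves (build ord l L) = sumn (map (fun C => nleaves (build ord l.-1 C)) (ord l L)).
Proof.
move=> Hl pL; rewrite buildE //=; last by lia.
by have := ord_pos Hl pL; case E : (ord l L) => //= _; rewrite -map_comp.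
Qed.

Lemma size_leaves l L : lev l -> part l L -> size (leaves l L) = nleaves (build ord l L).
Proof.
move: l L; apply: lev_ind => // l L Hl pL IH; rewrite leavesE ?nleavesE //; last by lia.
rewrite size_flatten /shape -map_comp; congr sumn; apply/eq_in_map => C CL; exact: IH.
Qed.

Lemma nleaves_pos l L : lev l -> part l L -> 0 < nleaves (build ord l L).
Proof.
move: l L; apply: lev_ind => // l L Hl pL IH; rewrite nleavesE //.
have := ord_pos Hl pL; case E : (ord l L) => [|C s] //= _.
by apply: leq_trans (IH C _) (leq_addr _ _); rewrite E mem_head.
Qed.

Lemma mem_leaves l L C : lev l -> part l L -> (C \in leaves l L) = part 1 C && (C \subset L)%SET.
Proof.
move=> Hl pL; move: l L Hl pL C; apply: lev_ind => [L pL C|l L Hl pL IH C].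
  rewrite /= inE; apply/eqP/andP=> [->|[pC /fintype.subsetP CL]]; first by rewrite pL.
  have [a aC _] := part_ex pC; exact: part_eq pC pL aC (CL a aC).
rewrite leavesE; last by lia.
apply/flatten_mapP/andP=> [[D DL]|[pC CL]].
  by rewrite IH // => /andP[-> CD]; split=> //; apply: fintype.subset_trans CD (ord_sub Hl pL DL).
have [a aC E] := part_ex pC; exists (cls l.-1 a); first exact: cls_ord Hl pL (fintype.subsetP CL a aC).
by rewrite IH ?pC ?E ?cls_sub ?sim_refl //; [lia|exact: cls_ord Hl pL (fintype.subsetP CL a aC)].
Qed.

Definition wfam (be : nat -> {set 'I_n} -> bword) l (L : {set 'I_n}) :=
  forall l1 L1, 1 < l1 <= l -> part l1 L1 -> (L1 \subset L)%SET ->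
    wf_word (size (ord l1 L1)) (be l1 L1).

Lemma wfam_child be l L C : 1 < l <= p.+1 -> part l L -> C \in ord l L -> wfam be l L -> wfam be l.-1 C.
Proof.
move=> Hl pL CL H l1 L1 Hl1 p1 L1C; apply: H => //; first by lia.
exact: fintype.subset_trans L1C (ord_sub Hl pL CL).
Qed.

Lemma wf_blocks_asm be l L : 1 < l <= p.+1 -> part l L ->
  (forall C, C \in ord l L -> wf_word (nleaves (build ord l.-1 C)) (asm be l.-1 C)) ->
  wf_blocks (map (fun C => nleaves (build ord l.-1 C)) (ord l L)) (map (asm be l.-1) (ord l L)).
Proof.
move=> Hl pL H; split; rewrite !size_map // => i Hi.
by rewrite !(nth_map fset0) //; apply: H; apply: mem_nth.
Qed.

Lemma wf_asm be l L : lev l -> part l L -> wfam be l L ->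
  wf_word (nleaves (build ord l L)) (asm be l L).
Proof.
move: l L; apply: lev_ind => // l L Hl pL IH Hw; rewrite nleavesE // asmE; last by lia.
apply: wf_gammaB; last by rewrite size_map; apply: Hw => //; lia.
by apply: wf_blocks_asm => // C CL; apply: IH => //; apply: wfam_child Hw.
Qed.

Lemma asm_ext be be' l L : lev l -> part l L ->
  (forall l1 L1, 1 < l1 <= l -> part l1 L1 -> (L1 \subset L)%SET -> be l1 L1 = be' l1 L1) ->
  asm be l L = asm be' l L.
Proof.
move: l L; apply: lev_ind => // l L Hl pL IH H; rewrite !asmE; try lia.
rewrite H //; last by lia.
congr gammaB; apply/eq_in_map => C CL; apply: IH => // l1 L1 Hl1 p1 L1C; apply: H => //; first by lia.
exact: fintype.subset_trans L1C (ord_sub Hl pL CL).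
Qed.

Lemma asm_breq be be' l L : lev l -> part l L -> wfam be l L ->
  (forall l1 L1, 1 < l1 <= l -> part l1 L1 -> (L1 \subset L)%SET ->
     breq (size (ord l1 L1)) (be l1 L1) (be' l1 L1)) ->
  breq (nleaves (build ord l L)) (asm be l L) (asm be' l L).
Proof.
move: l L; apply: lev_ind => [L pL _ _|l L Hl pL IH Hw H]; first exact: breq_refl.
rewrite nleavesE // !asmE; try lia.
apply: breq_gammaB; rewrite ?size_map //.
- move=> i Hi; rewrite !(nth_map fset0) //; apply: IH; first exact: mem_nth.
    by apply: wfam_child Hw => //; apply: mem_nth.
  move=> l1 L1 Hl1 p1 L1C; apply: H => //; first by lia.
  by apply: fintype.subset_trans L1C (ord_sub Hl pL (mem_nth _ Hi)).
- by apply: Hw => //; lia.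
- by apply: H => //; lia.
Qed.

(** [gammaB_inj] at each node, from [L] downwards; the widths are positive since every subtree has a
    leaf. *)
Lemma asm_inj be be' l L : lev l -> part l L -> wfam be l L -> wfam be' l L ->
  breq (nleaves (build ord l L)) (asm be l L) (asm be' l L) ->
  forall l1 L1, 1 < l1 <= l -> part l1 L1 -> (L1 \subset L)%SET ->
     breq (size (ord l1 L1)) (be l1 L1) (be' l1 L1).
Proof.
move: l L; apply: lev_ind => [L pL _ _ _ l1 L1|l L Hl pL IH Hw Hw']; first by lia.
rewrite nleavesE // !asmE; try lia.
have Hl' : lev l.-1 by lia.
case/gammaB_inj.
- by apply/allP => m /mapP[C CL ->]; apply: nleaves_pos => //; apply: ord_part CL.
- by apply: wf_blocks_asm => // C CL; apply: wf_asm => //; [apply: ord_part CL|apply: wfam_child Hw].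
- by apply: wf_blocks_asm => // C CL; apply: wf_asm => //; [apply: ord_part CL|apply: wfam_child Hw'].
- by rewrite size_map; apply: Hw => //; lia.
- by rewrite size_map; apply: Hw' => //; lia.
rewrite size_map => H0 H1 l1 L1 Hl1 p1 L1L.
have [e|ne] := eqVneq l1 l.
  have [a aL1 _] := part_ex p1; move: p1; rewrite e => p1.
  by have -> : L1 = L by apply: part_eq p1 pL aL1 (fintype.subsetP L1L a aL1).
have [a aL1 EL1] := part_ex p1.
have CL := cls_ord Hl pL (fintype.subsetP L1L a aL1); set C := cls l.-1 a in CL.
apply: (IH C CL); [exact: wfam_child Hw|exact: wfam_child Hw'| |lia|by []|].
  have Hi : index C (ord l L) < size (ord l L) by rewrite index_mem.
  by have := H1 _ Hi; rewrite !(nth_map fset0) // nth_index.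
by rewrite EL1 /C cls_sub ?sim_refl //; lia.
Qed.

(** One notion for two sources: automorphisms of the tree, read through [mS], and permutations of
    the coordinates, acting on parts by images. *)
Definition treemap (m : nat -> {set 'I_n} -> {set 'I_n}) := forall l L, lev l -> part l L ->
  [/\ part l (m l L), #|m l L| = #|L| &
      (1 < l -> perm_eq (map (m l.-1) (ord l L)) (ord l (m l L)))].

Lemma treemap_id : treemap (fun _ L => L).
Proof. by move=> l L Hl pL; split=> // _; rewrite map_id. Qed.

Lemma tiso_treemap m l L : treemap m -> lev l -> part l L -> tiso (build ord l L) (build ord l (m l L)).
Proof.
move=> Hm; move: l L; apply: lev_ind => [L pL|l L Hl pL IH].
  have [_ E _] := Hm 1 L isT pL; rewrite !build1 E.
  by apply: (@TIso _ [::] [::] [::]); [exact: List.Forall2_nil|exact: Permutation.perm_nil].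
have [pm Em Pm] := Hm l L ltac:(lia) pL.
rewrite !buildE ?Em; try lia.
apply: (@TIso _ _ _ (map (build ord l.-1) (map (m l.-1) (ord l L)))).
  apply/(Forall2_nth _ ptree0 ptree0); rewrite !size_map; split=> // i Hi.
  by rewrite -map_comp !(nth_map fset0) //; apply: IH; apply: mem_nth.
by apply: perm_Permutation; apply: Pm; lia.
Qed.

Lemma in_subtrees l L : lev l -> part l L -> List.In (build ord l L) (subtrees (Tplanar p ord)).
Proof.
have H d l0 L0 L1 : lev l0 -> lev (l0 + d) -> part l0 L0 -> part (l0 + d) L1 -> (L0 \subset L1)%SET ->
    List.In (build ord l0 L0) (subtrees (build ord (l0 + d) L1)).
  elim: d L1 => [|d IH] L1 Hl0 Hld p0 p1 s01.
    have [a a0 _] := part_ex p0; rewrite addn0 in p1 *.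
    by rewrite (part_eq p0 p1 a0 (fintype.subsetP s01 a a0)); case: build => r ts; left.
  have Hld' : 1 < l0 + d.+1 <= p.+1 by lia.
  rewrite [X in subtrees X]buildE /=; last by lia.
  right; have [a a0 E0] := part_ex p0.
  have CL := cls_ord Hld' p1 (fintype.subsetP s01 a a0); rewrite addnS /= in CL *.
  have := IH (cls (l0 + d) a) Hl0 ltac:(lia) p0 (part_cls _ _).
  rewrite {1}E0 cls_sub ?sim_refl ?leq_addr // => /(_ isT).
  elim: (ord (l0 + d).+1 L1) CL => //= C s IHs; rewrite inE => /orP[/eqP->|/IHs{}IHs] Hin; apply/List.in_app_iff.
    by left.
  by right; apply: IHs.
move=> Hl pL; have := H (p.+1 - l) l L [set: 'I_n]%SET Hl; rewrite subnKC; last by lia.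
by apply=> //; first [exact: part_top|lia|apply/fintype.subsetP => a _; rewrite inE].
Qed.

(** Compatible orderings are used here: a part and its image have isomorphic, hence equal, planar
    trees. *)
Lemma build_treemap m l L : treemap m -> lev l -> part l L -> build ord l (m l L) = build ord l L.
Proof.
move=> Hm Hl pL; apply/esym/Hc; [exact: in_subtrees|apply: in_subtrees => //; by case: (Hm l L Hl pL)|].
exact: tiso_treemap.
Qed.

Lemma tiso_refl l L : lev l -> part l L -> tiso (build ord l L) (build ord l L).
Proof. exact: tiso_treemap treemap_id. Qed.

(** The strand of a child of [L] must end at the place of its image among the ordered children of
    the image of [L]. *)
Definition cmp (m : nat -> {set 'I_n} -> {set 'I_n}) (be : nat -> {set 'I_n} -> bword) :=
  forall l L, 1 < l <= p.+1 -> part l L ->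
    wf_word (size (ord l L)) (be l L) /\
    act (be l L) (map (m l.-1) (ord l L)) = ord l (m l L).

Lemma cmp_wfam m be l L : l <= p.+1 -> cmp m be -> wfam be l L.
Proof. by move=> Hl H l1 L1 Hl1 p1 _; case: (H l1 L1 ltac:(lia) p1). Qed.

Lemma map_build_treemap m l L : treemap m -> 1 < l <= p.+1 -> part l L ->
  map (build ord l.-1) (ord l (m l L)) = map (build ord l.-1) (ord l L).
Proof.
move=> Hm Hl pL; have := build_treemap Hm _ pL; rewrite !buildE; try lia.
by move=> /(_ ltac:(lia))[_].
Qed.

Lemma cmp_cbr m be l L : treemap m -> cmp m be -> lev l -> part l L ->
  cbr (build ord l L) (asm be l L).
Proof.
move=> Hm Hb; move: l L; apply: lev_ind => [L pL|l L Hl pL IH]; first exact: cbr_leaf.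
have Hl' : lev l.-1 by lia.
have [wfb Eb] := Hb l L Hl pL.
have Hw : wfam be l L by apply: cmp_wfam Hb; lia.
have Hl2 : lev l by lia.
have wfA := wf_asm Hl2 pL Hw.
move: wfA; rewrite (asmE be L) ?[build ord l L]buildE; try lia; move=> wfA.
set ts := map (build ord l.-1) (ord l L); have st : size ts = size (ord l L) by rewrite size_map.
have actts : act (be l L) ts = ts.
  rewrite {2}/ts -(map_build_treemap Hm Hl pL) -Eb act_map -map_comp -act_map; congr act.
  by apply/eq_in_map => C CL /=; rewrite (build_treemap Hm) //; apply: ord_part CL.
have Ems : map (fun C => nleaves (build ord l.-1 C)) (ord l L) = map nleaves ts by rewrite -map_comp.
apply: (@cbr_node _ ts (be l L) (map (asm be l.-1) (ord l L))).
- by have := ord_pos Hl pL; rewrite -st; case: (ts).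
- by rewrite st.
- move=> i; rewrite st => Hi.
  have -> : nth ptree0 ts (perm_word (be l L) i) = nth ptree0 ts i.
    by rewrite -{1}actts nth_act // st.
  by rewrite (nth_map fset0) //; apply: tiso_refl => //; apply: ord_part (mem_nth _ _).
- by rewrite st size_map.
- apply/(Forall2_nth _ ptree0 [::]); rewrite !size_map; split=> // i Hi.
  by rewrite !(nth_map fset0) //; apply: IH; apply: mem_nth.
- by move: wfA.
- by rewrite Ems; apply: breq_refl.
Qed.

Lemma map_nleaves_treemap m l L : treemap m -> 1 < l <= p.+1 -> part l L ->
  map (fun C => nleaves (build ord l.-1 C)) (ord l (m l L)) =
  map (fun C => nleaves (build ord l.-1 C)) (ord l L).
Proof. by move=> Hm Hl pL; have := congr1 (map nleaves) (map_build_treemap Hm Hl pL); rewrite -!map_comp. Qed.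

(** The leaves remember [m], which allows the permutation of an assembled braid to be compared with
    an automorphism or with a translation. *)
Lemma cmp_act m be l L : treemap m -> cmp m be -> lev l -> part l L ->
  act (asm be l L) (map (m 1) (leaves l L)) = leaves l (m l L).
Proof.
move=> Hm Hb; move: l L; apply: lev_ind => [L pL|l L Hl pL IH] //.
have Hl' : lev l.-1 by lia.
have [wfb Eb] := Hb l L Hl pL.
rewrite asmE ?leavesE; try lia.
rewrite map_flatten -map_comp act_gammaB.
- congr flatten; rewrite -Eb -act_map; congr act; rewrite -map_comp.
  apply: (@eq_from_nth _ [::]) => [|i].
    by rewrite !size_map size_zip !size_map minnn.
  rewrite !size_map size_zip !size_map minnn => Hi.
  rewrite (nth_map ([::], [::])) ?size_zip ?size_map ?minnn // nth_zip ?size_map //=.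
  by rewrite !(nth_map fset0) //=; apply: IH; apply: mem_nth.
- rewrite -map_comp; apply/eq_in_map => C CL /=; rewrite size_map size_leaves //.
  exact: ord_part CL.
- apply: wf_blocks_asm => // C CL; apply: wf_asm => //; first exact: ord_part CL.
  by apply: cmp_wfam Hb; lia.
- by rewrite size_map.
Qed.

(** After the first braid the strands of [L] stand where those of [m l L] begin, so the second
    factor is read at [m l L]. *)
Lemma asm_cat m be be' be2 l L : treemap m -> cmp m be -> lev l -> part l L ->
  (forall l1 L1, 1 < l1 <= p.+1 -> part l1 L1 -> wf_word (size (ord l1 L1)) (be' l1 L1)) ->
  (forall l1 L1, 1 < l1 <= p.+1 -> part l1 L1 -> be2 l1 L1 = be l1 L1 ++ be' l1 (m l1 L1)) ->
  breq (nleaves (build ord l L)) (asm be2 l L) (asm be l L ++ asm be' l (m l L)).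
Proof.
move=> Hm Hb + + Hw' E2; move: l L; apply: lev_ind => [L pL|l L Hl pL IH]; first exact: breq_refl.
have Hl' : lev l.-1 by lia.
have [pm _ _] := Hm l L ltac:(lia) pL.
have [wfb Eb] := Hb l L Hl pL.
have Hw'm l1 L1 : l1 <= p.+1 -> wfam be' l1 L1 by move=> Hl1 l2 L2 Hl2 p2 _; apply: Hw' => //; lia.
rewrite nleavesE // !asmE; try lia.
rewrite (map_nleaves_treemap Hm Hl pL) E2 //.
set ms := map (fun C => nleaves _) (ord l L); set bs := map (asm be l.-1) _.
(* Permuted children have equal planar trees, so the widths are unchanged and the product law of
   [gammaB] applies with one list [ms]. *)
have Ems : act (be l L) ms = ms.
  rewrite {2}/ms -(map_nleaves_treemap Hm Hl pL) -Eb act_map -map_comp -act_map; congr act.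
  by apply/eq_in_map => C CL /=; rewrite (build_treemap Hm) //; apply: ord_part CL.
pose bs' := map (fun C => asm be' l.-1 (m l.-1 C)) (ord l L).
have Ebs : map (asm be' l.-1) (ord l (m l L)) = act (be l L) bs'.
  by rewrite -Eb act_map -map_comp -act_map.
have wb : wf_blocks ms bs.
  apply: wf_blocks_asm => // C CL; apply: wf_asm => //; first exact: ord_part CL.
  by apply: cmp_wfam Hb; lia.
have wb' : wf_blocks ms bs'.
  split; rewrite !size_map // => i Hi; rewrite !(nth_map fset0) //.
  have pC := ord_part Hl pL (mem_nth fset0 Hi); have [pmC _ _] := Hm _ _ Hl' pC.
  rewrite -(build_treemap Hm Hl' pC); apply: wf_asm => //; apply: Hw'm; lia.
have := @breq_gammaB_cat ms (be l L) (be' l (m l L)) bs bs' wb wb'; rewrite Ems size_map => /(_ wfb) K.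
rewrite Ebs; apply: breq_sym; apply: breq_trans K _.
apply: breq_gammaB.
- by rewrite !size_map size_zip !size_map minnn.
- by rewrite !size_map.
- move=> i; rewrite size_map => Hi; rewrite (nth_map ([::], [::])) ?size_zip ?size_map ?minnn //.
  rewrite nth_zip ?size_map //= !(nth_map fset0) //; apply: breq_sym.
  by apply: IH; apply: mem_nth.
- rewrite wf_cat size_map wfb /=.
  have := Hw' l (m l L) Hl pm; by rewrite -Eb size_act size_map.
- exact: breq_refl.
Qed.

Lemma cbr_build1 L w : cbr (build ord 1 L) w -> w = [::].
Proof.
by rewrite build1; move E : (PNode _ _) => t H; case: t w / H E => // r ts b bs w H _ _ _ _ _ _ [_ e]; case: H.
Qed.

Lemma pcbr_build1 L w : pcbr (build ord 1 L) w -> w = [::].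
Proof.
by rewrite build1; move E : (PNode _ _) => t H; case: t w / H E => // r ts b bs w H _ _ _ _ _ _ [_ e]; case: H.
Qed.

(** Compatibility turns the isomorphism condition on permuted children into an equality of planar
    trees. *)
Lemma cbr_inv l L w : 1 < l <= p.+1 -> part l L -> cbr (build ord l L) w ->
  exists b bs, [/\ wf_word (size (ord l L)) b,
    act b (map (build ord l.-1) (ord l L)) = map (build ord l.-1) (ord l L),
    size bs = size (ord l L),
    (forall i, i < size (ord l L) -> cbr (build ord l.-1 (nth fset0 (ord l L) i)) (nth [::] bs i)) &
    wf_word (nleaves (build ord l L)) w /\
    breq (nleaves (build ord l L)) w
      (gammaB (map (fun C => nleaves (build ord l.-1 C)) (ord l L)) b bs)].
Proof.
move=> Hl pL; have Hl' : lev l.-1 by lia.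
have E0 := @buildE l L ltac:(lia); rewrite [in X in X -> _]E0.
move E : (PNode _ _) => t H; case: t w / H E => [r|r ts b bs w] .
  by case=> _ /(congr1 size); rewrite size_map /= => e; have := ord_pos Hl pL; rewrite e.
move=> _ wb Hb sb /(Forall2_nth _ ptree0 [::])[_ Hcb] ww Hw [er ets]; subst r ts; rewrite size_map in wb Hb sb Hcb.
exists b, bs; split=> //.
- apply: (@eq_from_nth _ ptree0) => [|k]; rewrite size_act // size_map => Hk.
  set i := perm_word (winv b) k; have Ek : perm_word b i = k by rewrite -{1}(winvK b) perm_word_winv.
  have Hi : i < size (ord l L) by apply: perm_word_lt => //; rewrite wf_winv.
  rewrite -{1}Ek nth_act ?size_map // -[in RHS]Ek; apply/esym/Hc; last exact: Hb.
  + rewrite Ek (nth_map fset0) //; apply: in_subtrees => //; exact: ord_part (mem_nth _ _).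
  + rewrite (nth_map fset0) //; apply: in_subtrees => //; exact: ord_part (mem_nth _ _).
- by move=> i Hi; have := Hcb i Hi; rewrite (nth_map fset0).
- by rewrite E0; split=> //; move: Hw; rewrite -map_comp.
Qed.

Lemma cbr_wf l L w : lev l -> part l L -> cbr (build ord l L) w -> wf_word (nleaves (build ord l L)) w.
Proof.
move=> Hl pL H; have [l1|l1] := leqP l 1.
  have e : l = 1 by lia.
  by move: H; rewrite e => /cbr_build1->.
by case: (cbr_inv _ pL H) => [|b [bs [_ _ _ _ []]]] //; lia.
Qed.

Lemma pcbr_inv l L w : 1 < l <= p.+1 -> part l L -> pcbr (build ord l L) w ->
  exists b bs, [/\ wf_word (size (ord l L)) b,
    (forall i, i < size (ord l L) -> perm_word b i = i),
    size bs = size (ord l L),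
    (forall i, i < size (ord l L) -> pcbr (build ord l.-1 (nth fset0 (ord l L) i)) (nth [::] bs i)) &
    wf_word (nleaves (build ord l L)) w /\
    breq (nleaves (build ord l L)) w
      (gammaB (map (fun C => nleaves (build ord l.-1 C)) (ord l L)) b bs)].
Proof.
move=> Hl pL; have Hl' : lev l.-1 by lia.
have E0 := @buildE l L ltac:(lia); rewrite [in X in X -> _]E0.
move E : (PNode _ _) => t H; case: t w / H E => [r|r ts b bs w] .
  by case=> _ /(congr1 size); rewrite size_map /= => e; have := ord_pos Hl pL; rewrite e.
move=> _ wb Hb sb /(Forall2_nth _ ptree0 [::])[_ Hcb] ww Hw [er ets]; subst r ts; rewrite size_map in wb Hb sb Hcb.
exists b, bs; split=> //.
- by move=> i Hi; have := Hcb i Hi; rewrite (nth_map fset0).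
- by rewrite E0; split=> //; move: Hw; rewrite -map_comp.
Qed.

Lemma pcbr_cbr l L w : lev l -> part l L -> pcbr (build ord l L) w -> cbr (build ord l L) w.
Proof.
move=> Hl pL; move: l L Hl pL w; apply: lev_ind => [L pL w /pcbr_build1->|l L Hl pL IH w].
  exact: cbr_leaf.
case/(pcbr_inv Hl pL) => b [bs [wb Hb sb Hcb [ww Hw]]].
have E0 := @buildE l L ltac:(lia); rewrite E0 in ww Hw *.
apply: (@cbr_node _ _ b bs); rewrite ?size_map //.
- by have := ord_pos Hl pL; case: (ord l L).
- move=> i Hi; rewrite Hb // (nth_map fset0) //; apply: tiso_refl; [lia|exact: ord_part (mem_nth _ _)].
- apply/(Forall2_nth _ ptree0 [::]); rewrite size_map sb; split=> // i Hi.
  by rewrite (nth_map fset0) //; apply: IH; [exact: mem_nth|exact: Hcb].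
- by move: Hw; rewrite -map_comp.
Qed.

Lemma act_inv_leaves l L w b bs : 1 < l <= p.+1 -> part l L -> wf_word (size (ord l L)) b ->
  size bs = size (ord l L) ->
  (forall i, i < size (ord l L) -> wf_word (nleaves (build ord l.-1 (nth fset0 (ord l L) i))) (nth [::] bs i)) ->
  breq (nleaves (build ord l L)) w
      (gammaB (map (fun C => nleaves (build ord l.-1 C)) (ord l L)) b bs) ->
  act w (leaves l L) = flatten (act b (zipw (@act _) bs (map (leaves l.-1) (ord l L)))).
Proof.
move=> Hl pL wb sb Hbs Hw; have Hl2 : lev l by lia.
rewrite (act_breq (size_leaves Hl2 pL) Hw) leavesE; last by lia.
apply: act_gammaB; rewrite ?size_map //.
- rewrite -map_comp; apply/eq_in_map => C CL /=; apply: size_leaves; [lia|exact: ord_part CL].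
- by split; rewrite ?size_map // => i Hi; rewrite (nth_map fset0) //; apply: Hbs.
Qed.

Lemma pcbr_pure l L w : lev l -> part l L -> pcbr (build ord l L) w ->
  act w (leaves l L) = leaves l L.
Proof.
move=> Hl pL; move: l L Hl pL w; apply: lev_ind => [L pL w /pcbr_build1->|l L Hl pL IH w] //.
case/(pcbr_inv Hl pL) => b [bs [wb Hb sb Hcb [ww Hw]]]; have Hl' : lev l.-1 by lia.
rewrite (act_inv_leaves Hl pL wb sb _ Hw); last first.
  by move=> i Hi; apply: cbr_wf => //; [exact: ord_part (mem_nth _ _)|apply: pcbr_cbr; [lia|exact: ord_part (mem_nth _ _)|exact: Hcb]].
have sz : size (zipw (@act _) bs (map (leaves l.-1) (ord l L))) = size (ord l L).
  by rewrite size_map size_zip size_map sb minnn.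
rewrite act_pure ?sz // leavesE; last by lia.
congr flatten; apply: (@eq_from_nth _ [::]) => [|i]; rewrite sz ?size_map // => Hi.
rewrite (nth_map ([::], [::])) ?size_zip ?size_map ?sb ?minnn // nth_zip ?size_map //= (nth_map fset0) //.
by apply: IH; [exact: mem_nth|exact: Hcb].
Qed.

(** A block of leaves determines its child, because distinct children are disjoint and have leaves.
    If all leaves return to their places, so do the children and, inside each child, its leaves. *)
Lemma cbr_pure l L w : lev l -> part l L -> cbr (build ord l L) w ->
  act w (leaves l L) = leaves l L -> pcbr (build ord l L) w.
Proof.
move=> Hl pL; move: l L Hl pL w; apply: lev_ind => [L pL w /cbr_build1-> _|l L Hl pL IH w].
  exact: pcbr_leaf.
case/(cbr_inv Hl pL) => b [bs [wb Hb sb Hcb [ww Hw]]]; have Hl' : lev l.-1 by lia.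
have pC i : i < size (ord l L) -> part l.-1 (nth fset0 (ord l L) i).
  by move=> Hi; exact: ord_part (mem_nth _ _).
rewrite (act_inv_leaves Hl pL wb sb _ Hw); last first.
  by move=> i Hi; apply: cbr_wf => //; [exact: pC|exact: Hcb].
set ll := map (leaves l.-1) (ord l L); set Z := zipw _ bs ll.
have szl : size ll = size (ord l L) by rewrite size_map.
have sz : size Z = size (ord l L) by rewrite size_map size_zip szl sb minnn.
rewrite leavesE -/ll; last by lia.
(* The concatenations of the blocks agree by assumption; the blocks agree one by one because
   permuted children have equally many leaves. *)
move=> Hfl; have EZ : act b Z = ll.
  apply: eq_from_flatten_shape Hfl _; rewrite /shape -act_map.
  rewrite map_size_zipw_act ?szl ?sb // /ll -map_comp.
  have -> : [seq (size \o leaves l.-1) x | x <- ord l L] = map nleaves (map (build ord l.-1) (ord l L)).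
    by rewrite -map_comp; apply/eq_in_map => C CL /=; apply: size_leaves => //; exact: ord_part CL.
  by rewrite act_map Hb.
have key i : i < size (ord l L) -> perm_word b i = i /\
    act (nth [::] bs i) (leaves l.-1 (nth fset0 (ord l L) i)) = leaves l.-1 (nth fset0 (ord l L) i).
  move=> Hi; have Hpi := perm_word_lt wb Hi.
  have := @nth_act _ [::] b Z i; rewrite sz EZ => /(_ wb).
  rewrite (nth_map fset0) // (nth_map ([::], [::])) ?size_zip ?szl ?sb ?minnn //.
  rewrite nth_zip ?szl ?sb //= (nth_map fset0) // => E.
  have Epi : perm_word b i = i.
    have := nleaves_pos Hl' (pC i Hi); rewrite -size_leaves //; last exact: pC.
    case El : (leaves l.-1 (nth fset0 (ord l L) i)) => [|D s] // _.
    have D1 : D \in leaves l.-1 (nth fset0 (ord l L) i) by rewrite El mem_head.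
    have D2 : D \in leaves l.-1 (nth fset0 (ord l L) (perm_word b i)).
      by rewrite E (perm_mem (perm_act _ _)).
    move: D1 D2; rewrite !mem_leaves //; try exact: pC.
    move=> /andP[pD /fintype.subsetP s1] /andP[_ /fintype.subsetP s2].
    by have [a aD _] := part_ex pD; apply: (ord_disj Hl pL Hpi Hi (s2 a aD) (s1 a aD)).
  by split=> //; rewrite -E Epi.
have E0 := @buildE l L ltac:(lia); rewrite E0 in ww Hw *.
apply: (@pcbr_node _ _ b bs); rewrite ?size_map //.
- by have := ord_pos Hl pL; case: (ord l L).
- by move=> i /key[].
- apply/(Forall2_nth _ ptree0 [::]); rewrite size_map sb; split=> // i Hi.
  by rewrite (nth_map fset0) //; apply: IH; [exact: mem_nth|exact: Hcb|case: (key i Hi)].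
- by move: Hw; rewrite -map_comp.
Qed.

Definition fixfam (be : nat -> {set 'I_n} -> bword) l (L : {set 'I_n}) :=
  forall l1 L1, 1 < l1 <= l -> part l1 L1 -> (L1 \subset L)%SET ->
    wf_word (size (ord l1 L1)) (be l1 L1) /\
    act (be l1 L1) (map (build ord l1.-1) (ord l1 L1)) = map (build ord l1.-1) (ord l1 L1).

Lemma part_same l L L1 : part l L -> part l L1 -> (L1 \subset L)%SET -> L1 = L.
Proof.
by move=> pL p1 /fintype.subsetP s; have [a aL1 _] := part_ex p1; apply: part_eq p1 pL aL1 (s a aL1).
Qed.

Lemma find_ord l L i l1 L1 : 1 < l <= p.+1 -> part l L -> i < size (ord l L) -> part l1 L1 ->
  (L1 \subset nth fset0 (ord l L) i)%SET -> find (fun C : {set 'I_n} => (L1 \subset C)%SET) (ord l L) = i.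
Proof.
move=> Hl pL Hi p1 s1; apply: (@find_nth _ fset0) => // j ji; apply/negP => /fintype.subsetP s2.
have [a aL1 _] := part_ex p1.
by have := ord_disj Hl pL Hi (ltn_trans ji Hi) (fintype.subsetP s1 a aL1) (s2 a aL1); lia.
Qed.

Lemma part_below l L l1 L1 : 1 < l <= p.+1 -> part l L -> l1 < l -> part l1 L1 -> (L1 \subset L)%SET ->
  exists2 i, i < size (ord l L) & (L1 \subset nth fset0 (ord l L) i)%SET.
Proof.
move=> Hl pL Hl1 p1 s1; have [a aL1 E1] := part_ex p1.
have CL := cls_ord Hl pL (fintype.subsetP s1 a aL1); exists (index (cls l.-1 a) (ord l L)).
  by rewrite index_mem.
by rewrite nth_index // E1 cls_sub ?sim_refl //; lia.
Qed.

Lemma cbr_fam l L w : lev l -> part l L -> cbr (build ord l L) w ->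
  exists2 be, fixfam be l L & breq (nleaves (build ord l L)) w (asm be l L).
Proof.
move=> Hl pL; move: l L Hl pL w; apply: lev_ind => [L pL w /cbr_build1->|l L Hl pL IH w].
  by exists (fun _ _ => [::]) => [l1 L1|]; [lia|exact: breq_refl].
case/(cbr_inv Hl pL) => b [bs [wb Hb sb Hcb [ww Hw]]]; have Hl' : lev l.-1 by lia.
have /choice[F HF] : forall i, exists F : nat -> {set 'I_n} -> bword, i < size (ord l L) ->
    fixfam F l.-1 (nth fset0 (ord l L) i) /\
    breq (nleaves (build ord l.-1 (nth fset0 (ord l L) i))) (nth [::] bs i) (asm F l.-1 (nth fset0 (ord l L) i)).
  move=> i.
  have [Hi|] := ltnP i (size (ord l L)); last by exists (fun _ _ => [::]).
  by have [be H1 H2] := IH _ (mem_nth _ Hi) _ (Hcb i Hi); exists be.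
(* Below [L] the family of the unique child containing [L1] is consulted. *)
pose be (l1 : nat) (L1 : {set 'I_n}) := if l1 == l then b else F (find (fun C : {set 'I_n} => (L1 \subset C)%SET) (ord l L)) l1 L1.
have bE i l1 L1 : i < size (ord l L) -> l1 < l -> part l1 L1 -> (L1 \subset nth fset0 (ord l L) i)%SET ->
    be l1 L1 = F i l1 L1.
  by move=> Hi Hl1 p1 s1; rewrite /be ltn_eqF // (find_ord Hl pL Hi p1 s1).
exists be.
  move=> l1 L1 Hl1 p1 s1; have [e|ne] := eqVneq l1 l.
    move: p1; rewrite e => p1; rewrite (part_same pL p1 s1) /be eqxx; split=> //.
  have ll1 : l1 < l by lia.
  have [i Hi si] := part_below Hl pL ll1 p1 s1.
  rewrite (bE i) //.
  by case: (HF i Hi) => Hf _; apply: Hf => //; lia.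
rewrite asmE; last by lia.
apply: breq_trans Hw _; rewrite nleavesE //; apply: breq_gammaB; rewrite ?size_map //.
- move=> i Hi; rewrite !(nth_map fset0) //; have [_ H2] := HF i Hi.
  rewrite (@asm_ext be (F i)) //; first exact: ord_part (mem_nth _ _).
  by move=> l1 L1 Hl1 p1 s1; apply: bE => //; lia.
- by rewrite /be eqxx; apply: breq_refl.
Qed.

(** On a leaf any bijection between parts of equal rank will do. At an inner node the word decides
    which child of [L'] each child of [L] is sent to, and the maps obtained for the children are
    glued. *)
Lemma fam_map be l L L' : lev l -> part l L -> part l L' -> build ord l L' = build ord l L ->
  fixfam be l L ->
  exists s : 'I_n -> 'I_n, [/\ {in L &, injective s}, (s @: L)%SET = L' &
    forall l1 L1, 1 <= l1 <= l -> part l1 L1 -> (L1 \subset L)%SET ->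
      part l1 (s @: L1)%SET /\
      (1 < l1 -> act (be l1 L1) (map (fun C : {set 'I_n} => (s @: C)%SET) (ord l1 L1)) = ord l1 (s @: L1)%SET)].
Proof.
move=> Hl pL; move: l L Hl pL L'; apply: lev_ind => [L pL L' pL'|l L Hl pL IH L' pL'].
  rewrite !build1 => -[Ec] _; have [a0 _ _] := part_ex pL.
  pose s a := nth a0 (enum L') (index a (enum L)).
  have sE a : a \in L -> index a (enum L) < size (enum L') by move=> aL; rewrite -cardE Ec cardE index_mem mem_enum.
  have si : {in L &, injective s}.
    move=> a b aL bL /eqP; rewrite nth_uniq ?enum_uniq ?sE // => /eqP /(congr1 (nth a0 (enum L))).
    by rewrite !nth_index ?mem_enum.
  have E : (s @: L)%SET = L'.
    apply/eqP; rewrite eqEcard card_in_imset // Ec leqnn andbT; apply/fintype.subsetP => b /imsetP[a aL ->].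
    by rewrite -mem_enum mem_nth // sE.
  exists s; split=> // l1 L1 Hl1 p1 s1; have e : l1 = 1 by lia.
  by move: p1; rewrite e => p1; rewrite (part_same pL p1 s1) E.
rewrite !buildE; try lia.
case=> Ec Ets Hf; have Hl' : lev l.-1 by lia.
have [wb Hb] := Hf l L ltac:(lia) pL (subxx _).
(* Entry [i] is the child of [L'] at the place where the [i]-th strand ends. *)
pose E := act (winv (be l L)) (ord l L').
have sLL : size (ord l L') = size (ord l L) by have := congr1 size Ets; rewrite !size_map.
have sE : size E = size (ord l L) by rewrite size_act.
have actE : act (be l L) E = ord l L' by rewrite act_winvK.
have EL' : perm_eq E (ord l L') by apply: perm_act.
have pE i : i < size (ord l L) -> part l.-1 (nth fset0 E i).
  by move=> Hi; apply: (ord_part Hl pL'); rewrite -(perm_mem EL') mem_nth // sE.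
have bE i : i < size (ord l L) -> build ord l.-1 (nth fset0 E i) = build ord l.-1 (nth fset0 (ord l L) i).
  move=> Hi; rewrite -!(nth_map fset0 ptree0) ?sE //; congr nth; rewrite -act_map Ets -{1}Hb.
  exact: act_winv.
have /choice[S HS] : forall i, exists S : 'I_n -> 'I_n, i < size (ord l L) ->
    [/\ {in nth fset0 (ord l L) i &, injective S}, (S @: nth fset0 (ord l L) i)%SET = nth fset0 E i &
    forall l1 L1, 1 <= l1 <= l.-1 -> part l1 L1 -> (L1 \subset nth fset0 (ord l L) i)%SET ->
      part l1 (S @: L1)%SET /\
      (1 < l1 -> act (be l1 L1) (map (fun C : {set 'I_n} => (S @: C)%SET) (ord l1 L1)) = ord l1 (S @: L1)%SET)].
  move=> i.
  have [Hi|] := ltnP i (size (ord l L)); last by exists id.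
  have [|s Hs] := IH _ (mem_nth fset0 Hi) _ (pE i Hi) (bE i Hi); last by exists s.
  move=> l1 L1 Hl1 p1 s1; apply: Hf => //; first by lia.
  exact: fintype.subset_trans s1 (ord_sub Hl pL (mem_nth _ Hi)).
pose idx (a : 'I_n) := find (fun C : {set 'I_n} => a \in C) (ord l L).
pose s a := S (idx a) a.
have idxE i a : i < size (ord l L) -> a \in nth fset0 (ord l L) i -> idx a = i.
  move=> Hi ai; apply: (@find_nth _ fset0) => // j ji; apply/negP => aj.
  by have := ord_disj Hl pL Hi (ltn_trans ji Hi) ai aj; lia.
have imE i (L1 : {set 'I_n}) : i < size (ord l L) -> (L1 \subset nth fset0 (ord l L) i)%SET ->
    (s @: L1)%SET = (S i @: L1)%SET.
  move=> Hi /fintype.subsetP s1; apply: eq_in_imset => a aL1; by rewrite /s (idxE i) // s1.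
have inL a : a \in L -> exists2 i, i < size (ord l L) & a \in nth fset0 (ord l L) i.
  move=> aL; have CL := cls_ord Hl pL aL; exists (index (cls l.-1 a) (ord l L)); first by rewrite index_mem.
  by rewrite nth_index // cls_id.
have sin i a : i < size (ord l L) -> a \in nth fset0 (ord l L) i -> s a \in nth fset0 E i.
  by move=> Hi ai; case: (HS i Hi) => _ <- _; rewrite /s (idxE i) // imset_f.
have si : {in L &, injective s}.
  move=> a b /inL[i Hi ai] /inL[j Hj bj] e.
  have eij : i = j.
    apply/eqP; rewrite -(@nth_uniq _ fset0 E) ?sE // ?(perm_uniq EL') ?(ord_uniq Hl pL') //; apply/eqP.
    by apply: (part_eq (pE i Hi) (pE j Hj) (sin i a Hi ai)); rewrite e; apply: sin.
  subst j; case: (HS i Hi) => I _ _; apply: I => //; by move: e; rewrite /s !(idxE i).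
have EL : (s @: L)%SET = L'.
  apply/eqP; rewrite eqEcard card_in_imset // Ec leqnn andbT; apply/fintype.subsetP => b /imsetP[a /inL[i Hi ai] ->].
  apply: (fintype.subsetP (ord_sub Hl pL' _) _ (sin i a Hi ai)).
  by rewrite -(perm_mem EL') mem_nth // sE.
exists s; split=> // l1 L1 Hl1 p1 s1; have [e|ne] := eqVneq l1 l.
  move: p1; rewrite e => p1; rewrite (part_same pL p1 s1) EL; split=> // _; rewrite -actE; congr act.
  apply: (@eq_from_nth _ fset0) => [|i]; rewrite size_map ?sE // => Hi.
  by rewrite (nth_map fset0) // (imE i) //; case: (HS i Hi).
have ll1 : l1 < l by lia.
have [i Hi si'] := part_below Hl pL ll1 p1 s1.
rewrite (imE i) //; case: (HS i Hi) => _ _ /(_ l1 L1 ltac:(lia) p1 si')[H1 H2]; split=> // l11.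
rewrite -H2 //; congr act; apply/eq_in_map => C CL; apply: imE => //.
by apply: fintype.subset_trans si'; apply: ord_sub CL => //; lia.
Qed.

(** The common source of surjectivity and of the map to automorphisms: the permutation supplies both
    the end point of a lift with the given word and an automorphism of the tree. *)
Lemma cbr_perm w : cbr (Tplanar p ord) w ->
  exists s : 'S_n, exists be, [/\ treemap (fun _ L => (s @: L)%SET), cmp (fun _ L => (s @: L)%SET) be &
    breq (nleaves (Tplanar p ord)) w (asm be p.+1 [set: 'I_n]%SET)].
Proof.
move=> Hw; have pT := part_top; have lT : lev p.+1 by lia.
have [be Hf Hb] := cbr_fam lT pT Hw.
have [s [si sT Hs]] := fam_map lT pT pT erefl Hf.
have sinj : injective s by move=> a b; apply: si; rewrite inE.
have HL (L : {set 'I_n}) : (L \subset [set: 'I_n])%SET by apply/fintype.subsetP => a _; rewrite inE.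
have imE (L : {set 'I_n}) : (perm sinj @: L)%SET = (s @: L)%SET.
  by apply: eq_imset => a; rewrite permE.
have cmpb : cmp (fun _ L => (perm sinj @: L)%SET) be.
  move=> l L Hl pL; have [w1 _] := Hf l L Hl pL (HL L).
  have [_ H2] := Hs l L ltac:(lia) pL (HL L); split=> //.
  rewrite imE -H2; last by lia.
  by congr act; apply: eq_map => C; apply: imE.
exists (perm sinj), be; split=> //.
move=> l L Hl pL; have [p1 _] := Hs l L Hl pL (HL L); split.
- by rewrite imE.
- by rewrite card_imset //; apply: perm_inj.
- by move=> l1; have [_ <-] := cmpb l L ltac:(lia) pL; rewrite perm_sym perm_act.
Qed.

End Tree.

(** * The homomorphism to the automorphism group of the ranked tree *)

Section Automorphisms.
Local Open Scope nat_scope.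
Context (R : realType) (n p : nat) (A : 'M[R[i]]_(p, n)).
Variable ord : nat -> {set 'I_n} -> seq {set 'I_n}.
Hypothesis n0 : 0 < n.
Hypothesis Hv : valid_ord A ord.
Hypothesis Hc : compatible_ord p ord.

Local Notation part := (is_part A).
Local Notation lev l := (1 <= l <= p.+1).
Local Notation T := (Tplanar p ord).
Local Notation LV := (leaves ord p.+1 [set: 'I_n]%SET).
Local Notation fnode := (fnode A).

Lemma node_lev (v : fnode) : lev (flevel v).
Proof. by have /andP[H _] := valP v; rewrite /flevel H /= -ltnS ltn_ord. Qed.

Lemma node_part (v : fnode) : part (flevel v) (fset_of v).
Proof. by have /andP[_ H] := valP v. Qed.

Lemma node_ex l L : lev l -> part l L -> exists v : fnode, flevel v = l /\ fset_of v = L.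
Proof.
move=> Hl pL; have El : (inord l : 'I_p.+2) = l :> nat by rewrite inordK //; lia.
have H : is_nodeb A (inord l, L) by rewrite /is_nodeb /= El pL andbT; lia.
by exists (Sub (inord l, L) H); rewrite /flevel /fset_of SubK /= El.
Qed.

Lemma node_eq (u v : fnode) : flevel u = flevel v -> fset_of u = fset_of v -> u = v.
Proof.
move=> El Es; apply: val_inj; move: El Es; rewrite /flevel /fset_of.
by case: (val u) (val v) => a b [c d] /= El ->; congr pair; apply: val_inj.
Qed.

(** Reads a map of nodes as a map of sets level by level, with the identity as default off the tree,
    so that the results on [treemap] apply. *)
Definition mS (f : fnode -> fnode) l (L : {set 'I_n}) : {set 'I_n} :=
  if insub (inord l : 'I_p.+2, L) is Some v then fset_of (f v) else L.

Lemma mSE f v : mS f (flevel v) (fset_of v) = fset_of (f v).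
Proof.
rewrite /mS (_ : (inord (flevel v), fset_of v) = val v) ?valK //.
by rewrite /flevel /fset_of inord_val -surjective_pairing.
Qed.

Lemma parent_ex (v : fnode) : flevel v < p.+1 -> exists u, fparent v u.
Proof.
move=> Hl; have [a aL E] := part_ex (node_part v).
have [|u [u1 u2]] := @node_ex (flevel v).+1 (cls A (flevel v).+1 a) _ (part_cls _ _ _).
  by have := node_lev v; lia.
by exists u; rewrite /fparent u1 eqxx u2 E cls_sub // sim_refl.
Qed.

Lemma child_ex (v : fnode) : 1 < flevel v -> exists u, fparent u v.
Proof.
move=> Hl; have [a aL E] := part_ex (node_part v).
have [|u [u1 u2]] := @node_ex (flevel v).-1 (cls A (flevel v).-1 a) _ (part_cls _ _ _).
  by have := node_lev v; lia.
exists u; rewrite /fparent u1 u2 E cls_sub ?sim_refl ?leq_pred // andbT.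
by rewrite prednK //; lia.
Qed.

Lemma parent_unique (v u u' : fnode) : fparent v u -> fparent v u' -> u = u'.
Proof.
move=> /andP[/eqP E1 /fintype.subsetP s1] /andP[/eqP E2 /fintype.subsetP s2].
have [a av _] := part_ex (node_part v); apply: node_eq; first by rewrite E1 E2.
have p1 := node_part u; have p2 := node_part u'; rewrite E1 in p1; rewrite E2 in p2.
exact: part_eq p1 p2 (s1 a av) (s2 a av).
Qed.

Section Aut.
Variable s : {perm fnode}.
Hypothesis sA : s \in AutT A.

Lemma aut_root v : fis_root (s v) = fis_root v.
Proof. by move: sA; rewrite inE => /andP[/andP[/forallP H _] _]; exact: (eqP (H v)). Qed.

Lemma aut_parent u v : fparent (s u) (s v) = fparent u v.
Proof. by move: sA; rewrite inE => /andP[/andP[_ /forallP H] _]; apply/eqP; exact: (forallP (H u)). Qed.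

Lemma aut_rank v : #|fset_of (s v)| = #|fset_of v|.
Proof. by move: sA; rewrite inE => /andP[_ /forallP H]; apply/eqP; exact: (H v). Qed.

(** An automorphism is only required to respect root, parents and ranks; levels are recovered by
    induction on the distance from the root. *)
Lemma aut_level v : flevel (s v) = flevel v.
Proof.
have [d] := ubnP (p.+1 - flevel v); elim: d v => // d IH v Hd.
have [Hr|Hr] := boolP (fis_root v).
  by have := aut_root v; rewrite Hr (eqP Hr : flevel v = _) => /eqP.
have Hl : flevel v < p.+1 by have := node_lev v; move: Hr; rewrite /fis_root; lia.
have [u uv] := parent_ex Hl; have := uv; rewrite -aut_parent.
move: uv => /andP[/eqP E1 _] /andP[/eqP E2 _].
by have := IH u ltac:(lia); lia.
Qed.

Lemma treemap_aut : treemap A ord (mS s).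
Proof.
move=> l L Hl pL; have [v [v1 v2]] := node_ex Hl pL; subst l L.
rewrite !mSE; split; [by rewrite -aut_level; apply: node_part|exact: aut_rank|move=> l1].
have Hl1 : 1 < flevel v <= p.+1 by lia.
have pv' : part (flevel v) (fset_of (s v)) by rewrite -aut_level; apply: node_part.
have ch C : C \in ord (flevel v) (fset_of v) ->
    exists u, [/\ flevel u = (flevel v).-1, fset_of u = C & fparent u v].
  rewrite (ord_mem Hv) // => /andP[pC sC]; have [|u [u1 u2]] := node_ex _ pC; first by lia.
  by exists u; split=> //; rewrite /fparent u1 u2 sC prednK ?eqxx //; lia.
apply: uniq_perm; last 1 first.
- move=> D; apply/mapP/idP=> [[C /ch[u [u1 u2 uv]] ->]|].
    rewrite -u1 -u2 mSE (ord_mem Hv) // -{1}u1 -{1}(aut_level u) node_part /=.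
    by move: uv; rewrite -aut_parent => /andP[].
  rewrite (ord_mem Hv) // => /andP[pD sD]; have [|u' [u1 u2]] := node_ex _ pD; first by lia.
  have up : fparent u' (s v) by rewrite /fparent u1 u2 aut_level sD prednK ?eqxx //; lia.
  have := up; rewrite -[u'](permKV s) aut_parent => uv.
  have lu : flevel (s^-1 u')%g = (flevel v).-1 by rewrite -aut_level permKV.
  exists (fset_of (s^-1 u')%g); last by rewrite -lu mSE permKV.
  by rewrite (ord_mem Hv) // -{1}lu node_part; move: uv => /andP[].
- rewrite map_inj_in_uniq ?(ord_uniq Hv) // => C D /ch[u [u1 u2 _]] /ch[u' [u1' u2' _]].
  rewrite -{1}u1 -u2 -u1' -u2' !mSE => e; congr fset_of; apply: (@perm_inj _ s).
  by apply: node_eq => //; rewrite !aut_level u1 u1'.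
- exact: ord_uniq Hv _ _ Hl1 pv'.
Qed.

End Aut.

Lemma LV_top : part p.+1 [set: 'I_n]%SET. Proof. exact: part_top. Qed.

(** Induction from the leaves upwards: the image of a node is the parent of the image of any of its
    children. *)
Lemma aut_eq (s s' : {perm fnode}) : s \in AutT A -> s' \in AutT A ->
  map (mS s 1) LV = map (mS s' 1) LV -> s = s'.
Proof.
move=> sA sA' /eq_in_map E; apply/permP => v.
have [d] := ubnP (flevel v); elim: d v => // d IH v Hd.
have [l1|l1] := leqP (flevel v) 1.
  have e : flevel v = 1 by have := node_lev v; lia.
  apply: node_eq; first by rewrite !aut_level.
  have Ev : fset_of v \in LV.
    rewrite (mem_leaves n0 Hv) ?LV_top ?leqnn //.
    have := node_part v; rewrite e => ->; by apply/fintype.subsetP => a _; rewrite inE.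
  have := E _ Ev; by rewrite -[X in mS s X _]e -[X in mS s' X _]e !mSE.
have [u uv] := child_ex l1; have Hu : s u = s' u by apply: IH; case/andP: uv => /eqP; lia.
apply: (@parent_unique (s u)); first by rewrite aut_parent.
by rewrite Hu aut_parent.
Qed.

Definition aut_of (s : 'S_n) (v : fnode) : fnode := insubd v ((val v).1, (s @: (val v).2)%SET).

Lemma aut_ofE (s : 'S_n) (Hs : treemap A ord (fun _ L => (s @: L)%SET)) v :
  flevel (aut_of s v) = flevel v /\ fset_of (aut_of s v) = (s @: fset_of v)%SET.
Proof.
rewrite /flevel /fset_of /aut_of val_insubd.
have [p1 _ _] := Hs _ _ (node_lev v) (node_part v).
by rewrite /is_nodeb /= (_ : 0 < (val v).1) ?p1 //; have := node_lev v; rewrite /flevel; lia.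
Qed.

Lemma imset_sub (s : 'S_n) (B C : {set 'I_n}) : ((s @: B)%SET \subset (s @: C)%SET) = (B \subset C).
Proof.
apply/fintype.subsetP/fintype.subsetP=> H a aB.
  by have := H (s a) (imset_f _ aB); rewrite mem_imset //; apply: perm_inj.
by case/imsetP: aB => b bB ->; apply: imset_f; apply: H.
Qed.

Lemma aut_of_inj (s : 'S_n) (Hs : treemap A ord (fun _ L => (s @: L)%SET)) : injective (aut_of s).
Proof.
move=> u v e; have [l1 s1] := aut_ofE Hs u; have [l2 s2] := aut_ofE Hs v.
apply: node_eq; first by rewrite -l1 -l2 e.
by apply: (imset_inj (@perm_inj _ s)); rewrite -s1 -s2 e.
Qed.

Lemma aut_of_AutT (s : 'S_n) (Hs : treemap A ord (fun _ L => (s @: L)%SET)) :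
  perm (aut_of_inj Hs) \in AutT A.
Proof.
rewrite inE; apply/andP; split; first (apply/andP; split).
- by apply/forallP => v; rewrite permE /fis_root (proj1 (aut_ofE Hs v)).
- apply/forallP => u; apply/forallP => v; rewrite !permE /fparent.
  by rewrite !(proj1 (aut_ofE Hs _)) !(proj2 (aut_ofE Hs _)) imset_sub.
- apply/forallP => v; rewrite permE /frank (proj2 (aut_ofE Hs v)) card_imset //.
  exact: perm_inj.
Qed.

Lemma mS_aut_of (s : 'S_n) (Hs : treemap A ord (fun _ L => (s @: L)%SET)) l L :
  lev l -> part l L -> mS (perm (aut_of_inj Hs)) l L = (s @: L)%SET.
Proof.
move=> Hl pL; have [v [<- <-]] := node_ex Hl pL.
by rewrite mSE permE (proj2 (aut_ofE Hs v)).
Qed.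

Lemma map_leaf (f g : {set 'I_n} -> {set 'I_n}) : (forall C, part 1 C -> f C = g C) ->
  map f LV = map g LV.
Proof.
move=> H; apply/eq_in_map => C; rewrite (mem_leaves n0 Hv) ?LV_top ?leqnn //.
by case/andP => /H.
Qed.

Lemma treemap_top m : treemap A ord m -> m p.+1 [set: 'I_n]%SET = [set: 'I_n]%SET.
Proof.
move=> Hm; have [_ E _] := Hm p.+1 [set: 'I_n]%SET ltac:(lia) LV_top.
by apply/eqP; rewrite eqEcard E leqnn andbT; apply/fintype.subsetP => a _; rewrite inE.
Qed.

Definition psi (w : bword) : {perm fnode} :=
  xget 1%g [set s | s \in AutT A /\ act w (map (mS s 1) LV) = LV].

Lemma psiP w : cbr T w -> psi w \in AutT A /\ act w (map (mS (psi w) 1) LV) = LV.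
Proof.
move=> Hw; apply: (@xgetPex _ 1%g [set s | s \in AutT A /\ act w (map (mS s 1) LV) = LV]).
have [s [be [Hs Hb Ew]]] := cbr_perm n0 Hv Hc Hw.
exists (perm (aut_of_inj Hs)); split; first exact: aut_of_AutT.
rewrite (map_leaf (g := fun L => (s @: L)%SET)); last by move=> C pC; apply: mS_aut_of.
have lT : lev p.+1 by lia.
rewrite (act_breq _ Ew); last by rewrite size_map (size_leaves n0 Hv) ?LV_top ?leqnn.
have := cmp_act n0 Hv Hs Hb lT LV_top; rewrite (treemap_top Hs); exact.
Qed.

Lemma psi_unique w s : s \in AutT A -> act w (map (mS s 1) LV) = LV -> psi w = s.
Proof.
move=> sA Es; have [|pA Ep] := @xgetPex _ 1%g [set s | s \in AutT A /\ act w (map (mS s 1) LV) = LV].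
  by exists s.
rewrite -/(psi w) in pA Ep; apply: aut_eq => //.
by apply: (@act_inj _ w); rewrite Es Ep.
Qed.

Lemma psi_breq w w' : cbr T w -> cbr T w' -> breq (nleaves T) w w' -> psi w = psi w'.
Proof.
move=> Hw Hw' E; have [pA Ep] := psiP Hw'; apply: psi_unique => //.
by rewrite (act_breq _ E) //; rewrite size_map (size_leaves n0 Hv) ?LV_top //= leqnn.
Qed.

Lemma AutT_mul s s' : s \in AutT A -> s' \in AutT A -> (s * s')%g \in AutT A.
Proof.
move=> sA sA'; rewrite inE; apply/andP; split; first (apply/andP; split).
- by apply/forallP => v; rewrite permM !aut_root.
- by apply/forallP => u; apply/forallP => v; rewrite !permM !aut_parent.
- by apply/forallP => v; rewrite permM /frank !aut_rank.
Qed.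

Lemma mS_mul (s s' : {perm fnode}) l L : s \in AutT A -> lev l -> part l L ->
  mS (s * s')%g l L = mS s' l (mS s l L).
Proof.
move=> sA Hl pL; have [v [<- <-]] := node_ex Hl pL.
by rewrite !mSE permM -{1}(aut_level sA v) mSE.
Qed.

Lemma psi_mul w w' : cbr T w -> cbr T w' -> psi (w ++ w') = (psi w * psi w')%g.
Proof.
move=> Hw Hw'; have [pA Ep] := psiP Hw; have [pA' Ep'] := psiP Hw'.
apply: psi_unique => //; first exact: AutT_mul.
rewrite (map_leaf (g := fun L => mS (psi w') 1 (mS (psi w) 1 L))); last first.
  by move=> C pC; apply: mS_mul.
by rewrite map_comp act_cat act_map Ep.
Qed.

(** Every inner node receives some word with the permutation dictated by the automorphism; its signs
    are free. *)
Lemma psi_surj s : s \in AutT A -> exists w, cbr T w /\ psi w = s.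
Proof.
move=> sA; have Hm := treemap_aut sA; have lT : lev p.+1 by lia.
have /choice[be Hbe] : forall lL : nat * {set 'I_n}, exists b, 1 < lL.1 <= p.+1 -> part lL.1 lL.2 ->
    wf_word (size (ord lL.1 lL.2)) b /\
    act b (map (mS s lL.1.-1) (ord lL.1 lL.2)) = ord lL.1 (mS s lL.1 lL.2).
  move=> [l L] /=; have [Hl|] := boolP (1 < l <= p.+1); last by exists [::].
  have [pL|] := boolP (part l L); last by exists [::].
  have [_ _ /(_ ltac:(lia)) /act_surj[b wb Eb]] := Hm l L ltac:(lia) pL.
  by exists b => _ _; rewrite size_map in wb.
have Hb : cmp A ord (mS s) (fun l L => be (l, L)) by move=> l L Hl pL; apply: (Hbe (l, L)).
exists (asm ord (fun l L => be (l, L)) p.+1 [set: 'I_n]%SET).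
have Hw := cmp_cbr n0 Hv Hc Hm Hb lT LV_top; split=> //; apply: psi_unique => //.
by have := cmp_act n0 Hv Hm Hb lT LV_top; rewrite (treemap_top Hm).
Qed.

Lemma mS1 l L : lev l -> part l L -> mS (1%g : {perm fnode}) l L = L.
Proof. by move=> Hl pL; have [v [<- <-]] := node_ex Hl pL; rewrite mSE perm1. Qed.

Lemma AutT1 : (1%g : {perm fnode}) \in AutT A.
Proof.
rewrite inE; apply/andP; split; first (apply/andP; split).
- by apply/forallP => v; rewrite perm1.
- by apply/forallP => u; apply/forallP => v; rewrite !perm1.
- by apply/forallP => v; rewrite perm1.
Qed.

Lemma psi_kernel w : cbr T w -> (psi w = 1%g <-> pcbr T w).
Proof.
move=> Hw; have lT : lev p.+1 by lia.
have E1 : map (mS (1%g : {perm fnode}) 1) LV = LV.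
  by rewrite (map_leaf (g := id)) ?map_id // => C pC; apply: mS1.
split=> [E|Hp].
  have [_ Ep] := psiP Hw; rewrite E E1 in Ep.
  exact: (cbr_pure n0 Hv Hc lT LV_top Hw Ep).
apply: psi_unique => //; first exact: AutT1.
by rewrite E1; apply: (pcbr_pure n0 Hv Hc lT LV_top Hp).
Qed.

End Automorphisms.

(** * The topology of complex matrices in real coordinates *)

Section Coordinates.
Local Open Scope ring_scope.
Local Open Scope classical_set_scope.
Local Open Scope quotient_scope.
Context (R : realType) (n p : nat).
Local Notation M := 'M[R[i]]_(p, n).
Local Notation Re := complex.Re.
Local Notation Im := complex.Im.

Definition co (x : M) (j : 'I_p) (a : 'I_n) (b : bool) : R :=
  if b then Re (x j a) else Im (x j a).

Definition nr (e : R) (x y : M) := forall j a b, `|co x j a b - co y j a b| < e.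

Lemma co_eq x y : (forall j a b, co x j a b = co y j a b) -> x = y.
Proof.
move=> H; apply/matrixP => j a; have := H j a true; have := H j a false; rewrite /co /=.
by case: (x j a) (y j a) => u v [u' v'] /= -> ->.
Qed.

Lemma nr_refl e x : 0 < e -> nr e x x.
Proof. by move=> e0 j a b; rewrite subrr normr0. Qed.

Lemma nr_sym e x y : nr e x y -> nr e y x.
Proof. by move=> H j a b; rewrite distrC. Qed.

Lemma nr_trans e e' x y z : nr e x y -> nr e' y z -> nr (e + e') x z.
Proof.
move=> H H' j a b; apply: le_lt_trans (ltrD (H j a b) (H' j a b)).
exact: ler_distD.
Qed.

Lemma nr_le e e' x y : e <= e' -> nr e x y -> nr e' x y.
Proof. by move=> le H j a b; apply: lt_le_trans (H j a b) le. Qed.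

Lemma co_perm (s : 'S_n) x j a b : co (col_perm s x) j a b = co x j (s a) b.
Proof. by rewrite /co mxE. Qed.

Lemma nr_perm (s : 'S_n) e x y : nr e x y -> nr e (col_perm s x) (col_perm s y).
Proof. by move=> H j a b; rewrite !co_perm. Qed.

Lemma ball_co (z w : R[i]) (e : R) : ball z e%:C%C w ->
  `|Re z - Re w| < e /\ `|Im z - Im w| < e.
Proof.
rewrite /ball /= => H; have {}H : `|z - w| < e%:C%C by exact: H.
have e0 : 0 <= e by move: (le_lt_trans (normr_ge0 _) H); rewrite ltcR => /ltW.
move: H; rewrite normc_def ltcR.
have -> : Re (z - w) = Re z - Re w by case: z w => ? ? [].
have -> : Im (z - w) = Im z - Im w by case: z w => ? ? [].
move=> H; split; rewrite -sqrtr_sqr; apply: le_lt_trans H; apply: ler_wsqrtr.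
  by rewrite lerDl sqr_ge0.
by rewrite lerDr sqr_ge0.
Qed.

Lemma co_ball (z w : R[i]) (e : R) : 0 < e -> `|Re z - Re w| < e / 2 -> `|Im z - Im w| < e / 2 ->
  ball z e%:C%C w.
Proof.
move=> e0 H1 H2; suff : `|z - w| < e%:C%C by [].
rewrite normc_def ltcR.
have -> : Re (z - w) = Re z - Re w by case: (z) (w) => ? ? [].
have -> : Im (z - w) = Im z - Im w by case: (z) (w) => ? ? [].
rewrite -(ger0_norm (ltW e0)) -sqrtr_sqr ltr_sqrt ?exprn_gt0 //.
have {}H1 : (Re z - Re w) ^+ 2 < (e / 2) ^+ 2.
  by rewrite -(real_normK (num_real (Re z - Re w))) ltrXn2r // ?divr_ge0 // ltW.
have {}H2 : (Im z - Im w) ^+ 2 < (e / 2) ^+ 2.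
  by rewrite -(real_normK (num_real (Im z - Im w))) ltrXn2r // ?divr_ge0 // ltW.
apply: lt_trans (ltrD H1 H2) _; rewrite expr_div_n -mulrDr.
by rewrite gtr_pMr ?exprn_gt0 //; lra.
Qed.

Lemma nbhs_C (z : R[i]) (U : set R[i]) : nbhs z U <->
  exists2 e : R, 0 < e & forall w, `|Re z - Re w| < e -> `|Im z - Im w| < e -> U w.
Proof.
split=> [/nbhs_ballP[[e e'] /=]|[e e0 H]].
  (* Radii of balls are complex numbers here; a positive one has vanishing imaginary part. *)
  rewrite ltcE /= => /andP[/eqP ee e0] H; subst e'.
  by exists (e / 2); [rewrite divr_gt0|move=> w H1 H2; apply: H; apply: co_ball].
apply/nbhs_ballP; exists e%:C%C; first by rewrite /= ltcR.
by move=> w /ball_co[H1 H2]; apply: H.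
Qed.

Lemma fin_eps (I : finType) (P : I -> R -> Prop) :
  (forall i e e', 0 < e' -> e' <= e -> P i e -> P i e') ->
  (forall i, exists2 e, 0 < e & P i e) -> exists2 e, 0 < e & forall i, P i e.
Proof.
move=> H E; have /choice[g Hg] : forall i, exists e, 0 < e /\ P i e.
  by move=> i; have [e e0 He] := E i; exists e.
exists (\big[Num.min/1]_i g i); first by rewrite lt_bigmin // => i _; case: (Hg i).
move=> i; have [_ Pi] := Hg i; apply: H Pi; last by rewrite bigmin_le_cond.
by rewrite lt_bigmin // => k _; case: (Hg k).
Qed.

Lemma nbhs_mx (x : M) (U : set M) : nbhs x U <->
  exists2 e : R, 0 < e & forall y, nr e x y -> U y.
Proof.
split=> [[P HP HU]|[e e0 H]].
  have [|ja|e e0 He] := @fin_eps ('I_p * 'I_n)%type (fun ja e => forall w,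
      `|Re (x ja.1 ja.2) - Re w| < e -> `|Im (x ja.1 ja.2) - Im w| < e -> P ja.1 ja.2 w).
  - by move=> i e e' _ le H w h1 h2; apply: H; apply: lt_le_trans le.
  - by have /nbhs_C[e e0 He] := HP ja.1 ja.2; exists e.
  exists e => // y Hy; apply: HU => j a.
  by apply: (He (j, a)); [exact: (Hy j a true)|exact: (Hy j a false)].
exists (fun j a => [set w | `|Re (x j a) - Re w| < e /\ `|Im (x j a) - Im w| < e]).
  by move=> j a; apply/nbhs_C; exists e.
move=> y /= Hy; apply: H => j a b; have [H1 H2] := Hy j a.
by rewrite /co; case: b.
Qed.

End Coordinates.

(** * Neighbourhoods in B and equality in its quotient *)

Section Quotient.
Local Open Scope ring_scope.
Local Open Scope classical_set_scope.
Local Open Scope quotient_scope.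
Context (R : realType) (n p : nat) (A : 'M[R[i]]_(p, n)).
Local Notation M := 'M[R[i]]_(p, n).
Local Notation B := (@Bset R n p A).
Local Notation sB := (@sB R n p A).
Local Notation Bbar := (@Bbar R n p A).
Local Notation q := (\pi_Bbar : sB -> Bbar).

Lemma nbhs_sB (x : sB) (U : set sB) : nbhs x U <->
  exists2 e : R, 0 < e & forall y : sB, nr e (set_val x) (set_val y) -> U y.
Proof.
split.
  case=> V [[V' oV' EV] Vx VU].
  have : nbhs (set_val x : M) V' by apply: open_nbhs_nbhs; split => //; move: Vx; rewrite -EV.
  by case/nbhs_mx=> e e0 He; exists e => // y Hy; apply: VU; rewrite -EV; apply: He.
case=> e e0 H.
have : nbhs (set_val x : M) [set y | nr e (set_val x) y] by apply/nbhs_mx; exists e.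
rewrite nbhsE => -[V' [oV' Vx] VU].
exists (set_val @^-1` V'); split => //; first by exists V'.
by move=> y /VU; apply: H.
Qed.

Lemma q_eq (x y : sB) : q x = q y <-> exists s : 'S_n, set_val y = col_perm s (set_val x).
Proof.
have E := @eqmodP _ (@orbrel_equiv R n p A) x y.
split=> [/E/asboolP //|H]; exact/E/asboolP.
Qed.

Lemma q_surj (u : Bbar) : exists x, q x = u.
Proof. by exists (repr u); rewrite reprK. Qed.

End Quotient.

(** * Sheets, discrete lifts and continuous lifts *)

Section Covering.
Local Open Scope ring_scope.
Local Open Scope classical_set_scope.
Local Open Scope quotient_scope.
Context (R : realType) (n p : nat) (A : 'M[R[i]]_(p, n)) (Q : @sB R n p A).
Local Notation M := 'M[R[i]]_(p, n).
Local Notation B := (@Bset R n p A).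
Local Notation sB := (@sB R n p A).
Local Notation Bbar := (@Bbar R n p A).
Local Notation sim := (sim A).

(* Junk value off [B]: the class of [Q]. *)
Definition qv (x : M) : Bbar := \pi_Bbar (insubd Q x : sB).

Lemma qvE (x : sB) : qv (set_val x) = \pi_Bbar x.
Proof. by rewrite /qv valKd. Qed.

Lemma liftB x : B x -> exists y : sB, set_val y = x.
Proof. by move=> Bx; exists (SigSub (mem_set Bx)). Qed.

Lemma valB (x : sB) : B (set_val x). Proof. exact: set_mem (valP x). Qed.

Lemma qv_eq x y : B x -> B y -> qv x = qv y <-> exists s : 'S_n, y = col_perm s x.
Proof. by move=> /liftB[x' <-] /liftB[y' <-]; rewrite !qvE q_eq. Qed.

Lemma qv_surj u : exists2 x, B x & qv x = u.
Proof. by have [x <-] := q_surj u; exists (set_val x); [exact: valB|exact: qvE]. Qed.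

(** The partitions are visible in every point of [B], by descent from the top level, where all
    indices are related: at each row the inequality clause separates what the equality clause does
    not join. *)
Lemma simB x l a b : B x -> sim l.+1 a b <-> forall j : 'I_p, (l <= j)%N -> x j a = x j b.
Proof.
move=> Bx; split=> [ab j lj|].
  by have [_ [H _]] := Bx j; apply: H; apply: sim_mono ab.
have [d] := ubnP (p - l); elim: d l => // d IH l Hd H.
have [pl|lp] := leqP p l; first by apply: sim_mono (sim_top A a b).
have ab : sim l.+2 a b by apply: IH => [|j lj]; [lia|apply: H; lia].
apply/negPn/negP => nab; have [_ [_ /(_ a b nab ab)]] := Bx (Ordinal lp).
by rewrite H // eqxx.
Qed.

Definition adm (s : 'S_n) := forall l a b, sim l.+1 (s a) (s b) = sim l.+1 a b.

(** A point and its translate both determine the partitions by [simB], so [s] must preserve them. *)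
Lemma admP (s : 'S_n) x : B x -> B (col_perm s x) -> adm s.
Proof.
move=> Bx Bs l a b; apply/idP/idP.
  by move/(simB _ _ _ Bx) => H; apply/(simB _ _ _ Bs) => j lj; rewrite !mxE; apply: H.
by move/(simB _ _ _ Bs) => H; apply/(simB _ _ _ Bx) => j /H; rewrite !mxE.
Qed.

Lemma adm_B (s : 'S_n) x : adm s -> B x -> B (col_perm s x).
Proof.
move=> As Bx j; have [H0 [H1 H2]] := Bx j; split; [|split].
- rewrite -[RHS]H0 [RHS](reindex_inj (@perm_inj _ s)) /=.
  by apply: eq_bigr => a _; rewrite mxE.
- by move=> a b ab; rewrite !mxE; apply: H1; rewrite As.
- by move=> a b ab ab'; rewrite !mxE; apply: H2; rewrite As.
Qed.

(** Fixing one point means moving each index within its part of the finest partition, and all points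
    of [B] are constant on these parts. *)
Lemma fix_all (s : 'S_n) c y : B c -> col_perm s c = c -> B y -> col_perm s y = y.
Proof.
move=> Bc E By; apply/matrixP => j a; rewrite mxE.
have H : sim 1 (s a) a by apply/(simB _ _ _ Bc) => i _; rewrite -[in RHS]E mxE.
by apply: (proj1 (simB _ _ _ By) H).
Qed.

Lemma adm_mul (s t : 'S_n) : adm s -> adm t -> adm (s * t)%g.
Proof. by move=> As At l a b; rewrite !permM At As. Qed.

Lemma col_permK (s : 'S_n) (x : M) : col_perm s^-1%g (col_perm s x) = x.
Proof. by rewrite -col_permM mulVg col_perm1. Qed.

Lemma qv_adm (s : 'S_n) x : adm s -> B x -> qv (col_perm s x) = qv x.
Proof. by move=> As Bx; apply/esym/(qv_eq Bx (adm_B As Bx)); exists s. Qed.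

(* The clause on permutations separates the translates of the sheet; the last clause keeps
   the ball inside the star of the centre. *)
Definition good (c : M) (r : R) := [/\ B c, 0 < r,
  forall s : 'S_n, nr (6 * r) (col_perm s c) c -> col_perm s c = c &
  forall y j a b b', nr r c y -> co c j a b' < co c j b b' -> co y j a b' < co y j b b'].

Lemma good_ex c : B c -> exists r, good c r.
Proof.
move=> Bc.
have [|s|r1 r10 H1] := @fin_eps R 'S_n (fun s r => nr (6 * r) (col_perm s c) c -> col_perm s c = c).
- by move=> s e e' _ le H N; apply: H; apply: nr_le N; rewrite ler_pM2l.
- have [->|E] := eqVneq (col_perm s c) c; first by exists 1.
  have [j [a [b Hab]]] : exists j a b, co (col_perm s c) j a b <> co c j a b.
    apply: contrapT => N; case/eqP: E; apply: co_eq => j a b; apply: contrapT => N'.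
    by apply: N; exists j, a, b.
  (* With this radius the bound [6 * r] is exactly the displacement of one coordinate, which is not
     below itself, so the premise fails. *)
  exists (`|co (col_perm s c) j a b - co c j a b| / 6).
    by rewrite divr_gt0 // normr_gt0 subr_eq0; apply/eqP.
  by move=> /(_ j a b); rewrite mulrC divfK ?ltxx.
have [|[[[j a] b] b']|r2 r20 H2] := @fin_eps R ('I_p * 'I_n * 'I_n * bool)%type (fun u r =>
   forall y, nr r c y -> co c u.1.1.1 u.1.1.2 u.2 < co c u.1.1.1 u.1.2 u.2 ->
     co y u.1.1.1 u.1.1.2 u.2 < co y u.1.1.1 u.1.2 u.2).
- by move=> u e e' _ le H y N; apply: H; apply: nr_le N.
- move=> /=; have [lt|] := ltP (co c j a b') (co c j b b'); last by exists 1.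
  (* Half the gap: each of the two coordinates moves by less than this. *)
  exists ((co c j b b' - co c j a b') / 2) => [|y N _]; first by rewrite divr_gt0 ?subr_gt0.
  have := N j a b'; have := N j b b'; rewrite !ltr_norml => /andP[] ? ? /andP[] ? ?; lra.
exists (Num.min r1 r2); split=> //; first by rewrite lt_min r10 r20.
- by move=> s N; apply: H1; apply: nr_le N; rewrite ler_pM2l // ge_min lexx.
- move=> y j a b b' N; apply: (H2 (j, a, b, b')) => /=; apply: nr_le N.
  by rewrite ge_min lexx orbT.
Qed.

Lemma good_perm (s : 'S_n) c r : adm s -> good c r -> good (col_perm s c) r.
Proof.
move=> As [Bc r0 H1 H2]; split=> //; first exact: adm_B.
- move=> t N; have := nr_perm s^-1%g N; rewrite col_permK -!col_permM => /H1 E.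
  by rewrite -[in RHS]E -!col_permM !mulgA mulgV mul1g.
- move=> y j a b b' N; rewrite !co_perm => lt.
  have := H2 (col_perm s^-1%g y) j (s a) (s b) b'; rewrite !co_perm !permK; apply=> //.
  by have := nr_perm s^-1%g N; rewrite col_permK.
Qed.

(** The translate of [c] is joined to [c] through [y'], [c'] and [x] by four distances below [r],
    within the bound [6 * r] of [good]. Hence [s] fixes [c], and by [fix_all] also [y]. *)
Lemma sheet_uniq_le c r c' r' x y y' : good c r -> good c' r' -> r' <= r ->
  nr r c x -> nr r' c' x -> nr r c y -> nr r' c' y' -> B y -> B y' -> qv y = qv y' -> y = y'.
Proof.
move=> [Bc r0 H1 _] G' le cx cx' cy cy' By By' /(qv_eq By By')[s E].
have N : nr (6 * r) (col_perm s c) c.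
  have a1 := nr_perm s cy; rewrite -E in a1.
  have a2 := nr_trans a1 (nr_sym (nr_le le cy')).
  have a3 := nr_trans (nr_trans a2 (nr_le le cx')) (nr_sym cx).
  by apply: nr_le a3; lra.
by rewrite E (fix_all Bc (H1 s N) By).
Qed.

Lemma sheet_uniq c r c' r' x y y' : good c r -> good c' r' ->
  nr r c x -> nr r' c' x -> nr r c y -> nr r' c' y' -> B y -> B y' -> qv y = qv y' -> y = y'.
Proof.
move=> G G' cx cx' cy cy' By By' E; have [le|/ltW le] := leP r' r.
  exact: (sheet_uniq_le G G' le cx cx' cy cy' By By' E).
by apply/esym; apply: (sheet_uniq_le G' G le cx' cx cy' cy By' By (esym E)).
Qed.

Definition sheet c r : set Bbar := [set u | exists y, [/\ B y, nr r c y & qv y = u]].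

Lemma sheet_perm (s : 'S_n) c r : adm s -> sheet c r `<=` sheet (col_perm s c) r.
Proof.
move=> As u [z [Bz cz <-]]; exists (col_perm s z).
by split; [exact: adm_B|exact: nr_perm|exact: qv_adm].
Qed.

Lemma sheet_at c r x : good c r -> B x -> sheet c r (qv x) ->
  exists c', [/\ good c' r, nr r c' x & sheet c r `<=` sheet c' r].
Proof.
move=> G Bx [y [By cy /(qv_eq By Bx)[s E]]].
have As : adm s by apply: (@admP s y) => //; rewrite -E.
exists (col_perm s c); split; first exact: good_perm.
  by rewrite E; apply: nr_perm.
exact: sheet_perm.
Qed.

(** The point near [c] over the class of [y] is [y] itself, since the balls around [c] and [d] share
    the point [x]. *)
Lemma follow c r d r' x y : good c r -> good d r' -> nr r c x -> nr r' d x -> nr r' d y ->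
  B y -> sheet c r (qv y) -> nr r c y.
Proof.
move=> G G' cx dx dy By [z [Bz cz E]].
by rewrite -(sheet_uniq G G' cx dx cz dy Bz By E).
Qed.

(** A set is open in the quotient when its preimage is; a point of the preimage is a translate of a
    point near [c], and permutations act by isometries. *)
Lemma nbhs_sheet c r x : B x -> 0 < r -> nr r c x -> nbhs (qv x) (sheet c r).
Proof.
move=> Bx r0 cx.
suff H : open (sheet c r) by apply: open_nbhs_nbhs; split=> //; exists x.
suff H : @open sB (\pi_Bbar @^-1` sheet c r) by exact: H.
rewrite openE => y /= [z [Bz cz]]; rewrite -qvE => E; apply/nbhs_sB.
have [s Es] : exists s : 'S_n, z = col_perm s (set_val y) by apply/qv_eq => //; apply: valB.
have As : adm s by apply: (@admP s (set_val y)); [exact: valB|rewrite -Es].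
have [|[[j a] b]|e e0 He] := @fin_eps R ('I_p * 'I_n * bool)%type
  (fun u e => `|co c u.1.1 u.1.2 u.2 - co z u.1.1 u.1.2 u.2| + e <= r).
- by move=> u e e' _ le; apply: le_trans; rewrite lerD2l.
- exists (r - `|co c j a b - co z j a b|); first by rewrite subr_gt0; apply: cz.
  by rewrite /= addrC subrK.
exists e => // y' N; rewrite /preimage /= -qvE; exists (col_perm s (set_val y')).
split; [by apply: adm_B => //; apply: valB| |by apply: qv_adm => //; apply: valB].
have N' := nr_perm s N; rewrite -Es in N'.
move=> j a b; apply: lt_le_trans (He (j, a, b)).
by apply: le_lt_trans (ler_distD (co z j a b) _ _) _; rewrite ltrD2l; apply: N'.
Qed.

Lemma qv_cvg (Z : Type) (F : set_system Z) (FF : Filter F) (g : Z -> M) x : B x ->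
  (forall z, B (g z)) ->
  (forall e, 0 < e -> F [set z | nr e x (g z)]) -> (fun z => qv (g z)) @ F --> qv x.
Proof.
move=> Bx Bg H; have [x' Ex] := liftB Bx; rewrite -Ex qvE.
have /choice[g' Eg] : forall z, exists y : sB, set_val y = g z by move=> z; apply: liftB.
have -> : (fun z => qv (g z)) = \pi_Bbar \o g' by apply/funext => z /=; rewrite -Eg qvE.
apply: (@cvg_comp _ _ _ g' _ _ (nbhs x')); last exact: (@pi_continuous _ Bbar x').
move=> V /nbhs_sB[e e0 He]; apply: (@filterS _ F FF _ _ _ (H e e0)) => z /= N.
by apply: He; rewrite Ex Eg.
Qed.

Lemma path_nbhs (f : R -> Bbar) s (V : set Bbar) : {within `[0, 1], continuous f} ->
  0 <= s <= 1 -> nbhs (f s) V ->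
  exists2 e : R, 0 < e & forall s' : R, 0 <= s' <= 1 -> `|s' - s| < e -> V (f s').
Proof.
move=> /subspace_continuousP cf Hs HV.
have /cf/(_ V HV) : `[0, 1]%classic s by rewrite /= in_itv.
rewrite /nbhs /= /within /= => /nbhs_ballP[e e0 He]; exists e => // s' Hs' N.
by apply: He; [rewrite /ball /= distrC|rewrite /= in_itv].
Qed.

Lemma square_nbhs (H : R * R -> Bbar) s t (V : set Bbar) :
  {within `[0, 1] `*` `[0, 1], continuous H} -> 0 <= s <= 1 -> 0 <= t <= 1 -> nbhs (H (s, t)) V ->
  exists2 e : R, 0 < e & forall s' t' : R, 0 <= s' <= 1 -> 0 <= t' <= 1 ->
    `|s' - s| < e -> `|t' - t| < e -> V (H (s', t')).
Proof.
move=> /subspace_continuousP cf Hs Ht HV.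
have D : (`[0, 1] `*` `[0, 1])%classic (s, t) by split; rewrite /= in_itv.
have K : nbhs ((s, t) : R * R) [set x | (`[0, 1] `*` `[0, 1])%classic x -> V (H x)] := cf _ D V HV.
case/nbhs_ballP: K => e e0 He; exists e => // s' t' Hs' Ht' N N'.
by apply: He; split=> /=; rewrite ?in_itv //= /ball /= distrC.
Qed.

Lemma sheet_cover (u : Bbar) : exists c r, good c r /\ nbhs u (sheet c r).
Proof.
have [x Bx <-] := qv_surj u; have [r G] := good_ex Bx; exists x, r; split=> //.
by have [_ r0 _ _] := G; apply: nbhs_sheet => //; apply: nr_refl.
Qed.

Definition covered (f : R -> Bbar) a b := exists c r, good c r /\ forall s, a <= s <= b -> sheet c r (f s).

Lemma path_cover (f : R -> Bbar) : {within `[0, 1], continuous f} ->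
  exists2 N : nat, (0 < N)%N & forall i, (i < N)%N -> covered f (tm R N i) (tm R N i.+1).
Proof.
move=> cf; have [|N N0 HN] := @lebesgue1 R (M * R)%type (fun cr s => good cr.1 cr.2 /\ sheet cr.1 cr.2 (f s)).
  move=> s Hs; have [c [r [G HU]]] := sheet_cover (f s).
  by have [e e0 He] := path_nbhs cf Hs HU; exists e, (c, r); split=> // s' Hs' Ns; split=> //; apply: He.
exists N => // i iN.
have N0' : 0 < N%:R :> R by rewrite ltr0n.
have Ei : tm R N i.+1 = tm R N i + N%:R^-1 by rewrite /tm -natr1 mulrDl mul1r.
have t0 : 0 <= tm R N i by rewrite -(tm0 R N) tm_le.
have t1 : tm R N i.+1 <= 1 by rewrite -(tmM R N0) tm_le.
have iv : 0 < N%:R^-1 :> R by rewrite invr_gt0.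
have [|[c r] Hc] := HN (tm R N i); first by lra.
exists c, r; split=> [|s Hs]; last first.
  by apply: (proj2 (Hc s _ _)); [lra|rewrite ger0_norm; lra].
by apply: (proj1 (Hc (tm R N i) _ _)); [lra|rewrite subrr normr0; lra].
Qed.

Lemma square_cover (H : R * R -> Bbar) : {within `[0, 1] `*` `[0, 1], continuous H} ->
  exists2 N : nat, (0 < N)%N & forall i k, (i < N)%N -> (k < N)%N -> exists c r, good c r /\
    forall s t, tm R N i <= s <= tm R N i.+1 -> tm R N k <= t <= tm R N k.+1 -> sheet c r (H (s, t)).
Proof.
move=> cf; have [|N N0 HN] := @lebesgue2 R (M * R)%type
    (fun cr s t => good cr.1 cr.2 /\ sheet cr.1 cr.2 (H (s, t))).
  move=> s t Hs Ht; have [c [r [G HU]]] := sheet_cover (H (s, t)).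
  have [e e0 He] := square_nbhs cf Hs Ht HU.
  by exists e, (c, r); split=> // s' t' Hs' Ht' Ns Nt; split=> //; apply: He.
exists N => // i k iN kN.
have N0' : 0 < N%:R :> R by rewrite ltr0n.
have Ei m : tm R N m.+1 = tm R N m + N%:R^-1 by rewrite /tm -natr1 mulrDl mul1r.
have t0 m : 0 <= tm R N m by rewrite -(tm0 R N) tm_le.
have t1 m : (m < N)%N -> tm R N m.+1 <= 1 by move=> mN; rewrite -(tmM R N0) tm_le.
have iv : 0 < N%:R^-1 :> R by rewrite invr_gt0.
have [si sk] := (t0 i, t0 k); have [ui uk] := (t1 i iN, t1 k kN); have [ei ek] := (Ei i, Ei k).
have [| |[c r] Hc] := HN (tm R N i) (tm R N k); [by lra|by lra|].
exists c, r; split=> [|s t Hs Ht]; last first.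
  by apply: (proj2 (Hc s t _ _ _ _)); [lra|lra|rewrite ger0_norm; lra|rewrite ger0_norm; lra].
by apply: (proj1 (Hc (tm R N i) (tm R N k) _ _ _ _)); [lra|lra|rewrite subrr normr0; lra..].
Qed.

(* A lift of [f] at the nodes of a subdivision such that consecutive points lie on a common sheet
   that [f] does not leave in between. *)
Definition Disc (f : R -> Bbar) (N : nat) (x : nat -> M) :=
  (forall i, (i <= N)%N -> B (x i) /\ qv (x i) = f (tm R N i)) /\
  (forall i, (i < N)%N -> exists c r, [/\ good c r, nr r c (x i), nr r c (x i.+1) &
     forall s, tm R N i <= s <= tm R N i.+1 -> sheet c r (f s)]).

(** [sheet_at] moves the covering sheet by a permutation to one that contains the present point, and
    the next point is taken on it. *)
Lemma disc_ex f N x0 : (0 < N)%N -> (forall i, (i < N)%N -> covered f (tm R N i) (tm R N i.+1)) ->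
  B x0 -> qv x0 = f 0 -> exists2 x, Disc f N x & x 0%N = x0.
Proof.
move=> N0 Hc Bx0 E0.
suff H m : (m <= N)%N -> exists x, [/\ x 0%N = x0,
  forall i, (i <= m)%N -> B (x i) /\ qv (x i) = f (tm R N i) &
  forall i, (i < m)%N -> exists c r, [/\ good c r, nr r c (x i), nr r c (x i.+1) &
     forall s, tm R N i <= s <= tm R N i.+1 -> sheet c r (f s)]].
  by have [x [x1 x2 x3]] := H N (leqnn _); exists x.
elim: m => [_|m IH mN].
  by exists (fun _ => x0); split=> // i; rewrite leqn0 => /eqP->; rewrite tm0.
have [x [x1 x2 x3]] := IH (ltnW mN).
have [Bm Em] := x2 m (leqnn m).
have tl : tm R N m <= tm R N m.+1 by apply: tm_le.
have [c [r [G HU]]] := Hc m mN.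
have [|c' [G' cx sub]] := sheet_at G Bm; first by rewrite Em; apply: HU; lra.
have [y [By cy Ey]] : sheet c' r (f (tm R N m.+1)) by apply/sub/HU; lra.
exists (fun i => if (i <= m)%N then x i else y); split=> //.
- move=> i; rewrite leq_eqVlt ltnS => /orP[/eqP->|im]; last by rewrite im; apply: x2.
  by rewrite ltnn.
- move=> i im1; have [->|im] : i = m \/ (i < m)%N by lia.
    by rewrite leqnn ltnn; exists c', r; split=> // s /HU/sub.
  by rewrite (ltnW im) im; apply: x3.
Qed.

Lemma disc_unique f N x y : Disc f N x -> Disc f N y -> x 0%N = y 0%N ->
  forall i, (i <= N)%N -> x i = y i.
Proof.
move=> [x1 x2] [y1 y2] E0; elim=> // i IH iN.
have [c [r [G cx cx' _]]] := x2 i iN; have [d [r' [G' dy dy' _]]] := y2 i iN.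
have [Bx Ex] := x1 i.+1 iN; have [By Ey] := y1 i.+1 iN.
rewrite -IH ?(ltnW iN) // in dy.
by apply: (sheet_uniq G G' cx dy cx' dy' Bx By); rewrite Ex Ey.
Qed.

Lemma tm_mulD N K i r : (0 < K)%N -> (r <= K)%N -> tm R N i <= tm R (N * K) (i * K + r) <= tm R N i.+1.
Proof.
move=> K0 rK; rewrite -(@tm_mul R N K i K0) -(@tm_mul R N K i.+1 K0).
by rewrite !tm_le //; lia.
Qed.

(** A finer lift from the same start stays near the centre of each old cell by [follow]; on that
    sheet uniqueness forces it through the old nodes. *)
Lemma disc_refine f N K x : (0 < N)%N -> (0 < K)%N -> Disc f N x -> exists x',
  [/\ Disc f (N * K) x', (forall i, (i <= N)%N -> x' (i * K)%N = x i) &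
   forall i, (i < N)%N -> exists c r, good c r /\ forall k, (k <= K)%N -> nr r c (x' (i * K + k)%N)].
Proof.
move=> N0 K0 D; have [d1 d2] := D; have [B0 E0] := d1 0%N isT; rewrite tm0 in E0.
have [||y Dy Ey] := @disc_ex f (N * K) (x 0%N) _ _ B0 E0; first by rewrite muln_gt0 N0.
  move=> m mN; have iN : (m %/ K < N)%N by rewrite ltn_divLR.
  have [c [r [G _ _ HU]]] := d2 _ iN; exists c, r; split=> // s Hs; apply: HU.
  have lt := ltn_pmod m K0.
  have := @tm_mulD N K (m %/ K) (m %% K) K0 (ltnW lt); rewrite -divn_eq.
  have := @tm_mulD N K (m %/ K) (m %% K).+1 K0 lt; rewrite addnS -divn_eq.
  by move: Hs => /andP[] ? ? /andP[] ? ? /andP[] ? ?; lra.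
have [y1 y2] := Dy.
have cell i c r : (i < N)%N -> y (i * K)%N = x i -> good c r -> nr r c (x i) ->
   (forall s, tm R N i <= s <= tm R N i.+1 -> sheet c r (f s)) ->
   forall k, (k <= K)%N -> nr r c (y (i * K + k)%N).
  move=> iN E G cx HU; elim=> [_|k IH kK]; first by rewrite addn0 E.
  have lt : (i * K + k < N * K)%N by nia.
  have [d [r' [G' dy dy' _]]] := y2 _ lt; have [By Eb] := y1 _ lt.
  rewrite addnS; apply: (follow G G' (IH (ltnW kK)) dy dy' By); rewrite Eb; apply: HU.
  by rewrite -addnS; apply: tm_mulD.
have eq i : (i <= N)%N -> y (i * K)%N = x i.
  elim: i => [|i IH] iN; first by rewrite mul0n.
  have [c [r [G cx cx' HU]]] := d2 i iN.
  have H := cell i c r iN (IH (ltnW iN)) G cx HU K (leqnn K).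
  have e : (i * K + K = i.+1 * K)%N by rewrite mulSn addnC.
  have lt : (i.+1 * K <= N * K)%N by rewrite leq_mul2r iN orbT.
  rewrite e in H; have [By Eb] := y1 _ lt; have [Bx Ex] := d1 _ iN.
  apply: (sheet_uniq G G H H H cx' By Bx).
  by rewrite Eb Ex tm_mul.
exists y; split=> // i iN; have [c [r [G cx cx' HU]]] := d2 i iN.
by exists c, r; split=> //; apply: cell => //; apply: eq; apply: ltnW.
Qed.

(* Moving a discrete lift across one row of cells of a homotopy. *)
Lemma disc_row f g N x : (0 < N)%N -> Disc f N x ->
  (forall i, (i < N)%N -> exists c r, good c r /\
     forall s, tm R N i <= s <= tm R N i.+1 -> sheet c r (f s) /\ sheet c r (g s)) ->
  exists2 y, Disc g N y & forall i, (i < N)%N -> exists c r, [/\ good c r,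
    nr r c (x i), nr r c (x i.+1), nr r c (y i) & nr r c (y i.+1)].
Proof.
move=> N0 [d1 d2] Hc.
have tl i : tm R N i <= tm R N i.+1 by apply: tm_le.
have cells i : (i < N)%N -> exists c r, [/\ good c r, nr r c (x i), nr r c (x i.+1) &
    forall s, tm R N i <= s <= tm R N i.+1 -> sheet c r (g s)].
  move=> iN; have [c [r [G HU]]] := Hc i iN; have [Bx Ex] := d1 i (ltnW iN).
  have tli := tl i.
  have [|c' [G' cx sub]] := sheet_at G Bx; first by rewrite Ex; apply: (proj1 (HU _ _)); lra.
  exists c', r; split=> // [|s /HU[_ /sub] //].
  have [d [r' [G2 dx dx' _]]] := d2 i iN; have [Bx' Ex'] := d1 i.+1 iN.
  by apply: (follow G' G2 cx dx dx' Bx'); rewrite Ex'; apply/sub/(proj1 (HU _ _)); lra.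
have adj i : (i <= N)%N -> exists y, [/\ B y, qv y = g (tm R N i) &
    exists c r, [/\ good c r, nr r c (x i) & nr r c y]].
  move=> iN; have tli := tl i; have [lt|] := ltnP i N.
    have [c [r [G cx _ HU]]] := cells i lt.
    have [|y [By cy Ey]] := HU (tm R N i); first by lra.
    by exists y; split=> //; exists c, r.
  move=> Ni; have e : i = N.-1.+1 by lia.
  have lt : (N.-1 < N)%N by lia.
  have [c [r [G _ cx HU]]] := cells _ lt; rewrite -e in cx.
  have tln := tl N.-1.
  have [|y [By cy Ey]] := HU (tm R N i); first by rewrite e; lra.
  by exists y; split=> //; exists c, r.
have /choice[y Hy] : forall i, exists y, (i <= N)%N -> [/\ B y, qv y = g (tm R N i) &
    exists c r, [/\ good c r, nr r c (x i) & nr r c y]].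
  move=> i; have [iN|] := leqP i N; last by exists 0.
  by have [y Hy] := adj i iN; exists y.
have cell i : (i < N)%N -> exists c r, [/\ good c r, nr r c (x i), nr r c (x i.+1),
    nr r c (y i) /\ nr r c (y i.+1) & forall s, tm R N i <= s <= tm R N i.+1 -> sheet c r (g s)].
  move=> iN; have [c [r [G cx cx' HU]]] := cells i iN; exists c, r; split=> //.
  have tli := tl i.
  have [By Ey [d [r' [G' dx dy]]]] := Hy i (ltnW iN).
  have [By' Ey' [e [r2 [G2 ex ey]]]] := Hy i.+1 iN.
  split; first by apply: (follow G G' cx dx dy By); rewrite Ey; apply: HU; lra.
  by apply: (follow G G2 cx' ex ey By'); rewrite Ey'; apply: HU; lra.
exists y; last by move=> i /cell[c [r [G a b [d e] _]]]; exists c, r.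
split; first by move=> i /Hy[].
by move=> i /cell[c [r [G a b [d e] HU]]]; exists c, r.
Qed.

Lemma disc_homotopy (H : R * R -> Bbar) x0 : {within `[0, 1] `*` `[0, 1], continuous H} ->
  (forall t, 0 <= t <= 1 -> H (0, t) = H (0, 0) /\ H (1, t) = H (1, 0)) ->
  B x0 -> qv x0 = H (0, 0) ->
  exists N (x : nat -> nat -> M), [/\ (0 < N)%N,
    forall k, (k <= N)%N -> Disc (fun s => H (s, tm R N k)) N (x k),
    forall k, (k <= N)%N -> x k 0%N = x0 /\ x k N = x 0%N N &
    forall k i, (k < N)%N -> (i < N)%N -> exists c r, [/\ good c r,
      nr r c (x k i), nr r c (x k i.+1), nr r c (x k.+1 i) & nr r c (x k.+1 i.+1)]].
Proof.
move=> cH ends Bx0 Ex0; have [N N0 HN] := square_cover cH.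
have tl i : tm R N i <= tm R N i.+1 by apply: tm_le.
have t0 i : 0 <= tm R N i by rewrite -(tm0 R N) tm_le.
have t1 i : (i <= N)%N -> tm R N i <= 1 by move=> iN; rewrite -(tmM R N0) tm_le.
suff S m : (m <= N)%N -> exists x : nat -> nat -> M, [/\
    forall k, (k <= m)%N -> Disc (fun s => H (s, tm R N k)) N (x k),
    forall k, (k <= m)%N -> x k 0%N = x0 /\ x k N = x 0%N N &
    forall k i, (k < m)%N -> (i < N)%N -> exists c r, [/\ good c r,
      nr r c (x k i), nr r c (x k i.+1), nr r c (x k.+1 i) & nr r c (x k.+1 i.+1)]].
  by have [x [? ? ?]] := S N (leqnn N); exists N, x.
elim: m => [_|m IH mN].
  have [|||x Dx E] := @disc_ex (fun s => H (s, 0)) N x0 N0 => //.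
    move=> i iN; have [c [r [G HU]]] := HN i 0%N iN N0; exists c, r; split=> // s Hs.
    by apply: HU => //; have := t0 1%N; rewrite tm0 => ->; rewrite lexx.
  exists (fun _ => x); split=> // k; rewrite leqn0 => /eqP->.
  by rewrite tm0.
have [x [x1 x2 x3]] := IH (ltnW mN).
have [|y Dy Hy] := @disc_row _ (fun s => H (s, tm R N m.+1)) N (x m) N0 (x1 m (leqnn m)).
  move=> i iN; have [c [r [G HU]]] := HN i m iN mN; exists c, r; split=> // s Hs.
  by have tlm := tl m; split; apply: HU => //; lra.
(* The homotopy is constant on both vertical sides, so the ends of the new row have the same classes
   as those of the old row, and they lie on a common sheet. *)
have eq i : (i = 0 \/ i = N)%N -> y i = x m i.
  move=> Hi; have iN : (i <= N)%N by lia.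
  have [By Ey] := proj1 Dy i iN; have [Bx Ex] := proj1 (x1 m (leqnn m)) i iN.
  have [c [r [G cx cy]]] : exists c r, [/\ good c r, nr r c (x m i) & nr r c (y i)].
    case: Hi => ->; first by have [c [r [G a b d e]]] := Hy 0%N N0; exists c, r.
    have lt : (N.-1 < N)%N by lia.
    have [c [r [G a b d e]]] := Hy _ lt; exists c, r.
    by rewrite prednK // in b e.
  apply: (sheet_uniq G G cx cx cy cx By Bx); rewrite Ey Ex.
  have [h1 h2] := (t1 m (ltnW mN), t1 m.+1 mN); have [g1 g2] := (t0 m, t0 m.+1).
  have [|a b] := ends (tm R N m); first by lra.
  have [|a' b'] := ends (tm R N m.+1); first by lra.
  by case: Hi => ->; rewrite ?tm0 ?tmM ?a ?b ?a' ?b'.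
exists (fun k => if (k <= m)%N then x k else y); split.
- move=> k; rewrite leq_eqVlt ltnS => /orP[/eqP->|km]; last by rewrite km; apply: x1.
  by rewrite ltnn.
- move=> k; rewrite leq_eqVlt ltnS => /orP[/eqP->|km]; last by rewrite km; apply: x2.
  by rewrite ltnn leq0n !eq; [exact: x2|right|left].
- move=> k i km1 iN; have [->|km] : k = m \/ (k < m)%N by lia.
    by rewrite leqnn ltnn; apply: Hy.
  by rewrite (ltnW km) km; apply: x3.
Qed.

Lemma nr_open r c (y : M) : nr r c y -> exists2 e : R, 0 < e & forall z, nr e y z -> nr r c z.
Proof.
move=> cy; have [|[[j a] b]|e e0 He] := @fin_eps R ('I_p * 'I_n * bool)%type
  (fun u e => `|co c u.1.1 u.1.2 u.2 - co y u.1.1 u.1.2 u.2| + e <= r).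
- by move=> u e e' _ le; apply: le_trans; rewrite lerD2l.
- exists (r - `|co c j a b - co y j a b|); first by rewrite subr_gt0; apply: cy.
  by rewrite /= addrC subrK.
exists e => // z N j a b; apply: lt_le_trans (He (j, a, b)).
by apply: le_lt_trans (ler_distD (co y j a b) _ _) _; rewrite ltrD2l; apply: N.
Qed.

Definition ccont (T : topologicalType) (F : T -> M) :=
  forall j a b, continuous (fun s => co (F s) j a b).

Lemma ccont_nr (T : topologicalType) (F : T -> M) s (e : R) : ccont F -> 0 < e ->
  nbhs s [set s' | nr e (F s) (F s')].
Proof.
move=> cF e0; apply: filterS (_ : nbhs s [set s' | forall u : 'I_p * 'I_n * bool,
    `|co (F s) u.1.1 u.1.2 u.2 - co (F s') u.1.1 u.1.2 u.2| < e]).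
  by move=> s' H j a b; exact: (H (j, a, b)).
apply: filter_forall => -[[j a] b] /=.
by have /cvgrPdist_lt := cF j a b s; apply.
Qed.

(** The link from continuous lifts to words: pieces short enough to stay near one centre form a
    discrete lift and make the node configurations [fine]. *)
Lemma lift_disc (f : R -> Bbar) (F : R -> M) : ccont F -> (forall s, 0 <= s <= 1 -> B (F s)) ->
  (forall s, 0 <= s <= 1 -> qv (F s) = f s) -> exists N, [/\ (0 < N)%N, Disc f N (fun i => F (tm R N i)) &
  forall i, (i < N)%N -> exists c r, good c r /\ forall s, tm R N i <= s <= tm R N i.+1 -> nr r c (F s)].
Proof.
move=> cF BF qF.
have [|N N0 HN] := @lebesgue1 R (M * R)%type (fun cr s => good cr.1 cr.2 /\ nr cr.2 cr.1 (F s)).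
  move=> s Hs; have [r G] := good_ex (BF s Hs); have [_ r0 _ _] := G.
  have /nbhs_ballP[e e0 He] := @ccont_nr _ F s r cF r0.
  by exists e, (F s, r); split=> // s' _ Ns; split=> //; apply: He; rewrite /ball /= distrC.
have N0' : 0 < N%:R :> R by rewrite ltr0n.
have Ei i : tm R N i.+1 = tm R N i + N%:R^-1 by rewrite /tm -natr1 mulrDl mul1r.
have t0 i : 0 <= tm R N i by rewrite -(tm0 R N) tm_le.
have t1 i : (i <= N)%N -> tm R N i <= 1 by move=> iN; rewrite -(tmM R N0) tm_le.
have iv : 0 < N%:R^-1 :> R by rewrite invr_gt0.
have cells i : (i < N)%N -> exists c r, good c r /\ forall s, tm R N i <= s <= tm R N i.+1 -> nr r c (F s).
  move=> iN; have [[ti ei] ui] := (t0 i, Ei i, t1 _ iN).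
  have [|[c r] Hc] := HN (tm R N i); first by lra.
  exists c, r; split=> [|s Hs]; last first.
    by apply: (proj2 (Hc s _ _)); [lra|rewrite ger0_norm; lra].
  by apply: (proj1 (Hc (tm R N i) _ _)); [lra|rewrite subrr normr0; lra].
exists N; split=> //; split=> i iN.
  by have [ti ui] := (t0 i, t1 _ iN); split; [apply: BF; lra|apply: qF; lra].
have [c [r [G H]]] := cells i iN; exists c, r; have [[ti ei] ui] := (t0 i, Ei i, t1 _ iN).
split=> //; [by apply: H; lra|by apply: H; lra|move=> s Hs].
by exists (F s); split; [apply: BF; lra|exact: H|apply: qF; lra].
Qed.

Lemma tm_ex N s : (0 < N)%N -> 0 <= s <= 1 -> exists2 m, (m < N)%N & tm R N m <= s <= tm R N m.+1.
Proof.
move=> N0 Hs.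
suff H k : (k <= N)%N -> s <= tm R N k -> (0 < k)%N -> exists2 m, (m < N)%N & tm R N m <= s <= tm R N m.+1.
  by apply: (H N) => //; rewrite tmM //; lra.
elim: k => // k IH kN sk _; have [le|/ltW le] := leP (tm R N k) s; first by exists k; rewrite // le.
case: k IH kN sk le => [|k] IH kN sk le; last by apply: IH => //; apply: ltnW.
by exists 0%N; rewrite // sk andbT tm0; lra.
Qed.

Section LocalSection.
Variables (f : R -> Bbar) (c : M) (r : R) (t t' : R) (g : R -> M).
Hypothesis cf : {within `[0, 1], continuous f}.
Hypothesis G : good c r.
Hypothesis tt' : 0 <= t /\ t' <= 1.
Hypothesis Hg : forall s, t <= s <= t' -> [/\ B (g s), nr r c (g s) & qv (g s) = f s].

(** A section chosen point by point over one sheet is automatically continuous: near [s0] the path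
    stays in a small sheet around the value at [s0], and uniqueness identifies the chosen value with
    the point found there. *)
Lemma section_cont (k : R -> R) : continuous k -> (forall s, t <= k s <= t') -> ccont (fun s => g (k s)).
Proof.
move=> ck Hk j a b s0; apply/cvgrPdist_lt => e e0.
have [B0 c0 q0] := Hg (Hk s0); have [e' e0' He] := nr_open c0.
have m0 : 0 < Num.min e e' by rewrite lt_min e0 e0'.
have := nbhs_sheet B0 m0 (nr_refl _ m0); rewrite q0.
have [h1 h2] := tt'; have Hks := Hk s0.
move/(path_nbhs cf) => [|d d0 Hd]; first by lra.
have /cvgrPdist_lt /(_ d d0) := ck s0; apply: filterS => s Ns.
have Hs := Hk s; have [Bs cs qs] := Hg Hs.
have [||z [Bz nz qz]] := Hd (k s); [by lra|by rewrite distrC|].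
have cz : nr r c z by apply: He; apply: nr_le nz; rewrite ge_min lexx orbT.
have E : z = g (k s) by apply: (sheet_uniq G G cz cz cz cs Bz Bs); rewrite qz qs.
by rewrite -E; apply: lt_le_trans (nz j a b) _; rewrite ge_min lexx.
Qed.

End LocalSection.

Lemma lift_ex (f : R -> Bbar) x0 : {within `[0, 1], continuous f} -> B x0 -> qv x0 = f 0 ->
  exists F : R -> M, [/\ ccont F, F 0 = x0, forall s, 0 <= s <= 1 -> B (F s) &
    forall s, 0 <= s <= 1 -> qv (F s) = f s].
Proof.
move=> cf Bx0 E0; have [N N0 HN] := path_cover cf.
have [x [d1 d2] Ex0] := disc_ex N0 HN Bx0 E0.
have N0' : 0 < N%:R :> R by rewrite ltr0n.
have iv : 0 < N%:R^-1 :> R by rewrite invr_gt0.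
have Ei i : tm R N i.+1 = tm R N i + N%:R^-1 by rewrite /tm -natr1 mulrDl mul1r.
have t0 i : 0 <= tm R N i by rewrite -(tm0 R N) tm_le.
have t1 i : (i <= N)%N -> tm R N i <= 1 by move=> iN; rewrite -(tmM R N0) tm_le.
have /choice[g Hg] : forall i, exists g : R -> M, (i < N)%N -> exists c r, [/\ good c r,
   nr r c (x i), nr r c (x i.+1) &
   forall s, tm R N i <= s <= tm R N i.+1 -> [/\ B (g s), nr r c (g s) & qv (g s) = f s]].
  move=> i; have [iN|] := ltnP i N; last by exists (fun _ => 0).
  have [c [r [G cx cx' HU]]] := d2 i iN.
  have /choice[g Hg] : forall s, exists y, tm R N i <= s <= tm R N i.+1 -> [/\ B y, nr r c y & qv y = f s].
    move=> s; have [Hs|] := boolP (tm R N i <= s <= tm R N i.+1); last by exists 0.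
    by have [y [? ? ?]] := HU s Hs; exists y.
  by exists g => _; exists c, r.
have g0 i : (i < N)%N -> g i (tm R N i) = x i.
  move=> iN; have [c [r [G cx cx' H]]] := Hg i iN; have [Bx Ex] := d1 i (ltnW iN).
  have [|By cy Ey] := H (tm R N i); first by rewrite lexx tm_le.
  by apply: (sheet_uniq G G cx cx cy cx By Bx); rewrite Ey Ex.
have g1 i : (i < N)%N -> g i (tm R N i.+1) = x i.+1.
  move=> iN; have [c [r [G cx cx' H]]] := Hg i iN; have [Bx Ex] := d1 i.+1 iN.
  have [|By cy Ey] := H (tm R N i.+1); first by rewrite lexx tm_le.
  by apply: (sheet_uniq G G cx' cx' cy cx' By Bx); rewrite Ey Ex.
(* Time clamped to the [i]-th interval of the subdivision. *)
pose k i (s : R) : R := tm R N i + cl ((s - tm R N i) * N%:R) * N%:R^-1.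
have ck i : continuous (k i).
  apply: contD; first exact: contc.
  apply: contM; last exact: contc.
  apply: (@contcomp R R R (@cl R)); first exact: cont_cl.
  by apply: contM; [apply: contB; [exact: cont_id|exact: contc]|exact: contc].
have Hk i s : tm R N i <= k i s <= tm R N i.+1.
  have /andP[h1 h2] := cl_in ((s - tm R N i) * N%:R).
  by rewrite Ei /k lerDl lerD2l mulr_ge0 ?(ltW iv) //= ler_piMl // ltW.
have k0 i s : s <= tm R N i -> k i s = tm R N i.
  move=> h; rewrite /k cl_le0 ?mul0r ?addr0 //.
  by rewrite pmulr_lle0 // subr_le0.
have k1 i s : tm R N i.+1 <= s -> k i s = tm R N i.+1.
  move=> h; rewrite /k cl_ge1 ?mul1r ?Ei //.
  by rewrite -ler_pdivrMr // div1r; rewrite Ei in h; lra.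
have kid i s : tm R N i <= s <= tm R N i.+1 -> k i s = s.
  move=> /andP[h1 h2]; rewrite /k cl_id ?mulfK ?gt_eqF //; first by rewrite addrC subrK.
  rewrite mulr_ge0 ?subr_ge0 ?(ltW N0') //= -ler_pdivlMr // div1r; rewrite Ei in h2; lra.
(* The local sections are glued as a sum: finished pieces telescope and pending pieces contribute
   zero. *)
pose F s : M := x 0%N + \sum_(i < N) (g i (k i s) - x i).
have FE m s : (m < N)%N -> tm R N m <= s <= tm R N m.+1 -> F s = g m s.
  move=> mN Hs; case/andP: (Hs) => Hs1 Hs2.
  have pre q : (q <= m)%N -> x 0%N + \sum_(i < q) (g i (k i s) - x i) = x q.
    elim: q => [|q IH] qm; first by rewrite big_ord0 addr0.
    rewrite big_ord_recr /= addrA IH ?(ltnW qm) // k1 ?g1; first by rewrite addrC subrK.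
      exact: ltn_trans mN.
    by apply: le_trans Hs1; apply: tm_le.
  have post q : (m < q <= N)%N -> x 0%N + \sum_(i < q) (g i (k i s) - x i) = g m s.
    elim: q => // q IH /andP[mq qN]; rewrite big_ord_recr /= addrA.
    have [e|lt] : q = m \/ (m < q)%N by lia.
      by rewrite e pre // kid // addrC subrK.
    rewrite IH ?lt ?(ltnW qN) // k0 ?g0 ?subrr ?addr0 //.
    by apply: le_trans Hs2 _; apply: tm_le.
  by apply: post; rewrite mN leqnn.
have coD (u v : M) j a b : co (u + v) j a b = co u j a b + co v j a b.
  by rewrite /co mxE; case: (u j a) (v j a) b => ? ? [? ?] [].
have coB (u v : M) j a b : co (u - v) j a b = co u j a b - co v j a b.
  by rewrite /co !mxE; case: (u j a) (v j a) b => ? ? [? ?] [].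
have co0 j a b : co (0 : M) j a b = 0 by rewrite /co !mxE; case: b.
exists F; split.
- move=> j a b.
  have -> : (fun s => co (F s) j a b) =
      (fun s => co (x 0%N) j a b + \sum_(i < N) (co (g i (k i s)) j a b - co (x i) j a b)).
    apply/funext => s; rewrite /F coD; congr (_ + _).
    by apply: (big_ind2 (fun (u : M) (v : R) => co u j a b = v)) => [|u v u' v' <- <-|i _]; rewrite ?co0 ?coB ?coD.
  apply: contD; first exact: contc.
  pose h i s := if (i < N)%N then co (g i (k i s)) j a b - co (x i) j a b else 0.
  have -> : (fun s => \sum_(i < N) (co (g i (k i s)) j a b - co (x i) j a b)) =
      (fun s => \sum_(i < N) h i s).
    by apply/funext => s; apply: eq_bigr => i _; rewrite /h ltn_ord.
  apply: contsum => i; rewrite /h; have [iN|_] := ltnP i N; last exact: contc.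
  apply: contB; last exact: contc.
  have [c [r [G cx cx' H]]] := Hg i iN.
  by apply: (section_cont cf G (conj (t0 i) (t1 _ iN)) H) => // s; apply: Hk.
- rewrite (FE 0%N 0 N0); last by rewrite tm0 lexx t0.
  by rewrite -Ex0 -(g0 0%N N0) tm0.
- move=> s Hs; have [m mN Hm] := tm_ex N0 Hs; rewrite (FE m) //.
  by have [c [r [_ _ _ H]]] := Hg m mN; case: (H s Hm).
- move=> s Hs; have [m mN Hm] := tm_ex N0 Hs; rewrite (FE m) //.
  by have [c [r [_ _ _ H]]] := Hg m mN; case: (H s Hm).
Qed.

Lemma q_cont (T : topologicalType) (F : T -> M) : ccont F -> (forall z, B (F z)) ->
  continuous (fun z => qv (F z)).
Proof. by move=> cF BF z; apply: qv_cvg => // e e0; exact: (@ccont_nr _ F z e cF e0). Qed.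

End Covering.

(** * Words do not depend on the labels of the points *)

Section Relabelling.
Local Open Scope ring_scope.
Context (R : realType) (k : nat) (u : nat -> nat).
Hypothesis uk : forall a, (a < k)%N -> (u a < k)%N.
Hypothesis ui : forall a b, (a < k)%N -> (b < k)%N -> u a = u b -> a = b.
Local Notation cfg := (cfg R).

Let v a := if (a < k)%N then u a else a.

Lemma state_relabel : state k v.
Proof.
split=> [a ak|a b ak bk|a]; rewrite /v ?ak ?bk //; [exact: uk|exact: ui|].
by rewrite leqNgt => /negbTE->.
Qed.

Lemma red_relabel io p q w : red k io p q w ->
  red k (fun a => io (v a)) (fun a => p (v a)) (fun a => q (v a)) w.
Proof.
elim=> [p'|p' q' a b w' ak bk E lt _ IH]; first exact: red_nil.
have [a' ak' Ea] := state_surj state_relabel ak; have [b' bk' Eb] := state_surj state_relabel bk.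
by subst a b; apply: (@red_cons k _ (fun a => p' (v a)) (fun a => q' (v a)) a' b').
Qed.

Variables (x y : cfg).

Definition relabels (x' z : cfg) := forall a b, (a < k)%N -> x' (a, b) = z (u a, b).

Lemma relabel_conf x' z : relabels x' z -> conf k z -> conf k x'.
Proof.
by move=> H cz a b ak bk ab; rewrite !H //; apply: cz; [exact: uk|exact: uk|move/(ui ak bk)].
Qed.

Lemma pos_relabel x' z : relabels x' z -> pos k x' = (fun a => pos k z (v a)).
Proof.
move=> H; apply/funext => a; rewrite /pos /v; have [ak|] := ltnP a k; last first.
  by move=> ka; rewrite ltnNge ka.
rewrite uk //.
have E : perm_eq (map u (iota 0 k)) (iota 0 k).
  apply: uniq_perm; [|exact: iota_uniq|].
    rewrite map_inj_in_uniq ?iota_uniq // => b c; rewrite !mem_iota !add0n /=; exact: ui.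
  move=> b; rewrite mem_iota /= add0n; apply/mapP/idP=> [[c]|bk].
    by rewrite mem_iota add0n => /= ck ->; apply: uk.
  have [c ck Ec] := state_surj state_relabel bk.
  by exists c; rewrite ?mem_iota //; rewrite -Ec /v ck.
rewrite -[RHS](seq.permP E) count_map; apply: eq_in_count => b; rewrite mem_iota add0n /= => bk.
by rewrite /lex !H.
Qed.

Lemma star_relabel c' c x' z : relabels c' c -> relabels x' z -> star k c z -> star k c' x'.
Proof. by move=> Hc Hx S a b ak bk; rewrite !Hc // !Hx //; apply: S; apply: uk. Qed.

(** Letters record positions, and the relabelling transports positions and depth orders alike, so
    the same reduced word serves on both sides. *)
Lemma stepw_relabel x' y' : relabels x' x -> relabels y' y -> linked k x y ->
  breq k (stepw k x' y') (stepw k x y).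
Proof.
move=> Hx Hy [c [cc cx cy]]; pose c' : cfg := fun ab => c (u ab.1, ab.2).
have Hc : relabels c' c by [].
have cc' := relabel_conf Hc cc.
have sx := state_pos (star_conf cc cx); have sy := state_pos (star_conf cc cy).
have sx' := star_relabel Hc Hx cx; have sy' := star_relabel Hc Hy cy.
apply: breq_trans (stepwE cc' sx' sy') _; apply: breq_sym; apply: breq_trans (stepwE cc cx cy) _.
have px := state_pos (star_conf cc' sx'); have py := state_pos (star_conf cc' sy').
apply: (@red_unique k (pos k c') (pos k x') (pos k y')) => //.
- by move=> a b ak bk; apply: pos_inj.
- rewrite (pos_relabel Hc) (pos_relabel Hx) (pos_relabel Hy); apply: red_relabel; exact: hwP.
- exact: hwP.
Qed.

End Relabelling.

Lemma dw_relabel (R : realType) k (u : nat -> nat) (x x' : nat -> cfg R) m :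
  (forall a, (a < k)%N -> (u a < k)%N) ->
  (forall a b, (a < k)%N -> (b < k)%N -> u a = u b -> a = b) ->
  (forall i, (i <= m)%N -> relabels k u (x' i) (x i)) ->
  (forall i, (i < m)%N -> linked k (x i) (x i.+1)) -> breq k (dw k x' m) (dw k x m).
Proof.
move=> uk ui; elim: m => [|m IH] Hr Hl; first exact: breq_refl.
rewrite !dwS; apply: breq_cat; first by apply: IH => i Hi; [apply: Hr|apply: Hl]; lia.
by apply: (stepw_relabel uk ui); [apply: Hr; lia|apply: Hr|apply: Hl].
Qed.

Lemma dw_ext (R : realType) k (x x' : nat -> cfg R) m :
  (forall i, (i <= m)%N -> x' i = x i) -> dw k x' m = dw k x m.
Proof.
elim: m => [//|m IH] H; rewrite !dwS IH => [|i Hi]; last by apply: H; lia.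
by rewrite (H m (leqnSn m)) (H m.+1 (leqnn _)).
Qed.

(** * Node configurations of a point of B and the word of a lift at a node *)

Section Nodes.
Local Open Scope ring_scope.
Context (R : realType) (n p : nat) (A : 'M[R[i]]_(p, n)) (Q : @sB R n p A).
Variable ord : nat -> {set 'I_n} -> seq {set 'I_n}.
Hypothesis n0 : (0 < n)%N.
Hypothesis p0 : (0 < p)%N.
Hypothesis Hv : valid_ord A ord.
Local Notation M := 'M[R[i]]_(p, n).
Local Notation B := (@Bset R n p A).
Local Notation sim := (sim A).
Local Notation part := (is_part A).
Local Notation fset0 := (@finset.set0 'I_n).
Local Notation node l L := ((1 < l <= p.+1)%N /\ part l L).
Local Notation k l L := (size (ord l L)).
Local Notation qv := (qv Q).
Local Notation good := (@good R n p A).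
Local Notation adm := (@adm R n p A).

(** The children of a node of level [l] are told apart by the vector of index [l.-1], whose 0-based
    row is [l.-2]; row 0 is the default. *)
Definition rowi l : 'I_p := insubd (Ordinal p0) l.-2.

Lemma rowiE l : (1 < l <= p.+1)%N -> (rowi l).+2 = l :> nat.
Proof. by move=> Hl; rewrite /rowi val_insubd ifT //=; lia. Qed.

Lemma rowi_ord (j : 'I_p) : rowi j.+2 = j.
Proof. by apply: val_inj; rewrite /rowi val_insubd ltn_ord. Qed.

Lemma node_ord (j : 'I_p) a : node j.+2 (cls A j.+2 a).
Proof. by split; [have := ltn_ord j; lia|exact: part_cls]. Qed.

Definition rep (C : {set 'I_n}) : 'I_n := odflt (Ordinal n0) [pick a in C].

Lemma rep_in (C : {set 'I_n}) a : a \in C -> rep C \in C.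
Proof. by rewrite /rep => aC; case: pickP => //= /(_ a); rewrite aC. Qed.

(** For points of [B] all elements of a child carry the same value ([nc_val]); [rep] merely selects
    one. *)
Definition nc (x : M) l (L : {set 'I_n}) : cfg R :=
  fun ib => co x (rowi l) (rep (nth fset0 (ord l L) ib.1)) ib.2.

Lemma child_part l L i : node l L -> (i < k l L)%N -> part l.-1 (nth fset0 (ord l L) i).
Proof. by move=> [Hl pL] Hi; apply: (ord_part Hv Hl pL); apply: mem_nth. Qed.

Lemma child_rep l L i : node l L -> (i < k l L)%N ->
  rep (nth fset0 (ord l L) i) \in nth fset0 (ord l L) i.
Proof. by move=> HL Hi; have [a aC _] := part_ex (child_part HL Hi); apply: rep_in aC. Qed.

Lemma sim_part l L a b : part l L -> a \in L -> b \in L -> sim l a b.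
Proof. by move=> pL aL; rewrite (partE pL aL) inE. Qed.

Lemma nc_val x l L i a b : B x -> node l L -> (i < k l L)%N -> a \in nth fset0 (ord l L) i ->
  nc x l L (i, b) = co x (rowi l) a b.
Proof.
move=> Bx HL Hi aC; have [Hl pL] := HL.
have H : sim (rowi l).+1 (rep (nth fset0 (ord l L) i)) a.
  have -> : (rowi l).+1 = l.-1 by have := rowiE Hl; lia.
  by apply: sim_part (child_part HL Hi) (child_rep HL Hi) aC.
by have [_ [E _]] := Bx (rowi l); rewrite /nc /co /= (E _ _ H).
Qed.

(** Elements of distinct children are related at level [l] but not at level [l.-1], and these are
    the pairs that the inequality clause of [B] separates in this row. *)
Lemma nc_conf x l L : B x -> node l L -> conf (k l L) (nc x l L).
Proof.
move=> Bx HL i i' Hi Hi' ii' [E1 E2]; have [Hl pL] := HL.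
have a1 := child_rep HL Hi; have a2 := child_rep HL Hi'.
move: a1 a2 E1 E2; rewrite /nc /=; set a := rep _; set a' := rep _ => a1 a2 E1 E2.
have El := rowiE Hl.
have [_ [_ /(_ a a')]] := Bx (rowi l); rewrite El.
have E : x (rowi l) a = x (rowi l) a'.
  by move: E1 E2; rewrite /co; case: (x _ a) (x _ a') => ? ? [? ?] /= -> ->.
rewrite E eqxx => H.
have s1 : sim l a a'.
  have sub i0 : (i0 < k l L)%N -> {subset nth fset0 (ord l L) i0 <= L}.
    by move=> h; apply/fintype.subsetP; apply: (ord_sub Hv Hl pL); apply: mem_nth.
  by apply: (sim_part pL); [exact: (sub i Hi)|exact: (sub i' Hi')].
have s2 : ~~ sim (rowi l).+1 a a'.
  apply/negP; have -> : (rowi l).+1 = l.-1 by lia.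
  move=> s2; apply: ii'; apply/eqP; rewrite -(nth_uniq fset0 Hi Hi' (ord_uniq Hv Hl pL)).
  apply/eqP; apply: (part_eq (child_part HL Hi) (child_part HL Hi') a1).
  by rewrite (partE (child_part HL Hi') a2) inE sim_sym.
by have := H s2 s1.
Qed.

Lemma good_star c r y l L : good c r -> nr r c y -> star (k l L) (nc c l L) (nc y l L).
Proof. by move=> [_ _ _ H] N a b _ _; split=> [|_]; apply: H. Qed.

Lemma good_linked c r x y l L : node l L -> good c r -> nr r c x -> nr r c y ->
  linked (k l L) (nc x l L) (nc y l L).
Proof.
move=> HL G cx cy; exists (nc c l L); have [Bc _ _ _] := G.
by split; [exact: nc_conf|exact: good_star G cx|exact: good_star G cy].
Qed.

Section Adm.
Variable s : 'S_n.
Hypothesis As : adm s.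

Lemma adm_cls l a : (0 < l)%N -> (s @: cls A l a)%SET = cls A l (s a).
Proof.
case: l => // l _; apply/setP => b; rewrite inE -{1 2}(permKV s b) mem_imset; last exact: perm_inj.
by rewrite inE As.
Qed.

Lemma adm_part l L : (0 < l)%N -> part l L -> part l (s @: L)%SET.
Proof. by move=> l0 /part_ex[a _ ->]; rewrite adm_cls //; apply: part_cls. Qed.

Lemma adm_node l L : node l L -> node l (s @: L)%SET.
Proof. by move=> [Hl pL]; split=> //; apply: adm_part => //; lia. Qed.

Lemma imsetKV (L : {set 'I_n}) : (s @: (s^-1%g @: L))%SET = L.
Proof. by rewrite -imset_comp -[RHS]imset_id; apply: eq_imset => a; rewrite /= permKV. Qed.

Lemma adm_treemap : treemap A ord (fun _ L => (s @: L)%SET).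
Proof.
move=> l L Hl pL; have pL' : part l (s @: L)%SET by apply: adm_part => //; lia.
split=> // [|l1]; first by rewrite card_imset //; apply: perm_inj.
have Hl' : (1 < l <= p.+1)%N by lia.
apply: uniq_perm; last 1 first.
- move=> C; rewrite (ord_mem Hv) //; apply/mapP/idP=> [[D]|/andP[pC sC]].
    rewrite (ord_mem Hv) // => /andP[pD sD] ->; rewrite imsetS // adm_part //; lia.
  have pD : part l.-1 (s^-1%g @: C)%SET.
    have [a _ ->] := part_ex pC; apply/existsP; exists (s^-1%g a); apply/eqP/setP => b.
    rewrite -{1}(permK s b) mem_imset ?inE; last exact: perm_inj.
    have -> : l.-1 = l.-2.+1 by lia.
    by rewrite -[RHS]As permKV.
  exists (s^-1%g @: C)%SET; last by rewrite imsetKV.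
  rewrite (ord_mem Hv) // pD /=; apply/fintype.subsetP => a /imsetP[b bC ->].
  have /imsetP[c cL ->] := fintype.subsetP sC b bC; by rewrite permK.
- rewrite map_inj_in_uniq ?(ord_uniq Hv) // => C D _ _; apply: imset_inj; exact: perm_inj.
- exact: ord_uniq Hv _ _ Hl' pL'.
Qed.

Definition sg l (L : {set 'I_n}) i := index (s @: nth fset0 (ord l L) i)%SET (ord l (s @: L)%SET).

Lemma size_ord_adm l L : node l L -> k l (s @: L)%SET = k l L.
Proof.
move=> [Hl pL]; have [||_ _ H] := @adm_treemap l L; [by lia|by []|].
by rewrite -(perm_size (H _)) ?size_map //; lia.
Qed.

Lemma sg_mem l L i : node l L -> (i < k l L)%N -> (s @: nth fset0 (ord l L) i)%SET \in ord l (s @: L)%SET.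
Proof.
move=> [Hl pL] Hi; have [||_ _ H] := @adm_treemap l L; [by lia|by []|].
by rewrite -(perm_mem (H _)) ?map_f ?mem_nth //; lia.
Qed.

Lemma sg_lt l L i : node l L -> (i < k l L)%N -> (sg l L i < k l L)%N.
Proof. by move=> HL Hi; rewrite -(size_ord_adm HL) index_mem; apply: sg_mem. Qed.

Lemma sg_nth l L i : node l L -> (i < k l L)%N ->
  nth fset0 (ord l (s @: L)%SET) (sg l L i) = (s @: nth fset0 (ord l L) i)%SET.
Proof. by move=> HL Hi; apply: nth_index; apply: sg_mem. Qed.

Lemma sg_inj l L i i' : node l L -> (i < k l L)%N -> (i' < k l L)%N -> sg l L i = sg l L i' -> i = i'.
Proof.
move=> HL Hi Hi' E; have := sg_nth HL Hi; rewrite E (sg_nth HL Hi') => /imset_inj E'.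
have [Hl pL] := HL.
by apply/eqP; rewrite -(nth_uniq fset0 Hi Hi' (ord_uniq Hv Hl pL)) E' //; apply: perm_inj.
Qed.

Lemma sg_surj l L i : node l L -> (i < k l L)%N -> exists2 i', (i' < k l L)%N & sg l L i' = i.
Proof.
move=> HL Hi.
pose f (a : 'I_(k l L)) : 'I_(k l L) := Ordinal (sg_lt HL (ltn_ord a)).
have fi : injective f by move=> a b [E]; apply: val_inj; apply: (sg_inj HL) E.
have [g _ fg] := injF_bij fi; exists (g (Ordinal Hi)) => //.
by have := fg (Ordinal Hi) => /(congr1 val).
Qed.

(** Column [a] of the translate is column [s a], so a path of translates has at [L] the words that
    the original path has at [s @: L]. *)
Lemma nc_perm x l L : B x -> node l L ->
  relabels (k l L) (sg l L) (nc (col_perm s x) l L) (nc x l (s @: L)%SET).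
Proof.
move=> Bx HL i b Hi; have HL' := adm_node HL; have aC := child_rep HL Hi.
rewrite (nc_val _ (adm_B As Bx) HL Hi aC) co_perm (@nc_val _ _ _ _ (s (rep (nth fset0 (ord l L) i)))) //.
  by rewrite size_ord_adm // sg_lt.
by rewrite sg_nth // imset_f.
Qed.

End Adm.

Lemma treemap_adm (s : 'S_n) : treemap A ord (fun _ L => (s @: L)%SET) -> adm s.
Proof.
move=> Hm l a b; have [lp|pl] := leqP l p; last first.
  by rewrite !(sim_mono (leqW pl) (sim_top A _ _)).
have [||pL _ _] := Hm l.+1 (cls A l.+1 a); [by lia|exact: part_cls|].
have aL : s a \in (s @: cls A l.+1 a)%SET by rewrite imset_f // cls_id.
have : (s b \in (s @: cls A l.+1 a)%SET) = (b \in cls A l.+1 a).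
  by rewrite mem_imset //; apply: perm_inj.
by rewrite {1}(partE pL aL) !inE.
Qed.

(* From the chosen order of the children of [L] to the lexicographic order of their positions in [A]. *)
Definition cw l L : bword := hw (k l L) (pos (k l L) (nc A l L)) id (pos (k l L) (nc A l L)).

(** The outer factors turn a word between orderings by position into one between the chosen
    orderings. The closing factor belongs to [s @: L], because at the end of the lift the node [L]
    shows the configuration that [A] has at [s @: L]. *)
Definition be (x : nat -> M) N (s : 'S_n) l (L : {set 'I_n}) : bword :=
  cw l L ++ dw (k l L) (fun i => nc (x i) l L) N ++ winv (cw l (s @: L)%SET).

Hypothesis BA : B A.

Lemma cw_wf l L : node l L -> wf_word (k l L) (cw l L).
Proof. by move=> HL; apply: hw_wf; [exact: state_id|apply: state_pos; apply: nc_conf]. Qed.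

Lemma cw_perm l L a : node l L -> perm_word (cw l L) a = pos (k l L) (nc A l L) a.
Proof. by move=> HL; apply: (@hw_perm _ _ id _ a); [exact: state_id|apply: state_pos; apply: nc_conf]. Qed.

Definition steps (x : nat -> M) N := forall i, (i < N)%N -> exists c r,
  [/\ good c r, nr r c (x i) & nr r c (x i.+1)].

Lemma steps_linked x N l L i : steps x N -> node l L -> (i < N)%N ->
  linked (k l L) (nc (x i) l L) (nc (x i.+1) l L).
Proof. by move=> S HL /S[c [r [G cx cy]]]; apply: good_linked G cx cy. Qed.

Lemma be_perm x N (s : 'S_n) l L a : steps x N -> adm s -> x 0%N = A -> x N = col_perm s A ->
  node l L -> (a < k l L)%N -> perm_word (be x N s l L) a = sg s l L a.
Proof.
move=> S As E0 EN HL Ha; rewrite !perm_word_cat cw_perm // -{1}E0.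
rewrite (dw_perm (y := fun i => nc (x i) l L)); last by move=> i; apply: steps_linked.
rewrite EN (pos_relabel (fun a => @sg_lt s As l L a HL) (fun a b => @sg_inj s As l L a b HL) (nc_perm As BA HL)) Ha.
have HL' := adm_node As HL.
by rewrite -(size_ord_adm As HL) -cw_perm // perm_word_winv.
Qed.

Lemma be_cmp x N (s : 'S_n) : steps x N -> adm s -> x 0%N = A -> x N = col_perm s A ->
  cmp A ord (fun _ L => (s @: L)%SET) (be x N s).
Proof.
move=> S As E0 EN l L Hl pL; have HL : node l L by []; have HL' := adm_node As HL.
have W : wf_word (k l L) (be x N s l L).
  have w1 := cw_wf HL; have w2 := cw_wf HL'; rewrite (size_ord_adm As HL) in w2.
  rewrite !wf_cat w1 wf_winv w2 andbT.
  by apply: dw_wf => i; apply: steps_linked.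
split=> //; apply: (@eq_from_nth _ fset0); first by rewrite size_act size_map size_ord_adm.
rewrite size_act size_map => i Hi; have [i' Hi' Ei] := sg_surj As HL Hi.
rewrite -Ei sg_nth // -(be_perm S As E0 EN HL Hi') nth_act ?size_map //.
by rewrite (nth_map fset0).
Qed.

(** Inverse to [nc]: index [a] takes the point of its own child of level [j.+1] inside its node of
    level [j.+2]. *)
Definition raw (h : nat -> {set 'I_n} -> cfg R) (j : 'I_p) (a : 'I_n) (b : bool) : R :=
  h j.+2 (cls A j.+2 a) (index (cls A j.+1 a) (ord j.+2 (cls A j.+2 a)), b).

Definition mean h (j : 'I_p) b : R := (\sum_a raw h j a b) / n%:R.

(* Subtracting the mean of every row lands in the sum-zero space [t] and does not change braids. *)
Definition asB h : M := \matrix_(j, a)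
  (Complex (raw h j a true - mean h j true) (raw h j a false - mean h j false)).

Lemma co_asB h j a b : co (asB h) j a b = raw h j a b - mean h j b.
Proof. by rewrite /co mxE; case: b. Qed.

Lemma child_index (j : 'I_p) a : (index (cls A j.+1 a) (ord j.+2 (cls A j.+2 a)) < k j.+2 (cls A j.+2 a))%N.
Proof.
have [Hl pL] := node_ord j a; rewrite index_mem.
rewrite (ord_mem Hv) // part_cls /=; exact: cls_sub (leqnSn _) (sim_refl _ _ _).
Qed.

Lemma child_index_nth (j : 'I_p) a :
  nth fset0 (ord j.+2 (cls A j.+2 a)) (index (cls A j.+1 a) (ord j.+2 (cls A j.+2 a))) = cls A j.+1 a.
Proof. by apply: nth_index; rewrite -index_mem; apply: child_index. Qed.

Lemma asB_B h : (forall l L, node l L -> conf (k l L) (h l L)) -> B (asB h).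
Proof.
move=> Hh j; split; [|split].
- have n0' : n%:R != 0 :> R by rewrite pnatr_eq0; lia.
  have S b : \sum_a (raw h j a b - mean h j b) = 0.
    rewrite big_split /= sumr_const cardT size_enum_ord mulNrn /mean -[X in _ - X]mulr_natr.
    by rewrite divfK // subrr.
  have := S true; have := S false.
  have E : \sum_a asB h j a = Complex (\sum_a (raw h j a true - mean h j true))
                                 (\sum_a (raw h j a false - mean h j false)).
    apply: (big_rec3 (fun (u : R) (v : R) (w : R[i]) => w = Complex u v)) => // a u v w _ ->.
    by rewrite mxE.
  by rewrite E => -> ->.
- move=> a b ab; rewrite !mxE /raw (cls_eq ab).
  by rewrite (cls_eq (sim_mono (leqnSn _) ab)).
- move=> a b nab ab; apply/eqP; rewrite !mxE /raw (cls_eq ab) => -[/addIr E1 /addIr E2].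
  have ca := child_index j a; have cb := child_index j b; have na := child_index_nth j a.
  rewrite (cls_eq ab) in ca na; have Hc := Hh _ _ (node_ord j b).
  apply: (Hc _ _ ca cb) => // E; move/negP: nab; apply.
  by have := cls_id A j.+1 b; rewrite -(child_index_nth j b) -E na inE.
Qed.

Lemma raw_nc x j a b : B x -> raw (nc x) j a b = co x j a b.
Proof.
move=> Bx; rewrite /raw (@nc_val _ _ _ _ a) ?rowi_ord //.
- exact: node_ord.
- exact: child_index.
- by rewrite child_index_nth cls_id.
Qed.

Lemma raw_ext h h' j a b : (forall l L i b', node l L -> (i < k l L)%N -> h l L (i, b') = h' l L (i, b')) ->
  raw h j a b = raw h' j a b.
Proof. by move=> H; apply: H; [exact: node_ord|exact: child_index]. Qed.

Lemma asB_ext h h' : (forall l L i b', node l L -> (i < k l L)%N -> h l L (i, b') = h' l L (i, b')) ->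
  asB h = asB h'.
Proof.
move=> H; have E j a b : raw h j a b = raw h' j a b by apply: raw_ext.
apply: co_eq => j a b; rewrite !co_asB /mean E; congr (_ - _ / _).
by apply: eq_bigr => a' _.
Qed.

(** The rows of a point of [B] have sum zero, so the subtracted means vanish. *)
Lemma asB_nc x : B x -> asB (nc x) = x.
Proof.
move=> Bx; apply: co_eq => j a b; rewrite co_asB raw_nc //.
have -> : mean (nc x) j b = 0; last by rewrite subr0.
rewrite /mean (eq_bigr (fun a => co x j a b)); last by move=> a' _; apply: raw_nc.
have [E _] := Bx j; suff -> : \sum_a co x j a b = 0 by rewrite mul0r.
transitivity (if b then complex.Re (\sum_a x j a) else complex.Im (\sum_a x j a)).
  rewrite /co; case: b.
    by rewrite (big_morph (@complex.Re R) (id1 := 0) (op1 := +%R)) // => -[? ?] [? ?].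
  by rewrite (big_morph (@complex.Im R) (id1 := 0) (op1 := +%R)) // => -[? ?] [? ?].
by rewrite E; case: b.
Qed.

Lemma nc_asB h l L i b : (forall l L, node l L -> conf (k l L) (h l L)) -> node l L -> (i < k l L)%N ->
  nc (asB h) l L (i, b) = h l L (i, b) - mean h (rowi l) b.
Proof.
move=> Hh HL Hi; have [Hl pL] := HL; rewrite /nc co_asB /raw /= rowiE //.
have aC := child_rep HL Hi; set a := rep _ in aC *.
have El : (rowi l).+1 = l.-1 by have := rowiE Hl; lia.
have aL : a \in L.
  by apply: (fintype.subsetP _ a aC); apply: (ord_sub Hv Hl pL); apply: mem_nth.
rewrite El -(partE pL aL) -(partE (child_part HL Hi) aC) index_uniq //.
exact: ord_uniq Hv _ _ Hl pL.
Qed.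

End Nodes.

(** * Cancellation in braid groups *)

Section Cancel.
Variable N : nat.

Lemma breq_cancell u v v' : wf_word N u -> breq N (u ++ v) (u ++ v') -> breq N v v'.
Proof.
move=> wu H; have E w : breq N (winv u ++ u ++ w) w.
  by rewrite catA (breq_winvl wu); exact: breq_refl.
by rewrite -(E v) -(E v') H; exact: breq_refl.
Qed.

Lemma breq_cancelr u v v' : wf_word N u -> breq N (v ++ u) (v' ++ u) -> breq N v v'.
Proof.
move=> wu H; have E w : breq N ((w ++ u) ++ winv u) w.
  by rewrite -catA (breq_winvr wu) cats0; exact: breq_refl.
by rewrite -(E v) -(E v') H; exact: breq_refl.
Qed.

Lemma breq_cancel_mid a b c d d' e : wf_word N c -> breq N d d' ->
  breq N (a ++ (b ++ d) ++ e) ((a ++ b ++ winv c) ++ c ++ d' ++ e).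
Proof.
move=> wc H; rewrite -!catA; apply: breq_catl; apply: breq_catl.
by rewrite [winv c ++ _]catA (breq_winvl wc) H; exact: breq_refl.
Qed.

Lemma breq_conj a b c : wf_word N a -> wf_word N c ->
  breq N (a ++ (winv a ++ b ++ c) ++ winv c) b.
Proof.
move=> wa wc; rewrite -!catA (breq_winvr wc) cats0 catA (breq_winvr wa); exact: breq_refl.
Qed.

End Cancel.

(** * The map from loops in the quotient to cabled braids *)

Section Main.
Local Open Scope ring_scope.
Local Open Scope classical_set_scope.
Local Open Scope quotient_scope.
Context (R : realType) (n p : nat) (A : 'M[R[i]]_(p, n)) (Q : @sB R n p A).
Variable ord : nat -> {set 'I_n} -> seq {set 'I_n}.
Hypothesis n0 : (0 < n)%N.
Hypothesis p0 : (0 < p)%N.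
Hypothesis Hv : valid_ord A ord.
Hypothesis Hc : compatible_ord p ord.
Hypothesis QA : set_val Q = A.
Local Notation M := 'M[R[i]]_(p, n).
Local Notation B := (@Bset R n p A).
Local Notation Bbar := (@Bbar R n p A).
Local Notation sim := (sim A).
Local Notation part := (is_part A).
Local Notation fset0 := (@finset.set0 'I_n).
Local Notation node l L := ((1 < l <= p.+1)%N /\ part l L).
Local Notation k l L := (size (ord l L)).
Local Notation qv := (qv Q).
Local Notation good := (@good R n p A).
Local Notation adm := (@adm R n p A).
Local Notation Disc := (Disc Q).
Local Notation nc := (nc ord n0 p0).
Local Notation be := (be A ord n0 p0).
Local Notation cw := (cw A ord n0 p0).
Local Notation asB := (asB A ord).
Local Notation asm := (asm ord).
Local Notation top := ([set: 'I_n]%SET).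
Local Notation LV := (leaves ord p.+1 [set: 'I_n]%SET).
Local Notation T := (Tplanar p ord).
Local Notation Qbar := (\pi_Bbar Q).
Local Notation loop := (is_loop Qbar).

Let BA : B A. Proof. by have := valB Q; rewrite QA. Qed.
Let qA : qv A = Qbar. Proof. by have := qvE Q Q; rewrite QA. Qed.
Let pT : part p.+1 top. Proof. exact: part_top. Qed.
Let lT : (1 <= p.+1 <= p.+1)%N. Proof. by rewrite leqnn. Qed.

Lemma disc_steps f N x : Disc f N x -> steps A x N.
Proof. by move=> [_ H] i /H[c [r [G cx cy _]]]; exists c, r. Qed.

Lemma disc_ext f g N x : (0 < N)%N -> (forall s, 0 <= s <= 1 -> f s = g s) -> Disc f N x -> Disc g N x.
Proof.
move=> N0 E [d1 d2].
have t0 i : 0 <= tm R N i by rewrite -(tm0 R N) tm_le.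
have t1 i : (i <= N)%N -> tm R N i <= 1 by move=> iN; rewrite -(tmM R N0) tm_le.
split=> i iN.
  by have [? ?] := d1 i iN; split=> //; rewrite -E // t0 t1.
have [c [r [G cx cy HU]]] := d2 i iN; exists c, r; split=> // s Hs.
by have [a b] := (t0 i, t1 _ iN); rewrite -E; [exact: HU|lra].
Qed.

Definition same_words (x y : nat -> M) N N' := x N = y N' /\
  forall l L, node l L -> breq (k l L) (dw (k l L) (fun i => nc (x i) l L) N)
                                     (dw (k l L) (fun i => nc (y i) l L) N').

Lemma same_words_sym x y N N' : same_words x y N N' -> same_words y x N' N.
Proof. by move=> [E H]; split=> // l L HL; apply: breq_sym; apply: H. Qed.

Lemma same_words_trans x y z N N' N2 : same_words x y N N' -> same_words y z N' N2 -> same_words x z N N2.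
Proof.
by move=> [E H] [E' H']; split=> [|l L HL]; [rewrite E|apply: breq_trans (H l L HL) (H' l L HL)].
Qed.

Lemma refine_words f N K x : (0 < N)%N -> (0 < K)%N -> Disc f N x -> exists x',
  [/\ Disc f (N * K) x', x' 0%N = x 0%N & same_words x' x (N * K) N].
Proof.
move=> N0 K0 D; have [x' [D' E C]] := disc_refine N0 K0 D; exists x'; split=> //.
  by rewrite -(E 0%N).
split=> [|l L HL]; first by rewrite E.
rewrite (@dw_refine _ _ (fun i => nc (x' i) l L)) => [|i /C[c [r [G H]]]].
  rewrite (@dw_ext _ _ (fun i => nc (x i) l L)); first exact: breq_refl.
  by move=> i iN; rewrite E.
have [Bc _ _ _] := G; exists (nc c l L); first exact: (nc_conf Hv Bc HL).
by move=> j jK; exact: (good_star n0 p0 G (H j jK)).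
Qed.

(** Refined to [N * N'] steps the two lifts coincide by uniqueness, and refinement does not alter
    words. *)
Lemma disc_words f N N' x y : (0 < N)%N -> (0 < N')%N -> Disc f N x -> Disc f N' y ->
  x 0%N = y 0%N -> same_words x y N N'.
Proof.
move=> N0 N0' Dx Dy E; have [x' [Dx' Ex Sx]] := refine_words N0 N0' Dx.
have [y' [Dy' Ey Sy]] := refine_words N0' N0 Dy.
rewrite mulnC in Dy' Sy.
have U := disc_unique Dx' Dy' (etrans Ex (etrans E (esym Ey))).
apply: same_words_trans (same_words_sym Sx) _; apply: same_words_trans _ Sy.
split=> [|l L HL]; first exact: U.
by rewrite (@dw_ext _ _ (fun i => nc (y' i) l L)); [exact: breq_refl|move=> i iN; rewrite U].
Qed.

Lemma homotopy_words f g N N' x y : (0 < N)%N -> (0 < N')%N -> Disc f N x -> Disc g N' y ->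
  x 0%N = A -> y 0%N = A -> loop_homotopic Qbar f g -> same_words x y N N'.
Proof.
move=> N0 N0' Dx Dy Ex Ey [H [cH [H1 H2]]].
have m01 (t : R) : 0 <= t <= 1 -> t \in `[0, 1]%R by move=> Ht; rewrite in_itv.
have z01 : 0 <= (0 : R) <= 1 by rewrite lexx ler01.
have [| |m [X [m0 DX EX CX]]] := @disc_homotopy _ _ _ _ Q H A cH _ BA.
- by move=> t /m01/H2[-> ->]; have [-> ->] := H2 0 (m01 0 z01).
- by rewrite qA; have [-> _] := H2 0 (m01 0 z01).
have D0 : Disc f m (X 0%N).
  by apply: disc_ext (DX 0%N isT) => // s /m01/H1[<- _]; rewrite tm0.
have D1 : Disc g m (X m).
  by apply: disc_ext (DX m (leqnn m)) => // s /m01/H1[_ <-]; rewrite tmM.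
have [X0 _] := EX 0%N isT; have [Xm XE] := EX m (leqnn m).
apply: same_words_trans (disc_words N0 m0 Dx D0 _) _; first by rewrite X0.
apply: same_words_trans _ (disc_words m0 N0' D1 Dy _); last by rewrite Xm.
split=> // l L HL; suff S j : (j <= m)%N -> breq (k l L) (dw (k l L) (fun i => nc (X 0%N i) l L) m)
    (dw (k l L) (fun i => nc (X j i) l L) m) by apply: S.
elim: j => [_|j IH jm]; first exact: breq_refl.
apply: breq_trans (IH (ltnW jm)) _.
have [a0 am] := EX j (ltnW jm); have [b0 bm] := EX j.+1 jm.
have := @dw_grid _ (k l L) (fun i => nc (X j i) l L) (fun i => nc (X j.+1 i) l L) m.
(* The vertical sides of the grid are constant, so their words are empty. *)
rewrite a0 b0 am bm !stepw_id ?cats0 //=; try exact: (nc_conf Hv BA HL).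
  apply=> [i im|]; last exact: (nc_conf Hv BA HL).
  have [c [r [G h1 h2 h3 h4]]] := CX j i jm im; have [Bc _ _ _] := G.
  exists (nc c l L); split; first exact: (nc_conf Hv Bc HL).
  - exact: (good_star n0 p0 G h1).
  - exact: (good_star n0 p0 G h2).
  - exact: (good_star n0 p0 G h3).
  - exact: (good_star n0 p0 G h4).
by apply: (nc_conf Hv _ HL); have [/(_ m (leqnn m))[]] := D0.
Qed.

(** The end of a lift determines [s] only up to permutations inside the parts of level 1, and these
    act trivially on parts of every level. *)
Lemma same_perm (s s' : 'S_n) : adm s -> adm s' -> col_perm s A = col_perm s' A ->
  forall l L, (0 < l)%N -> part l L -> (s @: L = s' @: L)%SET.
Proof.
move=> As As' E l L l0 /part_ex[a _ ->]; rewrite !adm_cls //; apply: cls_eq.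
apply: (@sim_mono _ _ _ _ 1) => //; apply/(simB _ _ _ BA) => j _.
by have /matrixP/(_ j a) := E; rewrite !mxE.
Qed.

Lemma asm_words x y N N' (s s' : 'S_n) : steps A x N -> adm s -> adm s' ->
  x 0%N = A -> x N = col_perm s A -> y N' = col_perm s' A -> same_words x y N N' ->
  breq (nleaves T) (asm (be x N s) p.+1 top) (asm (be y N' s') p.+1 top).
Proof.
move=> S As As' E0 EN EN' [E H]; apply: (asm_breq n0 Hv lT pT).
  exact: (cmp_wfam n0 (leqnn _) (be_cmp n0 p0 Hv BA S As E0 EN)).
move=> l L Hl pL _; rewrite /be (same_perm As As' _ _ pL) -?EN -?EN' //; last by lia.
by rewrite (H l L (conj Hl pL)); exact: breq_refl.
Qed.

(** The permutation of the leaves recovers the images of the parts of level 1 and hence the end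
    point; [asm_inj] then recovers the word at each node, where the conjugating factors cancel. *)
Lemma words_asm x y N N' (s s' : 'S_n) : steps A x N -> steps A y N' -> adm s -> adm s' ->
  x 0%N = A -> y 0%N = A -> x N = col_perm s A -> y N' = col_perm s' A ->
  breq (nleaves T) (asm (be x N s) p.+1 top) (asm (be y N' s') p.+1 top) -> same_words x y N N'.
Proof.
move=> Sx Sy As As' Ex Ey EN EN' H.
have Cx := be_cmp n0 p0 Hv BA Sx As Ex EN; have Cy := be_cmp n0 p0 Hv BA Sy As' Ey EN'.
have ST (t : 'S_n) : (t @: top)%SET = top.
  by apply/setP => a; rewrite !inE -(permKV t a) imset_f ?inE.
have Tx : act (asm (be x N s) p.+1 top) (map (fun L : {set 'I_n} => (s @: L)%SET) LV) =
    leaves ord p.+1 (s @: top)%SET := cmp_act n0 Hv (adm_treemap n0 p0 Hv As) Cx lT pT.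
have Ty : act (asm (be y N' s') p.+1 top) (map (fun L : {set 'I_n} => (s' @: L)%SET) LV) =
    leaves ord p.+1 (s' @: top)%SET := cmp_act n0 Hv (adm_treemap n0 p0 Hv As') Cy lT pT.
rewrite ST in Tx; rewrite ST in Ty.
rewrite -(act_breq _ H) in Ty; last by rewrite size_map (size_leaves n0 Hv).
have /eq_in_map EL := act_inj (etrans Tx (esym Ty)).
have E : col_perm s A = col_perm s' A.
  apply/matrixP => j a; rewrite !mxE.
  have aL : cls A 1 a \in LV.
    by rewrite (mem_leaves n0 Hv) // part_cls; apply/fintype.subsetP => b _; rewrite inE.
  have := EL _ aL; rewrite !adm_cls // => Ec.
  apply: (proj1 (simB _ _ _ BA) (_ : sim 1 (s a) (s' a))) => //.
  by have := cls_id A 1 (s' a); rewrite -Ec inE.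
split=> [|l L HL]; first by rewrite EN EN'.
have [Hl pL] := HL.
have := asm_inj n0 Hv lT pT (cmp_wfam n0 (leqnn _) Cx) (cmp_wfam n0 (leqnn _) Cy) H Hl pL.
rewrite /be (same_perm As As' E _ pL); last by lia.
move=> K; have {K} := breq_cancell (cw_wf n0 p0 Hv BA HL) (K _).
have HL' := adm_node n0 p0 As' HL; have := cw_wf n0 p0 Hv BA HL'; rewrite (size_ord_adm n0 p0 Hv As' HL) => w.
move=> K; apply: (breq_cancelr (u := winv (cw l (s' @: L)%SET))); first by rewrite wf_winv.
by apply: K; apply/fintype.subsetP => b _; rewrite inE.
Qed.

(** A relation, since the subdivision, the lift and the final permutation are all chosen; by
    [isphi_unique] the braid does not depend on them. *)
Definition isphi f w := exists N x (s : 'S_n), [/\ (0 < N)%N, Disc f N x, x 0%N = A, adm s &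
  x N = col_perm s A /\ w = asm (be x N s) p.+1 top].

Lemma isphi_unique f w w' : isphi f w -> isphi f w' -> breq (nleaves T) w w'.
Proof.
move=> [N [x [s [N0 Dx Ex As [EN ->]]]]] [N' [y [s' [N0' Dy Ey As' [EN' ->]]]]].
apply: asm_words => //; first exact: disc_steps Dx.
by apply: disc_words Dx Dy _ => //; rewrite Ex.
Qed.

Lemma end_perm x : B x -> qv x = Qbar -> exists2 s : 'S_n, adm s & x = col_perm s A.
Proof.
move=> Bx; rewrite -qA => /esym/(qv_eq Q BA Bx)[s E]; exists s => //.
by apply: (admP BA); rewrite -E.
Qed.

Lemma isphi_ex f : loop f -> exists w, isphi f w.
Proof.
move=> [cf [f0 f1]]; have [N N0 HN] := path_cover Q cf.
have [|x Dx Ex] := disc_ex N0 HN BA; first by rewrite f0 qA.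
have [BN EN] := proj1 Dx N (leqnn N).
have [|s As Es] := end_perm BN; first by rewrite EN tmM.
by exists (asm (be x N s) p.+1 top); exists N, x, s.
Qed.

Lemma isphi_cbr f w : isphi f w -> cbr T w.
Proof.
move=> [N [x [s [N0 Dx Ex As [EN ->]]]]].
exact: (cmp_cbr n0 Hv Hc (adm_treemap n0 p0 Hv As) (be_cmp n0 p0 Hv BA (disc_steps Dx) As Ex EN) lT pT).
Qed.

Lemma fine_nc (F : R -> M) N l L : node l L ->
  (forall i, (i < N)%N -> exists c r, good c r /\ forall s, tm R N i <= s <= tm R N i.+1 -> nr r c (F s)) ->
  fine (k l L) N (fun s => nc (F s) l L).
Proof.
move=> HL H i /H[c [r [G Hc']]]; have [Bc _ _ _] := G; exists (nc c l L); first exact: (nc_conf Hv Bc HL).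
by move=> s /Hc'; apply: (good_star n0 p0 G).
Qed.

Lemma asB_ccont (Z : topologicalType) (h : Z -> nat -> {set 'I_n} -> cfg R) :
  (forall l L i, node l L -> continuous (fun z => h z l L i)) -> ccont (fun z => asB (h z)).
Proof.
move=> ch j a b.
have cr a' : continuous (fun z => raw A ord (h z) j a' b) by apply: ch; apply: node_ord n0 p0 _ _.
rewrite (_ : (fun _ => _) = (fun z => raw A ord (h z) j a b - mean A ord (h z) j b)); last first.
  by apply/funext => z; rewrite co_asB.
apply: contB; first exact: cr.
apply: contM; last exact: contc.
pose g i z := if insub i is Some a' then raw A ord (h z) j a' b else 0.
rewrite (_ : (fun _ => _) = (fun z => \sum_(i < n) g i z)); last first.
  by apply/funext => z; apply: eq_bigr => a' _; rewrite /g valK.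
apply: contsum => i; rewrite /g; case: insubP => [a' _ _|_]; [exact: cr|exact: contc].
Qed.

Lemma words_homotopic f g N N' x y : loop f -> loop g -> (0 < N)%N -> (0 < N')%N ->
  Disc f N x -> Disc g N' y -> x 0%N = A -> y 0%N = A -> same_words x y N N' -> loop_homotopic Qbar f g.
Proof.
move=> [cf [f0 f1]] [cg [g0 g1]] N0 N0' Dx Dy Ex Ey S.
have [|F [cF F0 BF qF]] := @lift_ex _ _ _ _ Q f A cf BA; first by rewrite f0 qA.
have [|G [cG G0 BG qG]] := @lift_ex _ _ _ _ Q g A cg BA; first by rewrite g0 qA.
have [m [m0 DF fF]] := lift_disc cF BF qF; have [m' [m0' DG fG]] := lift_disc cG BG qG.
have {}S : same_words (fun i => F (tm R m i)) (fun i => G (tm R m' i)) m m'.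
  apply: same_words_trans (disc_words m0 N0 DF Dx _) _; first by rewrite tm0 F0.
  by apply: same_words_trans S (disc_words N0' m0' Dy DG _); rewrite tm0 G0.
have [E1 HW] := S; rewrite !tmM // in E1.
have cnc (K : R -> M) l L : ccont K -> cpath (fun s => nc (K s) l L) by move=> cK [i b]; apply: cK.
have /choice[h Hh] : forall lL : nat * {set 'I_n}, exists H : R -> R -> cfg R, node lL.1 lL.2 ->
    [/\ forall j, continuous (fun u : R * R => H u.1 u.2 j),
      forall s t, 0 <= s <= 1 -> 0 <= t <= 1 -> conf (k lL.1 lL.2) (H s t),
      forall s, 0 <= s <= 1 -> H s 0 = nc (F s) lL.1 lL.2 /\ H s 1 = nc (G s) lL.1 lL.2 &
      forall t, 0 <= t <= 1 -> H 0 t = nc (F 0) lL.1 lL.2 /\ H 1 t = nc (F 1) lL.1 lL.2].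
  move=> [l L] /=; have [HL|] := pselect (node l L); last by exists (fun _ _ _ => 0).
  have [||H HH] := @ph_faithful R (k l L) m m' (fun s => nc (F s) l L) (fun s => nc (G s) l L) m0 m0'
    (cnc F l L cF) (cnc G l L cG) (fine_nc HL fF) (fine_nc HL fG) _ _ (HW l L HL).
  - by rewrite F0 G0.
  - by rewrite E1.
  by exists H.
(* Clamped parameters make this a continuous map from the whole plane to [B]; on the horizontal
   sides [asB_nc] gives back the two lifts. *)
pose H z := asB (fun l L => h (l, L) (cl z.1) (cl z.2)).
have BH z : B (H z).
  apply: (asB_B n0 p0 Hv) => l L HL; have [_ Hcf _ _] := Hh (l, L) HL.
  by apply: Hcf; apply: cl_in.
have cH : ccont (fun z : R * R => H z).
  apply: asB_ccont => l L i HL; have [ch _ _ _] := Hh (l, L) HL.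
  have c1 : continuous (fun z : R * R => cl z.1).
    by apply: (@contcomp R _ _ (@cl R)); [exact: cont_cl|exact: cont_fst].
  have c2 : continuous (fun z : R * R => cl z.2).
    by apply: (@contcomp R _ _ (@cl R)); [exact: cont_cl|exact: cont_snd].
  exact: (@cont_path2 R (nat * bool)%type (h (l, L)) (fun z => cl z.1) (fun z => cl z.2) i ch c1 c2).
have z01 : 0 <= (0 : R) <= 1 by rewrite lexx ler01.
have o01 : 0 <= (1 : R) <= 1 by rewrite lexx ler01.
have c0 : cl (0 : R) = 0 by rewrite cl_id.
have c1 : cl (1 : R) = 1 by rewrite cl_id.
exists (fun z => qv (H z)); split; last split.
- apply: continuous_subspaceT; exact: (@q_cont _ _ _ _ Q _ _ cH BH).
- move=> s; rewrite in_itv /= => Hs; rewrite /H /= c0 c1 cl_id //.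
  rewrite -qF // -qG //; split; congr qv.
    rewrite -[RHS](asB_nc n0 p0 Hv (BF s Hs)); apply: (asB_ext n0 p0 Hv) => l L i b HL _.
    by have [_ _ h3 _] := Hh (l, L) HL; have [-> _] := h3 s Hs.
  rewrite -[RHS](asB_nc n0 p0 Hv (BG s Hs)); apply: (asB_ext n0 p0 Hv) => l L i b HL _.
  by have [_ _ h3 _] := Hh (l, L) HL; have [_ ->] := h3 s Hs.
- move=> t; rewrite in_itv /= => Ht; rewrite /H /= c0 c1 (cl_id Ht).
  rewrite -{1}f0 -f1 -qF // -qF //; split; congr qv.
    rewrite -[RHS](asB_nc n0 p0 Hv (BF 0 z01)); apply: (asB_ext n0 p0 Hv) => l L i b HL _.
    by have [_ _ _ h4] := Hh (l, L) HL; have [-> _] := h4 t Ht.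
  rewrite -[RHS](asB_nc n0 p0 Hv (BF 1 o01)); apply: (asB_ext n0 p0 Hv) => l L i b HL _.
  by have [_ _ _ h4] := Hh (l, L) HL; have [_ ->] := h4 t Ht.
Qed.

Lemma tm_half K i : (0 < K)%N -> tm R (K + K) i = tm R K i / 2.
Proof. by move=> K0; rewrite /tm addnn -mul2n natrM invfM [2^-1 * _]mulrC mulrA. Qed.

Lemma tm_halfD K i : (0 < K)%N -> tm R (K + K) (K + i) = 1 / 2 + tm R K i / 2.
Proof.
move=> K0; have K0' : K%:R != 0 :> R by rewrite pnatr_eq0; lia.
by rewrite tm_half // /tm natrD mulrDl divff // mulrDl.
Qed.

(** The lift of the second loop starts at [A], so it is translated by [s] to start where the first
    one ends. *)
Lemma disc_cat f g K x y (s : 'S_n) : loop f -> loop g -> (0 < K)%N -> Disc f K x -> Disc g K y ->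
  adm s -> x K = col_perm s A -> y 0%N = A ->
  Disc (loop_cat f g) (K + K) (fun i => if (i < K)%N then x i else col_perm s (y (i - K)%N)).
Proof.
move=> [_ [f0 f1]] [_ [g0 g1]] K0 [x1 x2] [y1 y2] As EK E0.
have Lg u : 1 / 2 <= u -> loop_cat f g u = g (2 * u - 1).
  rewrite le_eqVlt /loop_cat => /orP[/eqP <-|lt].
    rewrite ifT; last by lra.
    have -> : 2 * (1 / 2) = 1 :> R by lra.
    by rewrite subrr f1 g0.
  by rewrite ifF //; apply/negbTE; rewrite -ltNge; lra.
have Lf u : u <= 1 / 2 -> loop_cat f g u = f (2 * u) by rewrite /loop_cat => h; rewrite ifT //; lra.
have t0 i : 0 <= tm R K i by rewrite -(tm0 R K) tm_le.
have t1 i : (i <= K)%N -> tm R K i <= 1 by move=> iK; rewrite -(tmM R K0) tm_le.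
have dbl (u : R) : 2 * (u / 2) = u by lra.
have dbl' (u : R) : 2 * (1 / 2 + u / 2) - 1 = u by lra.
split=> i iK; have [lt|ge] := ltnP i K.
- have [Bx Ex] := x1 i (ltnW lt); split=> //; rewrite Ex tm_half // Lf ?dbl //.
  by have := t1 i (ltnW lt); lra.
- have le : (i - K <= K)%N by lia.
  have [By Ey] := y1 _ le; split; first exact: adm_B.
  rewrite qv_adm // Ey -{2}(subnKC ge) tm_halfD // Lg ?dbl' //.
  by have := t0 (i - K)%N; lra.
- have [c [r [G cx cx' HU]]] := x2 i lt; exists c, r; split=> //.
    have [lt'|ge'] := ltnP i.+1 K => //.
    have e : i.+1 = K by lia.
    by rewrite e subnn E0 -EK -e.
  move=> u; rewrite !tm_half // => /andP[u1 u2]; have ti := t1 _ lt.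
  by rewrite Lf; [apply: HU; lra|lra].
- have e : i = (K + (i - K))%N by lia.
  have lt : (i - K < K)%N by lia.
  have [c [r [G cy cy' HU]]] := y2 _ lt; exists (col_perm s c), r; split.
  + exact: good_perm.
  + exact: nr_perm.
  + have -> : (i.+1 < K)%N = false by lia.
    by rewrite subSn //; apply: nr_perm.
  + rewrite {1 2}e -addnS !tm_halfD // => u /andP[u1 u2]; apply: sheet_perm => //.
    have ti := t0 (i - K)%N.
    by rewrite Lg; [apply: HU; lra|lra].
Qed.

Lemma isphi_cat f g w w' : loop f -> loop g -> isphi f w -> isphi g w' ->
  exists2 v, isphi (loop_cat f g) v & breq (nleaves T) v (w ++ w').
Proof.
move=> lf lg Hw Hw'; have [N [x [s [N0 Dx Ex As [EN Ew]]]]] := Hw.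
have [N' [y [s' [N0' Dy Ey As' [EN' Ew']]]]] := Hw'.
(* Both lifts are refined to [N * N'] steps, so that the junction at time 1/2 is a node of the
   subdivision of the product. *)
have [X [DX X0 SX]] := refine_words N0 N0' Dx; have [Y [DY Y0 SY]] := refine_words N0' N0 Dy.
rewrite Ex in X0; rewrite Ey in Y0; rewrite mulnC in DY SY.
have K0 : (0 < N * N')%N by rewrite muln_gt0 N0.
move: (N * N')%N K0 DX SX DY SY => K K0 DX SX DY SY.
have XK : X K = col_perm s A by case: SX => ->.
have YK : Y K = col_perm s' A by case: SY => ->.
have DZ := disc_cat lf lg K0 DX DY As XK Y0.
set Z := (fun i => _) in DZ.
have ZK i : Z (K + i)%N = col_perm s (Y i) by rewrite /Z ltnNge leq_addr addKn.
have ZX i : (i <= K)%N -> Z i = X i.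
  rewrite leq_eqVlt => /orP[/eqP->|lt]; last by rewrite /Z lt.
  by have := ZK 0%N; rewrite addn0 Y0 XK.
have Ass := adm_mul As As'.
exists (asm (be Z (K + K) (s * s')%g) p.+1 top).
  exists (K + K)%N, Z, (s * s')%g; split=> //; [by rewrite addn_gt0 K0|by rewrite ZX|].
  by rewrite ZK YK col_permM.
have E1 : breq (nleaves T) w (asm (be X K s) p.+1 top).
  by rewrite Ew; apply: asm_words (same_words_sym SX) => //; exact: disc_steps Dx.
have E2 : breq (nleaves T) w' (asm (be Y K s') p.+1 top).
  by rewrite Ew'; apply: asm_words (same_words_sym SY) => //; exact: disc_steps Dy.
have CX := be_cmp n0 p0 Hv BA (disc_steps DX) As X0 XK.
have CY := be_cmp n0 p0 Hv BA (disc_steps DY) As' Y0 YK.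
have ST : (s @: top)%SET = top by apply/setP => a; rewrite !inE -(permKV s a) imset_f ?inE.
apply: breq_trans (breq_cat (breq_sym E1) (breq_sym E2)).
have H := @asm_cat _ _ _ _ _ n0 Hv Hc (fun _ L => (s @: L)%SET) (be X K s) (be Y K s')
  (fun l L => be X K s l L ++ be Y K s' l (s @: L)%SET) p.+1 top (adm_treemap n0 p0 Hv As) CX lT pT.
rewrite ST in H; apply: breq_trans (H _ _); last by [].
  apply: (asm_breq n0 Hv lT pT).
    apply: (cmp_wfam n0 (leqnn _) (be_cmp n0 p0 Hv BA (disc_steps DZ) Ass _ _)); first by rewrite ZX.
    by rewrite ZK YK col_permM.
  move=> l L Hl pL _; have HL : node l L by []; have HL' := adm_node n0 p0 As HL.
  rewrite /be dwD (@dw_ext _ _ (fun i => nc (X i) l L)); last by move=> i iK; rewrite ZX.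
  have -> : ((s * s')%g @: L = s' @: (s @: L))%SET.
    by rewrite -imset_comp; apply: eq_imset => a; rewrite /= permM.
  have ek := size_ord_adm n0 p0 Hv As HL.
  (* The closing factor of the first word belongs to [s @: L] and cancels the opening factor of the
     second. *)
  apply: breq_cancel_mid; first by have := cw_wf n0 p0 Hv BA HL'; rewrite ek.
  rewrite ek; apply: (@dw_relabel _ _ (sg ord s l L)).
  - by move=> a; apply: (sg_lt n0 p0 Hv As HL).
  - by move=> a c; apply: (sg_inj n0 p0 Hv As HL).
  - by move=> i iK; rewrite ZK; apply: nc_perm => //; have [/(_ i iK)[]] := DY.
  - by move=> i iK; rewrite -ek; apply: steps_linked (disc_steps DY) HL' iK.
by move=> l L Hl pL; have [] := CY l L Hl pL.
Qed.

Lemma cmp_sg (s : 'S_n) b l L a : adm s -> cmp A ord (fun _ L => (s @: L)%SET) b -> node l L ->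
  (a < k l L)%N -> perm_word (b l L) a = sg ord s l L a.
Proof.
move=> As Cb HL Ha; have [Hl pL] := HL; have [wb ab] := Cb l L Hl pL.
have HL' := adm_node n0 p0 As HL; have [_ pL'] := HL'; have ek := size_ord_adm n0 p0 Hv As HL.
have := @nth_act _ fset0 (b l L) [seq (s @: C)%SET | C : {set 'I_n} <- ord l L] a.
rewrite size_map ab (nth_map fset0) // -(sg_nth n0 p0 Hv As HL Ha) => /(_ wb)/eqP.
rewrite nth_uniq ?ek; [by move/eqP|exact: perm_word_lt wb Ha|exact: (sg_lt n0 p0 Hv As HL Ha)|].
exact: ord_uniq Hv _ _ Hl pL'.
Qed.

(** A permutation inducing [w] gives the end point of the lift. Each node word, stripped of its
    conjugating factors, is realised by a polygon of configurations, and [asB] assembles the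
    polygons into a path in [B]. *)
Lemma isphi_surj w : cbr T w -> exists f, [/\ loop f & exists2 v, isphi f v & breq (nleaves T) v w].
Proof.
move=> /(cbr_perm n0 Hv Hc)[s [b [tm_s Cb Ew]]]; have As := treemap_adm n0 p0 tm_s.
have BS : B (col_perm s A) by apply: adm_B.
have /choice[lv Hlv] : forall lL : nat * {set 'I_n}, exists l0, node lL.1 lL.2 ->
    [/\ chain (k lL.1 lL.2) (nc A lL.1 lL.2) l0,
        last (nc A lL.1 lL.2) l0 = nc (col_perm s A) lL.1 lL.2, l0 <> [::] &
        breq (k lL.1 lL.2) (dword (k lL.1 lL.2) (nc A lL.1 lL.2) l0)
          (winv (cw lL.1 lL.2) ++ b lL.1 lL.2 ++ cw lL.1 (s @: lL.2)%SET)].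
  move=> [l L] /=; have [HL|] := pselect (node l L); last by exists [::].
  have HL' := adm_node n0 p0 As HL; have ek := size_ord_adm n0 p0 Hv As HL; have [Hl pL] := HL.
  have [wb _] := Cb l L Hl pL.
  have w1 := cw_wf n0 p0 Hv BA HL; have w2 := cw_wf n0 p0 Hv BA HL'; rewrite ek in w2.
  have [||l0 Hl0] := @realize R (k l L) (nc A l L) (nc (col_perm s A) l L)
      (winv (cw l L) ++ b l L ++ cw l (s @: L)%SET) (nc_conf Hv BA HL) (nc_conf Hv BS HL).
  - by rewrite !wf_cat wf_winv w1 wb w2.
  - move=> a Ha; rewrite !perm_word_cat -(cw_perm n0 p0 Hv BA a HL) perm_word_winv.
    rewrite (cmp_sg As Cb HL Ha) (cw_perm n0 p0 Hv BA _ HL') ek.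
    rewrite (pos_relabel (fun a => @sg_lt _ _ _ _ _ n0 p0 Hv s As l L a HL)
      (fun a c => @sg_inj _ _ _ _ _ n0 p0 Hv s As l L a c HL) (nc_perm n0 p0 Hv As BA HL)).
    by rewrite Ha.
  by exists l0.
pose P l L := upoly (nc A l L) (lv (l, L)).
have size_lv l L : node l L -> (0 < size (lv (l, L)))%N.
  by move=> HL; have [_ _ + _] := Hlv (l, L) HL; case: (lv (l, L)).
have Pconf l L u : node l L -> 0 <= u <= 1 -> conf (k l L) (P l L u).
  move=> HL Hu; have [ch _ _ _] := Hlv (l, L) HL.
  have [m mN Hm] := tm_ex (size_lv l L HL) Hu.
  by have [c cc Hcc] := fine_upoly ch mN; apply: star_conf cc (Hcc u Hm).
pose F u := asB (fun l L => P l L (cl u)).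
have BF u : B (F u) by apply: (asB_B n0 p0 Hv) => l L HL; apply: Pconf => //; apply: cl_in.
have cF : ccont F.
  apply: asB_ccont => l L i HL; apply: (@contcomp R R R (fun u => P l L u i) (@cl R)); last exact: cont_cl.
  exact: cpath_upoly.
have z01 : 0 <= (0 : R) <= 1 by rewrite lexx ler01.
have o01 : 0 <= (1 : R) <= 1 by rewrite lexx ler01.
have F0 : F 0 = A.
  rewrite -[RHS](asB_nc n0 p0 Hv BA); apply: (asB_ext n0 p0 Hv) => l L i b' HL _.
  by rewrite cl_id // /P -(tm0 R (size (lv (l, L)))) upoly_tm.
have F1 : F 1 = col_perm s A.
  rewrite -[RHS](asB_nc n0 p0 Hv BS); apply: (asB_ext n0 p0 Hv) => l L i b' HL _.
  have [_ <- _ _] := Hlv (l, L) HL; have sl := size_lv l L HL.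
  by rewrite cl_id // /P -(tmM R sl) upoly_tm // -[size _]/(size (nc A l L :: lv (l, L))).-1 nth_last.
pose f u := qv (F u).
have lf : loop f.
  split; [|split]; last 2 first.
  - by rewrite /f F0 qA.
  - by rewrite /f F1 qv_adm // qA.
  by apply: continuous_subspaceT; exact: (@q_cont _ _ _ _ Q _ _ cF BF).
have [N [N0 DF fF]] := @lift_disc _ _ _ _ Q f F cF (fun u _ => BF u) (fun u _ => erefl).
exists f; split=> //; exists (asm (be (fun i => F (tm R N i)) N s) p.+1 top).
  by exists N, (fun i => F (tm R N i)), s; split=> //; rewrite ?tm0 ?tmM // F0.
have C1 := be_cmp n0 p0 Hv BA (disc_steps DF) As.
apply: breq_trans (breq_sym Ew); apply: (asm_breq n0 Hv lT pT).
  by apply: (cmp_wfam n0 (leqnn _) (C1 _ _)); rewrite ?tm0 ?tmM.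
move=> l L Hl pL _; have HL : node l L by [].
have HL' := adm_node n0 p0 As HL; have ek := size_ord_adm n0 p0 Hv As HL.
have w1 := cw_wf n0 p0 Hv BA HL; have w2 := cw_wf n0 p0 Hv BA HL'; rewrite ek in w2.
apply: breq_trans (breq_conj (b l L) w1 w2); rewrite /be.
apply: breq_catl; apply: breq_catr.
have [ch _ _ Ed] := Hlv (l, L) HL; apply: breq_trans Ed; rewrite /= -dw_upoly.
(* The node configurations of the assembled path differ from the polygons by translations depending
   on time, which words ignore. *)
have Pm u i b' : 0 <= u <= 1 -> (i < k l L)%N -> P l L u (i, b') =
    nc (F u) l L (i, b') + mean A ord (fun l L => P l L u) (rowi p0 l) b'.
  move=> Hu Hi; rewrite /F (cl_id Hu) (nc_asB n0 p0 Hv) ?subrK // => l1 L1 HL1.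
  exact: Pconf.
have t01 i : (i <= N)%N -> 0 <= tm R N i <= 1.
  by move=> iN; rewrite -{1}(tm0 R N) -(tmM R N0) !tm_le.
have fineP : fine (k l L) N (P l L).
  move=> i iN; have [c cc Hcc] := fine_nc HL fF iN; exists c => // u Hu.
  have [/andP[h1 _] /andP[_ h2]] := (t01 i (ltnW iN), t01 _ iN).
  apply: (star_shift (t := mean A ord (fun l L => P l L u) (rowi p0 l)) (Hcc u Hu)) => a b' Ha.
  by apply: Pm => //; lra.
apply: breq_trans (hol_unique N0 (size_lv l L HL) fineP (fine_upoly ch)).
apply: (@dw_shift _ _ _ _ N (fun i => mean A ord (fun l L => P l L (tm R N i)) (rowi p0 l))).
  by move=> i iN; apply: fine_linked (fine_nc HL fF) iN.
by move=> i a b' iN Ha; apply: Pm => //; apply: t01.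
Qed.

Definition phi f : bword := xget [::] [set w | isphi f w].

Lemma phiP f : (exists w, isphi f w) -> isphi f (phi f).
Proof. by move=> [w Hw]; apply: (@xgetPex _ [::] [set w | isphi f w]); exists w. Qed.

Lemma phi_breq f w : isphi f w -> breq (nleaves T) (phi f) w.
Proof. by move=> Hw; apply: isphi_unique (phiP (ex_intro _ w Hw)) Hw. Qed.

Lemma phi_cbr f : loop f -> wf_word (nleaves T) (phi f) /\ cbr T (phi f).
Proof.
move=> /isphi_ex/phiP/isphi_cbr H; split=> //.
exact: (cbr_wf n0 Hv Hc lT pT H).
Qed.

Lemma phi_homotopic f g : loop f -> loop g ->
  loop_homotopic Qbar f g <-> breq (nleaves T) (phi f) (phi g).
Proof.
move=> lf lg; have [N [x [s [N0 Dx Ex As [EN ->]]]]] := phiP (isphi_ex lf).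
have [N' [y [s' [N0' Dy Ey As' [EN' ->]]]]] := phiP (isphi_ex lg); split=> H.
  by apply: asm_words => //; [exact: disc_steps Dx|exact: homotopy_words H].
apply: (words_homotopic lf lg N0 N0' Dx Dy Ex Ey).
by apply: words_asm H => //; [exact: disc_steps Dx|exact: disc_steps Dy].
Qed.

Lemma phi_cat f g : loop f -> loop g -> breq (nleaves T) (phi (loop_cat f g)) (phi f ++ phi g).
Proof.
move=> lf lg; have [v Hv' E] := isphi_cat lf lg (phiP (isphi_ex lf)) (phiP (isphi_ex lg)).
exact: breq_trans (phi_breq Hv') E.
Qed.

Lemma phi_surj w : cbr T w -> exists f, loop f /\ breq (nleaves T) (phi f) w.
Proof.
move=> /isphi_surj[f [lf [v Hv' E]]]; exists f; split=> //.
exact: breq_trans (phi_breq Hv') E.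
Qed.

End Main.

Unset Implicit Arguments.
Local Open Scope ring_scope.
Local Open Scope quotient_scope.

Theorem theorem4p22 (R : realType) (n p : nat) (A : 'M[R[i]]_(p, n)) :
  (2 <= n)%N -> (1 <= p)%N ->
  (forall j : 'I_p, \sum_(a < n) A j a = 0) ->
  forall ord : nat -> {set 'I_n} -> seq {set 'I_n},
  valid_ord A ord -> compatible_ord p ord ->
  forall Q : sB A, set_val Q = A ->
  let T := Tplanar p ord in
  let N := nleaves T in
  let Qbar := \pi_(Bbar A) Q in
  (* pi_1(Bbar, Qbar) ~= CBr(T, r): a map from loops to braid words inducing *)
  (* a well-defined, injective, surjective homomorphism pi_1 -> CBr(T, r)     *)
  (exists phi : (R -> Bbar A) -> bword,
     (forall f, is_loop Qbar f -> wf_word N (phi f) /\ cbr T (phi f)) /\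
     (forall f g, is_loop Qbar f -> is_loop Qbar g ->
        (loop_homotopic Qbar f g <-> breq N (phi f) (phi g))) /\
     (forall f g, is_loop Qbar f -> is_loop Qbar g ->
        breq N (phi (loop_cat f g)) (phi f ++ phi g)) /\
     (forall w, cbr T w -> exists f, is_loop Qbar f /\ breq N (phi f) w)) /\
  (* 1 -> PCBr(T) -> CBr(T, r) -> Aut(T, r) -> 1 is exact *)
  (forall w, pcbr T w -> cbr T w) /\
  (exists psi : bword -> {perm fnode A},
     (forall w w', cbr T w -> cbr T w' -> breq N w w' -> psi w = psi w') /\
     (forall w w', cbr T w -> cbr T w' -> psi (w ++ w') = (psi w * psi w')%g) /\
     (forall w, cbr T w -> psi w \in AutT A) /\
     (forall s, s \in AutT A -> exists w, cbr T w /\ psi w = s) /\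
     (forall w, cbr T w -> (psi w = 1%g <-> pcbr T w))).
Proof.
move=> n2 p0 _ ord Hv Hc Q QA T N Qbar.
have n0 : (0 < n)%N by apply: leq_trans n2.
have lT : (1 <= p.+1 <= p.+1)%N by rewrite leqnn.
split; last split.
- exists (phi Q ord n0 p0); split; [|split; [|split]].
  + by move=> f lf; apply: phi_cbr.
  + by move=> f g lf lg; apply: phi_homotopic.
  + by move=> f g lf lg; apply: phi_cat.
  + by move=> w Hw; apply: phi_surj.
- by move=> w; apply: (pcbr_cbr n0 Hv lT (part_top A n0)).
- exists (@psi R n p A ord); split; [|split; [|split; [|split]]].
  + by move=> w w'; apply: (psi_breq n0 Hv Hc).
  + by move=> w w'; apply: (psi_mul n0 Hv Hc).
  + by move=> w Hw; have [] := psiP n0 Hv Hc Hw.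
  + by move=> s; apply: (psi_surj n0 Hv Hc).
  + by move=> w; apply: (psi_kernel n0 Hv Hc).
Qed.
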